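(* Let $\Sigma$ be a compact oriented surface with negative Euler characteristic and (possibly empty) boundary, let $\Gamma=\pi_1(\Sigma)$, and let $\rho:\Gamma\to\mathrm{Sp}(2n,\mathbf R)$ be an Anosov maximal representation. If $\gamma\in\Gamma$ corresponds to a simple closed curve or boundary component of $\Sigma$, then $\langle\rho(\gamma)\rangle\backslash\mathcal Y_\gamma\subset\rho(\Gamma)\backslash\mathcal X$ has an embedded tubular neighbourhood $C(\gamma)$ of width $$w(\gamma):=\sqrt n\,\operatorname{arccoth}\left(\exp\left(\frac{\ell^R(\gamma)}{2\sqrt n}\right)\right)$$ with respect to the Riemannian metric. Moreover, if $\delta$ corresponds to a simple closed curve or boundary component that is disjoint from $\gamma$, then the neighbourhoods $C(\gamma)$ and $C(\delta)$ are disjoint.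
   Context: **Siegel space.** $\mathrm{Sp}(2n,\mathbf R)$ preserves the symplectic form with matrix $\begin{pmatrix}0&\mathrm{Id}_n\\-\mathrm{Id}_n&0\end{pmatrix}$ in the standard basis $e_1,\dots,e_{2n}$. For $\mathbf K=\mathbf R$ or $\mathbf C$, $\mathcal L(\mathbf K^{2n})$ is the set of Lagrangian subspaces. The symmetric space is $\mathcal X=\{X+iY: X\in \mathrm{Sym}(n,\mathbf R),\ Y\in\mathrm{Sym}^+(n,\mathbf R)\}$ ($\mathrm{Sym}^+$: positive definite) with action $\begin{pmatrix}A&B\\C&D\end{pmatrix}\cdot Z=(AZ+B)(CZ+D)^{-1}$. A symmetric matrix $Z$ is identified with the Lagrangian spanned by the columns of $\begin{pmatrix}Z\\ \mathrm{Id}_n\end{pmatrix}$, so $\mathcal X\subset\mathcal L(\mathbf C^{2n})$, $\mathrm{Sym}(n,\mathbf R)\subset\mathcal L(\mathbf R^{2n})$; $l_\infty=\langle e_1,\dots,e_n\rangle$; $\sigma$ (or a bar) is complex conjugation. A triple of pairwise transverse real Lagrangians is *maximal* if it is in the $\mathrm{Sp}(2n,\mathbf R)$-orbit of $(l_\infty,0,\mathrm{Id})$. **Cross-ratio and distance.** For $l_1$ transverse to $l_2$ and $l_3$ transverse to $l_4$, $R(l_1,l_2,l_3,l_4)=p_{l_1}^{\parallel l_2}\circ p_{l_4}^{\parallel l_3}|_{l_1}\in\mathrm{End}(l_1)$, with $p_l^{\parallel l'}$ the projection onto $l$ parallel to $l'$. The Riemannian distance is $d^R(X,Z)=\sqrt{\sum(\log\lambda_i)^2}$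 with $\lambda_i=\frac{1+\sqrt{r_i}}{1-\sqrt{r_i}}$, where $r_i$ are the eigenvalues of $R(X,\overline Z,Z,\overline X)$. It is induced by the $\mathrm{Sp}(2n,\mathbf R)$-invariant Riemannian metric with minimal holomorphic sectional curvature $-1$. The length of $\gamma$ is $\ell^R(\gamma)=\inf_{X\in\mathcal X}d^R(X,\rho(\gamma)X)$. **Maximal representations.** Fix a complete finite-area hyperbolization of (the interior of) $\Sigma$, giving an action of $\Gamma$ on $\mathbb S^1=\partial\mathbb H^2$. $\rho$ is *maximal* if there is a $\rho$-equivariant right-continuous map $\mathbb S^1\to\mathcal L(\mathbf R^{2n})$ sending positively oriented triples to maximal triples (equivalently, $\rho$ maximizes the Toledo invariant). $\rho$ is then injective with discrete image and $\rho(\Gamma)\backslash\mathcal X$ is a manifold. An element $g\in\mathrm{Sp}(2n,\mathbf R)$ is *Shilov hyperbolic* if it is conjugate to $\begin{pmatrix}A&0\\0&{}^tA^{-1}\end{pmatrix}$ with all eigenvalues of $A$ of absolute value $>1$; it then fixes two transverse real Lagrangians, one attractive and one repulsive. A maximal representation is called *Anosov* if the image of every peripheral element is Shilov hyperbolic (no condition if $\partial\Sigma=\emptyset$); then $\rho(\gamma)$ is Shilov hyperbolic for all $\gamma\ne1$, and $\Lambda_\gamma^\pm$ denote its attractive and repulsive Lagrangians. **Tubes and tubular neighbourhoods.** For $\gamma\neq 1$, $\mathcal Y_\gamma=\{l\in\mathcal X: R(\Lambda_\gamma^-,l,\sigma(l),\Lambda_\gamma^+)=-\mathrm{Id}\}$,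 a totally geodesic $\rho(\gamma)$-invariant submanifold. $C(\gamma)$ is the image in $\rho(\Gamma)\backslash\mathcal X$ of $\mathcal N_{w(\gamma)}(\mathcal Y_\gamma)=\{X\in\mathcal X: d^R(X,\mathcal Y_\gamma)<w(\gamma)\}$; it is embedded if $\langle\rho(\gamma)\rangle\backslash\mathcal N_{w(\gamma)}(\mathcal Y_\gamma)\to\rho(\Gamma)\backslash\mathcal X$ is injective.
   Formalization: In the second part δ is assumed not freely homotopic to γ or its inverse, since a parallel copy of γ is a disjoint curve for which C(γ) and C(δ) coincide. *)

(* Defs.v *)
From HB Require Import structures.
From mathcomp Require Import all_boot all_order all_algebra.
From mathcomp Require Import complex.
From mathcomp Require Import all_classical all_reals all_analysis.

Set Implicit Arguments.
Unset Strict Implicit.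
Unset Printing Implicit Defensive.

Import Order.TTheory GRing.Theory Num.Theory.
Import numFieldNormedType.Exports.

Local Open Scope classical_set_scope.
Local Open Scope complex_scope.
Local Open Scope ring_scope.

(** * Lagrangians and the Siegel space

    A subspace of K^2n is the row space of a square matrix, so vectors of K^2n
    are row vectors and g in Sp(2n, R) acts by v |-> v *m g^T. *)

Section Symplectic.
Variable n : nat.

Definition symplectic_form (K : fieldType) : 'M[K]_(n + n) :=
  block_mx 0 1%:M (- 1%:M) 0.

Definition symplectic (K : fieldType) : set 'M[K]_(n + n) :=
  [set g | g^T *m symplectic_form K *m g = symplectic_form K].

Definition lagrangian (K : fieldType) : set 'M[K]_(n + n) :=
  [set l | \rank l = n /\ l *m symplectic_form K *m l^T = 0].

Definition l_infty (K : fieldType) : 'M[K]_(n + n) :=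
  <<row_mx 1%:M (0 : 'M[K]_n)>>%MS.

(** The rows of [row_mx Z^T 1] are the transposed columns of (Z ; Id). *)
Definition lag_of_sym (K : fieldType) (Z : 'M[K]_n) : 'M[K]_(n + n) :=
  <<row_mx Z^T 1%:M>>%MS.

Definition lag_act (K : fieldType) (g l : 'M[K]_(n + n)) : 'M[K]_(n + n) :=
  l *m g^T.

(** The cross-ratio is the matrix of p_{l1}^{||l2} o p_{l4}^{||l3} in a basis of
    l1; in row convention the map applied first is written on the left, and
    [proj_mx l l'] is the projection onto l parallel to l'. *)
Definition cross_ratio (K : fieldType) (l1 l2 l3 l4 : 'M[K]_(n + n)) :
    'M[K]_(\rank l1) :=
  restrictmx l1 (proj_mx l4 l3 *m proj_mx l1 l2).

Variable R : realType.

Definition maximal_triple (l1 l2 l3 : 'M[R]_(n + n)) : Prop :=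
  exists2 g, symplectic g &
    [/\ (l1 == lag_act g (l_infty R))%MS,
        (l2 == lag_act g (lag_of_sym 0))%MS &
        (l3 == lag_act g (lag_of_sym 1%:M))%MS].

Definition posdef (Y : 'M[R]_n) : Prop :=
  forall v : 'rV[R]_n, v != 0 -> 0 < (v *m Y *m v^T) 0 0.

Definition complexify (p q : nat) (A : 'M[R]_(p, q)) : 'M[R[i]]_(p, q) :=
  map_mx (real_complex R) A.

Definition conj_mx (p q : nat) (A : 'M[R[i]]_(p, q)) : 'M[R[i]]_(p, q) :=
  map_mx conjc A.

Definition siegel : set 'M[R[i]]_n :=
  [set Z | exists X Y : 'M[R]_n,
     [/\ X^T = X, Y^T = Y, posdef Y &
         Z = complexify X + (0 +i* 1)%C *: complexify Y]].

Definition siegel_act (g : 'M[R]_(n + n)) (Z : 'M[R[i]]_n) : 'M[R[i]]_n :=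
  let h := complexify g in
  (ulsubmx h *m Z + ursubmx h) *m invmx (dlsubmx h *m Z + drsubmx h).

(** ** Riemannian distance and length *)

(** Eigenvalues with algebraic multiplicity. *)
Definition eigenvalues (k : nat) (M : 'M[R[i]]_k) : seq R[i] :=
  sval (closed_field_poly_normal (char_poly M)).

(** For X and Z in the Siegel space the eigenvalues r of the cross-ratio are
    real and lie in [0, 1[; [complex.Re] only reads them as elements of R. *)
Definition dist_R (X Z : 'M[R[i]]_n) : R :=
  let M := cross_ratio (lag_of_sym X) (lag_of_sym (conj_mx Z))
                       (lag_of_sym Z) (lag_of_sym (conj_mx X)) in
  let lambda (r : R[i]) : R :=
    let s := Num.sqrt (complex.Re r) in (1 + s) / (1 - s) in
  Num.sqrt (\sum_(r <- eigenvalues M) ln (lambda r) ^+ 2).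

Definition dist_to (A : set 'M[R[i]]_n) (X : 'M[R[i]]_n) : \bar R :=
  ereal_inf [set (dist_R X Z)%:E | Z in A].

Definition translation_length (g : 'M[R]_(n + n)) : R :=
  inf [set dist_R X (siegel_act g X) | X in siegel].

Definition arccoth (x : R) : R := ln ((x + 1) / (x - 1)) / 2.

Definition width (g : 'M[R]_(n + n)) : R :=
  let s : R := Num.sqrt n%:R in
  s * arccoth (expR (translation_length g / (2 * s))).

(** ** Shilov hyperbolic elements *)

(** [g] is conjugate by [h] to diag (A, A^-T) with A expanding.  The invariant
    Lagrangian h l_infty, on which g acts as A, is then the attractive one, and
    h <e_(n+1), .., e_2n> is the repulsive one. *)
Definition shilov_data (g h : 'M[R]_(n + n)) (A : 'M[R]_n) : Prop :=
  [/\ symplectic h,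
      g = h *m block_mx A 0 0 (invmx A)^T *m invmx h &
      forall a : R[i], eigenvalue (complexify A) a -> 1 < `|a|].

Definition shilov_hyperbolic (g : 'M[R]_(n + n)) : Prop :=
  exists h A, shilov_data g h A.

Definition attractive_repulsive (g Lp Lm : 'M[R]_(n + n)) : Prop :=
  exists h A, [/\ shilov_data g h A,
    (Lp == lag_act h (l_infty R))%MS &
    (Lm == lag_act h (lag_of_sym 0))%MS].

Definition tube_core (g : 'M[R]_(n + n)) : set 'M[R[i]]_n :=
  [set l | siegel l /\ exists Lp Lm, attractive_repulsive g Lp Lm /\
     cross_ratio (complexify Lm) (lag_of_sym l)
                 (lag_of_sym (conj_mx l)) (complexify Lp) = - 1%:M].

Definition tube (g : 'M[R]_(n + n)) : set 'M[R[i]]_n :=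
  [set X | siegel X /\ (dist_to (tube_core g) X < (width g)%:E)%E].

End Symplectic.

(** * Compact surfaces with boundary *)

Section Surface.
Variables (R : realType) (S : topologicalType).

Definition half_plane_chart (U : set S) (phi : S -> R * R) (psi : R * R -> S) :
    Prop :=
  [/\ open U,
      exists2 V : set (R * R), open V & phi @` U = V `&` [set z | 0 <= z.2],
      {within U, continuous phi},
      {within phi @` U, continuous psi} &
      {in U, cancel phi psi}].

Definition compact_surface : Prop :=
  [/\ hausdorff_space S, compact [set: S] &
      forall x : S, exists U phi psi, half_plane_chart U phi psi /\ U x].

Definition surface_interior : set S :=
  [set x | exists U phi psi,
     [/\ half_plane_chart U phi psi, U x & 0 < (phi x).2]].

Definition surface_boundary : set S := ~` surface_interior.

(** Closed curves are 1-periodic maps from the line. *)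
Definition closed_curve (c : R -> S) : Prop :=
  continuous c /\ forall t, c (t + 1) = c t.

Definition simple_closed_curve (c : R -> S) : Prop :=
  closed_curve c /\
  forall s t, c s = c t -> exists k : int, s = t + k%:~R.

Definition boundary_component_curve (c : R -> S) : Prop :=
  simple_closed_curve c /\
  exists2 x, surface_boundary x &
    range c = connected_component surface_boundary x.

Definition freely_homotopic (c d : R -> S) : Prop :=
  exists H : R * R -> S,
    [/\ {within [set z : R * R | 0 <= z.1 <= 1], continuous H},
        forall t, H (0, t) = c t,
        forall t, H (1, t) = d t &
        forall s t, 0 <= s <= 1 -> H (s, t + 1) = H (s, t)].

End Surface.

Arguments surface_interior R S : clear implicits.
Arguments surface_boundary R S : clear implicits.

(** * Hyperbolic plane and its boundary circle *)

Section HyperbolicPlane.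
Variable R : realType.

Definition upper_half_plane : set (R * R) := [set z | 0 < z.2].

Definition moebius (g : 'M[R]_2) (z : R * R) : R * R :=
  let w := ((g 0 0)%:C * (z.1 +i* z.2) + (g 0 1)%:C) /
           ((g 1 0)%:C * (z.1 +i* z.2) + (g 1 1)%:C) in
  (complex.Re w, complex.Im w).

(** Hyperbolic area, for the metric (dx^2 + dy^2) / y^2 *)
Definition hyperbolic_area
    (F : set (measurableTypeR R * measurableTypeR R)) : \bar R :=
  (\int[(@lebesgue_measure R \x @lebesgue_measure R)]_(z in F) (z.2 ^- 2)%:E)%E.

(** The boundary circle is R together with the point at infinity [None]. *)
Definition boundary_circle : Type := option R.

Definition moebius_circle (g : 'M[R]_2) (x : boundary_circle) :
    boundary_circle :=
  match x with
  | Some x => if g 1 0 * x + g 1 1 == 0 then None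
              else Some ((g 0 0 * x + g 0 1) / (g 1 0 * x + g 1 1))
  | None => if g 1 0 == 0 then None else Some (g 0 0 / g 1 0)
  end.

Definition circle_lt (x y : boundary_circle) : bool :=
  match x, y with
  | Some x, Some y => x < y
  | Some _, None => true
  | None, _ => false
  end.

(** Orientation as boundary of the upper half plane; (oo, 0, 1) is positive. *)
Definition positively_oriented (x y z : boundary_circle) : bool :=
  [|| circle_lt x y && circle_lt y z,
      circle_lt y z && circle_lt z x |
      circle_lt z x && circle_lt x y].

End HyperbolicPlane.

(** * Hyperbolized surfaces

    A complete finite-area hyperbolization of the interior of S, as a universal
    covering [unif] of the interior of S by the upper half plane.  Gamma is the
    group of deck transformations, that is the fundamental group of the interior
    of S, hence of S; it acts by the isometries [moebius (hol g)], and [hol] is multiplicative up to sign only, as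
    its natural target is PSL(2, R).  The surface is oriented by [unif], and its
    Euler characteristic is negative by Gauss-Bonnet. *)
Record hyperbolization (R : realType) (S : topologicalType)
    (Gamma : groupType) := Hyperbolization {
  hol : Gamma -> 'M[R]_2;
  unif : R * R -> S;
  hol_det : forall g, \det (hol g) = 1;
  hol_mul : forall g h z, upper_half_plane z ->
    moebius (hol (g * h)%g) z = moebius (hol g) (moebius (hol h) z);
  hol_free : forall g z, upper_half_plane z -> moebius (hol g) z = z -> g = 1%g;
  unif_continuous : {within @upper_half_plane R, continuous unif};
  unif_open : forall U, open U -> U `<=` @upper_half_plane R ->
    open (unif @` U);
  unif_locally_injective : forall z, upper_half_plane z ->
    exists2 U, nbhs z U & {in U &, injective unif};
  unif_image : unif @` @upper_half_plane R = surface_interior R S;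
  unif_fiber : forall z w, upper_half_plane z -> upper_half_plane w ->
    unif z = unif w <-> exists g, w = moebius (hol g) z;
  finite_area : exists F : set (measurableTypeR R * measurableTypeR R),
    [/\ measurable F, F `<=` @upper_half_plane R,
        forall z, upper_half_plane z ->
          exists2 w, F w & exists g, z = moebius (hol g) w &
        (hyperbolic_area F < +oo)%E]
}.

Section Curves.
Variables (R : realType) (S : topologicalType) (Gamma : groupType).
Variable H : hyperbolization R S Gamma.

(** The free homotopy class of c is the one of the projections of paths of the
    universal covering that are translated by gamma. *)
Definition represents (c : R -> S) (gamma : Gamma) : Prop :=
  exists lift : R -> R * R,
    [/\ continuous lift,
        forall t, upper_half_plane (lift t),
        forall t, lift (t + 1) = moebius (hol H gamma) (lift t) &
        freely_homotopic c (unif H \o lift)].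

(** A parametrized boundary component is in particular a simple closed curve,
    so that [simple_closed_curve] covers both types of curves. *)
Definition simple_element (gamma : Gamma) : Prop :=
  gamma <> 1%g /\ exists2 c, simple_closed_curve c & represents c gamma.

Definition peripheral (gamma : Gamma) : Prop :=
  exists2 c, boundary_component_curve c & represents c gamma.

(** Equality of the unoriented free homotopy classes *)
Definition parallel (gamma delta : Gamma) : Prop :=
  exists g, delta = (g * gamma * g^-1)%g \/ delta = (g * gamma^-1 * g^-1)%g.

(** Disjointness of the (unoriented) homotopy classes.  A curve is not regarded
    as disjoint from itself, although it is disjoint from a parallel copy. *)
Definition disjoint_elements (gamma delta : Gamma) : Prop :=
  ~ parallel gamma delta /\
  exists c d, [/\ simple_closed_curve c, represents c gamma,
    simple_closed_curve d, represents d delta & range c `&` range d = set0].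

(** * Maximal representations *)

Variable n : nat.

Definition representation (rho : Gamma -> 'M[R]_(n + n)) : Prop :=
  (forall g, symplectic (rho g)) /\
  (forall g h, rho (g * h)%g = rho g *m rho h).

(** Right continuity for the topology of the Grassmannian, that is the quotient
    topology of the space of frames. *)
Definition right_continuous (xi : boundary_circle R -> 'M[R]_(n + n)) : Prop :=
  forall x (F : 'M[R]_(n, n + n)) (e : R), (F == xi x)%MS -> 0 < e ->
  exists2 y, y <> x & forall z, positively_oriented x z y ->
    exists2 F' : 'M[R]_(n, n + n), (F' == xi z)%MS &
      forall i j, `|F' i j - F i j| < e.

Definition maximal_representation (rho : Gamma -> 'M[R]_(n + n)) : Prop :=
  representation rho /\
  exists xi : boundary_circle R -> 'M[R]_(n + n),
    [/\ forall x, lagrangian (xi x),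
        forall g x,
          (xi (moebius_circle (hol H g) x) == lag_act (rho g) (xi x))%MS,
        right_continuous xi &
        forall x y z, positively_oriented x y z ->
          maximal_triple (xi x) (xi y) (xi z)].

Definition anosov_maximal (rho : Gamma -> 'M[R]_(n + n)) : Prop :=
  maximal_representation rho /\
  forall gamma, peripheral gamma -> shilov_hyperbolic (rho gamma).

End Curves.

(** * Quotients and tubes in them *)

Section Quotient.
Variables (R : realType) (Gamma : groupType) (n : nat).
Variable rho : Gamma -> 'M[R]_(n + n).

Definition cyclic_subgroup (gamma : Gamma) : set Gamma :=
  [set g | exists k : nat, g = (gamma ^+ k)%g \/ g = (gamma ^- k)%g].

(** The class of X in the quotient of the Siegel space by rho(G) *)
Definition orbit_class (G : set Gamma) (X : 'M[R[i]]_n) : set 'M[R[i]]_n :=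
  [set siegel_act (rho g) X | g in G].

(** C(gamma), as a subset of the quotient by rho(Gamma) *)
Definition tube_image (gamma : Gamma) : set (set 'M[R[i]]_n) :=
  orbit_class [set: Gamma] @` tube (rho gamma).

(** The tube is a neighbourhood of its core, and its quotient by <rho(gamma)>
    maps injectively to the quotient by rho(Gamma). *)
Definition embedded_tubular_neighbourhood (gamma : Gamma) : Prop :=
  tube_core (rho gamma) `<=` tube (rho gamma) /\
  forall X Y, tube (rho gamma) X -> tube (rho gamma) Y ->
    orbit_class [set: Gamma] X = orbit_class [set: Gamma] Y ->
    orbit_class (cyclic_subgroup gamma) X =
    orbit_class (cyclic_subgroup gamma) Y.

End Quotient.

(* Main.v *)
(** For a real Lagrangian L put b_L(X) = |det <L, X>|^2 / det Im X.  By Hadamard's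
    inequality, applied to the cross-ratio that defines d^R, the function
    (log b_L) / sqrt n is 1-Lipschitz for d^R; this is all that is needed about
    the distance, neither its invariance nor the triangle inequality.  If g is
    conjugate to diag (A, A^-T), comparing X and g X gives a translation length
    of at least 2 log |det A| / sqrt n, hence an upper bound for w(g).

    Let gamma and delta be simple, disjoint and not commuting.  Up to inverses the
    limit map puts their fixed Lagrangians in such a cyclic order that, with those
    of gamma at 0 and oo, those of delta are the matrices 1 and D^2, where D > 1
    and det D < |det A|.  The functions log b_D and log b_(-D) agree on the core
    of gamma and differ by 2 log (det (D + 1) / det (D - 1)) on the core of delta.
    By Jensen's inequality for log coth, a common point of both tubes therefore
    forces w(gamma) < w(delta), and by symmetry w(delta) < w(gamma).

    The topological input is that the curves lift to paths of the upper half plane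
    that are disjoint and invariant under gamma and delta: the surface is pushed
    into its interior and the free homotopies are lifted.  By the Poincaré-Miranda
    theorem such paths meet if the axes cross, and a path invariant under gamma
    meets its image under any element that commutes with gamma, so that the
    centralizer of a simple element is the cyclic group it generates. *)
Require Import Defs.
From HB Require Import structures.
From mathcomp Require Import all_boot all_order all_algebra.
From mathcomp Require Import complex spectral.
From mathcomp Require Import all_classical all_reals all_analysis.
From mathcomp Require Import ring lra zify.

Set Implicit Arguments.
Unset Strict Implicit.
Unset Printing Implicit Defensive.

Import Order.TTheory GRing.Theory Num.Theory.
Import numFieldNormedType.Exports.

Local Open Scope classical_set_scope.
Local Open Scope ring_scope.

(** * The Poincaré-Miranda theorem in the plane *)

(** Embeddedness and disjointness come from one statement: if X lies in the tube of gamma and rho(q)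
    X in that of delta, then gamma commutes with q^-1 delta q. Embeddedness is the case delta =
    gamma. The matrices D and -D generalize the ends of a common perpendicular: for n = 1 the half
    circle of radius D is orthogonal to the geodesics (0, oo) and (1, D^2), and log b_D - log b_(-D)
    measures the position along it. The main obstacle is that a peripheral gamma may act on the half
    plane as a parabolic, although rho(gamma) is Shilov hyperbolic. Its attractive Lagrangian is
    then not a value of the limit map, which is only right-continuous. Positions are therefore
    described by repelling points and by the arcs that leave them in the positive direction, which
    exist for dilations and translations alike; the attractive Lagrangian of a parabolic is compared
    with the limit map through the Stein equation X = B X B^T + 1. The bound det D < |det A|
    expresses that gamma^-1 moves the repelling point of delta beyond the attractive Lagrangian of
    delta. *)

Section GridParity.
Variable m : nat.
Implicit Type l : nat -> nat -> nat.

(** The doors of Sperner's lemma. *)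
Definition door (x y : nat) : bool :=
  ((x == 0) && (y == 1)) || ((x == 1) && (y == 0)).

Definition trichromatic (s : seq nat) : bool :=
  [&& 0%N \in s, 1%N \in s & has (leq 2) s].

Lemma square_doors (x y z w : nat) :
  door x y (+) door z w (+) door x z (+) door y w ->
  trichromatic [:: x; y; z; w].
Proof.
by case: x => [|[|x]]; case: y => [|[|y]]; case: z => [|[|z]]; case: w => [|[|w]].
Qed.

(* Parity of the edges labelled {0, 1}: it is even around a square missing one
   label, and these edges only occur, an odd number of times, on the bottom. *)
Lemma grid_trichromatic l : (0 < m)%N ->
  (forall j, (j <= m)%N -> l 0%N j = 0%N) ->
  (forall j, (j <= m)%N -> l m j <> 0%N) ->
  (forall i, (i <= m)%N -> (l i 0 <= 1)%N) ->
  (forall i, (i <= m)%N -> l i m <> 1%N) ->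
  exists i j, [/\ (i < m)%N, (j < m)%N &
   trichromatic [:: l i j; l i.+1 j; l i j.+1; l i.+1 j.+1]].
Proof.
move=> m0 L R B T; apply: contrapT => no.
have sq i j : (i < m)%N -> (j < m)%N ->
    door (l i j) (l i.+1 j) (+) door (l i j.+1) (l i.+1 j.+1) =
    door (l i j) (l i j.+1) (+) door (l i.+1 j) (l i.+1 j.+1).
  move=> im jm; apply/eqP/negPn/negP => H.
  apply: no; exists i, j; split => //; apply: square_doors.
  by move: H; do 4 case: (door _ _).
(* Adding [sq] along a strip compares the door parities of neighbouring rows: they differ by the two
   vertical ends. No edge of the left side (all labels 0) or of the right side (no label 0) is a
   door, so the full parity is the same in all rows. *)
pose row j k := \big[addb/false]_(0 <= i < k) door (l i j) (l i.+1 j).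
have rowE j k : (j < m)%N -> (k <= m)%N ->
    row j k (+) row j.+1 k = door (l 0%N j) (l 0%N j.+1) (+) door (l k j) (l k j.+1).
  move=> jm; elim: k => [|k IH] km; first by rewrite /row !big_geq ?addbb.
  have := IH (ltnW km); have := sq k j km jm.
  rewrite /row !big_nat_recr //= -/(row j k) -/(row j.+1 k).
  by case: (row j k); case: (row j.+1 k); do 6 case: (door _ _).
have door0 j : (j < m)%N -> row j m = row j.+1 m.
  move=> jm; have := rowE j m jm (leqnn _).
  have -> : door (l 0%N j) (l 0%N j.+1) = false by rewrite /door !L // ltnW.
  have /eqP/negPf E1 := R _ (ltnW jm); have /eqP/negPf E2 := R _ jm.
  by rewrite /door E1 E2 andbF; case: (row j m); case: (row j.+1 m).
have rows j : (j <= m)%N -> row 0%N m = row j m.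
  by elim: j => // j IH jm; rewrite (IH (ltnW jm)); exact: door0.
have: row m m = false.
  rewrite /row big_nat big1 // => i /andP[_ im].
  have /eqP/negPf E1 := T _ (ltnW im); have /eqP/negPf E2 := T _ im.
  by rewrite /door E1 E2 andbF.
rewrite -(rows m) //.
(* The bottom only carries the labels 0 and 1 and starts with 0, so the parity of the doors passed
   so far is the current label. *)
have bot k : (k <= m)%N -> row 0%N k = (l k 0%N == 1%N).
  elim: k => [|k IH] km; first by rewrite /row big_geq ?L.
  rewrite /row big_nat_recr //= -/(row 0%N k) IH ?(ltnW km) // /door.
  have := B _ (ltnW km); have := B _ km.
  by case: (l k 0%N) => [|[|?]] //; case: (l k.+1 0%N) => [|[|?]].
rewrite bot //; have := R 0%N (leq0n _); have := B m (leqnn _).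
by case: (l m 0%N) => [|[|?]].
Qed.

End GridParity.

Section PoincareMiranda.
Variable R : realType.
Implicit Types F : R * R -> R * R.

Lemma near_pos (T : topologicalType) (f : T -> R) x :
  {for x, continuous f} -> 0 < f x -> \forall y \near x, 0 < f y.
Proof. by move=> cf fx; exact: (cf _ (open_nbhs_nbhs (conj (@open_gt _ 0) fx))). Qed.

Lemma near_neg (T : topologicalType) (f : T -> R) x :
  {for x, continuous f} -> f x < 0 -> \forall y \near x, f y < 0.
Proof. by move=> cf fx; exact: (cf _ (open_nbhs_nbhs (conj (@open_lt _ 0) fx))). Qed.

(** Sperner's argument. Without a zero, compactness yields a mesh such that on every ball of radius
    [2 / m] centred in the square one component keeps a strict sign. A trichromatic square of the
    labelling by signs contradicts this: each component is <= 0 at one of its corners and >= 0 at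
    another. *)
Lemma poincare_miranda_unit F : continuous F ->
  (forall y, (F (0, y)).1 <= 0) -> (forall y, 0 <= (F (1, y)).1) ->
  (forall x, (F (x, 0)).2 <= 0) -> (forall x, 0 <= (F (x, 1)).2) ->
  exists x y, [/\ 0 <= x <= 1, 0 <= y <= 1 & F (x, y) = 0].
Proof.
move=> cF L Rt B T; apply: contrapT => no.
have c1 : continuous (fun z => (F z).1).
  by move=> z; apply: continuous_comp; [exact: cF|exact: cvg_fst].
have c2 : continuous (fun z => (F z).2).
  by move=> z; apply: continuous_comp; [exact: cF|exact: cvg_snd].
pose Q : set (R * R) := `[0, 1] `*` `[0, 1].
have cQ : compact Q by apply: compact_setX; exact: segment_compact.
pose P (A : set (R * R)) := (forall z, A z -> (F z).1 < 0) \/ (forall z, A z -> (F z).1 > 0)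
   \/ (forall z, A z -> (F z).2 < 0) \/ (forall z, A z -> (F z).2 > 0).
have nP z : Q z -> exists2 e, 0 < e & P (ball z e).
  case: z => x y [/= x01 y01].
  have sol A : nbhs (x, y) A -> P A -> exists2 e : R, 0 < e & P (ball (x, y) e).
    move=> /nbhs_ballP[e e0 eA] PA; exists e => //; rewrite /P.
    by case: PA => [H|[H|[H|H]]]; [left|right; left|do 2 right; left|do 3 right] => z /eA/H.
  have : (F (x, y)).1 != 0 \/ (F (x, y)).2 != 0.
    have [e1|] := eqVneq (F (x, y)).1 0; last by left.
    have [e2|] := eqVneq (F (x, y)).2 0; last by right.
    case: no; exists x, y; split; [by rewrite in_itv in x01|by rewrite in_itv in y01|].
    by rewrite [F _]surjective_pairing e1 e2.
  case; rewrite neq_lt => /orP[] H.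
  - by apply: (sol _ (near_neg (c1 _) H)); left.
  - by apply: (sol _ (near_pos (c1 _) H)); right; left.
  - by apply: (sol _ (near_neg (c2 _) H)); do 2 right; left.
  - by apply: (sol _ (near_pos (c2 _) H)); do 3 right.
have [m m0 mP] : exists2 m : nat, (0 < m)%N & forall z, Q z -> P (ball z (2 / m%:R)).
  have /compact_near_coveringP nc := cQ.
  have [] := nc nat \oo (fun m z => (0 < m)%N /\ P (ball z (2 / m%:R))) _.
    move=> z /nP[e e0 Pe].
    exists (ball z (e / 2), [set m | (0 < m)%N /\ 2 / m%:R <= e / 2]).
      split; first by apply: nbhsx_ballx; rewrite divr_gt0.
      near=> m; split; first by near: m; exact: nbhs_infty_gt.
      rewrite ler_pdivrMr ?ltr0n; last by near: m; exact: nbhs_infty_gt.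
      rewrite -ler_pdivrMl ?divr_gt0 //.
      by near: m; exact: nbhs_infty_ger.
    case=> w m [/= zw [m1 me]]; split => //.
    have sub : ball w (2 / m%:R) `<=` ball z e.
      move=> u wu; rewrite [e]splitr; apply: ball_triangle zw _.
      exact: le_ball wu.
    by rewrite /P; case: Pe => [H|[H|[H|H]]];
      [left|right; left|do 2 right; left|do 3 right] => u /sub/H.
  move=> N _ H; exists N.+1 => //.
    by move=> z Qz; case: (H N.+1 (leqnSn _) z Qz).
have m0R : 0 < m%:R :> R by rewrite ltr0n.
pose g (i j : nat) : R * R := (i%:R / m%:R, j%:R / m%:R).
(* The tests on [i] and [j] force the boundary labels even where a component vanishes on a side;
   there the weak sign hypotheses still give the inequalities [l0], [l0n], [l1] and [l2]. *)
pose l (i j : nat) : nat :=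
  if (i == 0)%N || ((i < m)%N && ((F (g i j)).1 <= 0)) then 0%N
  else if (j == 0)%N || ((j < m)%N && ((F (g i j)).2 <= 0)) then 1%N else 2%N.
have mm : m%:R / m%:R = 1 :> R by rewrite divff // gt_eqF.
have l0 i j : l i j = 0%N -> (F (g i j)).1 <= 0.
  rewrite /l; case: ifP => [/orP[/eqP-> _|/andP[_]//]|_]; last by case: ifP.
  by rewrite /g mul0r; exact: L.
have l0n i j : (i <= m)%N -> (0 < l i j)%N -> 0 <= (F (g i j)).1.
  rewrite /l leq_eqVlt => /orP[/eqP -> _|im]; first by rewrite /g mm; exact: Rt.
  case: ifP => // /negbT; rewrite negb_or im /= => /andP[_].
  by rewrite -ltNge => /ltW.
have l1 i j : l i j = 1%N -> (F (g i j)).2 <= 0.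
  rewrite /l; case: ifP => // _; case: ifP => // /orP[/eqP-> _|/andP[_]//].
  by rewrite /g mul0r; exact: B.
have l2 i j : (j <= m)%N -> (1 < l i j)%N -> 0 <= (F (g i j)).2.
  rewrite /l leq_eqVlt => /orP[/eqP -> _|jm]; first by rewrite /g mm; exact: T.
  case: ifP => // _; case: ifP => // /negbT; rewrite negb_or jm /= => /andP[_].
  by rewrite -ltNge => /ltW.
have [i [j [im jm]]] : exists i j, [/\ (i < m)%N, (j < m)%N &
   trichromatic [:: l i j; l i.+1 j; l i j.+1; l i.+1 j.+1]].
  apply: grid_trichromatic => //.
  - move=> j jm; rewrite /l ltnn /= gtn_eqF //=; by case: ifP.
  - move=> i im; rewrite /l; case: ifP => // _; by rewrite eqxx.
  - move=> i im; rewrite /l; case: ifP => // _; by rewrite ltnn gtn_eqF.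
have Qg : Q (g i j).
  by split; rewrite /= in_itv /= divr_ge0 //= ler_pdivrMr // mul1r ler_nat ltnW.
have near_g a b : (a <= 1)%N -> (b <= 1)%N -> ball (g i j) (2 / m%:R) (g (i + a)%N (j + b)%N).
  have e1 k c : (c <= 1)%N -> `|k%:R / m%:R - (k + c)%N%:R / m%:R| < 2 / m%:R :> R.
    move=> c1'; rewrite -mulrBl natrD opprD addNKr.
    rewrite normrM normrN !normr_nat ger0_norm ?invr_ge0 // ltr_pM2r ?invr_gt0 // ltr_nat ltnS.
    exact: leq_trans c1' _.
  by move=> a1 b1; split; apply: e1.
set s := [:: _; _; _; _].
have sP x : x \in s -> exists i' j', [/\ ball (g i j) (2 / m%:R) (g i' j'),
    (i' <= m)%N, (j' <= m)%N & x = l i' j'].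
  have k (a b : nat) : (a <= 1)%N -> (b <= 1)%N -> exists i' j', [/\ ball (g i j) (2 / m%:R) (g i' j'),
    (i' <= m)%N, (j' <= m)%N & l (i + a)%N (j + b)%N = l i' j'].
    move=> a1 b1; exists (i + a)%N, (j + b)%N; split => //; [exact: near_g|lia|lia].
  rewrite !inE => /or4P[] /eqP ->.
  - by have := k 0%N 0%N isT isT; rewrite !addn0.
  - by have := k 1%N 0%N isT isT; rewrite !addn0 addn1.
  - by have := k 0%N 1%N isT isT; rewrite !addn0 addn1.
  - by have := k 1%N 1%N isT isT; rewrite !addn1.
case/and3P => /sP[i0 [j0 [b0 _ _ /esym/l0 H0]]] /sP[i1 [j1 [b1 i1m _ h1]]]
  /hasP[x /sP[i2 [j2 [b2 _ j2m ->]]] /(l2 _ _ j2m) H2].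
have H1 : 0 <= (F (g i1 j1)).1 by apply: l0n => //; rewrite -h1.
have H1' : (F (g i1 j1)).2 <= 0 by apply: l1; rewrite -h1.
case: (mP _ Qg) => [/(_ _ b1)|[/(_ _ b0)|[/(_ _ b2)|/(_ _ b1)]]]; apply/negP; by rewrite -leNgt.
Unshelve. all: by end_near.
Qed.

Lemma continuous_pair (T U V : topologicalType) (f : T -> U) (g : T -> V) :
  continuous f -> continuous g -> continuous (fun x => (f x, g x)).
Proof. by move=> cf cg x; exact: cvg_pair (cf x) (cg x). Qed.

Lemma poincare_miranda F (a b c d : R) : continuous F -> a < b -> c < d ->
  (forall y, c <= y <= d -> (F (a, y)).1 <= 0) ->
  (forall y, c <= y <= d -> 0 <= (F (b, y)).1) ->
  (forall x, a <= x <= b -> (F (x, c)).2 <= 0) ->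
  (forall x, a <= x <= b -> 0 <= (F (x, d)).2) ->
  exists x y, [/\ a <= x <= b, c <= y <= d & F (x, y) = 0].
Proof.
move=> cF ab cd L Rt B T.
(* An affine parametrization precomposed with the retraction of the line onto [0, 1]: the sign
   conditions on the sides of the rectangle become conditions on whole lines, as the unit version
   requires. *)
pose h (p q t : R) := p + Num.max 0 (Num.min 1 t) * (q - p).
have hc p q : continuous (h p q).
  move=> t; apply: cvgD; first exact: cvg_cst.
  apply: cvgM; last exact: cvg_cst.
  apply: continuous_max; first exact: cvg_cst.
  by apply: continuous_min; [exact: cvg_cst|exact: cvg_id].
have hb p q t : p < q -> p <= h p q t <= q.
  move=> pq; rewrite /h; set u := Num.max _ _.
  have /andP[u0 u1] : 0 <= u <= 1.
    by rewrite /u le_max lexx /= ge_max ler01 ge_min lexx.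
  by apply/andP; split; nra.
have h0 p q : h p q 0 = p by rewrite /h min_r ?maxxx ?mul0r ?addr0.
have h1 p q : h p q 1 = q by rewrite /h minxx max_r // mul1r addrC subrK.
pose G z := F (h a b z.1, h c d z.2).
have cG : continuous G.
  move=> z; apply: (@continuous_comp _ _ _ (fun z => (h a b z.1, h c d z.2)) F); last exact: cF.
  apply: continuous_pair => w; apply: continuous_comp; try exact: hc.
    exact: cvg_fst.
  exact: cvg_snd.
have [] := poincare_miranda_unit cG.
- by move=> y; rewrite /G /= h0; apply: L; exact: hb.
- by move=> y; rewrite /G /= h1; apply: Rt; exact: hb.
- by move=> x; rewrite /G /= h0; apply: B; exact: hb.
- by move=> x; rewrite /G /= h1; apply: T; exact: hb.
move=> x [y [_ _ e]]; exists (h a b x), (h c d y); split => //; exact: hb.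
Qed.

End PoincareMiranda.

(** * Moebius transformations of the upper half plane *)

Section Moebius.
Variable R : realType.
Implicit Types (g h : 'M[R]_2) (z w : R * R).

Local Notation U := (@upper_half_plane R).

Definition mx2 (a b c d : R) : 'M[R]_2 :=
  \matrix_(i, j) if i == 0 then if j == 0 then a else b
                 else if j == 0 then c else d.

Lemma sum_ord2 (V : nmodType) (F : 'I_2 -> V) : \sum_(i < 2) F i = F 0 + F 1.
Proof.
rewrite !big_ord_recl big_ord0 addr0; congr (F _ + F _).
exact: val_inj.
Qed.

Lemma mx2_eta g : g = mx2 (g 0 0) (g 0 1) (g 1 0) (g 1 1).
Proof.
apply/matrixP => i j; rewrite mxE.
by case: i => [[|[|//]] ?]; case: j => [[|[|//]] ?] /=; congr (g _ _); exact: val_inj.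
Qed.

Lemma mx2E (a b c d : R) : (mx2 a b c d 0 0 = a) * (mx2 a b c d 0 1 = b) *
  (mx2 a b c d 1 0 = c) * (mx2 a b c d 1 1 = d).
Proof. by rewrite !mxE. Qed.

Lemma mx2_mul a b c d a' b' c' d' : mx2 a b c d *m mx2 a' b' c' d' =
  mx2 (a * a' + b * c') (a * b' + b * d') (c * a' + d * c') (c * b' + d * d').
Proof.
rewrite [LHS]mx2_eta; congr mx2; by rewrite !mxE sum_ord2 !mxE.
Qed.

Lemma mx2_opp a b c d : - mx2 a b c d = mx2 (- a) (- b) (- c) (- d).
Proof. by rewrite [LHS]mx2_eta !mxE. Qed.

Lemma mx2_1 : 1%:M = mx2 1 0 0 1.
Proof. by rewrite [LHS]mx2_eta !mxE. Qed.

Lemma det_mx2 g : \det g = g 0 0 * g 1 1 - g 0 1 * g 1 0.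
Proof.
rewrite (expand_det_row _ 0) sum_ord2 /cofactor !det_mx11 !mxE /=.
rewrite !expr0 expr1 !mul1r mulN1r mulrN; congr (_ * g _ _ - _ * g _ _); exact: val_inj.
Qed.

Lemma inv_mx2 g : \det g = 1 -> invmx g = mx2 (g 1 1) (- g 0 1) (- g 1 0) (g 0 0).
Proof.
move=> dg; have gu : g \in unitmx by rewrite unitmxE dg unitr1.
apply: (can_inj (mulKmx gu)); rewrite mulmxV // {1}[g]mx2_eta mx2_mul mx2_1.
by move: dg; rewrite det_mx2 => dg; congr mx2; try ring; rewrite -dg; ring.
Qed.

Lemma mulcE (a b c d : R) : Complex a b * Complex c d = Complex (a * c - b * d) (a * d + b * c).
Proof. by []. Qed.

Lemma addcE (a b c d : R) : Complex a b + Complex c d = Complex (a + c) (b + d).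
Proof. by []. Qed.

Lemma divcE (a b c d : R) : Complex a b / Complex c d =
  Complex ((a * c + b * d) / (c ^+ 2 + d ^+ 2)) ((b * c - a * d) / (c ^+ 2 + d ^+ 2)).
Proof.
have -> : Complex a b / Complex c d = mulc (Complex a b) (invc (Complex c d)) by [].
by rewrite /mulc /invc; set n := (_ + _)^-1; congr Complex; ring.
Qed.

Lemma realcE (a : R) : real_complex R a = Complex a 0. Proof. by []. Qed.

(** |c z + d|^2, by which the imaginary part is divided. *)
Definition mob_den g z : R := (g 1 0 * z.1 + g 1 1) ^+ 2 + (g 1 0 * z.2) ^+ 2.

Definition toC z : R[i] := Complex z.1 z.2.

Lemma toC_inj : injective toC.
Proof. by move=> [x y] [x' y'] [-> ->]. Qed.

Local Open Scope complex_scope.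

Lemma toC_moebius g z : toC (moebius g z) =
  ((g 0 0)%:C * toC z + (g 0 1)%:C) / ((g 1 0)%:C * toC z + (g 1 1)%:C).
Proof. by rewrite /moebius /toC; set w := (_ / _); case: w. Qed.

Local Close Scope complex_scope.

Lemma moebiusE g z : moebius g z =
  (((g 0 0 * z.1 + g 0 1) * (g 1 0 * z.1 + g 1 1) + g 0 0 * g 1 0 * z.2 ^+ 2) / mob_den g z,
   \det g * z.2 / mob_den g z).
Proof.
apply: toC_inj; rewrite toC_moebius det_mx2 /mob_den; case: z => x y.
have e (a b : R) : a%:C%C * toC (x, y) + b%:C%C = Complex (a * x + b) (a * y).
  by rewrite /toC !realcE mulcE addcE /= !(mul0r, addr0, subr0).
rewrite !e divcE /toC /=; congr Complex; congr (_ / _); ring.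
Qed.

Lemma mob_den_gt0 g z : \det g = 1 -> U z -> 0 < mob_den g z.
Proof.
move=> dg; rewrite /upper_half_plane /= /mob_den => z0.
have [c0|c0] := eqVneq (g 1 0) 0.
  move: dg; rewrite det_mx2 c0 mulr0 subr0 !mul0r add0r expr0n /= addr0 => dg.
  rewrite exprn_even_gt0 //=; apply/negP => /eqP d0.
  by move: dg; rewrite d0 mulr0 => /eqP; rewrite eq_sym oner_eq0.
apply: ltr_wpDl; first exact: sqr_ge0.
by rewrite exprn_even_gt0 //= mulf_neq0 // gt_eqF.
Qed.

Lemma moebius_uhp g z : \det g = 1 -> U z -> U (moebius g z).
Proof.
move=> dg Uz; rewrite moebiusE /upper_half_plane /= dg mul1r divr_gt0 //.
exact: mob_den_gt0.
Qed.

Local Open Scope complex_scope.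

Lemma mob_den_neq0 g z : \det g = 1 -> U z -> (g 1 0)%:C * toC z + (g 1 1)%:C != 0.
Proof.
move=> dg Uz; have := mob_den_gt0 dg Uz; apply: contraTN => /eqP.
rewrite /toC !realcE !mulcE !addcE !(mul0r, addr0, subr0) => -[e1 e2].
by rewrite /mob_den e1 e2 expr0n /= addr0 ltxx.
Qed.

Lemma moebius_mul g h z : \det g = 1 -> \det h = 1 -> U z ->
  moebius (g *m h) z = moebius g (moebius h z).
Proof.
move=> dg dh Uz; apply: toC_inj; rewrite !toC_moebius.
have nh := mob_den_neq0 dh Uz.
have ng := mob_den_neq0 dg (moebius_uhp dh Uz).
have ngh : (\det (g *m h) = 1)%R by rewrite det_mulmx dg dh mul1r.
have {ngh} := mob_den_neq0 ngh Uz; move: ng; rewrite toC_moebius.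
rewrite !mxE !sum_ord2 !rmorphD !rmorphM /=.
set z' := toC z in nh *; move: nh.
move: (g 0 0)%:C (g 0 1)%:C (g 1 0)%:C (g 1 1)%:C (h 0 0)%:C (h 0 1)%:C (h 1 0)%:C (h 1 1)%:C.
move=> a b c d a' b' c' d' n1 n2 n3; field.
rewrite n1 /=; apply: contraNN n3 => /eqP e; apply/eqP; rewrite -e; ring.
Qed.

Local Close Scope complex_scope.

Lemma moebius1 z : moebius 1%:M z = z.
Proof.
by rewrite moebiusE /mob_den mx2_1 det_mx2 !mxE /=; case: z => x y /=; congr pair; field.
Qed.

Lemma moebiusN g z : moebius (- g) z = moebius g z.
Proof.
rewrite !moebiusE /mob_den !det_mx2 !mxE; congr pair; congr (_ / _); ring.
Qed.

Lemma moebius_continuous g z : \det g = 1 -> U z -> {for z, continuous (moebius g)}.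
Proof.
move=> dg Uz.
have -> : moebius g = fun z => (((g 0 0 * z.1 + g 0 1) * (g 1 0 * z.1 + g 1 1) + g 0 0 * g 1 0 * z.2 ^+ 2) / mob_den g z,
   \det g * z.2 / mob_den g z) by apply/funext => w; rewrite moebiusE.
have c1 : {for z, continuous (fun z : R * R => z.1)} by exact: cvg_fst.
have c2 : {for z, continuous (fun z : R * R => z.2)} by exact: cvg_snd.
have cc (a : R) : {for z, continuous (fun _ : R * R => a)} by exact: cvg_cst.
have lin (a b : R) : {for z, continuous (fun z : R * R => a * z.1 + b)}.
  exact: cvgD (cvgM (cc a) c1) (cc b).
have sq (f : R * R -> R) : {for z, continuous f} -> {for z, continuous (fun z => f z ^+ 2)}.
  by move=> Hf; exact: (cvgM Hf Hf).
have cd : {for z, continuous (mob_den g)}.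
  exact: cvgD (sq _ (lin _ _)) (sq _ (cvgM (cc _) c2)).
have cv : {for z, continuous (fun z => (mob_den g z)^-1)}.
  by apply: cvgV => //; rewrite gt_eqF // mob_den_gt0.
have k1 : {for z, continuous (fun z => ((g 0 0 * z.1 + g 0 1) * (g 1 0 * z.1 + g 1 1) + g 0 0 * g 1 0 * z.2 ^+ 2) / mob_den g z)}.
  exact: cvgM (cvgD (cvgM (lin _ _) (lin _ _)) (cvgM (cc _) (sq _ c2))) cv.
have k2 : {for z, continuous (fun z => \det g * z.2 / mob_den g z)}.
  exact: cvgM (cvgM (cc _) c2) cv.
exact: cvg_pair k1 k2.
Qed.

Definition psl_eq g h := g = h \/ g = - h.

Lemma psl_refl g : psl_eq g g. Proof. by left. Qed.

Lemma psl_sym g h : psl_eq g h -> psl_eq h g.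
Proof. by case=> ->; [left|right; rewrite opprK]. Qed.

Lemma psl_trans h g k : psl_eq g h -> psl_eq h k -> psl_eq g k.
Proof. by case=> -> [] ->; [left|right|right|left; rewrite opprK]. Qed.

Lemma psl_mul g g' h h' : psl_eq g g' -> psl_eq h h' -> psl_eq (g *m h) (g' *m h').
Proof.
by case=> -> [] ->; rewrite ?mulNmx ?mulmxN ?opprK; [left|right|right|left].
Qed.

Lemma psl_moebius g h z : psl_eq g h -> moebius g z = moebius h z.
Proof. by case=> ->; rewrite ?moebiusN. Qed.

(** Fixing the two points i and 2 i already forces b = c = 0 and a = d. *)
Lemma moebius_eq_id g : \det g = 1 -> (forall z, U z -> moebius g z = z) -> psl_eq g 1%:M.
Proof.
move=> dg fix_.
have key (t : R) : 0 < t -> g 0 1 = - g 1 0 * t ^+ 2 /\ g 0 0 = g 1 1.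
  move=> t0; have Ut : U (0, t) by [].
  have := congr1 toC (fix_ _ Ut); have := mob_den_neq0 dg Ut.
  rewrite toC_moebius => nz /(congr1 (fun w : R[i] => w * ((g 1 0)%:C * toC (0, t) + (g 1 1)%:C)%C)).
  rewrite divfK //= => -[] /=; rewrite !(mulr0, mul0r, subr0, addr0, add0r, sub0r, oppr0) => e1 e2; split.
    by rewrite e1; ring.
  by move: e2; rewrite mulrC => /(mulfI (lt0r_neq0 t0)).
have [b1 ad] := key 1 ltr01; have [b2 _] := key 2 (ltr0Sn _ 1).
have c0 : g 1 0 = 0 by lra.
have b0 : g 0 1 = 0 by rewrite b1 c0 oppr0 mul0r.
move: dg; rewrite det_mx2 ad b0 mul0r subr0 => /eqP; rewrite -expr2 sqrf_eq1 => /orP[]/eqP d1.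
  by left; rewrite [g]mx2_eta mx2_1 ad b0 c0 d1.
by right; rewrite [g]mx2_eta mx2_1 mx2_opp ad b0 c0 d1 oppr0.
Qed.

Lemma moebius_psl g h : \det g = 1 -> \det h = 1 ->
  (forall z, U z -> moebius g z = moebius h z) -> psl_eq g h.
Proof.
move=> dg dh e; have hu : h \in unitmx by rewrite unitmxE dh unitr1.
have dhi : \det (invmx h) = 1 by rewrite det_inv dh invr1.
have := @moebius_eq_id (invmx h *m g); rewrite det_mulmx dg dhi mulr1 => /(_ erefl).
case=> [z Uz|/(congr1 (mulmx h))|/(congr1 (mulmx h))].
- by rewrite moebius_mul // e // -moebius_mul // mulVmx // moebius1.
- by rewrite mulKVmx // mulmx1; left.
- by rewrite mulKVmx // mulmxN mulmx1; right.
Qed.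

End Moebius.

(** * Lifting homotopies of closed curves *)

Lemma connected_locally_constant (T : topologicalType) (A : set T) (P : T -> Prop) a b :
  connected A ->
  (forall x, A x -> \forall y \near x, A y -> (P x <-> P y)) ->
  A a -> A b -> P a -> P b.
Proof.
move=> cA loc Aa Ab Pa.
suff : [set x | A x /\ P x] = A by move=> e; have : A b by []; rewrite -e => -[].
apply: cA; first by exists a.
- exists (interior [set y | A y -> P y]); first exact: open_interior.
  apply/seteqP; split=> x /= [Ax Px]; split => //.
    by apply: filterS (loc x Ax) => y e Ay; apply/(e Ay).
  exact: (nbhs_singleton Px).
- exists (~` interior [set y | A y -> ~ P y]); first exact/open_closedC/open_interior.
  apply/seteqP; split=> x /= [Ax Px]; split => //.
    by move=> /nbhs_singleton /(_ Ax).
  apply: contrapT => nP; apply: Px.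
  by apply: filterS (loc x Ax) => y e Ay /(e Ay).
Qed.

Section Lift.
Variables (R : realType) (S : topologicalType) (Gamma : groupType).
Variable H : hyperbolization R S Gamma.
Implicit Types (g h : Gamma) (z : R * R).

Local Notation U := (@upper_half_plane R).

Lemma open_uhp : open U.
Proof.
have -> : U = (fun z : R * R => z.2) @^-1` [set y | 0 < y] by [].
by apply: open_comp; [move=> z _; exact: cvg_snd|exact: open_gt].
Qed.

Definition deck g z := moebius (hol H g) z.

Lemma deck_uhp g z : U z -> U (deck g z).
Proof. by move=> Uz; apply: moebius_uhp => //; exact: hol_det. Qed.

Lemma deckM g h z : U z -> deck (g * h)%g z = deck g (deck h z).
Proof. exact: hol_mul. Qed.

(** [hol] is multiplicative only through its action, so the matrix of 1 is not given; its action is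
    idempotent and invertible, hence trivial. *)
Lemma deck1 z : U z -> deck 1%g z = z.
Proof.
move=> Uz; have e (a : R * R) : U a -> moebius (hol H 1%g) a = moebius 1%:M a.
  move=> Ua.
  have d1 := hol_det H 1%g.
  have du : hol H 1%g \in unitmx by rewrite unitmxE d1 unitr1.
  have di : \det (invmx (hol H 1%g)) = 1 by rewrite det_inv d1 invr1.
  have := @hol_mul _ _ _ H 1%g 1%g a Ua; rewrite mul1g => /(congr1 (moebius (invmx (hol H 1%g)))).
  rewrite -moebius_mul // mulVmx // => ->.
  by rewrite -moebius_mul ?mulVmx ?moebius1 //; exact: moebius_uhp.
by rewrite /deck e // moebius1.
Qed.

Lemma deckK g z : U z -> deck g^-1%g (deck g z) = z.
Proof. by move=> Uz; rewrite -deckM // mulVg deck1. Qed.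

Lemma deckKV g z : U z -> deck g (deck g^-1%g z) = z.
Proof. by move=> Uz; rewrite -deckM // mulgV deck1. Qed.

Lemma deck_free g h z : U z -> deck g z = deck h z -> g = h.
Proof.
move=> Uz e; have : (h^-1 * g)%g = 1%g.
  by apply: (@hol_free _ _ _ H _ z Uz); rewrite -/(deck _ _) deckM // e deckK.
by move=> e1; rewrite -[g]mul1g -(mulgV h) -mulgA e1 mulg1.
Qed.

Lemma unif_deck g z : U z -> unif H (deck g z) = unif H z.
Proof. by move=> Uz; apply/esym/unif_fiber => //; [exact: deck_uhp|exists g]. Qed.

Lemma unif_eq z w : U z -> U w -> unif H z = unif H w -> exists g, w = deck g z.
Proof. by move=> Uz Uw /unif_fiber => /(_ Uz Uw). Qed.

Lemma deck_continuous g z : U z -> {for z, continuous (deck g)}.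
Proof. by move=> Uz; apply: moebius_continuous => //; exact: hol_det. Qed.

Definition section_on (W : set S) (s : S -> R * R) :=
  forall w : S, W w -> [/\ U (s w), unif H (s w) = w & {for w, continuous s}].

(** A section through every point of the fibre replaces the decomposition of the preimage into
    sheets. *)
Definition evenly_covered (W : set S) := open W /\
  forall z, U z -> W (unif H z) -> exists2 s, section_on W s & s (unif H z) = z.

(** A local inverse exists on the image of a small open set, by openness and local injectivity;
    composing it with deck transformations gives sections through all other points of the fibres. *)
Lemma unif_evenly_covered (x : S) : surface_interior R S x -> exists2 W, evenly_covered W & W x.
Proof.
rewrite -(unif_image H) => -[z Uz <-].
have [V0 V0z inj] := unif_locally_injective H Uz.
pose V := interior V0 `&` U.
have oV : open V by apply: openI; [exact: open_interior|exact: open_uhp].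
have VU : V `<=` U by move=> ? [].
have Vinj z1 z2 : V z1 -> V z2 -> unif H z1 = unif H z2 -> z1 = z2.
  by move=> [/interior_subset a _] [/interior_subset b _] /inj -> //; rewrite inE.
have oW : open (unif H @` V) by apply: unif_open.
exists (unif H @` V); last by exists z => //; split => //; exact/nbhs_interior.
have /choice[s0 s0P] : forall w, exists z, (unif H @` V) w -> V z /\ unif H z = w.
  move=> w.
  have [[y Vy yw]|nw] := EM ((unif H @` V) w); first by exists y.
  by exists 0.
have s0c w : (unif H @` V) w -> {for w, continuous s0}.
  move=> Ww B /nbhs_interior Bw; have [Vs sw] := s0P _ Ww.
  pose B' := interior B `&` V.
  have oB' : open B' by apply: openI => //; exact: open_interior.
  have : nbhs w (unif H @` B').
    apply: open_nbhs_nbhs; split; first by apply: unif_open => // ? [_ /VU].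
    by exists (s0 w) => //; split => //; exact: nbhs_singleton.
  apply: filterS => y [v [Bv Vv] <-].
  have [Vs' e] : V (s0 (unif H v)) /\ unif H (s0 (unif H v)) = unif H v by apply: s0P; exists v.
  by rewrite /= (Vinj _ _ Vs' Vv e); exact: interior_subset.
split=> // z' Uz' Wz'; have [Vs e] := s0P _ Wz'.
have [g gE] := unif_eq (VU _ Vs) Uz' e.
exists (deck g \o s0) => // w Ww /=; have [/VU Us e'] := s0P _ Ww; split.
- exact: deck_uhp.
- by rewrite unif_deck.
- by apply: continuous_comp; [exact: s0c|exact: deck_continuous].
Qed.

(** Agreement is an open condition by local injectivity of the covering, disagreement by
    continuity. *)
Lemma lift_unique (T : topologicalType) (A : set T) (f g : T -> R * R) a b :
  connected A -> (forall x, A x -> {for x, continuous f}) ->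
  (forall x, A x -> {for x, continuous g}) ->
  (forall x, A x -> U (f x) /\ U (g x)) ->
  (forall x, A x -> unif H (f x) = unif H (g x)) ->
  A a -> A b -> f a = g a -> f b = g b.
Proof.
move=> cA cf cg Ufg e; apply: (@connected_locally_constant _ A (fun x => f x = g x)) => // x Ax.
have [fg|fg] := EM (f x = g x).
  have [V Vx inj] := unif_locally_injective H (Ufg x Ax).1.
  have Vg : nbhs (g x) V by rewrite -fg.
  near=> y => Ay; split=> // _; apply: inj; rewrite ?inE; last exact: e.
  - by near: y; exact: cf Vx.
  - by near: y; exact: cg Vg.
have d0 : 0 < `|f x - g x| by rewrite normr_gt0 subr_eq0; apply/eqP.
have : \forall y \near x, 0 < `|f y - g y|.
  apply: (@near_pos _ _ (fun y => `|f y - g y|)) => //.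
  by apply: cvg_norm; apply: cvgB; [exact: cf|exact: cg].
apply: filterS => y; rewrite normr_gt0 subr_eq0 => /eqP ne _.
by split.
Unshelve. all: by end_near.
Qed.

Definition equivariant_path g (c : R -> R * R) :=
  [/\ continuous c, forall t, U (c t) & forall t, c (t + 1) = deck g (c t)].

Definition has_lift g (k : R -> S) :=
  exists2 c, equivariant_path g c & forall t, unif H (c t) = k t.

Lemma connected_ball (x e : R) : connected (ball x e).
Proof.
apply/connected_intervalP => a b; rewrite -!ball_normE /= => xa xb c /andP[ac cb].
by move: xa xb; rewrite !ltr_norml !ltrBlDr !ltrBrDr => /andP[? ?] /andP[? ?]; apply/andP; split; lra.
Qed.

(** A Lebesgue number for one period of the curve at time [s0], extended to the whole line by
    periodicity. *)
Lemma uniform_evenly_covered (K : R * R -> S) (s0 : R) : continuous K ->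
  (forall z, surface_interior R S (K z)) -> (forall s t, K (s, t + 1) = K (s, t)) ->
  exists2 e : R, 0 < e & forall t, exists2 W, evenly_covered W &
    forall s' t', ball s0 e s' -> ball t e t' -> W (K (s', t')).
Proof.
move=> cK iK pK.
have /compact_near_coveringP nc := @segment_compact R 0 1.
pose P (e t : R) := exists2 W, evenly_covered W &
    forall s' t', ball s0 e s' -> ball t e t' -> W (K (s', t')).
have [] := nc R (0^'+) P _.
  move=> t _; have [W eW Wx] := unif_evenly_covered (iK (s0, t)).
  have : nbhs (s0, t) (K @^-1` W).
    by apply: cK; apply: open_nbhs_nbhs; split => //; case: eW.
  move=> /nbhs_ballP[e /= e0 eW'].
  exists (ball t (e / 2), [set e' | e' <= e / 2]).
    split; first by apply: nbhsx_ballx; rewrite divr_gt0.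
    by apply: nbhs_right_le; rewrite divr_gt0.
  move=> [t1 e1] [/= tt1 e1e]; exists W => // s' t' bs bt; apply: eW'; split => /=.
    by apply: le_ball bs; apply: (le_trans e1e); rewrite ler_pdivrMr //; lra.
  by rewrite [e]splitr; apply: ball_triangle tt1 _; exact: le_ball bt.
move=> d /= d0 dP.
have PP : `[0, 1] `<=` P (d / 2).
  apply: dP; last by rewrite divr_gt0.
  by rewrite /ball_ /= sub0r normrN gtr0_norm ?divr_gt0 // ltr_pdivrMr //; lra.
exists (d / 2); first by rewrite divr_gt0.
move=> t.
pose n := Num.floor t.
have t01 : t - n%:~R \in `[0, 1].
  by rewrite in_itv /= subr_ge0 floor_le_tmp lerBlDl ltW // -[1]/(1%:~R) -intrD floorD1_gt.
have pKn (k : nat) s u : K (s, u + k%:R) = K (s, u).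
  by elim: k u => [|k IH] u; rewrite ?addr0 // -natr1 addrA pK.
have pKz (k : int) s u : K (s, u + k%:~R) = K (s, u).
  case: k => k; first exact: pKn.
  by rewrite NegzE -(pKn k.+1) mulrNz addrNK.
have [W eW WP] := PP _ t01; exists W => // s' t' bs bt.
rewrite -(pKz (- n)) mulrNz; apply: WP => //.
by move: bt; rewrite -!ball_normE /= opprB addrA subrK.
Qed.

(** The lift at time [s] selects for each [t] a local section of the covering; applying these
    sections to the curve at time [s'] gives its lift, once sections chosen at nearby parameters are
    known to agree. *)
Lemma lift_step (K : R * R -> S) g (s0 : R) : continuous K ->
  (forall z, surface_interior R S (K z)) -> (forall s t, K (s, t + 1) = K (s, t)) ->
  exists2 e, 0 < e & forall s s', ball s0 e s -> ball s0 e s' ->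
    has_lift g (fun t => K (s, t)) -> has_lift g (fun t => K (s', t)).
Proof.
move=> cK iK pK; have [e e0 eP] := uniform_evenly_covered s0 cK iK pK.
exists e => // s s' bs bs' [c [cc Uc ec] uc].
have /choice[sg sgP] : forall t, exists st, exists W, [/\ section_on W st,
    st (K (s, t)) = c t & forall s' t', ball s0 e s' -> ball t e t' -> W (K (s', t'))].
  move=> t.
  have [W eW WP] := eP t.
  have Wt : W (unif H (c t)) by rewrite uc; apply: WP => //; exact: ballxx.
  by have [st stW stE] := eW.2 _ (Uc t) Wt; exists st, W; split => //; rewrite -uc.
have K1 u : continuous (fun t => K (u, t)).
  by move=> t; apply: (@continuous_comp _ _ _ (fun t => (u, t)) K); [apply: continuous_pair => ?; [exact: cvg_cst|exact: cvg_id]|exact: cK].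
have K2 t : continuous (fun u => K (u, t)).
  by move=> u; apply: (@continuous_comp _ _ _ (fun u => (u, t)) K); [apply: continuous_pair => ?; [exact: cvg_id|exact: cvg_cst]|exact: cK].
(* Two applications of uniqueness: from [u] back to [s] at the fixed parameter [t'], then along the
   given lift from [t] to [t'], starting where the section at [t] takes the value [c t]. *)
have along t t' u : ball t e t' -> ball s0 e u -> sg t (K (u, t')) = sg t' (K (u, t')).
  move=> tt' bu; have [W [sW sc WP]] := sgP t; have [W' [sW' sc' WP']] := sgP t'.
  have t't' : ball t' e t' by exact: ballxx.
  apply: (@lift_unique _ (ball s0 e) (fun u => sg t (K (u, t'))) (fun u => sg t' (K (u, t'))) s u) => //.
  - exact: connected_ball.
  - by move=> x bx; apply: continuous_comp; [exact: K2|have [] := sW _ (WP _ _ bx tt')].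
  - by move=> x bx; apply: continuous_comp; [exact: K2|have [] := sW' _ (WP' _ _ bx t't')].
  - by move=> x bx; have [] := sW _ (WP _ _ bx tt'); have [] := sW' _ (WP' _ _ bx t't').
  - by move=> x bx; have [_ -> _] := sW _ (WP _ _ bx tt'); have [_ -> _] := sW' _ (WP' _ _ bx t't').
  rewrite sc'.
  apply: (@lift_unique _ (ball t e) (fun t' => sg t (K (s, t'))) c t t') => //.
  - exact: connected_ball.
  - by move=> x bx; apply: continuous_comp; [exact: K1|have [] := sW _ (WP _ _ bs bx)].
  - by move=> x bx; exact: cc.
  - by move=> x bx; have [] := sW _ (WP _ _ bs bx).
  - by move=> x bx; have [_ -> _] := sW _ (WP _ _ bs bx).
  - exact: ballxx.
exists (fun t => sg t (K (s', t))); last first.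
  by move=> t; have [W [sW _ WP]] := sgP t; have [_ -> _] := sW _ (WP _ _ bs' (ballxx t e0)).
split.
- move=> t; have [W [sW _ WP]] := sgP t.
  have ct : {for t, continuous (fun t' => sg t (K (s', t')))}.
    by apply: continuous_comp; [exact: K1|have [] := sW _ (WP _ _ bs' (ballxx t e0))].
  rewrite /continuous_at; apply: cvg_trans ct; apply: near_eq_cvg.
  by exists e => //= t' bt; exact: along.
- by move=> t; have [W [sW _ WP]] := sgP t; have [] := sW _ (WP _ _ bs' (ballxx t e0)).
move=> t; have [W [sW sc WP]] := sgP t; have [W' [sW' sc' WP']] := sgP (t + 1).
have tt : ball t e t by exact: ballxx.
have tt' : ball (t + 1) e (t + 1) by exact: ballxx.
(* Both sides lift the path [u] to [K (u, t)], and at [u = s] they agree by equivariance of the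
   given lift. *)
apply: (@lift_unique _ (ball s0 e) (fun u => sg (t + 1) (K (u, t + 1))) (fun u => deck g (sg t (K (u, t)))) s s') => //.
- exact: connected_ball.
- by move=> x bx; apply: continuous_comp; [exact: K2|have [] := sW' _ (WP' _ _ bx tt')].
- move=> x bx; have [Ux _ cx] := sW _ (WP _ _ bx tt).
  apply: continuous_comp; last exact: deck_continuous.
  by apply: continuous_comp; [exact: K2|].
- move=> x bx; have [Ux _ cx] := sW _ (WP _ _ bx tt); have [] := sW' _ (WP' _ _ bx tt').
  by move=> *; split => //; exact: deck_uhp.
- move=> x bx; have [Ux ex cx] := sW _ (WP _ _ bx tt); have [_ -> _] := sW' _ (WP' _ _ bx tt').
  by rewrite unif_deck // ex pK.
- by rewrite sc' sc ec.
Qed.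

Lemma homotopy_lift (K : R * R -> S) g : continuous K ->
  (forall z, surface_interior R S (K z)) -> (forall s t, K (s, t + 1) = K (s, t)) ->
  has_lift g (fun t => K (0, t)) -> has_lift g (fun t => K (1, t)).
Proof.
move=> cK iK pK.
move=> h0.
apply: (@connected_locally_constant R `[0%R, 1%R] (fun s => has_lift g (fun t => K (s, t))) 0 1) => //.
- exact: segment_connected.
- move=> s _; have [e e0 eP] := lift_step g s cK iK pK.
  exists e => //= s' bs _; split; apply: eP => //; exact: ballxx.
- by rewrite /= in_itv /= lexx ler01.
- by rewrite /= in_itv /= lexx ler01.
Qed.

End Lift.

(** * Pushing a surface into its interior *)

Lemma within_continuous_comp (X Y Z : topologicalType) (A : set Y) (f : Y -> Z)
    (g : X -> Y) (x : X) :
  {within A, continuous f} -> {for x, continuous g} -> A (g x) ->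
  (\forall y \near x, A (g y)) -> {for x, continuous (f \o g)}.
Proof.
move=> /subspace_continuousP cf cg Ax nA B Bf.
have /cg := cf _ Ax B Bf; rewrite nbhs_filterE => nB.
change (nbhs x ((f \o g) @^-1` B)).
by apply: filterS2 nA nB => y Ay; apply.
Qed.

Lemma continuous_fst_at (T X Y : topologicalType) (f : T -> X * Y) (x : T) :
  {for x, continuous f} -> {for x, continuous (fun y => (f y).1)}.
Proof. by move=> cf; exact: (cvg_comp _ _ cf cvg_fst). Qed.

Lemma continuous_snd_at (T X Y : topologicalType) (f : T -> X * Y) (x : T) :
  {for x, continuous f} -> {for x, continuous (fun y => (f y).2)}.
Proof. by move=> cf; exact: (cvg_comp _ _ cf cvg_snd). Qed.

Section Push.
Variables (R : realType) (S : topologicalType).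
Local Notation int := (surface_interior R S).

Definition clamp (u : R) : R := Num.max 0 (Num.min 1 u).

Lemma clamp_itv u : 0 <= clamp u <= 1.
Proof. by rewrite /clamp le_max lexx /= ge_max ler01 ge_min lexx. Qed.

Lemma clamp0 : clamp 0 = 0.
Proof. by rewrite /clamp min_r ?maxxx ?ler01. Qed.

Lemma clamp1 : clamp 1 = 1.
Proof. by rewrite /clamp minxx max_r. Qed.

Lemma clamp_gt0 u : 0 < u -> 0 < clamp u.
Proof. by move=> u0; rewrite /clamp lt_max lt_min u0 ltr01 orbT. Qed.

Lemma clamp_continuous : continuous clamp.
Proof.
move=> t; apply: continuous_max; first exact: cvg_cst.
by apply: continuous_min; [exact: cvg_cst|exact: cvg_id].
Qed.

(** Injectivity at each time keeps curves simple and disjoint. The last clause makes pushes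
    composable: a point that one of them has brought to the interior is kept there by the next. *)
Definition push (E : R -> S -> S) := [/\ continuous (fun z : R * S => E z.1 z.2),
  forall x, E 0 x = x, forall u, injective (E u) &
  forall u x, E u x = x \/ int (E u x)].

Definition pushes_in (A : set S) := exists2 E, push E &
  forall x u, A x -> 0 < u -> int (E u x).

Lemma pushes_in0 : pushes_in set0.
Proof.
exists (fun _ x => x) => //.
by split=> //; [move=> z; exact: cvg_snd|move=> _ ? ?|left].
Qed.

Lemma pushes_inS A B : A `<=` B -> pushes_in B -> pushes_in A.
Proof. by move=> AB [E pE EB]; exists E => // x u /AB; exact: EB. Qed.

Lemma pushes_inU A B : pushes_in A -> pushes_in B -> pushes_in (A `|` B).
Proof.
move=> [E [cE E0 iE xE] EA] [F [cF F0 iF xF] FB].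
have intF u x : int x -> int (F u x) by case: (xF u x) => [->|].
exists (fun u x => F u (E u x)); first split.
- move=> z; apply: (@continuous_comp _ _ _ (fun z : R * S => (z.1, E z.1 z.2)) (fun z : R * S => F z.1 z.2)); last exact: cF.
  by apply: continuous_pair => w; [exact: cvg_fst|exact: cE].
- by move=> x; rewrite E0 F0.
- by move=> u x y /iF/iE.
- by move=> u x; case: (xE u x) => [->|/intF]; [exact: xF|right].
move=> x u [Ax|Bx] u0; first exact/intF/EA.
by case: (xE u x) => [->|/intF]; [exact: FB|exact].
Qed.

(** * A push supported in a single chart *)

Section LocalPush.
Variables (U : set S) (phi : S -> R * R) (psi : R * R -> S) (x0 : S) (V : set (R * R)).
Variable e : R.
Hypotheses (hS : hausdorff_space S) (oU : open U) (oV : open V).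
Hypothesis Vim : phi @` U = V `&` [set z | 0 <= z.2].
Hypotheses (cphi : {within U, continuous phi})
           (cpsi : {within phi @` U, continuous psi})
           (K : {in U, cancel phi psi}) (Ux0 : U x0) (e0 : 0 < e).
Let p := phi x0.
Hypothesis Ve : forall q : R * R, `|q.1 - p.1| <= e + e -> `|q.2 - p.2| <= e + e -> V q.

(** A tent supported in the square of radius [e] around [p]. It is 1-Lipschitz in the second
    coordinate, so adding at most half of it to that coordinate is injective. *)
Let b (q : R * R) : R := Num.max 0 (Num.min (e - `|q.1 - p.1|) (e - `|q.2 - p.2|)).

Let b_ge0 q : 0 <= b q. Proof. by rewrite /b le_max lexx. Qed.

Let b_le q : b q <= e.
Proof. by rewrite /b ge_max ltW //= ge_min gerBl normr_ge0. Qed.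

Let b_gt0 q : 0 < b q -> `|q.1 - p.1| < e /\ `|q.2 - p.2| < e.
Proof. by rewrite /b lt_max ltxx lt_min /= !subr_gt0 => /andP[]. Qed.

Let b_lip x y y' : y <= y' -> b (x, y) <= b (x, y') + (y' - y).
Proof.
move=> yy'; rewrite {1}/b ge_max; apply/andP; split.
  by rewrite addr_ge0 // subr_ge0.
rewrite -lerBlDr /b le_max; apply/orP; right => /=.
rewrite lerBlDr; set m := Num.min _ _; rewrite -lerBlDr.
have t1 := ler_distD y y' p.2; rewrite le_min; apply/andP; split.
  by rewrite lerBlDr; apply: (@le_trans _ _ (e - `|x - p.1|)); [rewrite /m ge_min lexx|rewrite lerDl subr_ge0].
have : m <= e - `|y - p.2| by rewrite /m ge_min lexx orbT.
have : `|y' - y| = y' - y by rewrite ger0_norm // subr_ge0.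
lra.
Qed.

Let b_cont : continuous b.
Proof.
have cn (f : R * R -> R) c : continuous f -> continuous (fun q => e - `|f q - c|).
  move=> cf q; apply: cvgB; first exact: cvg_cst.
  by apply: cvg_norm; apply: cvgB; [exact: cf|exact: cvg_cst].
have cM (f : R * R -> R) : continuous f -> continuous (fun q => Num.max 0 (f q)).
  by move=> cf q; exact: (continuous_max (cvg_cst 0) (cf q)).
have cm (f g : R * R -> R) : continuous f -> continuous g ->
    continuous (fun q => Num.min (f q) (g q)).
  by move=> cf cg q; exact: (continuous_min (cf q) (cg q)).
by apply: cM; apply: cm; [apply: (cn fst) => z; exact: cvg_fst|apply: (cn snd) => z; exact: cvg_snd].
Qed.

Let mv (u : R) (q : R * R) : R * R := (q.1, q.2 + clamp u / 2 * b q).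
Let E (u : R) (x : S) : S := if `[< U x >] then psi (mv u (phi x)) else x.

Let mv_im u x : U x -> (phi @` U) (mv u (phi x)).
Proof.
move=> Ux; have : (phi @` U) (phi x) by exists x.
rewrite Vim => -[Vx y0]; have /andP[c0 c1] := clamp_itv u.
have := b_ge0 (phi x); rewrite le_eqVlt => /orP[/eqP b0|b0].
  by rewrite /mv -b0 mulr0 addr0 -surjective_pairing; split.
have [h1 h2] := b_gt0 b0; have bl := b_le (phi x).
have m0 : 0 <= clamp u / 2 * b (phi x) by rewrite mulr_ge0 ?divr_ge0 // ltW.
have m1 : clamp u / 2 * b (phi x) <= e.
  have : clamp u / 2 <= 1 by rewrite ler_pdivrMr //; lra.
  by move: (b_ge0 (phi x)) => ? ?; nra.
split; last by rewrite /= addr_ge0.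
apply: Ve => /=; first by rewrite (le_trans (ltW h1)) // lerDl ltW.
by rewrite addrAC (le_trans (ler_normD _ _)) // lerD ?(ltW h2) // ger0_norm.
Qed.

Let phipsi q : (phi @` U) q -> phi (psi q) = q /\ U (psi q).
Proof. by move=> [x Ux <-]; rewrite K ?inE. Qed.

Let cphi_at x : U x -> {for x, continuous phi}.
Proof. by move=> Ux; move: cphi; rewrite continuous_open_subspace // => /(_ x); rewrite inE; apply. Qed.

Lemma local_push : push E.
Proof.
split.
- move=> [u x]; have [Ux|nUx] := EM (U x).
    have c1 : {for (u, x), continuous (fun z : R * S => phi z.2)}.
      by apply: continuous_comp; [exact: cvg_snd|exact: cphi_at].
    have c2 : {for (u, x), continuous (fun z : R * S => mv z.1 (phi z.2))}.
      have p1 : {for (u, x), continuous (fun z : R * S => (phi z.2).1)}.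
        exact: continuous_fst_at c1.
      have p2 : {for (u, x), continuous (fun z : R * S => (phi z.2).2)}.
        exact: continuous_snd_at c1.
      have p3 : {for (u, x), continuous (fun z : R * S => clamp z.1)}.
        by apply: (@continuous_comp _ _ _ fst clamp); [exact: cvg_fst|exact: clamp_continuous].
      have p4 : {for (u, x), continuous (fun z : R * S => b (phi z.2))}.
        by apply: (@continuous_comp _ _ _ (fun z : R * S => phi z.2) b) => //; exact: b_cont.
      exact: (cvg_pair p1 (cvgD p2 (cvgM (cvgM p3 (cvg_cst _)) p4))).
    have nU : \forall z \near (u, x), U z.2.
      apply: (@cvg_snd _ _ (nbhs u) (nbhs x)); exact: open_nbhs_nbhs.
    move=> B BE.
    have e1 : E u x = psi (mv u (phi x)) by rewrite /E asboolT.
    have c3 := @within_continuous_comp _ _ _ (phi @` U) psi (fun z : R * S => mv z.1 (phi z.2)) (u, x) cpsi c2 (mv_im u Ux).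
    have nb : \forall y \near (u, x), (phi @` U) (mv y.1 (phi y.2)).
      by apply: filterS nU => z; exact: mv_im.
    have := c3 nb B; rewrite /= in BE *; rewrite -e1 => /(_ BE) c4.
    change (nbhs (u, x) (fun z => B (E z.1 z.2))).
    by apply: filterS2 nU c4 => z Uz; rewrite /= /E asboolT.
  (* Here [x] lies outside the chart domain. The part of the chart where points may move is
     contained in a compact set, whose image is closed because the surface is Hausdorff; off this
     image [E] is the identity. *)
  pose D : set (R * R) := `[p.1 - e, p.1 + e] `*` `[p.2 - e, p.2 + e].
  have cD : compact (D `&` [set q | 0 <= q.2]).
    apply: compact_closedI; first by apply: compact_setX; exact: segment_compact.
    by apply: (@closed_comp _ _ snd [set y : R | 0 <= y]); [move=> ? _; exact: cvg_snd|exact: closed_ge].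
  have DU : D `&` [set q | 0 <= q.2] `<=` phi @` U.
    rewrite Vim => q [[/= d1 d2] q0]; split=> //; apply: Ve.
      by move: d1; rewrite in_itv /= => /andP[? ?]; rewrite ler_norml; apply/andP; split; lra.
    by move: d2; rewrite in_itv /= => /andP[? ?]; rewrite ler_norml; apply/andP; split; lra.
  pose C := psi @` (D `&` [set q | 0 <= q.2]).
  have clC : closed C.
    apply: (compact_closed hS); apply: continuous_compact => //.
    exact: continuous_subspaceW cpsi.
  have nC : nbhs x (~` C).
    apply: open_nbhs_nbhs; split; first exact: closed_openC.
    by move=> [q /DU /phipsi[_ Uq] qx]; apply: nUx; rewrite -qx.
  have nC2 : \forall z \near (u, x), (~` C) z.2.
    by apply: (@cvg_snd _ _ (nbhs u) (nbhs x)).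
  have Eid v y : (~` C) y -> E v y = y.
    rewrite /E; case: asboolP => // Uy nD.
    have : b (phi y) = 0.
      apply/eqP/negPn/negP; rewrite eq_le b_ge0 andbT -ltNge => /b_gt0[].
      rewrite !ltr_norml => /andP[? ?] /andP[? ?]; apply: nD; exists (phi y); last by rewrite K ?inE.
      split; last by have : (phi @` U) (phi y) by [exists y]; rewrite Vim => -[].
      by split; rewrite /= in_itv /=; apply/andP; split; lra.
    by rewrite /mv => ->; rewrite mulr0 addr0 -surjective_pairing K ?inE.
  rewrite /continuous_at /= /E asboolF //.
  apply: (@cvg_trans _ (snd @ (u, x))); last exact: cvg_snd.
  apply: near_eq_cvg; near=> z; rewrite -/(E z.1 z.2) Eid //; by near: z.
- move=> x; rewrite /E; case: asboolP => // Ux.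
  by rewrite /mv clamp0 !mul0r addr0 -surjective_pairing K ?inE.
- have inj u : {in U &, injective (fun x => psi (mv u (phi x)))}.
    move=> x y; rewrite !inE => Ux Uy /(congr1 phi).
    rewrite !(phipsi (mv_im _ _)).1 // /mv => -[e1 e2].
    suff e3 : phi x = phi y by rewrite -[x]K ?inE // e3 K ?inE.
    rewrite [phi x]surjective_pairing [phi y]surjective_pairing e1; congr pair.
    have /andP[c0 c1] := clamp_itv u.
    move: e2; rewrite [phi x]surjective_pairing [phi y]surjective_pairing e1 /=.
    move: (phi x).2 (phi y).2 => s t.
    wlog st : s t / s <= t => [W|] E2.
      by have [/W/(_ E2)//|/ltW/W/(_ (esym E2))] := leP s t.
    by have := b_lip (phi y).1 st => ?; apply/eqP; rewrite eq_le st /=; nra.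
  move=> u x y; rewrite /E; case: asboolP => Ux; case: asboolP => Uy //.
  + by apply: inj; rewrite inE.
  + by move=> exy; case: Uy; rewrite -exy; exact: (phipsi (mv_im _ _)).2.
  + by move=> exy; case: Ux; rewrite exy; exact: (phipsi (mv_im _ _)).2.
- move=> u x; rewrite /E; case: asboolP => Ux; last by left.
  have := b_ge0 (phi x); rewrite le_eqVlt => /orP[/eqP b0|b0].
    by left; rewrite /mv -b0 mulr0 addr0 -surjective_pairing K ?inE.
  have /andP[] := clamp_itv u; rewrite le_eqVlt => /orP[/eqP c0 _|c0 _].
    by left; rewrite /mv -c0 !mul0r addr0 -surjective_pairing K ?inE.
  right; exists U, phi, psi; have [em Um] := phipsi (mv_im u Ux).
  split=> //; first by split => //; exists V => //; exact: oV.
  rewrite em /=; have : (phi @` U) (phi x) by exists x.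
  by rewrite Vim => -[_ /= ?]; rewrite ltr_wpDl // mulr_gt0 // divr_gt0.
Unshelve. all: by end_near.
Qed.

Lemma local_pushes_in : pushes_in (U `&` [set x | 0 < b (phi x)]).
Proof.
exists E; first exact: local_push.
move=> x u [Ux /= b0] u0; rewrite /E asboolT //.
exists U, phi, psi; have [em Um] := phipsi (mv_im u Ux).
split=> //; first by split => //; exists V => //; exact: oV.
rewrite em /=; have : (phi @` U) (phi x) by exists x.
by rewrite Vim => -[_ /= ?]; rewrite ltr_wpDl // mulr_gt0 // divr_gt0 // clamp_gt0.
Qed.

Lemma nbhs_local : nbhs x0 (U `&` [set x | 0 < b (phi x)]).
Proof.
apply: filterI; first exact: open_nbhs_nbhs.
apply: (@near_pos _ _ (b \o phi)) => /=.
  by apply: continuous_comp; [exact: cphi_at|exact: b_cont].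
by rewrite /b !subrr normr0 subr0 lt_max lt_min e0 orbT.
Qed.

End LocalPush.

Lemma pushes_in_near (x : S) : hausdorff_space S ->
  (exists U (phi : S -> R * R) psi, half_plane_chart U phi psi /\ U x) ->
  exists2 A, nbhs x A & pushes_in A.
Proof.
move=> hS [U [phi [psi [[oU [V oV Vim] cphi cpsi K] Ux]]]].
have Vp : V (phi x) by have : (phi @` U) (phi x) by [exists x]; rewrite Vim => -[].
have /nbhs_ballP[d /= d0 dV] : nbhs (phi x) V by exact: open_nbhs_nbhs.
have e0 : 0 < d / 3 by rewrite divr_gt0.
have Ve (q : R * R) : `|q.1 - (phi x).1| <= d / 3 + d / 3 ->
    `|q.2 - (phi x).2| <= d / 3 + d / 3 -> V q.
  move=> h1 h2; apply: dV.
  have e : d / 3 + d / 3 < d by rewrite -mulrDl ltr_pdivrMr //; lra.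
  by split => /=; rewrite -ball_normE /= distrC; apply: le_lt_trans e.
exists (U `&` [set y | 0 < Num.max 0 (Num.min (d / 3 - `|(phi y).1 - (phi x).1|) (d / 3 - `|(phi y).2 - (phi x).2|))]).
  exact: (@nbhs_local U phi x (d / 3)).
exact: (@local_pushes_in U phi psi x V (d / 3)).
Qed.

Lemma compact_surface_push : compact_surface R S ->
  exists2 E, push E & forall x u, 0 < u -> int (E u x).
Proof.
move=> [hS cS charts].
suff [E pE EP] : pushes_in [set: S] by exists E => // x u; exact: EP.
apply: contrapT => nP.
(* Compactness in terms of filters: the complements of the sets that can be pushed in form a filter.
   If it were proper it would have a cluster point, which the local push around that point
   excludes. *)
pose F : set_system S := [set A | pushes_in (~` A)].
have FF : ProperFilter F.
  apply: Build_ProperFilter_ex; first last.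
    split; rewrite /F /=.
    - by rewrite setCT; exact: pushes_in0.
    - by move=> A B PA PB; rewrite /= setCI; exact: pushes_inU.
    - by move=> A B AB PA; apply: pushes_inS PA; exact: subsetC.
  move=> A FA; apply: contrapT => nA; apply: nP; apply: pushes_inS FA => x _ Ax.
  by apply: nA; exists x.
have [|x [_ cx]] := cS F FF; first by rewrite /F /= setCT; exact: pushes_in0.
have [A xA PA] := pushes_in_near hS (charts x).
have FA : F (~` A) by rewrite /F /= setCK.
by have [y [nA Ay]] := cx _ _ FA xA.
Qed.

Variables (Gamma : groupType) (H : hyperbolization R S Gamma).

Lemma represents_lift (E : R -> S -> S) (c : R -> S) (gamma : Gamma) :
  push E -> (forall x u, 0 < u -> int (E u x)) -> represents H c gamma ->
  has_lift H gamma (fun t => E 1 (c t)).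
Proof.
move=> [cE E0 _ iE] iE1 [l [cl Ul el [K [cK K0 K1 pK]]]].
pose D := [set z : R * R | 0 <= z.1 <= 1].
(* The free homotopy may run through the boundary, where there is nothing to lift. It is therefore
   read backwards, from the projected path to [c], while being pushed: at time 0 the curve lies in
   the interior by construction, at positive times because of the push. *)
pose G (z : R * R) := E (clamp z.1) (K (1 - clamp z.1, z.2)).
have Dg (z : R * R) : D (1 - clamp z.1, z.2).
  by have /andP[? ?] := clamp_itv z.1; rewrite /D /=; apply/andP; split; lra.
have c1 (z : R * R) : {for z, continuous (fun z : R * R => clamp z.1)}.
  by apply: (@continuous_comp _ _ _ fst clamp); [exact: cvg_fst|exact: clamp_continuous].
have cg (z : R * R) : {for z, continuous (fun z : R * R => (1 - clamp z.1, z.2))}.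
  have cB : {for z, continuous (fun z : R * R => 1 - clamp z.1)}.
    by apply: cvgB; [exact: cvg_cst|exact: c1].
  have c2 : {for z, continuous (fun z : R * R => z.2)} by exact: cvg_snd.
  exact: (cvg_pair cB c2).
have cKg (z : R * R) : {for z, continuous (fun z : R * R => K (1 - clamp z.1, z.2))}.
  by apply: (within_continuous_comp cK (cg z) (Dg z)); apply: filterE => w; exact: Dg.
have cG : continuous G.
  move=> z; apply: (@continuous_comp _ _ _ (fun z : R * R => (clamp z.1, K (1 - clamp z.1, z.2)))
    (fun z : R * S => E z.1 z.2)); last exact: cE.
  exact: (cvg_pair (c1 z) (cKg z)).
have := @homotopy_lift _ _ _ H G gamma cG.
have -> : (fun t => G (1, t)) = (fun t => E 1 (c t)).
  by apply/funext => t; rewrite /G /= clamp1 subrr K0.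
apply.
- move=> [s t]; rewrite /G /=; have /andP[] := clamp_itv s.
  rewrite le_eqVlt => /orP[/eqP <- _|s0 _].
    by rewrite E0 subr0 K1 /= -(unif_image H); exists (l t).
  exact: iE1.
- by move=> s t; rewrite /G /= pK //; exact: (Dg (s, t)).
exists l => // t; by rewrite /G /= clamp0 E0 subr0 K1.
Qed.

(** * Lifts of simple closed curves *)

Definition simple_path (gamma : Gamma) (f : R -> R * R) :=
  equivariant_path H gamma f /\
  forall h s t, deck H h (f s) = f t -> cyclic_subgroup gamma h.

Definition disjoint_paths (f e : R -> R * R) :=
  forall h s t, deck H h (f s) <> e t.

Lemma equivariant_pathX gamma f : equivariant_path H gamma f ->
  forall (n : nat) t, f (t + n%:R) = deck H (gamma ^+ n)%g (f t).
Proof.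
move=> [cf Uf ef]; elim=> [|n IH] t; first by rewrite addr0 expg0 deck1.
by rewrite -natr1 addrA ef IH expgS deckM.
Qed.

Lemma equivariant_path_conj gamma f g : equivariant_path H gamma f ->
  equivariant_path H (g * gamma * g^-1)%g (deck H g \o f).
Proof.
move=> [cf Uf ef]; split.
- by move=> t; apply: continuous_comp; [exact: cf|exact: deck_continuous].
- by move=> t; exact: deck_uhp.
- by move=> t /=; rewrite ef -!deckM // ?mulgVK //; exact: deck_uhp.
Qed.

Lemma simple_path_conj gamma f g : simple_path gamma f ->
  simple_path (g * gamma * g^-1)%g (deck H g \o f).
Proof.
move=> [ef sf]; split; first exact: equivariant_path_conj.
have [_ Uf _] := ef.
move=> h s t /= e.
have : deck H (g^-1 * h * g)%g (f s) = f t.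
  by rewrite !deckM ?e ?deckK //; exact: deck_uhp.
have conjX k : ((g * gamma * g^-1) ^+ k = g * gamma ^+ k * g^-1)%g.
  by elim: k => [|k IH]; rewrite ?expg0 ?mulg1 ?mulgV // !expgS IH !mulgA mulgVK.
have hE : h = (g * (g^-1 * h * g) * g^-1)%g by rewrite !mulgA mulgV mul1g mulgK.
move=> /sf[k [] E]; exists k; rewrite hE E; [left|right]; rewrite conjX //.
by rewrite !invgM invgK mulgA.
Qed.

Lemma lift_simple (E : R -> S -> S) (c : R -> S) gamma f :
  push E -> simple_closed_curve c -> equivariant_path H gamma f ->
  (forall t, unif H (f t) = E 1 (c t)) -> simple_path gamma f.
Proof.
move=> [_ _ iE _] [_ sc] ef uf; split=> // h s t e.
have [_ Uf _] := ef.
have /iE/sc[k] : E 1 (c s) = E 1 (c t).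
  by rewrite -!uf -e unif_deck.
case: k => n sE.
  exists n; right; apply: (@deck_free _ _ _ H _ _ (f s)) => //.
  by rewrite e sE -[n%:~R]/(n%:R : R) (equivariant_pathX ef) deckK.
exists n.+1; left; apply: (@deck_free _ _ _ H _ _ (f s)) => //.
by rewrite e -(equivariant_pathX ef) sE NegzE mulrNz addrNK.
Qed.

Lemma simple_element_path gamma : compact_surface R S -> simple_element H gamma ->
  exists f, simple_path gamma f.
Proof.
move=> /compact_surface_push[E pE E1] [_ [c sc rc]].
have [f ef uf] := represents_lift pE E1 rc.
by exists f; exact: lift_simple uf.
Qed.

Lemma disjoint_elements_paths gamma delta : compact_surface R S ->
  disjoint_elements H gamma delta ->
  exists f e, [/\ simple_path gamma f, simple_path delta e & disjoint_paths f e].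
Proof.
move=> /compact_surface_push[E pE E1] [_ [c [d [sc rc sd rd cd]]]].
have [f ef uf] := represents_lift pE E1 rc.
have [e ee ue] := represents_lift pE E1 rd.
exists f, e; split; [exact: lift_simple uf|exact: lift_simple ue|].
move=> h s t he; have [_ Uf _] := ef.
have [_ _ iE _] := pE.
have : E 1 (c s) = E 1 (d t) by rewrite -uf -ue -he unif_deck.
move=> /iE cdE; have : (range c `&` range d) (c s) by split; [exists s|exists t].
by rewrite cd.
Qed.

End Push.

(** * Crossings of invariant paths of the upper half plane *)

Section Crossing.
Variable R : realType.
Local Notation U := (@upper_half_plane R).

Lemma shift_nat (V : R -> R) (tau : R) : (forall t, V (t + 1) = V t + tau) ->
  forall (n : nat) t, V (t + n%:R) = V t + n%:R * tau.
Proof.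
move=> eV; elim=> [|n IH] t; first by rewrite addr0 mul0r addr0.
by rewrite -natr1 addrA eV IH mulrDl mul1r addrA.
Qed.

Lemma shift_natN (V : R -> R) (tau : R) : (forall t, V (t + 1) = V t + tau) ->
  forall (n : nat) t, V (t - n%:R) = V t - n%:R * tau.
Proof.
by move=> eV n t; rewrite -[in RHS](subrK n%:R t) (shift_nat eV) addrK.
Qed.

(** The first path is unbounded in both directions of [V] and, in [H], stays between the levels
    which the second path has at [T1] and [T2]. Poincaré-Miranda applies to (V1 - V2, H2 - H1) on a
    rectangle whose first side has enough periods to leave the range of [V2] on [[T1, T2]]. *)
Lemma crossing (V1 H1 V2 H2 : R -> R) (tau T1 T2 : R) :
  continuous V1 -> continuous H1 -> continuous V2 -> continuous H2 ->
  0 < tau -> (forall t, V1 (t + 1) = V1 t + tau) -> T1 < T2 ->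
  (forall s, H2 T1 <= H1 s) -> (forall s, H1 s <= H2 T2) ->
  exists s t, V1 s = V2 t /\ H1 s = H2 t.
Proof.
move=> cV1 cH1 cV2 cH2 tau0 eV T12 h1 h2.
have cV2T : {within `[T1, T2], continuous V2} by exact: continuous_subspaceT.
have [tM _ tMP] := EVT_max (ltW T12) cV2T.
have [tm _ tmP] := EVT_min (ltW T12) cV2T.
have arch (C : R) : exists n : nat, C < n%:R * tau /\ (0 < n)%N.
  exists (Num.trunc (`|C| / tau)).+1; split=> //; rewrite -ltr_pdivrMr //.
  apply: le_lt_trans (_ : `|C| / tau < _).
    by rewrite ler_pM2r ?invr_gt0 // ler_norm.
  by have /andP[] := truncn_itv (divr_ge0 (normr_ge0 C) (ltW tau0)).
have [n [nP n0]] := arch (V2 tM - V1 0); have [m [mP m0]] := arch (V1 0 - V2 tm).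
pose F (z : R * R) := (V1 z.1 - V2 z.2, H2 z.2 - H1 z.1).
have cf1 (f : R -> R) : continuous f -> continuous (fun z : R * R => f z.1).
  by move=> cf z; apply: continuous_comp; [exact: cvg_fst|exact: cf].
have cf2 (f : R -> R) : continuous f -> continuous (fun z : R * R => f z.2).
  by move=> cf z; apply: continuous_comp; [exact: cvg_snd|exact: cf].
have cF : continuous F.
  by apply: continuous_pair => z; apply: cvgB; (apply: cf1 || apply: cf2).
have [] := @poincare_miranda R F (0 - m%:R) (0 + n%:R) T1 T2 cF _ T12 _ _ _ _.
- by rewrite sub0r add0r (@lt_trans _ _ 0) ?oppr_lt0 ?ltr0n.
- move=> y yT /=; rewrite (shift_natN eV).
  have := tmP y; rewrite in_itv => /(_ yT); lra.
- move=> y yT /=; rewrite (shift_nat eV).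
  have := tMP y; rewrite in_itv => /(_ yT); lra.
- by move=> x _ /=; rewrite subr_le0.
- by move=> x _ /=; rewrite subr_ge0.
by move=> s [t [_ _ [e1 e2]]]; exists s, t; split; lra.
Qed.

Lemma crossing_swap (V1 H1 V2 H2 : R -> R) (tau T1 T2 : R) :
  continuous V1 -> continuous H1 -> continuous V2 -> continuous H2 ->
  0 < tau -> (forall t, V1 (t + 1) = V1 t + tau) -> T1 < T2 ->
  (forall s, H1 s <= H2 T1) -> (forall s, H2 T2 <= H1 s) ->
  exists s t, V1 s = V2 t /\ H1 s = H2 t.
Proof.
move=> cV1 cH1 cV2 cH2 tau0 eV T12 h1 h2.
have cN (f : R -> R) : continuous f -> continuous (fun t => - f t).
  by move=> cf t; apply: cvgN; exact: cf.
have [||s [t [e1 e2]]] := crossing cV1 (cN _ cH1) cV2 (cN _ cH2) tau0 eV T12.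
- by move=> s; rewrite lerN2.
- by move=> s; rewrite lerN2.
by exists s, t; split=> //; exact: oppr_inj.
Qed.

Lemma periodic_extrema (h : R -> R) : continuous h -> (forall t, h (t + 1) = h t) ->
  exists T1 T2, [/\ T1 < T2, forall s, h T1 <= h s & forall s, h s <= h T2].
Proof.
move=> ch ph.
have ph' t : h (t + 1) = h t + 0 by rewrite addr0 ph.
have chT : {within `[0, 1], continuous h} by exact: continuous_subspaceT.
have [tM tM01 tMP] := EVT_max ler01 chT.
have [tm tm01 tmP] := EVT_min ler01 chT.
have red (s : R) : exists2 u, u \in `[0, 1] & h u = h s.
  have hz (k : int) u : h (u - k%:~R) = h u.
    case: k => k; first by rewrite (shift_natN ph') mulr0 subr0.
    by rewrite NegzE mulrNz opprK (shift_nat ph') mulr0 addr0.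
  exists (s - (Num.floor s)%:~R); last exact: hz.
  by rewrite in_itv /= subr_ge0 floor_le_tmp lerBlDl ltW // -[1]/(1%:~R) -intrD floorD1_gt.
(* Both extrema are found in [0, 1]; a shift by one period would still allow [T1 = T2]. *)
exists tm, (tM + 2%:R); split.
- by move: tM01 tm01; rewrite !in_itv /= => /andP[? ?] /andP[? ?]; lra.
- by move=> s; have [u u01 <-] := red s; exact: tmP.
- by move=> s; have [u u01 <-] := red s; rewrite (shift_nat ph') mulr0 addr0; exact: tMP.
Qed.

Definition dil (l : R) : 'M[R]_2 := mx2 l 0 0 l^-1.
Definition trans (b : R) : 'M[R]_2 := mx2 1 b 0 1.

Lemma det_dil l : l != 0 -> \det (dil l) = 1.
Proof. by move=> l0; rewrite det_mx2 !mxE /= mulr0 subr0 divff. Qed.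

Lemma det_trans b : \det (trans b) = 1.
Proof. by rewrite det_mx2 !mxE /= mulr0 subr0 mulr1. Qed.

Lemma moebius_dil l z : l != 0 -> moebius (dil l) z = (l ^+ 2 * z.1, l ^+ 2 * z.2).
Proof.
move=> l0; rewrite moebiusE det_dil // /mob_den !mxE /=.
by congr pair; field; rewrite ?l0 ?expf_neq0.
Qed.

Lemma moebius_trans b z : moebius (trans b) z = (z.1 + b, z.2).
Proof. by rewrite moebiusE det_trans /mob_den !mxE /=; congr pair; field. Qed.

Lemma ln_sqr_gt0 (l : R) : 1 < l -> 0 < ln (l ^+ 2).
Proof. by move=> l1; rewrite ln_gt0 // exprn_egt1. Qed.

Section DilPath.
Variables (f : R -> R * R) (l : R).
Hypotheses (l1 : 1 < l) (cf : continuous f) (Uf : forall t, U (f t)).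
Hypothesis ef : forall t, f (t + 1) = moebius (dil l) (f t).

Let l0 : l != 0. Proof. by rewrite gt_eqF // (lt_trans ltr01). Qed.

(** Constant on the rays from 0, hence invariant under dilations. Together with the logarithm of the
    height, which dilations translate, it gives coordinates of the half plane. *)
Definition slope (z : R * R) : R := z.1 / z.2.

Lemma slope_continuous (g : R -> R * R) : continuous g -> (forall t, U (g t)) ->
  continuous (fun t => slope (g t)).
Proof.
move=> cg Ug t; apply: cvgM.
  by apply: (cvg_comp _ _ (cg t)); exact: cvg_fst.
apply: cvgV; first by rewrite gt_eqF //; exact: Ug.
by apply: (cvg_comp _ _ (cg t)); exact: cvg_snd.
Qed.

Lemma height_continuous (g : R -> R * R) : continuous g -> (forall t, U (g t)) ->
  continuous (fun t => ln (g t).2).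
Proof.
move=> cg Ug t.
apply: (@continuous_comp _ _ _ (fun t => (g t).2) (@ln R)); last by apply: continuous_ln; exact: Ug.
by apply: (cvg_comp _ _ (cg t)); exact: cvg_snd.
Qed.

Lemma dil_height t : ln (f (t + 1)).2 = ln (f t).2 + ln (l ^+ 2).
Proof.
by rewrite ef moebius_dil //= lnM 1?addrC // posrE ?Uf // exprn_even_gt0.
Qed.

Lemma dil_slope t : slope (f (t + 1)) = slope (f t).
Proof.
rewrite ef moebius_dil // /slope /=; have := Uf t; rewrite /upper_half_plane /= => y0.
by field; rewrite gt_eqF //= l0.
Qed.

Lemma slope_height_inj (z w : R * R) : U z -> U w -> ln z.2 = ln w.2 -> slope z = slope w -> z = w.
Proof.
case: z w => [x y] [x' y']; rewrite /upper_half_plane /slope /= => y0 y0' /ln_inj e.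
by rewrite e ?posrE // => /mulIf -> //; rewrite invr_eq0 gt_eqF.
Qed.

(** The translate of the path has the same slopes; between times of minimal and of maximal slope it
    crosses the whole strip in which the path runs. *)
Lemma dil_meets_dil k : k != 0 -> exists s t, f s = moebius (dil k) (f t).
Proof.
move=> k0.
have cH := slope_continuous cf Uf; have cV := height_continuous cf Uf.
have [T1 [T2 [T12 m M]]] := periodic_extrema cH dil_slope.
have cV2 : continuous (fun t => ln (f t).2 + ln (k ^+ 2)).
  by move=> t; apply: cvgD; [exact: cV|exact: cvg_cst].
have [s [t [e1 e2]]] := crossing cV cH cV2 cH (ln_sqr_gt0 l1) dil_height T12 m M.
exists s, t; apply: slope_height_inj => //.
- by apply: moebius_uhp => //; exact: det_dil.
- by rewrite e1 moebius_dil //= lnM 1?addrC // posrE ?Uf // exprn_even_gt0.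
rewrite e2 moebius_dil // /slope /=; have := Uf t; rewrite /upper_half_plane /= => y0.
by field; rewrite gt_eqF //= k0.
Qed.

(** Along an orbit of a dilation [slope z] is constant and [z.2] is multiplied, so the term with a c
    dominates at one end of the orbit and the term with b d at the other. *)
Lemma slope_mx2 a b c d z : a * d - b * c = 1 -> U z -> slope (moebius (mx2 a b c d) z) =
  a * c * (1 + slope z ^+ 2) * z.2 + (a * d + b * c) * slope z + b * d / z.2.
Proof.
move=> D Uz; have dM : \det (mx2 a b c d) = 1 by rewrite det_mx2 !mxE.
have := mob_den_gt0 dM Uz; rewrite moebiusE dM /slope !mxE /= => q0.
have y0 : z.2 != 0 by rewrite gt_eqF //; exact: Uz.
by rewrite mul1r; field; rewrite y0 gt_eqF.
Qed.

Lemma dil_pow (n : nat) t : f (t + n%:R) = ((l ^+ 2) ^+ n * (f t).1, (l ^+ 2) ^+ n * (f t).2).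
Proof.
elim: n => [|n IH]; first by rewrite addr0 !mul1r -surjective_pairing.
by rewrite -natr1 addrA ef IH moebius_dil //= !mulrA -exprS.
Qed.

End DilPath.

Lemma pow_large (l C : R) : 1 < l -> exists n : nat, C < l ^+ n /\ (0 < n)%N.
Proof.
move=> l1; have bern (n : nat) : 1 + n%:R * (l - 1) <= l ^+ n.
  elim: n => [|n IH]; first by rewrite mul0r addr0.
  rewrite exprS -natr1; have : 0 <= n%:R :> R by [].
  move: (l ^+ n) IH; set q : R := n%:R => p IH q0.
  apply: le_trans (_ : l * (1 + q * (l - 1)) <= _); last by rewrite ler_pM2l // (lt_trans ltr01).
  by have := mulr_ge0 q0 (sqr_ge0 (l - 1)); lra.
have d0 : 0 < l - 1 by rewrite subr_gt0.
exists (Num.trunc (`|C| / (l - 1))).+1; split=> //.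
apply: lt_le_trans (bern _).
have /andP[_] := truncn_itv (divr_ge0 (normr_ge0 C) (ltW d0)).
rewrite ltr_pdivrMr // => h; have := ler_norm C; lra.
Qed.

(** The ends of the second axis are a / c and b / d, and the sign condition says that 0 and oo
    separate them. The slope along the second path then becomes arbitrarily large, with opposite
    signs, at its two ends, whereas it is bounded on the first path. *)
Lemma linked_paths_meet (f e : R -> R * R) (l l' a b c d : R) :
  1 < l -> continuous f -> (forall t, U (f t)) ->
  (forall t, f (t + 1) = moebius (dil l) (f t)) ->
  1 < l' -> continuous e -> (forall t, U (e t)) ->
  (forall t, e (t + 1) = moebius (dil l') (e t)) ->
  a * d - b * c = 1 -> a * c * (b * d) < 0 ->
  exists s t, f s = moebius (mx2 a b c d) (e t).
Proof.
move=> l1 cf Uf ef l'1 ce Ue ee D ABneg.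
have dM : \det (mx2 a b c d) = 1 by rewrite det_mx2 !mxE.
pose g t := moebius (mx2 a b c d) (e t).
have Ug t : U (g t) by exact: moebius_uhp.
have cg : continuous g.
  by move=> t; apply: continuous_comp; [exact: ce|exact: moebius_continuous].
have cH := slope_continuous cf Uf; have cV := height_continuous cf Uf.
have cH2 := slope_continuous cg Ug; have cV2 := height_continuous cg Ug.
have [t1 [t2 [_ m M]]] := periodic_extrema cH (dil_slope l1 Uf ef).
have L2 := ln_sqr_gt0 l1; have hE := dil_height l1 Uf ef.
set h0 := slope (e 0); set y0 := (e 0).2.
have y0p : 0 < y0 by exact: Ue.
pose A := a * c * (1 + h0 ^+ 2) * y0; pose Bd := b * d / y0; pose Cc := (a * d + b * c) * h0.
have l20 : l' ^+ 2 != 0 by rewrite expf_neq0 // gt_eqF // (lt_trans ltr01).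
have l21 : 1 < l' ^+ 2 by rewrite exprn_egt1.
have P0 (n : nat) : (l' ^+ 2) ^+ n != 0 by rewrite expf_neq0.
have y00 : y0 != 0 by rewrite gt_eqF.
have gp (n : nat) : slope (g (0 + n%:R)) = A * (l' ^+ 2) ^+ n + Cc + Bd / (l' ^+ 2) ^+ n.
  rewrite /g slope_mx2 // (dil_pow l'1 ee) /slope /= -/y0.
  move: (P0 n); move: ((l' ^+ 2) ^+ n) => P p0.
  have -> : P * (e 0).1 / (P * y0) = h0.
    by rewrite /h0 /slope -/y0; field; rewrite p0 y00.
  by rewrite /A /Cc /Bd; field; rewrite p0 y00.
have gm (n : nat) : slope (g (0 - n%:R)) = A / (l' ^+ 2) ^+ n + Cc + Bd * (l' ^+ 2) ^+ n.
  have : e 0 = ((l' ^+ 2) ^+ n * (e (0 - n%:R)).1, (l' ^+ 2) ^+ n * (e (0 - n%:R)).2).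
    by rewrite -(dil_pow l'1 ee) subrK.
  move: (P0 n); move: ((l' ^+ 2) ^+ n) => P p0 e0.
  have q0 : (e (0 - n%:R)).2 != 0 by rewrite gt_eqF //; exact: Ue.
  have x2 : (e (0 - n%:R)).2 = y0 / P by rewrite /y0 e0 /= mulrAC divff ?mul1r.
  have x1 : slope (e (0 - n%:R)) = h0.
    by rewrite /h0 /slope e0 /=; field; rewrite p0 q0.
  by rewrite /g slope_mx2 // x1 x2 /A /Cc /Bd; field; rewrite p0 y00.
have s0 : 0 < 1 + h0 ^+ 2 by rewrite ltr_pwDl // sqr_ge0.
(* Large enough that the dominant terms of [gp] and [gm] outweigh the remaining ones and pass both
   extremal slopes of [f]. *)
pose Z := slope (f t2) - slope (f t1) + `|slope (f t1)| + `|A| + `|Bd| + `|Cc|.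
have [n [nP n0]] : exists n : nat,
    (Z < `|A| * (l' ^+ 2) ^+ n /\ Z < `|Bd| * (l' ^+ 2) ^+ n) /\ (0 < n)%N.
  have ac0 : a * c != 0 by apply: contraTneq ABneg => ->; rewrite mul0r ltxx.
  have bd0 : b * d != 0 by apply: contraTneq ABneg => ->; rewrite mulr0 ltxx.
  have A0 : A != 0 := mulf_neq0 (mulf_neq0 ac0 (lt0r_neq0 s0)) y00.
  have B0 : Bd != 0 by rewrite mulf_neq0 // invr_eq0.
  have [n1 [h1 n10]] := pow_large (Z / `|A|) l21.
  have [n2 [h2 _]] := pow_large (Z / `|Bd|) l21.
  have mono i j : (l' ^+ 2) ^+ i <= (l' ^+ 2) ^+ (i + j).
    by rewrite ler_eXn2l // leq_addr.
  exists (n1 + n2)%N; split; last by rewrite addn_gt0 n10.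
  split; rewrite mulrC -ltr_pdivrMr ?normr_gt0 //.
    exact: lt_le_trans h1 (mono _ _).
  by apply: lt_le_trans h2 _; rewrite addnC; exact: mono.
have p1 : 1 <= (l' ^+ 2) ^+ n by apply: exprn_ege1; exact: ltW.
move: nP (gp n) (gm n); move: p1; move: ((l' ^+ 2) ^+ n) => p p1 [h1 h2] gpE gmE.
have p0 : 0 < p by apply: lt_le_trans p1.
have T12 : 0 - n%:R < 0 + n%:R :> R by rewrite sub0r add0r (@lt_trans _ _ 0) ?oppr_lt0 ?ltr0n.
have abs (x : R) : - `|x| <= x <= `|x| by rewrite -ler_norml.
have small (x : R) : - `|x| <= x / p <= `|x|.
  rewrite -ler_norml normrM normfV (gtr0_norm p0) ler_pdivrMr //.
  by rewrite ler_peMr.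
have /andP[sA sA'] := small A; have /andP[sB sB'] := small Bd.
have /andP[aC aC'] := abs Cc; have /andP[am am'] := abs (slope (f t1)).
have mM := m t2; rewrite /Z in h1 h2.
have [A0|A0] := leP 0 A.
  have B0 : Bd <= 0.
    move: A0; rewrite /A -mulrA pmulr_lge0 ?mulr_gt0 // => ac0.
    rewrite /Bd pmulr_lle0 ?invr_gt0 //; rewrite leNgt; apply/negP => bd0.
    by move: ABneg; rewrite ltNge mulr_ge0 // ltW.
  rewrite (ger0_norm A0) in h1 h2 sA sA'; rewrite (ler0_norm B0) in h1 h2 sB sB'.
  have [||s [t [e1 e2]]] := crossing cV cH cV2 cH2 L2 hE T12.
  - by move=> s; apply: le_trans (m s); rewrite gmE; lra.
  - by move=> s; apply: (le_trans (M s)); rewrite gpE; lra.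
  by exists s, t; exact: (slope_height_inj (Uf s) (Ug t) e1 e2).
have B0 : 0 <= Bd.
  move: A0; rewrite /A -mulrA pmulr_llt0 ?mulr_gt0 // => ac0.
  rewrite /Bd pmulr_lge0 ?invr_gt0 //; rewrite leNgt; apply/negP => bd0.
  by move: ABneg; rewrite ltNge mulr_le0 // ltW.
rewrite (ltr0_norm A0) in h1 h2 sA sA'; rewrite (ger0_norm B0) in h1 h2 sB sB'.
have [||s [t [e1 e2]]] := crossing_swap cV cH cV2 cH2 L2 hE T12.
- by move=> s; apply: (le_trans (M s)); rewrite gmE; lra.
- by move=> s; apply: le_trans (m s); rewrite gpE; lra.
by exists s, t; exact: (slope_height_inj (Uf s) (Ug t) e1 e2).
Qed.

Lemma trans_meets_trans (f : R -> R * R) (b c : R) : 0 < b ->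
  continuous f -> (forall t, f (t + 1) = moebius (trans b) (f t)) ->
  exists s t, f s = moebius (trans c) (f t).
Proof.
move=> b0 cf ef.
have c1 : continuous (fun t => (f t).1) by move=> t; apply: (cvg_comp _ _ (cf t)); exact: cvg_fst.
have c2 : continuous (fun t => (f t).2) by move=> t; apply: (cvg_comp _ _ (cf t)); exact: cvg_snd.
have e1 t : (f (t + 1)).1 = (f t).1 + b by rewrite ef moebius_trans.
have e2 t : (f (t + 1)).2 = (f t).2 by rewrite ef moebius_trans.
have [T1 [T2 [T12 m M]]] := periodic_extrema c2 e2.
have cV2 : continuous (fun t => (f t).1 + c).
  by move=> t; apply: cvgD; [exact: c1|exact: cvg_cst].
have [s [t [h1 h2]]] := crossing c1 c2 cV2 c2 b0 e1 T12 m M.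
by exists s, t; rewrite moebius_trans -h1 -h2 -surjective_pairing.
Qed.

End Crossing.

(** * Relative position of the axes of two simple elements *)

Section Position.
Variables (R : realType) (S : topologicalType) (Gamma : groupType).
Variable H : hyperbolization R S Gamma.
Implicit Types (g h gamma delta : Gamma) (q T : 'M[R]_2).

Local Notation U := (@upper_half_plane R).

(** In the coordinates [q] the deck transformation acts as [T]; equality is taken in PSL(2, R). *)
Definition hol_rel gamma q T := psl_eq (hol H gamma *m q) (q *m T).

Lemma hol_mulP g h : psl_eq (hol H (g * h)%g) (hol H g *m hol H h).
Proof.
apply: moebius_psl; rewrite ?det_mulmx ?hol_det ?mulr1 // => z Uz.
by rewrite hol_mul // moebius_mul ?hol_det.
Qed.

Lemma hol_relM g h q T T' : hol_rel g q T -> hol_rel h q T' -> hol_rel (g * h)%g q (T *m T').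
Proof.
rewrite /hol_rel => eg eh.
apply: (psl_trans (psl_mul (hol_mulP g h) (psl_refl q))).
rewrite -mulmxA; apply: (psl_trans (psl_mul (psl_refl _) eh)).
by rewrite !mulmxA; exact: psl_mul (psl_refl _).
Qed.

Lemma hol_rel_moebius g q T z : \det q = 1 -> \det T = 1 -> hol_rel g q T -> U z ->
  deck H g (moebius q z) = moebius q (moebius T z).
Proof.
move=> dq dT e Uz; rewrite /deck -moebius_mul ?hol_det // -moebius_mul //.
exact: psl_moebius.
Qed.

Lemma U_i : U (0, 1). Proof. by rewrite /upper_half_plane /=. Qed.

Lemma hol_rel1 q : \det q = 1 -> hol_rel 1%g q 1%:M.
Proof.
move=> dq; rewrite /hol_rel mulmx1 -[X in psl_eq _ X]mul1mx.
apply: psl_mul; last exact: psl_refl.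
by apply: moebius_psl; rewrite ?hol_det ?det1 // => z Uz; rewrite moebius1; exact: deck1.
Qed.

Lemma moebius_inj q z w : \det q = 1 -> U z -> U w -> moebius q z = moebius q w -> z = w.
Proof.
move=> dq Uz Uw e; have qu : q \in unitmx by rewrite unitmxE dq unitr1.
have di : \det (invmx q) = 1 by rewrite det_inv dq invr1.
by rewrite -[z]moebius1 -(mulVmx qu) moebius_mul // e -moebius_mul // mulVmx // moebius1.
Qed.

Lemma hol_rel_eq g h q T : \det q = 1 -> \det T = 1 ->
  hol_rel g q T -> hol_rel h q T -> g = h.
Proof.
move=> dq dT eg eh.
apply: (@deck_free _ _ _ H _ _ (moebius q (0, 1))); first exact: (moebius_uhp dq U_i).
by rewrite (hol_rel_moebius dq dT eg U_i) (hol_rel_moebius dq dT eh U_i).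
Qed.

Lemma hol_rel_psl g q T T' : psl_eq T T' -> hol_rel g q T -> hol_rel g q T'.
Proof. by move=> e eg; apply: (psl_trans eg); exact: psl_mul (psl_refl _) e. Qed.

Lemma hol_rel_change g q A T T' : psl_eq (T *m A) (A *m T') ->
  hol_rel g q T -> hol_rel g (q *m A) T'.
Proof.
move=> e eg; rewrite /hol_rel mulmxA.
apply: (psl_trans (psl_mul eg (psl_refl A))).
by rewrite -!mulmxA; exact: psl_mul (psl_refl _) e.
Qed.

Lemma hol_rel_uniq g q T T' : \det q = 1 -> hol_rel g q T -> hol_rel g q T' -> psl_eq T T'.
Proof.
move=> dq /psl_sym e e'; have qu : q \in unitmx by rewrite unitmxE dq unitr1.
have := psl_mul (psl_refl (invmx q)) (psl_trans e e').
by rewrite !mulKmx.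
Qed.

Lemma unitmx_det1 q : \det q = 1 -> q \in unitmx.
Proof. by move=> dq; rewrite unitmxE dq unitr1. Qed.

Lemma det_inv1 q : \det q = 1 -> \det (invmx q) = 1.
Proof. by move=> dq; rewrite det_inv dq invr1. Qed.

Lemma hol_relV g q T : \det q = 1 -> \det T = 1 -> hol_rel g q T -> hol_rel g^-1%g q (invmx T).
Proof.
move=> dq dT eg; have gu := unitmx_det1 (hol_det H g).
have Tu := unitmx_det1 dT.
have eV : psl_eq (hol H g^-1%g) (invmx (hol H g)).
  apply: moebius_psl; rewrite ?det_inv1 ?hol_det // => z Uz.
  apply: (@moebius_inj (hol H g)); rewrite ?hol_det //.
  - by apply: moebius_uhp; rewrite ?hol_det.
  - by apply: moebius_uhp; rewrite ?det_inv1 ?hol_det.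
  - rewrite -[RHS]moebius_mul ?det_inv1 ?hol_det // mulmxV // moebius1.
    exact: deckKV.
apply: (psl_trans (psl_mul eV (psl_refl q))).
have := psl_mul (psl_refl (invmx (hol H g))) (psl_mul eg (psl_refl (invmx T))).
by rewrite (mulmxK Tu) -mulmxA (mulKmx gu) => /psl_sym.
Qed.

(* The conjugates of a translation by a dilation tend to the identity, which
   contradicts the local injectivity of the covering. *)
Lemma small_translation gamma kappa q (a b tau : R) : \det q = 1 -> a != 0 -> a ^+ 2 < 1 ->
  hol_rel gamma q (mx2 a b 0 a^-1) -> hol_rel kappa q (trans tau) -> tau = 0.
Proof.
move=> dq a0 a1 eg ek.
have dT : \det (mx2 a b 0 a^-1) = 1 by rewrite det_mx2 !mxE /= mulr0 subr0 divff.
have conj (h : Gamma) t : hol_rel h q (trans t) ->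
    hol_rel (gamma * h * gamma^-1)%g q (trans (a ^+ 2 * t)).
  move=> eh; have := hol_relM (hol_relM eg eh) (hol_relV dq dT eg).
  rewrite inv_mx2 // !mxE /= /trans !mx2_mul; congr (hol_rel _ _ (mx2 _ _ _ _)); by field.
have [k ke] : exists k : nat -> Gamma, forall n, hol_rel (k n) q (trans ((a ^+ 2) ^+ n * tau)).
  exists (fun n => iter n (fun h => (gamma * h * gamma^-1)%g) kappa).
  by elim=> [|n IH] /=; [rewrite mul1r|rewrite exprS -mulrA; exact: conj].
pose z0 := moebius q (0, 1).
have Uz0 : U z0 := moebius_uhp dq U_i.
have [V Vz inj] := unif_locally_injective H Uz0.
have cq : {for 0, continuous (fun x : R => moebius q (x, 1))}.
  have c1 : {for (0 : R), continuous (fun x : R => (x, 1 : R))}.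
    exact: (cvg_pair cvg_id (cvg_cst _)).
  exact: (continuous_comp c1 (moebius_continuous dq U_i)).
have /nbhs_ballP[e /= e0 eV] := cq V Vz.
have [n [nP _]] : exists n : nat, (`|tau| + 1) / e < (a ^- 2) ^+ n /\ (0 < n)%N.
  by apply: pow_large; rewrite invf_gt1 // lt_def sqr_ge0 expf_neq0.
have p0 : 0 < (a ^+ 2) ^+ n by rewrite exprn_gt0 // lt_def sqr_ge0 expf_neq0.
have small : `|(a ^+ 2) ^+ n * tau| < e.
  rewrite normrM gtr0_norm //; move: nP; rewrite exprVn ltr_pdivrMr // mulrC ltr_pdivlMr //.
  by move: ((a ^+ 2) ^+ n) p0 (normr_ge0 tau) => p; nra.
have Vn : V (moebius q ((a ^+ 2) ^+ n * tau, 1)).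
  by apply: eV; rewrite -ball_normE /= sub0r normrN.
have dkE : deck H (k n) z0 = moebius q ((a ^+ 2) ^+ n * tau, 1).
  by rewrite /z0 (hol_rel_moebius dq (det_trans _) (ke n) U_i) moebius_trans add0r.
have : deck H (k n) z0 = z0.
  apply: inj; rewrite ?inE ?dkE //; first exact: nbhs_singleton.
  by rewrite -dkE unif_deck.
have Ux (x : R) : U (x, 1) by rewrite /upper_half_plane /=.
rewrite dkE /z0 => /(moebius_inj dq (Ux _) U_i)[] /eqP.
by rewrite mulf_eq0 (gt_eqF p0) => /eqP.
Qed.

(** The commutator of two elements fixing oo is a translation by [tau]. If one of them has a^2 <> 1,
    it or its inverse contracts translations and [small_translation] gives [tau = 0]; if both are
    parabolic, the formula for [tau] vanishes. *)
Lemma shared_commute gamma delta q T T' : \det q = 1 -> \det T = 1 -> \det T' = 1 ->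
  T 1 0 = 0 -> T' 1 0 = 0 -> hol_rel gamma q T -> hol_rel delta q T' ->
  (gamma * delta = delta * gamma)%g.
Proof.
move=> dq dT dT' T0 T0' eg ed.
set a := T 0 0; set b := T 0 1; set c := T' 0 0; set d := T' 0 1.
have a0 : a != 0.
  by apply/eqP => h; move: dT; rewrite det_mx2 T0 -/a h mulr0 mul0r subr0 => /eqP; rewrite eq_sym oner_eq0.
have c0 : c != 0.
  by apply/eqP => h; move: dT'; rewrite det_mx2 T0' -/c h mulr0 mul0r subr0 => /eqP; rewrite eq_sym oner_eq0.
have TE : T = mx2 a b 0 a^-1.
  rewrite [T]mx2_eta T0 -/a -/b; congr mx2; apply: (mulfI a0); rewrite divff //.
  by move: dT; rewrite det_mx2 T0 mulr0 subr0.
have TE' : T' = mx2 c d 0 c^-1.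
  rewrite [T']mx2_eta T0' -/c -/d; congr mx2; apply: (mulfI c0); rewrite divff //.
  by move: dT'; rewrite det_mx2 T0' mulr0 subr0.
pose tau := a * b * (1 - c ^+ 2) - c * d * (1 - a ^+ 2).
pose kappa := ((gamma * delta) * (gamma^-1 * delta^-1))%g.
have ek : hol_rel kappa q (trans tau).
  have := hol_relM (hol_relM eg ed) (hol_relM (hol_relV dq dT eg) (hol_relV dq dT' ed)).
  rewrite !inv_mx2 // TE TE' !mxE /= !mx2_mul /trans.
  by congr (hol_rel _ _ (mx2 _ _ _ _)); rewrite /tau; field; rewrite ?a0 ?c0.
have hyp (g : Gamma) (x y : R) : x != 0 -> x ^+ 2 != 1 -> hol_rel g q (mx2 x y 0 x^-1) -> tau = 0.
  move=> x0 x1 e; case: (ltgtP (x ^+ 2) 1) x1 => // x1 _; first exact: small_translation x1 e ek.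
  have dX : \det (mx2 x y 0 x^-1) = 1 by rewrite det_mx2 !mxE /= mulr0 subr0 divff.
  have := hol_relV dq dX e; rewrite inv_mx2 // !mxE /= oppr0 -{2}[x]invrK => e'.
  apply: (small_translation dq _ _ e' ek); first by rewrite invr_eq0.
  by rewrite exprVn invf_lt1 // (lt_trans ltr01).
have t0 : tau = 0.
  have [a1|a1] := eqVneq (a ^+ 2) 1; last by apply: (hyp gamma a b) => //; rewrite -TE.
  have [c1|c1] := eqVneq (c ^+ 2) 1; last by apply: (hyp delta c d) => //; rewrite -TE'.
  by rewrite /tau a1 c1 subrr !mulr0 subr0.
have k1 : kappa = 1%g.
  apply: (@hol_rel_eq _ _ q (trans 0)); rewrite ?det_trans // -?t0 //.
  by rewrite t0 /trans -mx2_1; exact: hol_rel1.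
move: k1; rewrite /kappa -invgM => /(congr1 (fun x => x * (delta * gamma))%g).
by rewrite mulgVK mul1g.
Qed.

(** Normal forms up to inversion of the nontrivial deck transformations: elliptic elements are
    excluded by freeness, parabolic ones come from the cusps. *)
Inductive motion := Dil of R | Trans of R.

Definition motion_mx (N : motion) := match N with Dil l => dil l | Trans b => trans b end.
Definition motion_pos (N : motion) := match N with Dil l => 1 < l | Trans b => 0 < b end.

(* The repelling fixed point, as a vector of R^2, and the arc that starts there
   in the positive direction: 0 and (0, oo) for a dilation, oo and R for a
   translation. *)
Definition rep_pt (N : motion) : R * R := match N with Dil _ => (0, 1) | Trans _ => (1, 0) end.
Definition in_arc (N : motion) (v : R * R) : Prop :=
  match N with Dil _ => 0 < v.1 * v.2 | Trans _ => v.2 != 0 end.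

Definition act2 q (v : R * R) : R * R := (q 0 0 * v.1 + q 0 1 * v.2, q 1 0 * v.1 + q 1 1 * v.2).

Definition axis gamma m N := [/\ \det m = 1, motion_pos N & hol_rel gamma m (motion_mx N)].

Lemma det_motion N : motion_pos N -> \det (motion_mx N) = 1.
Proof.
by case: N => /= [l l1|b _]; rewrite ?det_trans ?det_dil // gt_eqF // (lt_trans ltr01).
Qed.

(** It exchanges 0 and oo, and so the two ends of the axis of a dilation. Translations have no such
    flip: positivity of [b] already selects one of gamma and its inverse. *)
Definition J2 : 'M[R]_2 := mx2 0 (-1) 1 0.

Lemma det_J2 : \det J2 = 1.
Proof. by rewrite det_mx2 !mxE /= mulr0 sub0r mulN1r opprK. Qed.

Lemma axis_flip gamma m l : axis gamma m (Dil l) -> axis gamma^-1%g (m *m J2) (Dil l).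
Proof.
move=> [dm l1 em]; have /= l0 : l != 0 by rewrite gt_eqF // (lt_trans ltr01).
split => //; first by rewrite det_mulmx dm det_J2 mulr1.
apply: hol_rel_change (hol_relV dm (det_motion l1) em).
rewrite /= inv_mx2 ?det_dil // !mxE /= /J2 /dil !mx2_mul.
by left; congr mx2; ring.
Qed.

Lemma axis_upper gamma q (a b : R) : gamma <> 1%g -> \det q = 1 -> a != 0 ->
  hol_rel gamma q (mx2 a b 0 a^-1) ->
  exists g m N, (g = gamma \/ g = gamma^-1%g) /\ axis g m N.
Proof.
move=> g1 dq a0 eg.
have dT : \det (mx2 a b 0 a^-1) = 1 by rewrite det_mx2 !mxE /= mulr0 subr0 divff.
have egV := hol_relV dq dT eg.
rewrite inv_mx2 // !mxE /= oppr0 in egV.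
have [a1|a1] := eqVneq (a ^+ 2) 1.
  have aV : a^-1 = a by apply: (mulfI a0); rewrite divff // -expr2 a1.
  have pT (x : R) : psl_eq (mx2 a x 0 a) (trans (a * x)).
    move: a1 => /eqP; rewrite sqrf_eq1 => /orP[]/eqP ->; first by left; rewrite mul1r.
    by right; rewrite /trans mx2_opp mulN1r opprK oppr0.
  rewrite aV in eg egV.
  have e1 := hol_rel_psl (pT _) eg; have e2 := hol_rel_psl (pT _) egV.
  have [b0|b0|b0] := ltgtP (a * b) 0.
  - exists gamma^-1%g, q, (Trans (a * - b)); split; [by right|split=> //=].
    by rewrite mulrN oppr_gt0.
  - by exists gamma, q, (Trans (a * b)); split; [left|split].
  case: g1; apply: (hol_rel_eq dq (det_trans _) e1); rewrite b0 /trans -mx2_1; exact: hol_rel1.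
have n0 : 1 - a ^+ 2 != 0 by rewrite subr_eq0 eq_sym.
have n0' : 1 - a * a != 0 by rewrite -expr2.
(* The finite fixed point of z |-> a^2 z + a b, moved to 0. *)
pose x0 := a * b / (1 - a ^+ 2).
have dm : \det (q *m trans x0) = 1 by rewrite det_mulmx dq det_trans mulr1.
have e1 : hol_rel gamma (q *m trans x0) (mx2 a 0 0 a^-1).
  apply: hol_rel_change eg; left; rewrite /trans !mx2_mul /x0; congr mx2; by field; rewrite ?a0 ?n0 ?n0'.
have e2 : hol_rel gamma^-1%g (q *m trans x0) (mx2 a^-1 0 0 a).
  apply: hol_rel_change egV; left; rewrite /trans !mx2_mul /x0; congr mx2; by field; rewrite ?a0 ?n0 ?n0'.
have pD (x : R) : x != 0 -> psl_eq (mx2 x 0 0 x^-1) (dil `|x|).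
  move=> xn; have [x0'|x0'] := leP 0 x; first by left; rewrite ger0_norm.
  by right; rewrite ltr0_norm // /dil mx2_opp oppr0 opprK invrN opprK.
have na : `|a| != 1.
  by apply: contra a1 => /eqP h; rewrite -normr1 in h; rewrite -[a ^+ 2]ger0_norm ?sqr_ge0 // normrX h normr1 expr1n.
case: (ltgtP `|a| 1) na => // ha _.
- exists gamma^-1%g, (q *m trans x0), (Dil `|a^-1|); split; [by right|split=> //=].
    by rewrite normfV invf_gt1 // normr_gt0.
  by apply: hol_rel_psl (pD _ _) _; rewrite ?invr_eq0 // invrK.
- exists gamma, (q *m trans x0), (Dil `|a|); split; [by left|split=> //=].
  exact: hol_rel_psl (pD _ a0) _.
Qed.

Lemma axis_exists gamma : gamma <> 1%g ->
  exists g m N, (g = gamma \/ g = gamma^-1%g) /\ axis g m N.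
Proof.
move=> g1; have dM := hol_det H gamma; move: (dM); rewrite det_mx2.
have ME := mx2_eta (hol H gamma); have den := @mob_den_neq0 _ (hol H gamma) _ dM.
have fixE := @toC_moebius R (hol H gamma).
set a := hol H gamma 0 0 in ME fixE *; set b := hol H gamma 0 1 in ME fixE *.
set c := hol H gamma 1 0 in ME fixE den *; set d := hol H gamma 1 1 in ME fixE den * => D.
have [c0|c0] := eqVneq c 0.
  have a0 : a != 0.
    by apply/eqP => h; move: D; rewrite c0 h mulr0 mul0r subr0 => /eqP; rewrite eq_sym oner_eq0.
  apply: (@axis_upper gamma 1%:M a b) => //; first exact: det1.
  rewrite /hol_rel mulmx1 mul1mx ME c0; left; congr mx2; apply: (mulfI a0).
  by rewrite divff // -D c0 mulr0 subr0.
pose Dl := (a + d) ^+ 2 - 4.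
have [Dl0|Dl0] := leP 0 Dl; last first.
  exfalso; apply: g1.
  (* For |trace| < 2 this is a fixed point in the half plane. *)
  pose x := (a - d) / (2 * c); pose y := Num.sqrt (- Dl) / (2 * `|c|).
  have Uz : U (x, y) by rewrite /upper_half_plane /= divr_gt0 ?sqrtr_gt0 ?oppr_gt0 // mulr_gt0 // normr_gt0.
  apply: (@hol_free _ _ _ H _ (x, y)) => //; apply: toC_inj; rewrite fixE.
  apply: (mulIf (den _ Uz)); rewrite divfK ?den //.
  have y2 : y ^+ 2 = - Dl / (4 * c ^+ 2).
    rewrite /y expr_div_n sqr_sqrtr ?oppr_ge0 ?ltW // exprMn real_normK ?num_real //.
    by congr (_ / (_ * _)); rewrite expr2 -natrM.
  rewrite /toC /= !realcE !mulcE !addcE; congr Complex.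
    apply/eqP; rewrite -subr_eq0; apply/eqP.
    transitivity (b + (a - d) * x - c * (x ^+ 2) + c * y ^+ 2); first ring.
    have -> : b = (a * d - 1) / c by rewrite -D; field.
    by rewrite y2 /x /Dl; field.
  have -> : x = (a - d) / (2 * c) by [].
  by field.
(* A real fixed point, which the coordinates [mx2 x (-1) 1 0] place at oo. *)
pose x := ((a - d) + Num.sqrt Dl) / (2 * c).
have fx : c * x ^+ 2 + (d - a) * x - b = 0.
  have s2 : Num.sqrt Dl ^+ 2 = Dl by rewrite sqr_sqrtr.
  have -> : b = (a * d - 1) / c by rewrite -D; field.
  rewrite /x; move: (Num.sqrt Dl) s2 => s; rewrite /Dl => s2.
  have -> : c * ((a - d + s) / (2 * c)) ^+ 2 + (d - a) * ((a - d + s) / (2 * c)) - (a * d - 1) / c =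
    (s ^+ 2 - ((a + d) ^+ 2 - 4)) / (4 * c) by field.
  by rewrite s2 subrr mul0r.
have k0 : c * x + d != 0.
  apply/eqP => h; have : a * d - b * c = (c * x + d) * (a - c * x) + c * (c * x ^+ 2 + (d - a) * x - b) by ring.
  by rewrite h fx mul0r mulr0 addr0 D => /eqP; rewrite oner_eq0.
apply: (@axis_upper gamma (mx2 x (-1) 1 0) (c * x + d) (- c)) => //.
  by rewrite det_mx2 !mxE /= mulr0 sub0r mulN1r opprK.
left; rewrite ME !mx2_mul; congr mx2.
- apply/eqP; rewrite -subr_eq0; apply/eqP.
  transitivity (- (c * x ^+ 2 + (d - a) * x - b)); first by ring.
  by rewrite fx oppr0.
- have -> : (c * x + d)^-1 = a - c * x.
    apply: (mulfI k0); rewrite divff // -D.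
    have -> : a * d - b * c = (c * x + d) * (a - c * x) + c * (c * x ^+ 2 + (d - a) * x - b) by ring.
    by rewrite fx mulr0 addr0.
  ring.
- ring.
- ring.
Qed.

Lemma normal_path gamma m N f : axis gamma m N -> equivariant_path H gamma f ->
  exists F : R -> R * R, [/\ continuous F, forall t, U (F t),
    forall t, F (t + 1) = moebius (motion_mx N) (F t) & forall t, f t = moebius m (F t)].
Proof.
move=> [dm N0 em] [cf Uf ef]; have mu := unitmx_det1 dm; have di := det_inv1 dm.
have dN := det_motion N0.
have fE t : f t = moebius m (moebius (invmx m) (f t)).
  by rewrite -moebius_mul // mulmxV // moebius1.
have UF t : U (moebius (invmx m) (f t)) by exact: moebius_uhp.
exists (fun t => moebius (invmx m) (f t)); split => //.
- by move=> t; apply: continuous_comp; [exact: cf|exact: moebius_continuous].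
- move=> t; apply: (moebius_inj dm) => //; first exact: moebius_uhp.
  by rewrite -fE ef {1}fE (hol_rel_moebius dm dN em).
Qed.

Lemma axes_unlinked gamma delta m k l l' f e :
  axis gamma m (Dil l) -> axis delta k (Dil l') ->
  equivariant_path H gamma f -> equivariant_path H delta e ->
  (forall s t, f s <> e t) -> let K := invmx m *m k in
  ~ (K 0 0 * K 1 0 * (K 0 1 * K 1 1) < 0).
Proof.
move=> am ak ef ee fe K neg.
have [F [cF UF eF fE]] := normal_path am ef; have [E [cE UE eE eEE]] := normal_path ak ee.
have [dm l1 _] := am; have [dk l1' _] := ak.
have dK : \det K = 1 by rewrite det_mulmx det_inv1 // dk mulr1.
have [s [t st]] := linked_paths_meet l1 cF UF eF l1' cE UE eE
  (etrans (esym (det_mx2 K)) dK) neg.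
apply: (fe s t); rewrite fE eEE st -mx2_eta -moebius_mul ?mulmxA ?mulmxV ?mul1mx //.
exact: unitmx_det1.
Qed.

Lemma cyclic_subgroupV gamma h : cyclic_subgroup gamma^-1%g h <-> cyclic_subgroup gamma h.
Proof.
suff i g : cyclic_subgroup g^-1%g h -> cyclic_subgroup g h.
  by split; [exact: i|rewrite -{1}[gamma]invgK; exact: i].
have XV (x : Gamma) k : (x^-1 ^+ k = x ^- k)%g.
  elim: k => [|k IH]; first by rewrite !expg0 invg1.
  by rewrite expgS IH expgSr invgM.
by move=> [k [] ->]; exists k; rewrite XV ?invgK; [right|left].
Qed.

Lemma commuteVg (x y : Gamma) : (x * y = y * x)%g -> (x^-1 * y = y * x^-1)%g.
Proof. by move=> c; rewrite -[LHS](mulgK x) -(mulgA x^-1%g) -c mulKg. Qed.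

Lemma cyclic_commute gamma h : cyclic_subgroup gamma h -> (gamma * h = h * gamma)%g.
Proof.
have c k : (gamma * gamma ^+ k = gamma ^+ k * gamma)%g by rewrite -expgS expgSr.
by move=> [k [] ->] //; apply/esym/commuteVg.
Qed.

Lemma simple_pathV gamma f : simple_path H gamma f -> simple_path H gamma^-1%g (fun t => f (- t)).
Proof.
move=> [[cf Uf ef] sf]; split; first split.
- move=> t; apply: (@continuous_comp _ _ _ (fun t : R => - t) f); last exact: cf.
  exact: (cvgN cvg_id).
- by move=> t; exact: Uf.
- by move=> t; rewrite -[in RHS](subrK 1 (- t)) ef deckK // opprD.
by move=> h s t /sf; rewrite cyclic_subgroupV.
Qed.

Lemma simple_path_sign gamma g f : g = gamma \/ g = gamma^-1%g -> simple_path H gamma f ->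
  exists2 f', simple_path H g f' & forall t, exists u, f' t = f u.
Proof.
move=> [] -> sf; first by exists f => // t; exists t.
by exists (fun t => f (- t)); [exact: simple_pathV|move=> t; exists (- t)].
Qed.

Lemma hol_rel_ex h m : \det m = 1 -> hol_rel h m (invmx m *m hol H h *m m).
Proof. by move=> dm; left; rewrite !mulmxA mulmxV ?mul1mx //; exact: unitmx_det1. Qed.

(** In the coordinates of the axis of gamma, an element commuting with it is again a dilation or a
    translation, so its image of the path meets the path. Commutation in PSL(2, R) could also hold
    with the sign -1, which det K = 1 excludes. *)
Lemma simple_centralizer gamma f h : gamma <> 1%g -> simple_path H gamma f ->
  (gamma * h = h * gamma)%g -> cyclic_subgroup gamma h.
Proof.
move=> g1 sf com; have [g [m [N [gE am]]]] := axis_exists g1.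
have comg : (g * h = h * g)%g.
  by case: gE => -> //; exact: commuteVg.
have [f' sf' _] := simple_path_sign gE sf.
suff : cyclic_subgroup g h by case: gE => -> //; rewrite cyclic_subgroupV.
have [ef' sf''] := sf'; have [dm N0 em] := am.
have [F [cF UF eF fE]] := normal_path am ef'.
set K := invmx m *m hol H h *m m; have eh : hol_rel h m K := hol_rel_ex h dm.
have dK : \det K = 1 by rewrite !det_mulmx det_inv1 // hol_det dm !mulr1.
have cK : psl_eq (motion_mx N *m K) (K *m motion_mx N).
  by apply: (hol_rel_uniq dm (hol_relM em eh)); rewrite comg; exact: hol_relM.
suff [s [t st]] : exists s t, F s = moebius K (F t).
  by apply: (sf'' h t s); rewrite !fE st (hol_rel_moebius dm dK eh).
move: dK; rewrite det_mx2.
move: cK; rewrite [K]mx2_eta; move: (K 0 0) (K 0 1) (K 1 0) (K 1 1) => a b c d.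
rewrite !mxE /=; case: N N0 em eF {am} => [l /= l1 _|b0 /= b00 _] eF.
  rewrite /dil !mx2_mul => E D; have l0 : 0 < l by apply: lt_trans l1.
  have ll : l * l^-1 = 1 by rewrite divff // gt_eqF.
  have lV : l^-1 < 1 by rewrite invf_lt1.
  have lV0 : 0 < l^-1 by rewrite invr_gt0.
  have [b0 c0] : b = 0 /\ c = 0.
    case: E => [/matrixP E|]; last first.
      rewrite mx2_opp => /matrixP E; exfalso.
      have := E 0 0; have := E 0 1; have := E 1 1; rewrite !mxE /= => e1 e2 e3.
      have a0 : a = 0 by nra.
      have d0 : d = 0 by nra.
      have b0 : b = 0 by nra.
      by move: D; rewrite a0 b0 !mul0r subr0 => /eqP; rewrite eq_sym oner_eq0.
    have := E 0 1; have := E 1 0; rewrite !mxE /= => e1 e2.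
    by split; nra.
  have a0 : a != 0.
    by apply/eqP => h0; move: D; rewrite h0 b0 !mul0r subr0 => /eqP; rewrite eq_sym oner_eq0.
  have -> : mx2 a b c d = dil a.
    rewrite /dil b0 c0; congr mx2; apply: (mulfI a0); rewrite divff // -D b0; ring.
  exact: (dil_meets_dil l1 cF UF eF a0).
rewrite /trans !mx2_mul => E D.
have [c0 ad] : c = 0 /\ a = d.
  case: E => [/matrixP E|]; last first.
    rewrite mx2_opp => /matrixP E; exfalso.
    have := E 0 0; have := E 1 0; rewrite !mxE /= => e1 e2.
    have c0 : c = 0 by lra.
    have a0 : a = 0 by move: e2; rewrite c0; lra.
    by move: D; rewrite a0 c0 mul0r mulr0 subr0 => /eqP; rewrite eq_sym oner_eq0.
  have := E 0 0; have := E 0 1; rewrite !mxE /= => e1 e2.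
  split; first by nra.
  by apply: (mulfI (lt0r_neq0 b00)); lra.
have pK : psl_eq (mx2 a b c d) (trans (a * b)).
  move: D; rewrite c0 -ad mulr0 subr0 -expr2 => /eqP; rewrite sqrf_eq1 => /orP[]/eqP ->.
    by left; rewrite mul1r.
  by right; rewrite /trans mx2_opp mulN1r opprK oppr0.
have [s [t st]] := trans_meets_trans (a * b) b00 cF eF.
by exists s, t; rewrite st; apply/esym/psl_moebius.
Qed.

(** The conjugate h delta h^-1 has the ends L(oo) and L(0). As delta is simple, its axis and that of
    the conjugate are not linked, so L(0) lies on the same side of 0 and oo as L(oo). *)
Lemma push_in_arc delta k l e h L : axis delta k (Dil l) -> simple_path H delta e ->
  hol_rel h k L -> \det L = 1 -> (h * delta <> delta * h)%g ->
  0 < L 0 0 * L 1 0 -> L 0 1 != 0 -> 0 < L 0 1 * L 1 1.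
Proof.
move=> ak [ee se] eh dL ncom L1 L2; have [dk l1 ek] := ak.
have l0 : 0 < l by apply: lt_trans l1.
have ku := unitmx_det1 dk.
have dd : \det (dil l) = 1 := det_motion l1.
have ec : hol_rel (h * delta * h^-1)%g k (L *m dil l *m invmx L).
  exact: hol_relM (hol_relM eh ek) (hol_relV dk dL eh).
have ac : axis (h * delta * h^-1)%g (k *m L) (Dil l).
  split=> //; first by rewrite det_mulmx dk dL mulr1.
  by apply: hol_rel_change ec; left; rewrite mulmxKV //; exact: unitmx_det1.
case: (ltgtP (L 0 1 * L 1 1) 0) => // [neg|/eqP L0]; exfalso.
  apply: (axes_unlinked ak ac ee (equivariant_path_conj h ee)).
    move=> s t st; apply: ncom; apply/esym/cyclic_commute.
    by apply: (se h t s); rewrite st.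
  by rewrite mulKmx // pmulr_rlt0.
(* The remaining case L(0) = oo: delta and its conjugate share the fixed point oo, so they commute,
   which is impossible because their other fixed points 0 and L(oo) differ. *)
move: L0; rewrite mulf_eq0 (negPf L2) /= => /eqP L11.
set p := L 0 0 in L1; set q := L 0 1 in L2; set r := L 1 0 in L1.
have LE : L = mx2 p q r 0 by rewrite [L]mx2_eta L11.
have D : q * r = -1.
  by move: dL; rewrite det_mx2 L11 mulr0 sub0r -/q -/r => <-; rewrite opprK.
have p0 : p != 0 by apply: contraTneq L1 => ->; rewrite mul0r ltxx.
have T2 : L *m dil l *m invmx L = mx2 l^-1 (p * q * (l^-1 - l)) 0 l.
  rewrite inv_mx2 // LE /dil !mxE /= !mx2_mul; congr mx2.
  - by transitivity (- (q * r) / l); [ring|rewrite D opprK mul1r].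
  - by ring.
  - by ring.
  - by transitivity (- (q * r) * l); [ring|rewrite D opprK mul1r].
have dT2 : \det (L *m dil l *m invmx L) = 1 by rewrite !det_mulmx dL dd det_inv1 // !mulr1.
have com : (delta * (h * delta * h^-1) = (h * delta * h^-1) * delta)%g.
  by apply: (shared_commute dk dd dT2 _ _ ek ec); [rewrite !mxE|rewrite T2 !mxE].
have := hol_rel_uniq dk (hol_relM ek ec); rewrite com => /(_ _ (hol_relM ec ek)).
have ll : l * l^-1 = 1 by rewrite divff // gt_eqF.
rewrite T2 /= /dil !mx2_mul; case=> [/matrixP|]; last first.
  have lr : l^-1 * l = 1 by rewrite mulrC.
  by rewrite mx2_opp => /matrixP /(_ 0 0); rewrite !mx2E ll lr !mulr0; lra.
move=> /(_ 0 1); rewrite !mxE /= mulr0 mul0r.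
move=> E; have lV : l^-1 < 1 by rewrite invf_lt1.
have : (p * q) * (l - l^-1) ^+ 2 = 0.
  transitivity (- ((l * (p * q * (l^-1 - l)) + 0) - (0 + p * q * (l^-1 - l) / l))); first by ring.
  by rewrite E subrr oppr0.
by move=> /eqP; rewrite !mulf_eq0 (negPf p0) (negPf L2) /= orbb subr_eq0 gt_eqF // (lt_trans lV).
Qed.

(* In the coordinates m the repelling point of delta lies in the arc of gamma, and
   in the coordinates k its image under gamma^-1 lies in the arc of delta. *)
Definition rel_position gamma m N delta k N' := let K := invmx m *m k in
  [/\ axis gamma m N, axis delta k N', in_arc N (act2 K (rep_pt N')) &
      in_arc N' (act2 (invmx K *m invmx (motion_mx N) *m K) (rep_pt N'))].

Definition good_position gamma delta := exists g d m N k N',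
  [/\ g = gamma \/ g = gamma^-1%g, d = delta \/ d = delta^-1%g &
      rel_position g m N d k N'].

Lemma inv_J2_mul (m k : 'M[R]_2) : \det m = 1 -> invmx (m *m J2) *m k = invmx J2 *m (invmx m *m k).
Proof.
move=> dm; have mu := unitmx_det1 dm; have Ju := unitmx_det1 det_J2.
have u : m *m J2 \in unitmx by rewrite unitmx_mul mu Ju.
apply: (can_inj (mulKmx u)); rewrite mulKVmx // !mulmxA.
by rewrite -(mulmxA m) mulmxV // mulmx1 mulmxV // mul1mx.
Qed.

Lemma det_conj1 (K X : 'M[R]_2) : \det K = 1 -> \det X = 1 -> \det (invmx K *m X *m K) = 1.
Proof. by move=> dK dX; rewrite !det_mulmx det_inv1 // dK dX !mulr1. Qed.

Lemma push_entries_dil (K : 'M[R]_2) l : \det K = 1 -> l != 0 ->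
  invmx K *m invmx (dil l) *m K =
  mx2 (l^-1 - K 0 1 * K 1 0 * (l - l^-1)) (- (K 0 1 * K 1 1 * (l - l^-1)))
      (K 0 0 * K 1 0 * (l - l^-1)) (l + K 0 1 * K 1 0 * (l - l^-1)).
Proof.
move=> dK l0; have KE := mx2_eta K; rewrite !inv_mx2 ?det_dil //.
move: dK; rewrite det_mx2; move: (K 0 0) (K 0 1) (K 1 0) (K 1 1) KE => a b c d -> D.
rewrite /dil !mx2E !mx2_mul; have ad : a * d = 1 + b * c by rewrite -D subrK.
congr mx2.
- by transitivity (a * d * l^-1 - b * c * l); [ring|rewrite ad; ring].
- by ring.
- by ring.
- by transitivity (a * d * l - b * c * l^-1); [ring|rewrite ad; ring].
Qed.

Lemma push_entries_trans (K : 'M[R]_2) b0 : \det K = 1 ->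
  invmx K *m invmx (trans b0) *m K =
  mx2 (1 - b0 * (K 1 0 * K 1 1)) (- (b0 * K 1 1 ^+ 2))
      (b0 * K 1 0 ^+ 2) (1 + b0 * (K 1 0 * K 1 1)).
Proof.
move=> dK; have KE := mx2_eta K; rewrite !inv_mx2 ?det_trans //.
move: dK; rewrite det_mx2; move: (K 0 0) (K 0 1) (K 1 0) (K 1 1) KE => a b c d -> D.
rewrite /trans !mx2E !mx2_mul; congr mx2.
- by transitivity (a * d - b * c - b0 * (c * d)); [ring|rewrite D].
- by ring.
- by ring.
- by transitivity (a * d - b * c + b0 * (c * d)); [ring|rewrite D].
Qed.

(** * Relative positions read off the signs of a change of coordinates *)

Section NormalizedSigns.
Variables (gamma delta : Gamma) (m k : 'M[R]_2) (e : R -> R * R).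
Hypothesis se : simple_path H delta e.
Hypothesis ncom : (gamma * delta <> delta * gamma)%g.
Let K := invmx m *m k.

Lemma hol_rel_push N N' : axis gamma m N -> axis delta k N' ->
  hol_rel gamma^-1%g k (invmx K *m invmx (motion_mx N) *m K).
Proof.
move=> [dm N0 em] [dk N0' ek]; have mu := unitmx_det1 dm.
have kE : k = m *m K by rewrite /K mulKVmx.
rewrite {1}kE; apply: hol_rel_change (hol_relV dm (det_motion N0) em).
left; rewrite !mulmxA mulmxV ?mul1mx // unitmx_mul unitmx_inv mu.
exact: unitmx_det1.
Qed.

Lemma detK N N' : axis gamma m N -> axis delta k N' -> \det K = 1.
Proof. by move=> [dm _ _] [dk _ _]; rewrite det_mulmx det_inv1 // dk mulr1. Qed.

Lemma noncomV : (gamma^-1 * delta <> delta * gamma^-1)%g.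
Proof. by move=> /commuteVg; rewrite invgK. Qed.

(** In the coordinates of gamma, a / c and b / d are the attracting and the repelling end of delta,
    with difference 1 / (c d). The signs thus say that 0 < attracting end < repelling end. A
    computation locates the image of the attracting end under gamma^-1, and [push_in_arc] transfers
    this to the repelling end. *)
Lemma position_dil_dil l l' : axis gamma m (Dil l) -> axis delta k (Dil l') ->
  0 < K 0 0 * K 1 0 -> 0 < K 0 1 * K 1 1 -> K 1 0 * K 1 1 < 0 ->
  rel_position gamma m (Dil l) delta k (Dil l').
Proof.
move=> am ak ac bd cd; have dK := detK am ak; have eL := hol_rel_push am ak.
have [dm l1 _] := am; have l0 : 0 < l by apply: lt_trans l1.
have dd : \det (invmx (dil l)) = 1 by rewrite det_inv1 // (det_motion l1).
split=> //; rewrite -/K /= /act2 /= ?mulr0 ?mulr1 ?add0r //.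
have lV : l^-1 < 1 by rewrite invf_lt1.
have lV0 : 0 < l^-1 by rewrite invr_gt0.
have bc : K 0 1 * K 1 0 < 0.
  by rewrite ltNge; apply/negP => bc; have := sqr_ge0 (K 1 1); nra.
apply: (push_in_arc ak se eL (det_conj1 dK dd) noncomV);
  rewrite /= push_entries_dil ?(gt_eqF l0) // !mx2E /=.
  have ll : 0 < l - l^-1 by rewrite subr_gt0 (lt_trans lV).
  apply: mulr_gt0; last exact: mulr_gt0.
  by rewrite subr_gt0 (@lt_trans _ _ 0) // pmulr_llt0.
by rewrite oppr_eq0 mulf_neq0 ?(gt_eqF bd) // subr_eq0 gt_eqF // (lt_trans lV).
Qed.

Lemma position_trans_dil b0 l' : axis gamma m (Trans b0) -> axis delta k (Dil l') ->
  K 1 0 * K 1 1 < 0 -> rel_position gamma m (Trans b0) delta k (Dil l').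
Proof.
move=> am ak cd; have dK := detK am ak; have eL := hol_rel_push am ak.
have [dm /= b00 _] := am.
have dd : \det (invmx (trans b0)) = 1 by rewrite det_inv1 // det_trans.
have d0 : K 1 1 != 0 by apply: contraTneq cd => ->; rewrite mulr0 ltxx.
have c0 : K 1 0 != 0 by apply: contraTneq cd => ->; rewrite mul0r ltxx.
split=> //; rewrite -/K /= /act2 /= ?mulr0 ?mulr1 ?add0r //.
apply: (push_in_arc ak se eL (det_conj1 dK dd) noncomV);
  rewrite /= push_entries_trans // !mx2E /=.
  apply: mulr_gt0; first by rewrite subr_gt0 (@lt_trans _ _ 0) // pmulr_rlt0.
  by rewrite mulr_gt0 // exprn_even_gt0.
by rewrite oppr_eq0 mulf_neq0 ?gt_eqF // exprn_even_gt0.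
Qed.

Lemma position_trans_trans b0 b1 : axis gamma m (Trans b0) -> axis delta k (Trans b1) ->
  K 1 0 != 0 -> rel_position gamma m (Trans b0) delta k (Trans b1).
Proof.
move=> am ak c0; have dK := detK am ak; have [dm /= b00 _] := am.
split=> //; rewrite -/K /= ?push_entries_trans // /act2 /= !mulr0 !mulr1 !addr0 // !mx2E /=.
by rewrite mulf_neq0 ?gt_eqF // exprn_even_gt0.
Qed.

Lemma position_dil_trans l b1 : axis gamma m (Dil l) -> axis delta k (Trans b1) ->
  0 < K 0 0 * K 1 0 -> rel_position gamma m (Dil l) delta k (Trans b1).
Proof.
move=> am ak ac; have dK := detK am ak; have [dm /= l1 _] := am.
have l0 : 0 < l by apply: lt_trans l1.
split=> //; rewrite -/K /= ?push_entries_dil ?(gt_eqF l0) // /act2 /= !mulr0 !mulr1 !addr0 // !mx2E /=.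
have lV : l^-1 < 1 by rewrite invf_lt1.
by rewrite mulf_neq0 ?(gt_eqF ac) // subr_eq0 gt_eqF // (lt_trans lV).
Qed.

End NormalizedSigns.

(** The change of coordinates fixes oo, so both elements fix the same boundary point. *)
Lemma upper_commute gamma delta m k N N' : axis gamma m N -> axis delta k N' ->
  (invmx m *m k) 1 0 = 0 -> (gamma * delta = delta * gamma)%g.
Proof.
move=> [dm N0 em] [dk N0' ek]; set K := invmx m *m k => K0.
have mu := unitmx_det1 dm.
have dK : \det K = 1 by rewrite det_mulmx det_inv1 // dk mulr1.
have mE : m = k *m invmx K by rewrite -[k](mulKVmx mu) -/K mulmxK // unitmx_det1.
have dN := det_motion N0; have dN' := det_motion N0'; clearbody K.
have e' : hol_rel delta m (K *m motion_mx N' *m invmx K).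
  rewrite mE; apply: hol_rel_change ek; left.
  by rewrite -!mulmxA mulKmx //; exact: unitmx_det1.
apply: (shared_commute dm dN _ _ _ em e').
- by rewrite !det_mulmx dK dN' det_inv1 // !mulr1.
- by case: (N) => ?; rewrite !mxE.
rewrite inv_mx2 // K0; move: (mx2_eta K); rewrite K0.
move: (K 0 0) (K 0 1) (K 1 1) => a b d ->.
by case: (N') => ? /=; rewrite /dil /trans !mx2_mul !mx2E; ring.
Qed.

Lemma J2_entries (K : 'M[R]_2) : [/\ K *m J2 = mx2 (K 0 1) (- K 0 0) (K 1 1) (- K 1 0) &
  invmx J2 *m K = mx2 (K 1 0) (K 1 1) (- K 0 0) (- K 0 1)].
Proof.
rewrite inv_mx2 ?det_J2 // {1 6}[K]mx2_eta /J2 !mxE /= !mx2_mul.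
by split; congr mx2; ring.
Qed.

Lemma noncomm_sign (gamma delta g d : Gamma) : g = gamma \/ g = gamma^-1%g ->
  d = delta \/ d = delta^-1%g -> (g * d = d * g)%g -> (gamma * delta = delta * gamma)%g.
Proof.
move=> gE dE c.
have {c}c : (gamma * d = d * gamma)%g.
  by case: gE c => -> // /commuteVg; rewrite invgK.
by case: dE c => -> // /esym/commuteVg; rewrite invgK => ->.
Qed.

Lemma axes_good_position gamma delta f e : gamma <> 1%g -> delta <> 1%g ->
  simple_path H gamma f -> simple_path H delta e -> (forall s t, f s <> e t) ->
  (gamma * delta <> delta * gamma)%g -> good_position gamma delta.
Proof.
move=> g1 d1 sf se fe ncom.
have [g [m [N [gE am]]]] := axis_exists g1; have [d [k [N' [dE ak]]]] := axis_exists d1.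
have VV (x y : Gamma) : x = y \/ x = y^-1%g -> x^-1%g = y \/ x^-1%g = y^-1%g.
  by case=> ->; [right|left; rewrite invgK].
have sV x : x = delta \/ x = delta^-1%g -> exists e', simple_path H x e'.
  by move=> xE; have [e' ? _] := simple_path_sign xE se; exists e'.
have nc x y : x = gamma \/ x = gamma^-1%g -> y = delta \/ y = delta^-1%g -> (x * y <> y * x)%g.
  by move=> xE yE /(noncomm_sign xE yE).
have [f' sf' ff'] := simple_path_sign gE sf; have [e' se' ee'] := simple_path_sign dE se.
have fe' s t : f' s <> e' t.
  by have [u ->] := ff' s; have [v ->] := ee' t; exact: fe.
have [dm N0 _] := am; have [dk N0' _] := ak.
have n10 : (invmx m *m k) 1 0 != 0 by apply/eqP => h; exact: (nc _ _ gE dE (upper_commute am ak h)).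
have flipk l : N' = Dil l -> [/\ axis d^-1%g (k *m J2) (Dil l), invmx m *m (k *m J2) = (invmx m *m k) *m J2
    & (invmx m *m k) 1 1 != 0].
  move=> E; have ak2 : axis d^-1%g (k *m J2) (Dil l) by apply: axis_flip; rewrite -E.
  have E2 : invmx m *m (k *m J2) = (invmx m *m k) *m J2 by rewrite mulmxA.
  split=> //; apply/eqP => h; apply: (nc _ _ gE (VV _ _ dE)); apply: (upper_commute am ak2).
  by rewrite E2; have [-> _] := J2_entries (invmx m *m k); rewrite !mx2E.
have flipm l : N = Dil l -> [/\ axis g^-1%g (m *m J2) (Dil l), invmx (m *m J2) *m k = invmx J2 *m (invmx m *m k)
    & (invmx m *m k) 0 0 != 0].
  move=> E; have am2 : axis g^-1%g (m *m J2) (Dil l) by apply: axis_flip; rewrite -E.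
  have E2 := inv_J2_mul k dm.
  split=> //; apply/eqP => h; apply: (nc _ _ (VV _ _ gE) dE); apply: (upper_commute am2 ak).
  by rewrite E2; have [_ ->] := J2_entries (invmx m *m k); rewrite !mx2E /= h oppr0.
case: N N0 am flipm => [l|b0] N0 am flipm; case: N' N0' ak flipk => [l'|b1] N0' ak flipk.
- have [am2 mJ a0] := flipm l erefl; have [ak2 kJ d0] := flipk l' erefl.
  have mkJ := inv_J2_mul (k *m J2) dm.
  have b0 : (invmx m *m k) 0 1 != 0.
    apply/eqP => h; apply: (nc _ _ (VV _ _ gE) (VV _ _ dE)); apply: (upper_commute am2 ak2).
    rewrite mkJ kJ; have [-> _] := J2_entries (invmx m *m k).
    by have [_ ->] := J2_entries (mx2 ((invmx m *m k) 0 1) (- (invmx m *m k) 0 0) ((invmx m *m k) 1 1) (- (invmx m *m k) 1 0)); rewrite !mx2E /= h oppr0.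
  have unl : 0 < (invmx m *m k) 0 0 * (invmx m *m k) 1 0 * ((invmx m *m k) 0 1 * (invmx m *m k) 1 1).
    rewrite lt_def !mulf_neq0 //= leNgt; apply/negP.
    by case: sf' se' => [ef' _] [ee'' _]; apply: (axes_unlinked am ak ef' ee'' fe').
  (* [x] is gamma or its inverse, chosen such that both ends of delta lie in (0, oo), which is
     possible as the axes are not linked. If c d > 0, passing to the inverse of delta exchanges its
     ends. *)
  have step x mm : (x = gamma \/ x = gamma^-1%g) -> axis x mm (Dil l) ->
      0 < (invmx mm *m k) 0 0 * (invmx mm *m k) 1 0 -> 0 < (invmx mm *m k) 0 1 * (invmx mm *m k) 1 1 ->
      (invmx mm *m k) 1 0 * (invmx mm *m k) 1 1 != 0 -> good_position gamma delta.
    move=> xE xa ac bd; case: ltgtP => // cd _.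
      exists x, d, mm, (Dil l), k, (Dil l'); split=> //.
      exact: (position_dil_dil se' (nc _ _ xE dE)).
    exists x, d^-1%g, mm, (Dil l), (k *m J2), (Dil l'); split=> //; first exact: VV.
    have [e'' se''] := sV _ (VV _ _ dE).
    have E2 : invmx mm *m (k *m J2) = (invmx mm *m k) *m J2 by rewrite mulmxA.
    have [JE _] := J2_entries (invmx mm *m k).
    apply: (position_dil_dil se'' (nc _ _ xE (VV _ _ dE)) xa ak2); rewrite E2 JE !mx2E /= ?mulrNN //.
    by rewrite mulrN oppr_lt0 mulrC.
  have [ac|ac|ac] := ltgtP ((invmx m *m k) 0 0 * (invmx m *m k) 1 0) 0.
  - apply: (step _ _ (VV _ _ gE) am2); rewrite mJ; have [_ ->] := J2_entries (invmx m *m k); rewrite !mx2E /=.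
    + by rewrite mulrN mulrC oppr_gt0.
    + rewrite mulrN oppr_gt0 mulrC; move: unl; rewrite nmulr_rgt0 //.
    + by rewrite mulrNN mulf_neq0.
  - by apply: (step _ _ gE am) => //; [move: unl; rewrite pmulr_rgt0|rewrite mulf_neq0].
  by move: unl; rewrite ac mul0r ltxx.
- have [am2 mJ a0] := flipm l erefl.
  have [ac|ac|/eqP] := ltgtP ((invmx m *m k) 0 0 * (invmx m *m k) 1 0) 0; last by rewrite mulf_eq0 (negPf a0) (negPf n10).
    exists g^-1%g, d, (m *m J2), (Dil l), k, (Trans b1); split=> //; first exact: VV.
    apply: (position_dil_trans am2 ak); rewrite mJ; have [_ ->] := J2_entries (invmx m *m k); rewrite !mx2E /=.
    by rewrite mulrN mulrC oppr_gt0.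
  exists g, d, m, (Dil l), k, (Trans b1); split=> //; exact: position_dil_trans.
- have [ak2 kJ d0] := flipk l' erefl.
  have [cd|cd|/eqP] := ltgtP ((invmx m *m k) 1 0 * (invmx m *m k) 1 1) 0; last by rewrite mulf_eq0 (negPf d0) (negPf n10).
    exists g, d, m, (Trans b0), k, (Dil l'); split=> //.
    exact: (position_trans_dil se' (nc _ _ gE dE)).
  exists g, d^-1%g, m, (Trans b0), (k *m J2), (Dil l'); split=> //; first exact: VV.
  have [e'' se''] := sV _ (VV _ _ dE).
  apply: (position_trans_dil se'' (nc _ _ gE (VV _ _ dE)) am ak2).
  rewrite kJ; have [-> _] := J2_entries (invmx m *m k); rewrite !mx2E /=.
  by rewrite mulrN oppr_lt0 mulrC.
exists g, d, m, (Trans b0), k, (Trans b1); split=> //; exact: position_trans_trans.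
Qed.

End Position.

(** * The boundary circle *)

Section Circle.
Variable R : realType.
Implicit Types (u v w : R * R) (x y z : boundary_circle R) (g h : 'M[R]_2).

Definition cpt v : boundary_circle R := if v.2 == 0 then None else Some (v.1 / v.2).

Definition clift x : R * R := if x is Some a then (a, 1) else (1, 0).

Definition wedge u v : R := u.1 * v.2 - u.2 * v.1.

Lemma cliftK x : cpt (clift x) = x.
Proof. by case: x => [a|]; rewrite /cpt /= ?oner_eq0 ?divr1 ?eqxx. Qed.

Lemma clift_neq0 x : clift x != 0.
Proof.
by case: x => [a|] /=; apply/eqP => -[] /eqP; rewrite ?oner_eq0 //; move=> _ /eqP; rewrite oner_eq0.
Qed.

(** The product of wedges is homogeneous of degree 2 in each vector, so its sign depends on the
    points only, and it is invariant under SL(2, R). This gives the invariance of the orientation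
    under Moebius transformations. *)
Lemma positively_orientedE u v w : u != 0 -> v != 0 -> w != 0 ->
  positively_oriented (cpt u) (cpt v) (cpt w) = (0 < wedge u v * wedge v w * wedge w u).
Proof.
have nz (a b : R) : (a, b) != 0 -> b = 0 -> a != 0.
  by move=> n e; apply: contra n => /eqP ->; rewrite e.
case: u v w => [a b] [c d] [e f] /nz u0 /nz v0 /nz w0; rewrite /cpt /wedge /positively_oriented /=.
have sq (t : R) : t != 0 -> 0 < t ^+ 2 by move=> t0; rewrite exprn_even_gt0.
have lt_div (p q r s : R) : q != 0 -> s != 0 -> (p / q < r / s) = (0 < q * s * (r * q - p * s)).
  move=> q0 s0; rewrite -subr_gt0.
  have -> : r / s - p / q = (q * s * (r * q - p * s)) / (q * s) ^+ 2 by field; rewrite q0 s0.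
  by rewrite pmulr_lgt0 // invr_gt0 sq // mulf_neq0.
have [b0|b0] := eqVneq b 0; have [d0|d0] := eqVneq d 0; have [f0|f0] := eqVneq f 0;
  rewrite /= ?andbF ?andbT ?orbF.
- by rewrite b0 d0 f0; apply/esym/negbTE; rewrite -leNgt; lra.
- by rewrite b0 d0; apply/esym/negbTE; rewrite -leNgt !(mul0r, mulr0, subrr).
- by rewrite b0 f0; apply/esym/negbTE; rewrite -leNgt !(mul0r, mulr0, subrr).
- have a0 := u0 b0; rewrite lt_div // b0.
  have -> : (a * d - 0 * c) * (c * f - d * e) * (e * 0 - f * a) = a ^+ 2 * (d * f * (e * d - c * f)) by ring.
  by rewrite (pmulr_rgt0 _ (sq _ a0)).
- by rewrite d0 f0; apply/esym/negbTE; rewrite -leNgt !(mul0r, mulr0, subrr).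
- have c0 := v0 d0; rewrite lt_div // d0.
  have -> : (a * 0 - b * c) * (c * f - 0 * e) * (e * b - f * a) = c ^+ 2 * (f * b * (a * f - e * b)) by ring.
  by rewrite (pmulr_rgt0 _ (sq _ c0)).
- have e0 := w0 f0; rewrite lt_div // f0.
  have -> : (a * d - b * c) * (c * 0 - d * e) * (e * b - 0 * a) = e ^+ 2 * (b * d * (c * b - a * d)) by ring.
  by rewrite (pmulr_rgt0 _ (sq _ e0)).
have -> : (a * d - b * c) * (c * f - d * e) * (e * b - f * a) =
   (b * d * f) ^+ 2 * ((a / b - c / d) * (c / d - e / f) * (e / f - a / b)) by field; rewrite b0 d0 f0.
rewrite (pmulr_rgt0 _ (sq _ (mulf_neq0 (mulf_neq0 b0 d0) f0))).
move: (a / b) (c / d) (e / f) => x y z.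
have -> : (z < x) = ((y - x) + (z - y) < 0) by rewrite -subr_lt0; congr (_ < _); ring.
have -> : (x - y) * (y - z) * (z - x) = (y - x) * (z - y) * ((y - x) + (z - y)) by ring.
rewrite -(subr_gt0 x y) -(subr_gt0 y z); move: (y - x) (z - y) => p q.
case: (ltgtP p 0) => p0; case: (ltgtP q 0) => q0 /=; rewrite ?andbF ?andbT ?orbF /=.
- by apply/esym/negbTE; rewrite -leNgt; apply: mulr_ge0_le0; [apply: mulr_le0; exact: ltW|lra].
- by rewrite nmulr_rgt0 // nmulr_rlt0.
- by rewrite q0 mulr0 mul0r ltxx.
- by rewrite nmulr_rgt0 // pmulr_rlt0.
- by rewrite !mulr_gt0 // addr_gt0.
- by rewrite q0 mulr0 mul0r ltxx addr0; apply/negbTE; rewrite -leNgt ltW.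
- by rewrite p0 !mul0r ltxx.
- by rewrite p0 !mul0r ltxx add0r; apply/negbTE; rewrite -leNgt ltW.
by rewrite p0 !mul0r ltxx.
Qed.

Lemma act2_wedge g u v : wedge (act2 g u) (act2 g v) = \det g * wedge u v.
Proof. by rewrite det_mx2 /wedge /act2 /=; ring. Qed.

Lemma act2M g h v : act2 (g *m h) v = act2 g (act2 h v).
Proof. by rewrite /act2 !mxE !sum_ord2 /=; congr pair; ring. Qed.

Lemma act2_1 v : act2 1%:M v = v.
Proof. by rewrite /act2 !mxE /= !mul1r !mul0r addr0 add0r -surjective_pairing. Qed.

Lemma act2_neq0 g v : \det g = 1 -> v != 0 -> act2 g v != 0.
Proof.
move=> dg; apply: contra => /eqP e.
have gu : g \in unitmx by rewrite unitmxE dg unitr1.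
by rewrite -[v]act2_1 -(mulVmx gu) act2M e /act2 /= !mulr0 addr0.
Qed.

Lemma moebius_circle_cpt g v : \det g = 1 -> v != 0 ->
  moebius_circle g (cpt v) = cpt (act2 g v).
Proof.
move=> dg v0; rewrite /cpt; have [e|n] := eqVneq v.2 0.
  have v1 : v.1 != 0 by apply: contra v0 => /eqP h; rewrite [v]surjective_pairing h e.
  rewrite /= e !mulr0 !addr0 mulf_eq0 (negPf v1) orbF.
  by case: ifP => // c0; congr Some; field; rewrite v1 c0.
rewrite /=; have -> : g 1 0 * (v.1 / v.2) + g 1 1 = (g 1 0 * v.1 + g 1 1 * v.2) / v.2 by field.
rewrite mulf_eq0 invr_eq0 (negPf n) orbF; case: ifP => // c0.
by congr Some; field; rewrite n c0.
Qed.

Lemma moebius_circleE g x : \det g = 1 -> moebius_circle g x = cpt (act2 g (clift x)).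
Proof. by move=> dg; rewrite -moebius_circle_cpt ?clift_neq0 // cliftK. Qed.

Lemma positively_oriented_moebius g x y z : \det g = 1 ->
  positively_oriented (moebius_circle g x) (moebius_circle g y) (moebius_circle g z) =
  positively_oriented x y z.
Proof.
move=> dg; rewrite !moebius_circleE // positively_orientedE ?act2_neq0 ?clift_neq0 //.
by rewrite !act2_wedge dg !mul1r -positively_orientedE ?clift_neq0 // !cliftK.
Qed.

Lemma moebius_circle_mul g h x : \det g = 1 -> \det h = 1 ->
  moebius_circle (g *m h) x = moebius_circle g (moebius_circle h x).
Proof.
move=> dg dh; rewrite [moebius_circle h x]moebius_circleE // moebius_circle_cpt ?act2_neq0 ?clift_neq0 //.
by rewrite moebius_circleE ?act2M // det_mulmx dg dh mulr1.
Qed.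

Lemma moebius_circle_psl g h x : psl_eq g h -> moebius_circle g x = moebius_circle h x.
Proof.
case=> -> //; case: x => [a|] /=; rewrite !mxE.
  rewrite mulNr -opprD oppr_eq0; case: ifP => // n; congr Some.
  by rewrite mulNr -opprD invrN mulrNN.
by rewrite oppr_eq0 invrN mulrNN.
Qed.

Lemma moebius_circle_dil (l a : R) : l != 0 -> moebius_circle (dil l) (Some a) = Some (l ^+ 2 * a).
Proof.
by move=> l0; rewrite /= !mx2E mul0r add0r invr_eq0 (negPf l0) addr0 invrK; congr Some; ring.
Qed.

Lemma moebius_circle_dil_fix (l : R) : l != 0 -> moebius_circle (dil l) None = None.
Proof. by rewrite /= !mx2E eqxx. Qed.

Lemma moebius_circle_trans (b a : R) : moebius_circle (trans b) (Some a) = Some (a + b).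
Proof. by rewrite /= !mx2E mul0r add0r oner_eq0 mul1r divr1. Qed.

Lemma moebius_circle_trans_fix (b : R) : moebius_circle (trans b) None = None.
Proof. by rewrite /= !mx2E eqxx. Qed.

Definition in_arc_pt (N : motion R) x :=
  match N, x with
  | Dil _, Some a => 0 < a
  | Trans _, Some _ => true
  | _, None => false
  end.

Lemma in_arc_cpt N v : in_arc N v -> in_arc_pt N (cpt v).
Proof.
case: N v => [l|b] [p q]; rewrite /cpt /=; last by move=> /negPf ->.
move=> pq; have q0 : q != 0 by apply: contraTneq pq => ->; rewrite mulr0 ltxx.
rewrite (negPf q0); have -> : p / q = (p * q) / q ^+ 2 by field.
by rewrite divr_gt0 // exprn_even_gt0.
Qed.

End Circle.

(** * Positive definite matrices and eigenvalues *)

Section LinearAlgebra.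
Variable R : realType.
Local Notation C := R[i].

Lemma conj_mxM m n p (A : 'M[C]_(m, n)) (B : 'M[C]_(n, p)) : conj_mx (A *m B) = conj_mx A *m conj_mx B.
Proof. exact: map_mxM. Qed.

Lemma conj_mxD m n (A B : 'M[C]_(m, n)) : conj_mx (A + B) = conj_mx A + conj_mx B.
Proof. exact: map_mxD. Qed.

Lemma conj_mxN m n (A : 'M[C]_(m, n)) : conj_mx (- A) = - conj_mx A.
Proof. exact: map_mxN. Qed.

Lemma conj_mxT m n (A : 'M[C]_(m, n)) : conj_mx A^T = (conj_mx A)^T.
Proof. by rewrite /conj_mx map_trmx. Qed.

Lemma conj_mxK m n (A : 'M[C]_(m, n)) : conj_mx (conj_mx A) = A.
Proof. by apply/matrixP => i j; rewrite !mxE conjcK. Qed.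

Lemma conj_complexify m n (A : 'M[R]_(m, n)) : conj_mx (complexify A) = complexify A.
Proof. by apply/matrixP => i j; rewrite !mxE conjc_real. Qed.

Lemma complexifyM m n p (A : 'M[R]_(m, n)) (B : 'M[R]_(n, p)) : complexify (A *m B) = complexify A *m complexify B.
Proof. exact: map_mxM. Qed.

Lemma complexifyT m n (A : 'M[R]_(m, n)) : complexify A^T = (complexify A)^T.
Proof. by rewrite /complexify map_trmx. Qed.

Lemma complexify_inj m n : injective (@complexify R m n).
Proof.
move=> A B /matrixP e; apply/matrixP => i j; apply: (@complexI R).
by have := e i j; rewrite !mxE.
Qed.

Lemma ltr0C (k : R) : (0 < k%:C%C) = (0 < k).
Proof. by rewrite -(ltcR 0 k). Qed.

Lemma real_mxP m n (A : 'M[C]_(m, n)) : conj_mx A = A -> exists B, A = complexify B.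
Proof.
move=> /matrixP e; exists (map_mx (@complex.Re R) A); apply/matrixP => i j; rewrite !mxE.
have := e i j; rewrite mxE; case: (A i j) => a b [/eqP]; rewrite eq_sym -addr_eq0 => /eqP h.
by congr (_ +i* _)%C; lra.
Qed.

Definition adj m n (A : 'M[C]_(m, n)) : 'M[C]_(n, m) := (conj_mx A)^T.

Lemma adjE m n (A : 'M[C]_(m, n)) : adj A = map_mx Num.conj A^T.
Proof. by apply/matrixP => i j; rewrite !mxE. Qed.

Lemma adjM m n p (A : 'M[C]_(m, n)) (B : 'M[C]_(n, p)) : adj (A *m B) = adj B *m adj A.
Proof. by rewrite /adj conj_mxM trmx_mul. Qed.

Lemma adjK m n (A : 'M[C]_(m, n)) : adj (adj A) = A.
Proof. by rewrite /adj conj_mxT trmxK conj_mxK. Qed.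

Lemma adjD m n (A B : 'M[C]_(m, n)) : adj (A + B) = adj A + adj B.
Proof. by rewrite /adj conj_mxD linearD. Qed.

Lemma adjN m n (A : 'M[C]_(m, n)) : adj (- A) = - adj A.
Proof. by rewrite /adj conj_mxN linearN. Qed.

Lemma adj_complexify m n (A : 'M[R]_(m, n)) : adj (complexify A) = complexify A^T.
Proof. by rewrite /adj conj_complexify complexifyT. Qed.

Lemma rV_neq0_ex (V : zmodType) n (v : 'rV[V]_n) : v != 0 -> exists j, v 0 j != 0.
Proof.
move=> v0; apply/existsP; apply: contraNT v0 => /existsPn h.
by apply/eqP/rowP => j; rewrite mxE; apply/eqP; have := h j; rewrite negbK.
Qed.

Definition cposdef n (Y : 'M[C]_n) := forall v : 'rV[C]_n, v != 0 -> 0 < (v *m Y *m adj v) 0 0.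

Lemma mulmx_adj_gt0 n (v : 'rV[C]_n) : v != 0 -> 0 < (v *m adj v) 0 0.
Proof.
move=> v0; rewrite mxE; have [j vj] := rV_neq0_ex v0.
have nn (i : 'I_n) : 0 <= v 0 i * adj v i 0 by rewrite !mxE mulcJ_ge0.
rewrite (bigD1 j) //= ltr_wpDr ?sumr_ge0 // lt_def nn andbT.
by rewrite !mxE mulf_neq0 // conjc_eq0.
Qed.

Lemma mulmx_tr_gt0 n (v : 'rV[R]_n) : v != 0 -> 0 < (v *m v^T) 0 0.
Proof.
move=> v0; rewrite mxE; have [j vj] := rV_neq0_ex v0.
rewrite (bigD1 j) //= ltr_wpDr ?sumr_ge0 //; first by move=> i _; rewrite mxE -expr2 sqr_ge0.
by rewrite mxE -expr2 exprn_even_gt0.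
Qed.

Lemma complexify_eq0 m n (A : 'M[R]_(m, n)) : (complexify A == 0) = (A == 0).
Proof. by rewrite /complexify map_mx_eq0. Qed.

Lemma rV_rect n (v : 'rV[C]_n) : exists x y : 'rV[R]_n, v = complexify x + 'i%C *: complexify y.
Proof.
exists (map_mx (@complex.Re R) v), (map_mx (@complex.Im R) v).
by apply/rowP => j; rewrite !mxE; exact: complexE.
Qed.

Lemma symmetric_cross n (Y : 'M[R]_n) (x y : 'rV[R]_n) : Y^T = Y ->
  (x *m Y *m y^T) 0 0 = (y *m Y *m x^T) 0 0.
Proof.
move=> sY; have -> : x *m Y *m y^T = (y *m Y *m x^T)^T by rewrite !trmx_mul trmxK sY mulmxA.
by rewrite mxE.
Qed.

Lemma complex_form n (Y : 'M[R]_n) (x y : 'rV[R]_n) : Y^T = Y ->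
  let v := complexify x + 'i%C *: complexify y in
  (v *m complexify Y *m adj v) 0 0 = ((x *m Y *m x^T) 0 0 + (y *m Y *m y^T) 0 0)%:C%C.
Proof.
move=> sY v.
have e (a b : 'rV[R]_n) : (complexify a *m complexify Y *m (complexify b)^T) 0 0 = ((a *m Y *m b^T) 0 0)%:C%C.
  by rewrite -complexifyT -!complexifyM mxE.
rewrite /v /adj conj_mxD conj_complexify.
have -> : conj_mx ('i%C *: complexify y) = - 'i%C *: complexify y.
  apply/rowP => j; rewrite !mxE; apply/eqP; rewrite eq_complex /=.
  by apply/andP; split; apply/eqP; ring.
rewrite linearD linearZ /= !mulmxDl !mulmxDr -!scalemxAl -!scalemxAr scalerA.
rewrite mxE [X in X + _]mxE [X in _ + X]mxE [X in _ + X + _]mxE [X in _ + (X + _)]mxE [X in _ + (_ + X)]mxE !e.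
rewrite (symmetric_cross y x sY) mulrN -expr2 sqr_i opprK mul1r rmorphD /=.
by move: (_%:C)%C (_%:C)%C ((y *m Y *m y^T) 0 0)%:C%C => p q r; ring.
Qed.

Lemma posdef_complexify n (Y : 'M[R]_n) : Y^T = Y -> posdef Y -> cposdef (complexify Y).
Proof.
move=> sY pY v; have [x [y ->]] := rV_rect v => v0; rewrite complex_form //.
have nn (z : 'rV[R]_n) : 0 <= (z *m Y *m z^T) 0 0.
  by have [->|/pY/ltW//] := eqVneq z 0; rewrite !mul0mx mxE.
rewrite ltr0C; have [x0|x0] := eqVneq x 0; last by rewrite ltr_pwDl ?pY.
have [y0|y0] := eqVneq y 0; last by rewrite ltr_wpDl ?pY.
by move: v0; rewrite x0 y0 /complexify !map_mx0 scaler0 addr0 eqxx.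
Qed.

Lemma complexify_posdef n (Y : 'M[R]_n) : cposdef (complexify Y) -> posdef Y.
Proof.
move=> pY v v0; have := pY (complexify v); rewrite complexify_eq0 => /(_ v0).
by rewrite adj_complexify -!complexifyM mxE ltr0C.
Qed.

Lemma hermitian_spectral n (Y : 'M[C]_n) : adj Y = Y -> cposdef Y ->
  exists (P : 'M[C]_n) (d : 'I_n -> R), [/\ P *m adj P = 1%:M, adj P *m P = 1%:M,
    forall i, 0 < d i & Y = adj P *m diag_mx (\row_i (d i)%:C%C) *m P].
Proof.
move=> hY pY; have hs : Y \is hermsymmx.
  by apply/is_hermitianmxP; rewrite expr0 scale1r -{1}hY adjE.
have := orthomx_spectralP (hermitian_normalmx hs) => /=.
have uP := spectral_unitarymx Y; rewrite (invmx_unitary uP) -map_trmx map_trmx -adjE.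
have PP : spectralmx Y *m adj (spectralmx Y) = 1%:M by rewrite adjE; exact/unitarymxP.
set P := spectralmx Y in uP PP *; set s := spectral_diag Y => YE.
have PP' : adj P *m P = 1%:M by exact: mulmx1C.
have sE i : s 0 i = (row i P *m Y *m adj (row i P)) 0 0.
  have -> : row i P *m Y *m adj (row i P) = row i (P *m Y *m adj P) *m delta_mx i 0.
    rewrite !row_mul -!mulmxA; congr (_ *m (_ *m _)); rewrite /adj /conj_mx.
    by apply/colP => j; rewrite !mxE (bigD1 i) //= !mxE !eqxx mulr1 big1 ?addr0 // => k /negPf ki; rewrite !mxE ki mulr0.
  rewrite YE !mulmxA PP mul1mx -mulmxA PP mulmx1 mxE (bigD1 i) //= !mxE !eqxx mulr1n mulr1.
  by rewrite big1 ?addr0 // => j /negPf ji; rewrite !mxE ji mulr0.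
have rP i : row i P != 0.
  apply/eqP => h; have : (P *m adj P) i i = 1 by rewrite PP mxE eqxx.
  have -> : (P *m adj P) i i = (row i P *m adj P) 0 i by rewrite -row_mul [RHS]mxE.
  by rewrite h mul0mx mxE => /eqP; rewrite eq_sym oner_eq0.
exists P, (fun i => complex.Re (s 0 i)); split; [exact: PP|exact: PP'| |].
  by move=> i; have := pY _ (rP i); rewrite -sE ltcE => /andP[_].
rewrite {1}YE; congr (_ *m diag_mx _ *m _); apply/rowP => i; rewrite mxE RRe_real //.
by apply: gtr0_real; rewrite sE; exact: pY.
Qed.

Lemma det_adj_unitary n (P : 'M[C]_n) : P *m adj P = 1%:M -> \det P * \det (adj P) = 1.
Proof. by move=> h; rewrite -det_mulmx h det1. Qed.

Lemma posdef_spectrum n (Y : 'M[R]_n) : Y^T = Y -> posdef Y ->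
  exists d : 'I_n -> R, (forall i, 0 < d i) /\ forall t : R, \det (Y + t%:M) = \prod_i (d i + t).
Proof.
move=> sY pY; have [|P [d [PP PP' d0 YE]]] := hermitian_spectral _ (posdef_complexify sY pY).
  by rewrite adj_complexify sY.
exists d; split=> // t; apply: (@complexI R).
rewrite -det_map_mx map_mxD /= -/(complexify Y) map_scalar_mx /= YE.
have -> : (t%:C%C)%:M = adj P *m (t%:C%C)%:M *m P :> 'M[C]_n by rewrite mul_mx_scalar -scalemxAl PP' scalemx1.
rewrite -mulmxDl -mulmxDr !det_mulmx mulrAC [X in X * _]mulrC det_adj_unitary // mul1r.
have -> : diag_mx (\row_i (d i)%:C%C) + (t%:C%C)%:M = diag_mx (\row_i (d i + t)%:C%C) :> 'M[C]_n.
  by apply/matrixP => i j; rewrite !mxE rmorphD /=; case: eqP => //= _; rewrite ?mulr1n ?mulr0n ?addr0.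
by rewrite det_diag rmorph_prod /=; apply: eq_bigr => i _; rewrite mxE.
Qed.

Lemma eigenvalue_unitmx n (B : 'M[C]_n) z : ~~ eigenvalue B z -> B - z%:M \in unitmx.
Proof. by rewrite /eigenvalue /eigenspace negbK kermx_eq0 row_free_unit. Qed.

(** By Cayley-Hamilton the characteristic polynomial of [A] kills [X] from the left. Moved to the
    right it becomes a product of invertible matrices B - z. *)
Lemma sylvester n (A B X : 'M[C]_n) : A *m X = X *m B ->
  (forall z, eigenvalue A z -> ~~ eigenvalue B z) -> X = 0.
Proof.
case: n A B X => [|n] A B X e dis; first by apply/matrixP => -[].
have [rs rsE] := closed_field_poly_normal (char_poly A).
rewrite (monicP (char_poly_monic A)) scale1r in rsE.
have shift z : (A - z%:M) *m X = X *m (B - z%:M).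
  by rewrite mulmxBl mulmxBr e mul_scalar_mx mul_mx_scalar.
have prodE s : (\prod_(z <- s) (A - z%:M)) *m X = X *m (\prod_(z <- s) (B - z%:M)).
  elim: s => [|z s IH]; first by rewrite !big_nil; exact: etrans (mul1mx X) (esym (mulmx1 X)).
  by rewrite !big_cons -!mulmxE -mulmxA IH mulmxA shift mulmxA.
have : (\prod_(z <- rs) (A - z%:M)) = 0.
  rewrite -[RHS](Cayley_Hamilton A) rsE rmorph_prod /=; apply: eq_bigr => z _.
  by rewrite rmorphB /= horner_mx_X horner_mx_C.
move=> h; have := prodE rs; rewrite h mul0mx => /esym XB.
have u : \prod_(z <- rs) (B - z%:M) \in unitmx.
  have sub z : z \in rs -> B - z%:M \in unitmx.
    move=> zr; apply: eigenvalue_unitmx; apply: dis; rewrite eigenvalue_root_char rsE.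
    by rewrite root_prod_XsubC.
  elim: rs sub {rsE h XB} => [|z s IH] sub; first by rewrite big_nil unitmx1.
  rewrite big_cons -mulmxE unitmx_mul sub ?mem_head // IH // => w ws.
  by apply: sub; rewrite inE ws orbT.
by rewrite -[X](mulmxK u) XB mul0mx.
Qed.

Lemma conjc_gt0 (z : C) : 0 < z -> 0 < z^*%C.
Proof. by case: z => a b; rewrite !ltcE /= => /andP[/eqP -> h]; rewrite oppr0 eqxx. Qed.

Lemma posdef_sqrt n (Y : 'M[R]_n) : Y^T = Y -> posdef Y ->
  exists D : 'M[R]_n, [/\ D^T = D, posdef D & D *m D = Y].
Proof.
move=> sY pY; have [|P [d [PP PP' d0 YE]]] := hermitian_spectral _ (posdef_complexify sY pY).
  by rewrite adj_complexify sY.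
pose S := diag_mx (\row_i (Num.sqrt (d i))%:C%C) : 'M[C]_n.
pose Z := adj P *m S *m P.
have ZZ : Z *m Z = complexify Y.
  rewrite /Z YE !mulmxA -[X in X *m S *m P]mulmxA PP mulmx1 -[X in X *m P]mulmxA mulmx_diag.
  congr (_ *m diag_mx _ *m _); apply/rowP => i; rewrite !mxE -rmorphM /= -expr2 sqr_sqrtr ?ltW //.
have aS : adj S = S.
  apply/matrixP => i j; rewrite !mxE.
  by rewrite [i == j]eq_sym !mulrb; case: eqVneq => [->|_]; rewrite ?conjc_real ?conjc0.
have aZ : adj Z = Z by rewrite /Z !adjM adjK aS mulmxA.
have pZ (v : 'rV[C]_n) : v != 0 -> 0 < (v *m Z *m adj v) 0 0.
  move=> v0; rewrite /Z -!mulmxA mulmxA -[v *m adj P]/(v *m adj P) -{2}[P]adjK -adjM.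
  set w := v *m adj P; have w0 : w != 0.
    by apply: contra v0 => /eqP h; rewrite -[v]mulmx1 -PP' mulmxA -/w h mul0mx.
  clearbody w; have [j wj] := rV_neq0_ex w0.
  have -> : (w *m (S *m adj w)) 0 0 = \sum_i (Num.sqrt (d i))%:C%C * (w 0 i * (w 0 i)^*%C).
    rewrite mxE; apply: eq_bigr => i _; rewrite mxE (bigD1 i) //= big1 ?addr0 => [|k /negPf ki].
      by rewrite !mxE eqxx mulr1n mulrCA mulrA.
    by rewrite !mxE eq_sym ki mulr0n mul0r.
  have nn (i : 'I_n) : 0 <= (Num.sqrt (d i))%:C%C * (w 0 i * (w 0 i)^*%C).
    by rewrite mulr_ge0 ?mulcJ_ge0 // ler0c sqrtr_ge0.
  rewrite (bigD1 j) //= ltr_wpDr ?sumr_ge0 // lt_def nn andbT !mulf_neq0 ?conjc_eq0 //.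
  by rewrite gt_eqF // ltr0C sqrtr_gt0.
clearbody Z.
have pos_eig (Q : 'M[C]_n) z : cposdef Q -> eigenvalue Q z -> 0 < z.
  move=> pQ /eigenvalueP[v vQ v0]; have := pQ v v0.
  by rewrite vQ -scalemxAl mxE pmulr_lgt0 // mulmx_adj_gt0.
have cZZ : conj_mx Z *m conj_mx Z = Z *m Z by rewrite -conj_mxM ZZ conj_complexify.
have pcZ : cposdef (conj_mx Z).
  move=> v v0; have cv0 : conj_mx v != 0.
    by apply: contra v0 => /eqP h; rewrite -[v]conj_mxK h /conj_mx map_mx0.
  have -> : v *m conj_mx Z *m adj v = conj_mx (conj_mx v *m Z *m adj (conj_mx v)).
    by rewrite !conj_mxM /adj conj_mxT !conj_mxK.
  by rewrite mxE; apply: conjc_gt0; exact: pZ.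
(* The spectral theorem only gives a complex root [Z]. As Z^2 is real, Z - conj Z intertwines [Z],
   with positive spectrum, and -conj Z, with negative spectrum, so it vanishes. *)
have Zr : conj_mx Z = Z.
  apply/esym/eqP; rewrite -subr_eq0; apply/eqP; apply: (@sylvester n Z (- conj_mx Z)).
    by rewrite mulmxBr mulmxN mulmxBl opprB cZZ.
  move=> z zZ; apply/negP => /eigenvalueP[v vQ v0].
  have : eigenvalue (conj_mx Z) (- z).
    by apply/eigenvalueP; exists v => //; rewrite scaleNr -vQ mulmxN opprK.
  move=> /(pos_eig _ _ pcZ); have := pos_eig _ _ pZ zZ.
  by move=> /ltW a /lt_le_trans b; have := b 0; rewrite oppr_le0 => /(_ a); rewrite ltxx.
have [D DE] := real_mxP Zr.
exists D; split.
- by apply: complexify_inj; rewrite -adj_complexify -DE aZ.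
- by apply: complexify_posdef; rewrite -DE.
- by apply: complexify_inj; rewrite complexifyM -DE.
Qed.

Lemma posdef_unitmx n (Y : 'M[R]_n) : posdef Y -> Y \in unitmx.
Proof.
move=> pY; rewrite -row_free_unit -kermx_eq0; apply/rowV0P => v /sub_kermxP vY.
by apply/eqP/negPn/negP => /pY; rewrite vY mul0mx mxE ltxx.
Qed.

Lemma posdef_congr n (Y A : 'M[R]_n) : A \in unitmx -> posdef Y -> posdef (A *m Y *m A^T).
Proof.
move=> Au pY v v0; have vA : v *m A != 0.
  by apply: contra v0 => /eqP h; rewrite -[v](mulmxK Au) h mul0mx.
by have := pY _ vA; rewrite trmx_mul !mulmxA.
Qed.

Lemma prod_gt1 n (d : 'I_n -> R) : (0 < n)%N -> (forall i, 0 < d i) -> 1 < \prod_i (d i + 1).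
Proof.
case: n d => // n d _ d0.
rewrite big_ord_recl; have p1 : 1 <= \prod_(i < n) (d (lift ord0 i) + 1).
  elim/big_ind : _ => // [x y x1 y1|i _]; first exact: mulr_ege1.
  by rewrite lerDr ltW.
have := d0 ord0; nra.
Qed.

(** With D^2 = Y one has Z = D (W + 1) D for a positive definite [W], and det (W + 1) > 1. *)
Lemma det_posdef_lt n (Y Z : 'M[R]_n) : (0 < n)%N -> Y^T = Y -> Z^T = Z -> posdef Y ->
  posdef (Z - Y) -> 0 < \det Y /\ \det Y < \det Z.
Proof.
move=> n0 sY sZ pY pZ.
have [D [sD pD DD]] := posdef_sqrt sY pY; have Du := posdef_unitmx pD.
have dD0 : \det D != 0 by rewrite -unitfE -unitmxE.
have dY : 0 < \det Y by rewrite -DD det_mulmx -expr2 exprn_even_gt0.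
split=> //.
have Diu : invmx D \in unitmx by rewrite unitmx_inv.
have sDi : (invmx D)^T = invmx D by rewrite trmx_inv sD.
pose W := invmx D *m (Z - Y) *m (invmx D)^T.
have pW : posdef W by exact: posdef_congr.
have sW : W^T = W by rewrite /W !trmx_mul trmxK linearB /= sY sZ mulmxA.
have [d [d0 dE]] := posdef_spectrum sW pW.
have ZE : Z = D *m (W + 1%:M) *m D.
  rewrite mulmxDr mulmxDl mulmx1 DD /W sDi !mulmxA mulmxV // mul1mx mulmxKV //.
  by rewrite subrK.
rewrite ZE !det_mulmx dE mulrAC -det_mulmx DD -[X in X < _]mulr1 ltr_pM2l //.
exact: prod_gt1.
Qed.

Lemma row_mx_neq0 (v : 'rV[C]_1) : (v == 0) = (v 0 0 == 0).
Proof.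
apply/eqP/eqP => [->|h]; first by rewrite mxE.
by apply/rowP => j; rewrite (ord1 j) h mxE.
Qed.

(** Completion of the square in the first variable. *)
Lemma schur_complement n (e : 'M[C]_1) (f : 'M[C]_(n, 1)) (E : 'M[C]_n) (t : 'rV[C]_1) (u : 'rV[C]_n) :
  e \in unitmx -> adj e = e -> let c := f *m invmx e in
  row_mx t u *m block_mx e (adj f) f E *m adj (row_mx t u) =
  (t + u *m c) *m e *m adj (t + u *m c) + u *m (E - c *m adj f) *m adj u.
Proof.
move=> eu ae c.
have ac : adj c = invmx e *m adj f.
  rewrite /c adjM; congr (_ *m _); rewrite -[RHS]mulmx1 -[X in _ = _ *m X](_ : e *m adj (invmx e) = 1%:M).
    by rewrite mulKmx.
  by rewrite -{1}ae -adjM mulVmx // /adj /conj_mx map_mx1 trmx1.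
have -> : adj (row_mx t u) = col_mx (adj t) (adj u) by rewrite /adj /conj_mx map_row_mx tr_row_mx.
rewrite mul_row_block mul_row_col adjD adjM ac mulmxDr !mulmxDl mulmxBr mulmxBl !mulmxA.
rewrite (mulmxKV eu) /c -!mulmxA (mulmxA e (invmx e)) mulmxV // mul1mx !mulmxA.
by rewrite -!addrA; congr (_ + (_ + (_ + _))); rewrite [RHS]addrC subrK.
Qed.

Lemma form1 (e : C) (s : 'rV[C]_1) : (s *m e%:M *m adj s) 0 0 = e * (s 0 0 * (s 0 0)^*%C).
Proof. by rewrite mul_mx_scalar -scalemxAl mxE mxE big_ord1 !mxE. Qed.

(** Induction on the size instead of the series for [E]: the corner satisfies e (1 - |mu|^2) > 0,
    and the Schur complement of the corner inherits the inequality with the smaller triangular block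
    of [B]. *)
Lemma trig_stein n (B E : 'M[C]_n) : is_trig_mx B -> (forall i, `|B i i| < 1) ->
  adj E = E -> cposdef (E - B *m E *m adj B) -> cposdef E.
Proof.
elim: n B E => [|n IH] B E tB dB aE pF v v0; first by rewrite thinmx0 eqxx in v0.
move: B E tB dB aE pF v v0; rewrite -[n.+1]/(1 + n)%N => B E tB dB aE pF v v0.
pose b := ulsubmx B; pose B1 := dlsubmx B; pose B2 := drsubmx B.
have BE : B = block_mx b 0 B1 B2.
  move: (tB); rewrite -{1}[B]submxK is_trig_block_mx // => /and3P[/eqP h _ _].
  by rewrite -[LHS]submxK h.
have tB2 : is_trig_mx B2 by move: (tB); rewrite BE is_trig_block_mx // => /and3P[].
have dB2 i : `|B2 i i| < 1 by have := dB (rshift 1 i); rewrite {1}BE block_mxEdr.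
pose e := ulsubmx E; pose f := dlsubmx E; pose E' := drsubmx E.
have EE : E = block_mx e (adj f) f E' /\ adj e = e /\ adj E' = E'.
  have : adj E = block_mx (adj e) (adj f) (adj (ursubmx E)) (adj E').
    by rewrite -{1}[E]submxK /adj /conj_mx map_block_mx tr_block_mx.
  rewrite aE -{1}[E]submxK => /eq_block_mx[h1 h2 h3 h4].
  by split; [rewrite -{1}[E]submxK h2|split].
have {EE}[EE [ae aE']] := EE.
pose e0 := e 0 0; have eS : e = e0%:M by exact: mx11_scalar.
pose mu := b 0 0; have bS : b = mu%:M by exact: mx11_scalar.
have mu1 : `|mu| < 1 by have := dB (lshift n 0); rewrite {1}BE block_mxEul.
have QF (w : 'rV[C]_(1 + n)) : (w *m (E - B *m E *m adj B) *m adj w) 0 0 =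
    (w *m E *m adj w) 0 0 - ((w *m B) *m E *m adj (w *m B)) 0 0.
  by rewrite mulmxBr mulmxBl mxE [X in _ + X]mxE adjM !mulmxA.
have e00 : 0 < e0.
  have n0 : row_mx 1%:M 0 != 0 :> 'rV[C]_(1 + n).
    by apply/eqP => /rowP/(_ (lshift n 0)); rewrite row_mxEl !mxE => /eqP; rewrite oner_eq0.
  have := pF _ n0; rewrite QF.
  have -> : row_mx 1%:M 0 *m B = mu *: row_mx 1%:M 0 :> 'rV[C]_(1 + n).
    by rewrite {1}BE mul_row_block !mul0mx !mul1mx !addr0 bS scale_row_mx scaler0 scalemx1.
  have -> : adj (mu *: row_mx 1%:M 0 : 'rV[C]_(1 + n)) = mu^*%C *: adj (row_mx 1%:M 0).
    by apply/matrixP => i j; rewrite !mxE rmorphM.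
  rewrite -!scalemxAl -scalemxAr !scalerA [X in _ - X]mxE.
  have -> : (row_mx 1%:M 0 *m E *m adj (row_mx 1%:M 0 : 'rV[C]_(1 + n))) 0 0 = e0.
    rewrite EE mul_row_block !mul0mx !mul1mx !addr0.
    have -> : adj (row_mx 1%:M 0 : 'rV[C]_(1 + n)) = col_mx 1%:M 0.
      by rewrite /adj /conj_mx map_row_mx tr_row_mx map_mx1 map_mx0 trmx1 trmx0.
    by rewrite mul_row_col mulmx1 mulmx0 addr0.
  rewrite -[X in X - _]mul1r -mulrBl.
  have mm : mu * mu^*%C = `|mu| ^+ 2 by rewrite -normCK.
  rewrite mm pmulr_rgt0 // subr_gt0 expr_lt1 ?normr_ge0 //.
have eu : e \in unitmx by rewrite eS unitmxE det_scalar1 unitfE gt_eqF.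
pose c := f *m invmx e; pose E2 := E' - c *m adj f.
have QE (t : 'rV[C]_1) (u : 'rV[C]_n) : (row_mx t u *m E *m adj (row_mx t u)) 0 0 =
    e0 * ((t + u *m c) 0 0 * ((t + u *m c) 0 0)^*%C) + (u *m E2 *m adj u) 0 0.
  by rewrite EE schur_complement // mxE {2}eS form1.
have nn (s : 'rV[C]_1) : 0 <= e0 * (s 0 0 * (s 0 0)^*%C) by rewrite mulr_ge0 ?mulcJ_ge0 // ltW.
have ae2 : adj E2 = E2.
  have aei : adj (invmx e) = invmx e.
    by rewrite /adj /conj_mx map_invmx trmx_inv -/(conj_mx e) -/(adj e) ae.
  by rewrite /E2 /c adjD adjN !adjM adjK aei aE' mulmxA.
have pE2 : cposdef E2.
  (* The vector (-w c, w) makes the square in [QE] vanish; for its image under [B] the square is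
     nonnegative and may be dropped. *)
  apply: (IH B2) => // w w0.
  have n0 : row_mx (- (w *m c)) w != 0.
    by apply: contra w0 => /eqP h; rewrite -[w](row_mxKr (- (w *m c))) h linear0.
  have z0 : (- (w *m c) + w *m c) 0 0 = 0 by rewrite addNr mxE.
  have vB : row_mx (- (w *m c)) w *m B = row_mx (- (w *m c) *m b + w *m B1) (w *m B2).
    by rewrite {1}BE mul_row_block mulmx0 add0r.
  have := pF _ n0; rewrite QF {1}QE z0 mul0r mulr0 add0r vB QE.
  move: (- (w *m c) *m b + w *m B1 + w *m B2 *m c) => s; rewrite subr_gt0 => h.
  rewrite adjM !mulmxA in h.
  rewrite mulmxBr mulmxBl mxE [X in _ + X]mxE subr_gt0 !mulmxA.
  by apply: le_lt_trans h; rewrite lerDr; exact: nn.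
rewrite -[v]hsubmxK QE.
have [u0|u0] := eqVneq (rsubmx v) 0; last by rewrite ltr_wpDl ?pE2.
have z1 : (0 : 'M[C]_1) 0 0 = 0 by rewrite mxE.
rewrite u0 !mul0mx addr0 z1 addr0 mulr_gt0 // lt_def mulcJ_ge0 andbT mulf_neq0 ?conjc_eq0 //.
all: rewrite -row_mx_neq0; apply: contra v0 => /eqP h; by rewrite -[v]hsubmxK h u0 row_mx0.
Qed.

(** A unitary change of basis makes [B] triangular, with its eigenvalues on the diagonal. *)
Lemma cposdef_stein n (B E : 'M[C]_n.+1) : adj E = E ->
  (forall a, eigenvalue B a -> `|a| < 1) -> cposdef (E - B *m E *m adj B) -> cposdef E.
Proof.
move=> aE eB cF.
have [P uP tP] := @Schur _ n.+1 B isT.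
have PP : P *m adj P = 1%:M by rewrite adjE; exact/unitarymxP.
have PP' : adj P *m P = 1%:M by exact: mulmx1C.
have PPk m (X : 'M[C]_(m, n.+1)) : X *m adj P *m P = X by rewrite -mulmxA PP' mulmx1.
move: tP; rewrite /similar_to conjymx // -map_trmx map_trmx -adjE => tP.
have adjP0 (w : 'rV[C]_n.+1) : w != 0 -> w *m P != 0.
  by apply: contra => /eqP h; rewrite -[w]mulmx1 -PP mulmxA h mul0mx.
have adjP0' (w : 'rV[C]_n.+1) : w != 0 -> w *m adj P != 0.
  by apply: contra => /eqP h; rewrite -[w]PPk h mul0mx.
have FE : P *m E *m adj P - (P *m B *m adj P) *m (P *m E *m adj P) *m adj (P *m B *m adj P) =
    P *m (E - B *m E *m adj B) *m adj P.
  rewrite [in RHS]mulmxBr [in RHS]mulmxBl; congr (_ - _).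
  by rewrite adjM adjM adjK !mulmxA !PPk.
have pE : cposdef (P *m E *m adj P).
  apply: (@trig_stein _ (P *m B *m adj P)).
  - exact: tP.
  - move=> i; apply: eB.
    have : eigenvalue (P *m B *m adj P) ((P *m B *m adj P) i i).
      rewrite eigenvalue_root_char char_poly_trig //.
      by rewrite /root horner_prod (bigD1 i) //= !hornerE subrr mul0r.
    move=> /eigenvalueP[v ve v0]; apply/eigenvalueP; exists (v *m P); last exact: adjP0.
    by rewrite scalemxAl -ve !mulmxA PPk.
  - by rewrite adjM adjM adjK aE mulmxA.
  move=> v v0; have := cF _ (adjP0 _ v0).
  by rewrite FE adjM !mulmxA.
move=> v v0; have := pE _ (adjP0' _ v0).
by rewrite adjM adjK !mulmxA !PPk.
Qed.

Lemma posdef_stein n (B E : 'M[R]_n) : E^T = E ->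
  (forall a, eigenvalue (complexify B) a -> `|a| < 1) ->
  posdef (E - B *m E *m B^T) -> posdef E.
Proof.
case: n B E => [|n] B E sE eB pF; first by move=> v; rewrite thinmx0 eqxx.
apply: complexify_posdef; apply: (@cposdef_stein _ (complexify B)) => //.
  by rewrite adj_complexify sE.
rewrite adj_complexify -!complexifyM.
have -> : complexify E - complexify (B *m E *m B^T) = complexify (E - B *m E *m B^T).
  by rewrite /complexify map_mxB.
by apply: posdef_complexify => //; rewrite linearB /= !trmx_mul trmxK sE mulmxA.
Qed.

End LinearAlgebra.

(** * The cyclic order on maximal triples of Lagrangians *)

Section Lagrangians.
Variables (R : realType) (n : nat).
Implicit Types (g h w : 'M[R]_(n + n)) (l : 'M[R]_(n + n)) (X Y Z : 'M[R]_n).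

Local Notation J := (symplectic_form n R).

Definition frame_oo : 'M[R]_(n, n + n) := row_mx 1%:M 0.
Definition frame X : 'M[R]_(n, n + n) := row_mx X^T 1%:M.

Lemma symplectic_formK : J *m J = - 1%:M.
Proof.
rewrite /symplectic_form mulmx_block !mul0mx !mulmx0 !mul1mx !mulmx1 !addr0 !add0r.
by rewrite (scalar_mx_block n n 1) opp_block_mx !oppr0.
Qed.

Lemma symplectic_unit g : symplectic g -> g \in unitmx.
Proof.
move=> sg; have : (- J *m g^T *m J) *m g = 1%:M.
  by rewrite -!mulmxA (mulmxA g^T) sg mulNmx symplectic_formK opprK.
by move=> /mulmx1_unit[].
Qed.

Lemma symplecticM g h : symplectic g -> symplectic h -> symplectic (g *m h).
Proof.
move=> sg sh; rewrite /symplectic /= trmx_mul -!mulmxA (mulmxA J) (mulmxA g^T) (mulmxA g^T) sg.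
by rewrite mulmxA.
Qed.

Lemma symplecticV g : symplectic g -> symplectic (invmx g).
Proof.
move=> sg; have gu := symplectic_unit sg; have gtu : g^T \in unitmx by rewrite unitmx_tr.
have := congr1 (fun x => invmx g^T *m x *m invmx g) sg.
rewrite /= -!mulmxA mulKmx // mulmxV // mulmx1 => e.
by rewrite /symplectic /= trmx_inv -mulmxA -e.
Qed.

Lemma symplectic_blockP (a b c d : 'M[R]_n) : symplectic (block_mx a b c d) <->
  [/\ a^T *m c = c^T *m a, b^T *m d = d^T *m b & a^T *m d - c^T *m b = 1%:M].
Proof.
have E : (block_mx a b c d)^T *m J *m block_mx a b c d =
   block_mx (a^T *m c - c^T *m a) (a^T *m d - c^T *m b) (b^T *m c - d^T *m a) (b^T *m d - d^T *m b).
  rewrite tr_block_mx /symplectic_form mulmx_block !mulmx0 !mulmx1 !mulmxN !mulmx1 !addr0 !add0r.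
  by rewrite mulmx_block !mulNmx; congr block_mx; rewrite addrC.
rewrite /symplectic /= E /symplectic_form; split.
  by move=> /eq_block_mx[/subr0_eq -> -> _ /subr0_eq ->].
move=> [e1 e2 e3]; rewrite e1 e2 e3 !subrr; congr block_mx.
by have := congr1 (fun x => - x^T) e3; rewrite /= linearB /= !trmx_mul !trmxK trmx1 opprB.
Qed.

Lemma frame_oo_act (a b c d : 'M[R]_n) : frame_oo *m (block_mx a b c d)^T = row_mx a^T c^T.
Proof. by rewrite tr_block_mx mul_row_block !mul0mx !mul1mx !addr0. Qed.

Lemma frame_act X (a b c d : 'M[R]_n) : frame X *m (block_mx a b c d)^T =
  row_mx (X^T *m a^T + b^T) (X^T *m c^T + d^T).
Proof. by rewrite tr_block_mx mul_row_block !mul1mx. Qed.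

Lemma frame_free X : row_free (frame X).
Proof.
apply/row_freeP; exists (col_mx 0 1%:M).
by rewrite mul_row_col mulmx0 mulmx1 add0r.
Qed.

Lemma frame_oo_free : row_free frame_oo.
Proof.
apply/row_freeP; exists (col_mx 1%:M 0).
by rewrite mul_row_col mulmx0 mulmx1 addr0.
Qed.

Lemma free_eqmx_unit m (F G : 'M[R]_(n, m)) : row_free F -> (F :=: G)%MS ->
  exists2 U, U \in unitmx & F = U *m G.
Proof.
move=> fF e; have /submxP[U UE] : (F <= G)%MS by rewrite e.
exists U => //; rewrite -row_free_unit /row_free; move: fF; rewrite /row_free {1}UE => /eqP rF.
by rewrite eqn_leq rank_leq_row /= -{1}rF mxrankM_maxl.
Qed.

Lemma unit_eqmx m (U : 'M[R]_n) (F : 'M[R]_(n, m)) : U \in unitmx -> (U *m F :=: F)%MS.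
Proof. by move=> Uu; apply: eqmxMfull; rewrite row_full_unit. Qed.

Lemma eqmx_act m1 m2 (F : 'M[R]_(m1, n + n)) (G : 'M[R]_(m2, n + n)) h :
  (F :=: G)%MS -> (F *m h^T :=: G *m h^T)%MS.
Proof. exact: eqmxMr. Qed.

Lemma eqmx_act_inj m1 m2 (F : 'M[R]_(m1, n + n)) (G : 'M[R]_(m2, n + n)) h : h \in unitmx ->
  (F *m h^T :=: G *m h^T)%MS -> (F :=: G)%MS.
Proof.
move=> hu e; have htu : h^T \in unitmx by rewrite unitmx_tr.
by rewrite -(mulmxK htu F) -(mulmxK htu G); exact: eqmxMr.
Qed.

Lemma frame_inj X Y : (frame X :=: frame Y)%MS -> X = Y.
Proof.
move=> /(free_eqmx_unit (frame_free X))[U _].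
rewrite /frame mul_mx_row mulmx1 => /eq_row_mx[e1 e2].
by apply: trmx_inj; rewrite e1 -e2 mul1mx.
Qed.

Lemma lag_actE h (F : 'M[R]_(n, n + n)) : (lag_act h <<F>>%MS :=: F *m h^T)%MS.
Proof. by rewrite /lag_act; apply: eqmxMr; exact: genmxE. Qed.

(** [maximal_triple] for row spaces of matrices with any number of rows, so that frames and square
    matrices can be mixed. *)
Definition mtriple m1 m2 m3 (l1 : 'M[R]_(m1, n + n)) (l2 : 'M[R]_(m2, n + n)) (l3 : 'M[R]_(m3, n + n)) :=
  exists2 g, symplectic g & [/\ (l1 :=: frame_oo *m g^T)%MS, (l2 :=: frame 0 *m g^T)%MS &
    (l3 :=: frame 1%:M *m g^T)%MS].

Lemma maximal_tripleE l1 l2 l3 : maximal_triple l1 l2 l3 <-> mtriple l1 l2 l3.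
Proof.
split=> -[g sg [e1 e2 e3]]; exists g => //; split.
- exact: eqmx_trans (eqmxP e1) (lag_actE _ _).
- exact: eqmx_trans (eqmxP e2) (lag_actE _ _).
- exact: eqmx_trans (eqmxP e3) (lag_actE _ _).
- by apply/eqmxP; apply: eqmx_trans e1 (eqmx_sym (lag_actE _ _)).
- by apply/eqmxP; apply: eqmx_trans e2 (eqmx_sym (lag_actE _ _)).
- by apply/eqmxP; apply: eqmx_trans e3 (eqmx_sym (lag_actE _ _)).
Qed.

(** Z |-> (1 - Z)^-1, which permutes oo, 0 and 1 cyclically. *)
Definition cycle_mx : 'M[R]_(n + n) := block_mx 0 1%:M (- 1%:M) 1%:M.

Lemma trmxN1 : (- 1%:M : 'M[R]_n)^T = - 1%:M.
Proof. by rewrite linearN /= trmx1. Qed.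

Lemma cycle_symplectic : symplectic cycle_mx.
Proof.
apply/symplectic_blockP; rewrite trmxN1 trmx0 trmx1; split.
- by rewrite mul0mx mulmx0.
- by [].
- by rewrite mul0mx mulNmx mul1mx sub0r opprK.
Qed.

Lemma cycle_oo : frame_oo *m cycle_mx^T = - frame 0.
Proof. by rewrite frame_oo_act /frame !trmx0 trmxN1 opp_row_mx oppr0. Qed.

Lemma cycle_0 : frame 0 *m cycle_mx^T = frame 1%:M.
Proof. by rewrite frame_act /frame !trmx0 trmx1 !mul0mx !add0r. Qed.

Lemma cycle_1 : frame 1%:M *m cycle_mx^T = frame_oo.
Proof. by rewrite frame_act /frame_oo trmxN1 !trmx0 !trmx1 mulmx0 !mul1mx addNr add0r. Qed.

Lemma symplectic_upper w : symplectic w -> (frame_oo *m w^T :=: frame_oo)%MS ->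
  exists a b, [/\ a \in unitmx, w = block_mx a b 0 (invmx a)^T & (b *m a^T)^T = b *m a^T].
Proof.
rewrite -[w]submxK; move: (ulsubmx w) (ursubmx w) (dlsubmx w) (drsubmx w) => a b c d.
rewrite symplectic_blockP frame_oo_act => sw e.
have /submxP[U] : (row_mx a^T c^T <= frame_oo)%MS by rewrite e.
rewrite mul_mx_row mulmx0 => /eq_row_mx[_ c0].
have {}c0 : c = 0 by apply: trmx_inj; rewrite c0 trmx0.
move: sw; rewrite c0 trmx0 !mul0mx subr0 => -[_ e2 e3].
exists a, b.
have [u1 u2] := mulmx1_unit e3; have au : a \in unitmx by rewrite -unitmx_tr.
have dE : d = (invmx a)^T by rewrite trmx_inv -[LHS](mulKmx u1) e3 mulmx1.
split=> //; first by rewrite -dE.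
rewrite trmx_mul trmxK; have := e2; rewrite dE trmxK => e4.
by rewrite -[LHS]mulmx1 -[X in _ *m X](mulVmx u1) -trmx_inv mulmxA -[X in X *m _](mulmxA) e4 !mulmxA mulmxV // mul1mx.
Qed.

Lemma upper_frame X (a b : 'M[R]_n) : a \in unitmx -> (b *m a^T)^T = b *m a^T -> X^T = X ->
  (frame X *m (block_mx a b 0 (invmx a)^T)^T :=: frame (a *m X *m a^T + b *m a^T))%MS /\
  (a *m X *m a^T + b *m a^T)^T = a *m X *m a^T + b *m a^T.
Proof.
move=> au sb sX; have aiu : invmx a \in unitmx by rewrite unitmx_inv.
have s : (a *m X *m a^T + b *m a^T)^T = a *m X *m a^T + b *m a^T.
  by rewrite linearD /= sb !trmx_mul trmxK sX mulmxA.
split=> //; rewrite frame_act trmx0 mulmx0 add0r trmxK.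
have -> : row_mx (X^T *m a^T + b^T) (invmx a) = invmx a *m frame (a *m X *m a^T + b *m a^T).
  rewrite /frame mul_mx_row mulmx1 s mulmxDr !mulmxA mulVmx // mul1mx sX; congr (row_mx (_ + _) _).
  by rewrite -mulmxA -sb trmx_mul trmxK mulmxA mulVmx // mul1mx.
exact: unit_eqmx.
Qed.

Section Triples.
Variables m1 m2 m3 : nat.
Variables (l1 : 'M[R]_(m1, n + n)) (l2 : 'M[R]_(m2, n + n)) (l3 : 'M[R]_(m3, n + n)).

Lemma mtriple_cycle : mtriple l1 l2 l3 -> mtriple l2 l3 l1.
Proof.
move=> [g sg [e1 e2 e3]]; exists (g *m cycle_mx); first exact: symplecticM cycle_symplectic.
rewrite trmx_mul !mulmxA cycle_oo cycle_0 cycle_1; split=> //.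
by rewrite mulNmx; apply: eqmx_trans e2 (eqmx_sym (eqmx_opp _)).
Qed.

(** In a chart with the first Lagrangian at oo, maximality is the order X < Y of symmetric matrices.
    A square root of Y - X gives the symplectic map that fixes oo and sends 0 and 1 to [X] and
    [Y]. *)
Lemma mtriple_of_lt h X Y : symplectic h -> X^T = X -> Y^T = Y -> posdef (Y - X) ->
  (l1 :=: frame_oo *m h^T)%MS -> (l2 :=: frame X *m h^T)%MS -> (l3 :=: frame Y *m h^T)%MS ->
  mtriple l1 l2 l3.
Proof.
move=> sh sX sY pYX e1 e2 e3.
have sYX : (Y - X)^T = Y - X by rewrite linearB /= sX sY.
have [D [sD pD DD]] := posdef_sqrt sYX pYX; have Du := posdef_unitmx pD.
pose w := block_mx D (X *m invmx D) 0 (invmx D)^T.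
have bD : X *m invmx D *m D^T = X by rewrite sD mulmxKV.
have sb : (X *m invmx D *m D^T)^T = X *m invmx D *m D^T by rewrite bD.
have sw : symplectic w.
  apply/symplectic_blockP; rewrite trmx0 mulmx0 !mul0mx subr0; split=> //.
    by rewrite trmxK trmx_mul trmx_inv sX sD mulmxA.
  by rewrite -trmx_mul mulVmx // trmx1.
exists (h *m w); first exact: symplecticM.
rewrite trmx_mul !mulmxA; split.
- apply: (eqmx_trans e1); apply/eqmx_act; rewrite frame_oo_act trmx0.
  have -> : row_mx D^T 0 = D *m frame_oo by rewrite mul_mx_row mulmx1 mulmx0 sD.
  by apply/eqmx_sym/unit_eqmx.
- apply: (eqmx_trans e2); apply/eqmx_act; apply: eqmx_sym.
  have [] := @upper_frame 0 D (X *m invmx D) Du sb (trmx0 _ _ _).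
  by rewrite mulmx0 mul0mx add0r bD.
apply: (eqmx_trans e3); apply/eqmx_act; apply: eqmx_sym.
have [] := @upper_frame 1%:M D (X *m invmx D) Du sb (trmx1 _ _).
by rewrite mulmx1 bD sD DD subrK.
Qed.

Lemma lt_of_mtriple h : symplectic h -> mtriple l1 l2 l3 -> (l1 :=: frame_oo *m h^T)%MS ->
  exists X Y, [/\ X^T = X, Y^T = Y, posdef (Y - X),
    (l2 :=: frame X *m h^T)%MS & (l3 :=: frame Y *m h^T)%MS].
Proof.
move=> sh [g sg [e1 e2 e3]] e1'.
have hu := symplectic_unit sh; have htu : h^T \in unitmx by rewrite unitmx_tr.
pose w := invmx h *m g; have gE : g = h *m w by rewrite /w mulKVmx.
have sw : symplectic w by apply: symplecticM => //; exact: symplecticV.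
have : (frame_oo *m w^T :=: frame_oo)%MS.
  apply: (eqmx_act_inj hu); rewrite -mulmxA -trmx_mul -gE.
  exact: eqmx_trans (eqmx_sym e1) e1'.
move=> /(symplectic_upper sw)[a [b [au wE sb]]].
have [f0 s0] := @upper_frame 0 a b au sb (trmx0 _ _ _).
have [f1 s1] := @upper_frame 1%:M a b au sb (trmx1 _ _).
exists (a *m 0 *m a^T + b *m a^T), (a *m 1%:M *m a^T + b *m a^T); split=> //.
- rewrite mulmx0 mul0mx add0r addrK; apply: posdef_congr => // v v0.
  by rewrite mulmx1; exact: mulmx_tr_gt0.
- by apply: (eqmx_trans e2); rewrite gE trmx_mul mulmxA wE; exact: eqmx_act.
by apply: (eqmx_trans e3); rewrite gE trmx_mul mulmxA wE; exact: eqmx_act.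
Qed.

End Triples.

Lemma posdefD X Y : posdef X -> posdef Y -> posdef (X + Y).
Proof. by move=> pX pY v v0; rewrite mulmxDr mulmxDl mxE addr_gt0 ?pX ?pY. Qed.

Lemma mulmx_tr_ge0 (v : 'rV[R]_n) : 0 <= (v *m v^T) 0 0.
Proof. by have [->|/mulmx_tr_gt0/ltW//] := eqVneq v 0; rewrite mul0mx mxE. Qed.

Section Order.
Variables m1 m2 m3 m4 : nat.
Variables (l1 : 'M[R]_(m1, n + n)) (l2 : 'M[R]_(m2, n + n)) (l3 : 'M[R]_(m3, n + n)) (l4 : 'M[R]_(m4, n + n)).

Lemma mtriple_trans : mtriple l1 l2 l3 -> mtriple l1 l3 l4 -> mtriple l1 l2 l4.
Proof.
move=> t1 t2; have [h sh [e1 e2 e3]] := t1.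
have hu := symplectic_unit sh.
have [X [Y [sX sY p e2' e3']]] := lt_of_mtriple sh t1 e1.
have [X' [Z [sX' sZ p' e3'' e4]]] := lt_of_mtriple sh t2 e1.
have XY : Y = X'.
  by apply: frame_inj; apply: (eqmx_act_inj hu); exact: eqmx_trans (eqmx_sym e3') e3''.
apply: (mtriple_of_lt sh sX sZ _ e1 e2' e4).
have -> : Z - X = (Z - X') + (Y - X) by rewrite XY addrA subrK.
exact: posdefD.
Qed.

(** In the chart where the first three Lagrangians are oo, 0 and 1, the fourth is some Z > 1.
    Turning the chart by [cycle_mx] puts the last three at oo, 0 and W = 1 - Z^-1, and W > 0 because
    Z W Z = (Z - 1) + (Z - 1)^2. *)
Lemma mtriple_tail : mtriple l1 l2 l3 -> mtriple l1 l3 l4 -> mtriple l2 l3 l4.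
Proof.
move=> [g sg [e1 e2 e3]] t2; have gu := symplectic_unit sg.
have [X [Z [sX sZ p e3' e4]]] := lt_of_mtriple sg t2 e1.
have X1 : X = 1%:M.
  by apply: frame_inj; apply: (eqmx_act_inj gu); exact: eqmx_trans (eqmx_sym e3') e3.
rewrite X1 in p.
have pZ : posdef Z.
  rewrite -[Z](subrK 1%:M); apply: posdefD => // v v0.
  by rewrite mulmx1; exact: mulmx_tr_gt0.
have Zu := posdef_unitmx pZ.
have sZi : (invmx Z)^T = invmx Z by rewrite trmx_inv sZ.
pose W := 1%:M - invmx Z.
have sW : W^T = W by rewrite linearB /= trmx1 sZi.
have pW : posdef (W - 0).
  rewrite subr0; have -> : W = invmx Z *m (Z - 1%:M + (Z - 1%:M) *m (Z - 1%:M)^T) *m (invmx Z)^T.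
    have -> : Z - 1%:M + (Z - 1%:M) *m (Z - 1%:M)^T = (Z - 1%:M) *m Z.
      by rewrite linearB /= trmx1 sZ [X in _ + X]mulmxBr mulmx1 [LHS]addrC subrK.
    rewrite sZi.
    by rewrite mulmxA mulmxK // mulmxBr mulmx1 mulVmx.
  apply: posdef_congr; first by rewrite unitmx_inv.
  move=> v v0; rewrite mulmxDr mulmxDl mxE addrC ltr_wpDl ?p //.
  have -> (Q : 'M[R]_n) : v *m (Q *m Q^T) *m v^T = (v *m Q) *m (v *m Q)^T.
    by rewrite trmx_mul !mulmxA.
  exact: mulmx_tr_ge0.
have sh : symplectic (g *m cycle_mx) by apply: symplecticM => //; exact: cycle_symplectic.
apply: (mtriple_of_lt sh (trmx0 _ _ _) sW pW); rewrite trmx_mul !mulmxA.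
- by rewrite cycle_oo mulNmx; apply: eqmx_trans e2 (eqmx_sym (eqmx_opp _)).
- by rewrite cycle_0.
apply: (eqmx_trans e4); apply: eqmx_act; apply: eqmx_sym.
have -> : frame W *m cycle_mx^T = invmx Z *m frame Z.
  rewrite frame_act /frame mul_mx_row mulmx1 sZ mulVmx // trmxN1 !trmx0 !trmx1 mulmx0 add0r.
  by rewrite mulmxN mulmx1 sW /W opprB subrK.
by apply: unit_eqmx; rewrite unitmx_inv.
Qed.

End Order.
End Lagrangians.

(** * Shilov hyperbolic elements *)

Section Shilov.
Variables (R : realType) (n : nat).
Local Notation C := R[i].
Local Notation J := (symplectic_form n R).

Lemma eigenvalueE (A : 'M[C]_n) a : eigenvalue A a = (A - a%:M \notin unitmx).
Proof. by rewrite /eigenvalue /eigenspace kermx_eq0 row_free_unit. Qed.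

Lemma eigenvalue_tr (A : 'M[C]_n) a : eigenvalue A^T a = eigenvalue A a.
Proof. by rewrite !eigenvalueE -[in RHS]unitmx_tr linearB /= tr_scalar_mx. Qed.

Lemma eigenvalue_invmx (A : 'M[C]_n) a : A \in unitmx -> eigenvalue (invmx A) a ->
  a != 0 /\ eigenvalue A a^-1.
Proof.
move=> Au /eigenvalueP[v vA v0].
have vE : v = a *: (v *m A) by rewrite scalemxAl -vA mulmxKV.
have a0 : a != 0 by apply: contra v0 => /eqP a0; rewrite vE a0 scale0r.
by split=> //; apply/eigenvalueP; exists v => //; rewrite [in RHS]vE scalerA mulVf // scale1r.
Qed.

Definition diag_sp (A : 'M[R]_n) : 'M[R]_(n + n) := block_mx A 0 0 (invmx A)^T.

Definition expanding (A : 'M[R]_n) := forall a : C, eigenvalue (complexify A) a -> 1 < `|a|.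

Lemma complexify_unit (A : 'M[R]_n) : (complexify A \in unitmx) = (A \in unitmx).
Proof. by rewrite /complexify map_unitmx. Qed.

Lemma complexify_inv (A : 'M[R]_n) : complexify (invmx A) = invmx (complexify A).
Proof. by rewrite /complexify map_invmx. Qed.

Lemma expanding_unit (A : 'M[R]_n) : expanding A -> A \in unitmx.
Proof.
move=> eA; rewrite -complexify_unit; apply: contraT => nu.
have /eA : eigenvalue (complexify A) 0 by rewrite eigenvalueE raddf0 subr0.
by rewrite normr0 ltr10.
Qed.

Lemma expanding_tr (A : 'M[R]_n) : expanding A -> expanding A^T.
Proof. by move=> eA a; rewrite complexifyT eigenvalue_tr; exact: eA. Qed.

Lemma contracting_inv (A : 'M[R]_n) a : expanding A -> eigenvalue (complexify (invmx A)) a -> `|a| < 1.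
Proof.
move=> eA; rewrite complexify_inv => /eigenvalue_invmx[|a0 /eA].
  by rewrite complexify_unit expanding_unit.
by rewrite normfV invf_gt1 // normr_gt0.
Qed.

Lemma expanding_inv (A : 'M[R]_n) : A \in unitmx ->
  (forall a : C, eigenvalue (complexify A) a -> `|a| < 1) -> expanding (invmx A).
Proof.
move=> Au cA a; rewrite complexify_inv => /eigenvalue_invmx[|a0 /cA].
  by rewrite complexify_unit.
by rewrite normfV invf_lt1 // normr_gt0.
Qed.

(** The unit circle separates the two spectra. *)
Lemma sylvester_expanding (A B X : 'M[R]_n) : expanding A -> expanding B ->
  A *m X = X *m (invmx B)^T -> X = 0.
Proof.
move=> eA eB e; apply/eqP; rewrite -complexify_eq0; apply/eqP.
apply: (@sylvester _ _ (complexify A) (complexify (invmx B)^T)); first by rewrite -!complexifyM e.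
move=> z /eA z1; apply/negP; rewrite complexifyT eigenvalue_tr => /(contracting_inv eB) z2.
by have := lt_trans z1 z2; rewrite ltxx.
Qed.


Lemma sylvester_expandingV (A B X : 'M[R]_n) : expanding A -> expanding B ->
  (invmx A)^T *m X = X *m B -> X = 0.
Proof.
move=> eA eB e; apply: trmx_inj; rewrite trmx0.
apply: (@sylvester_expanding B^T A^T); try exact: expanding_tr.
by rewrite -trmx_mul -e trmx_mul trmxK trmx_inv trmxK.
Qed.

(** The change between two diagonalizing frames intertwines expanding and contracting blocks off the
    diagonal; those blocks vanish, so it preserves both Lagrangians. *)
Lemma shilov_unique g h0 A0 h1 A1 : shilov_data g h0 A0 -> shilov_data g h1 A1 ->
  (frame_oo R n *m h1^T :=: frame_oo R n *m h0^T)%MS /\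
  (frame (0 : 'M[R]_n) *m h1^T :=: frame (0 : 'M[R]_n) *m h0^T)%MS.
Proof.
move=> [s0 e0 x0] [s1 e1 x1].
have u0 := symplectic_unit s0; have u1 := symplectic_unit s1.
pose K := invmx h0 *m h1; have hE : h1 = h0 *m K by rewrite /K mulKVmx.
have Ku : K \in unitmx by rewrite unitmx_mul unitmx_inv u0.
have : diag_sp A0 *m K = K *m diag_sp A1.
  have := congr1 (fun x => invmx h0 *m x *m h1) e0; rewrite {1}e1 !mulmxA mulmxKV // mulVmx // mul1mx.
  by rewrite -!mulmxA -/K => <-.
clearbody K; rewrite hE trmx_mul !mulmxA; move: Ku; rewrite -[K]submxK.
move: (ulsubmx K) (ursubmx K) (dlsubmx K) (drsubmx K) => a b c d Ku.
rewrite /diag_sp !mulmx_block !mul0mx !mulmx0 !addr0 !add0r => /eq_block_mx[ea eb ec ed].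
have b0 : b = 0 by exact: (sylvester_expanding x0 x1).
have c0 : c = 0 by exact: (sylvester_expandingV x0 x1).
move: Ku; rewrite b0 c0 unitmxE det_ublock unitrM -!unitmxE => /andP[au du].
split; apply/eqmx_act; rewrite ?frame_oo_act ?frame_act /= !trmx0 ?mul0mx ?add0r.
  have -> : row_mx a^T 0 = a^T *m frame_oo R n by rewrite mul_mx_row mulmx1 mulmx0.
  by apply: unit_eqmx; rewrite unitmx_tr.
have -> : row_mx 0 d^T = d^T *m frame 0 by rewrite mul_mx_row mulmx1 trmx0 mulmx0.
by apply: unit_eqmx; rewrite unitmx_tr.
Qed.

Lemma form_symplectic : symplectic J.
Proof.
apply/symplectic_blockP; rewrite !trmx0 trmxN1 !mul0mx !mulmx0; split=> //.
by rewrite mulNmx mul1mx sub0r opprK.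
Qed.

Lemma form_oo : frame_oo R n *m J^T = - frame 0.
Proof. by rewrite frame_oo_act /frame !trmx0 linearN /= trmx1 opp_row_mx oppr0. Qed.

Lemma form_0 : frame (0 : 'M[R]_n) *m J^T = frame_oo R n.
Proof. by rewrite frame_act /frame_oo !trmx0 !trmx1 !mul0mx add0r add0r. Qed.

Lemma diag_spV A : A \in unitmx -> diag_sp A *m diag_sp (invmx A) = 1%:M.
Proof.
move=> Au; rewrite /diag_sp mulmx_block !mul0mx !mulmx0 !addr0 !add0r mulmxV // invmxK.
by rewrite -trmx_mul mulmxV // trmx1 -scalar_mx_block.
Qed.

(** [J] exchanges the Lagrangians 0 and oo, and inversion exchanges attraction and repulsion. *)
Lemma shilov_flip g h A : shilov_data g h A -> shilov_data (invmx g) (h *m J) A^T.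
Proof.
move=> [sh gE eA]; have hu := symplectic_unit sh; have Au := expanding_unit eA.
have Ju := symplectic_unit form_symplectic.
split; [exact: symplecticM form_symplectic| |exact: expanding_tr].
have e : diag_sp (invmx A) *m J = J *m diag_sp A^T.
  rewrite /diag_sp /symplectic_form !mulmx_block !mul0mx !mulmx0 !addr0 !add0r !mulmx1 !mul1mx.
  by rewrite !mulmxN !mulNmx mulmx1 mul1mx invmxK trmx_inv trmxK.
have DK : h *m diag_sp (invmx A) *m invmx h *m g = 1%:M.

  rewrite gE -/(diag_sp A) !mulmxA mulmxKV // -[X in X *m invmx h](mulmxA h) (mulmx1C (diag_spV Au)).
  by rewrite mulmx1 mulmxV.
have gu : g \in unitmx by have [] := mulmx1_unit DK.
rewrite -[LHS]mul1mx -DK mulmxK //.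
have -> : invmx (h *m J) = invmx J *m invmx h.
  have hJu : h *m J \in unitmx by rewrite unitmx_mul hu.
  apply: (can_inj (mulKmx hJu)); rewrite mulmxV // mulmxA mulmxK // mulmxV //.
by rewrite -/(diag_sp A^T) !mulmxA -[X in X *m invmx J](mulmxA h) -e !mulmxA mulmxK.
Qed.

Lemma shilov_conj (g k h : 'M[R]_(n + n)) A : symplectic k -> shilov_data g h A ->
  shilov_data (k *m g *m invmx k) (k *m h) A.
Proof.
move=> sk [sh gE eA]; have hu := symplectic_unit sh; have ku := symplectic_unit sk.
split=> //; first exact: symplecticM.
have -> : invmx (k *m h) = invmx h *m invmx k.
  have hJu : k *m h \in unitmx by rewrite unitmx_mul hu ku.
  apply: (can_inj (mulKmx hJu)); rewrite mulmxV // mulmxA mulmxK // mulmxV //.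
by rewrite gE !mulmxA.
Qed.

(* In a parabolic fixed point the limit map only bounds the spectrum of B by 1;
   Shilov hyperbolicity excludes the unit circle, and makes the fixed
   Lagrangian frame_oo the repulsive one. *)
Lemma shilov_upper w h1 A1 (b c : 'M[R]_n) : w = block_mx b c 0 (invmx b)^T -> b \in unitmx ->
  shilov_data w h1 A1 -> (forall a : C, eigenvalue (complexify b) a -> `|a| <= 1) ->
  (forall a : C, eigenvalue (complexify b) a -> `|a| < 1) /\
  (frame 0 *m h1^T :=: frame_oo R n)%MS /\
  exists X, (frame_oo R n *m h1^T :=: frame X)%MS.
Proof.
move=> wE bu [s1 e1 x1] le1.
have u1 := symplectic_unit s1; have u1t : h1^T \in unitmx by rewrite unitmx_tr.
have Au := expanding_unit x1.
have lt1 (a : C) : eigenvalue (complexify b) a -> `|a| < 1.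
  (* An eigenvector of [b] for a on the unit circle would give one for the block diagonal matrix of
     [A1] and its inverse transpose, which has no eigenvalue there. *)
  move=> ea; rewrite lt_neqAle le1 // andbT; apply/negP => /eqP a1.
  have a0 : a != 0 by rewrite -normr_eq0 a1 oner_eq0.
  move: ea; rewrite -eigenvalue_tr => /eigenvalueP[u ub u0].
  pose x := row_mx u 0 *m invmx (complexify h1)^T.
  have cu1 : (complexify h1)^T \in unitmx by rewrite unitmx_tr /complexify map_unitmx.
  have x0 : x != 0.
    apply: contra u0 => /eqP x0; have : row_mx u 0 = 0 :> 'rV_(n + n) by rewrite -[LHS](mulmxKV cu1) -/x x0 mul0mx.
    by rewrite -[RHS](@row_mx0 _ 1 n n) => /eq_row_mx[-> _].
  have xw : x *m (complexify (diag_sp A1))^T = a *: x.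
    have : row_mx u 0 *m (complexify w)^T = a *: row_mx u 0.
      rewrite wE /complexify map_block_mx tr_block_mx mul_row_block !mul0mx !addr0 raddf0 trmx0 mulmx0.
      by rewrite -/(complexify b) ub scale_row_mx scaler0.
    rewrite /x scalemxAl => <-; rewrite e1 -/(diag_sp A1) !complexifyM !trmx_mul !mulmxA.
    have -> : (complexify (invmx h1))^T = invmx (complexify h1)^T.
      by rewrite /complexify map_invmx trmx_inv.
    by rewrite mulmxK.
  move: x0 xw; rewrite -[x]hsubmxK; move: (lsubmx x) (rsubmx x) => y z x0.
  have -> : (complexify (diag_sp A1))^T = block_mx (complexify A1)^T 0 0 (complexify (invmx A1)).
    by rewrite -complexifyT /diag_sp tr_block_mx !trmx0 trmxK /complexify map_block_mx !map_mx0 map_trmx.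
  rewrite mul_row_block !mulmx0 !addr0 !add0r scale_row_mx => /eq_row_mx[ey ez].
  have [y0|y0] := eqVneq y 0; last first.
    have : eigenvalue (complexify A1) a by rewrite -eigenvalue_tr; apply/eigenvalueP; exists y.
    by move/x1; rewrite a1 ltxx.
  have [z0|z0] := eqVneq z 0; first by move: x0; rewrite y0 z0 row_mx0 eqxx.
  have : eigenvalue (complexify (invmx A1)) a.
    by apply/eigenvalueP; exists z => //; rewrite -ez.
  by move/(contracting_inv x1); rewrite a1 ltxx.
split=> //.
have : w *m h1 = h1 *m diag_sp A1 by rewrite e1 mulmxKV.
rewrite wE; move: (u1); rewrite -[h1]submxK.
move: (ulsubmx h1) (ursubmx h1) (dlsubmx h1) (drsubmx h1) => p q r d uh.
rewrite /diag_sp !mulmx_block !mul0mx !mulmx0 !addr0 !add0r => /eq_block_mx[_ _ _ ed].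
(* [d] intertwines the expanding inverse transpose of [b] with the contracting one of [A1]. Its
   vanishing means that [h1] maps the Lagrangian 0 to oo. *)
have d0 : d = 0.
  exact: (sylvester_expanding (expanding_tr (expanding_inv bu lt1)) x1 ed).
move: uh; rewrite d0; set K := block_mx p q r 0 => Ku.
have : K *m J \in unitmx by rewrite unitmx_mul Ku symplectic_unit //; exact: form_symplectic.
rewrite /K /symplectic_form mulmx_block !mulmx0 !mulmxN !mulmx1 !addr0 !add0r oppr0 unitmxE det_ublock unitrM -!unitmxE.
move=> /andP[qu ru]; have {}qu : q \in unitmx by rewrite -[q]opprK -scaleN1r unitmxZ ?unitrN1.
rewrite frame_act frame_oo_act !trmx0 !mul0mx !add0r; split.
  have -> : row_mx q^T 0 = q^T *m frame_oo R n by rewrite mul_mx_row mulmx1 mulmx0.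
  by apply: unit_eqmx; rewrite unitmx_tr.
exists (p *m invmx r).
have -> : row_mx p^T r^T = r^T *m frame (p *m invmx r).
  by rewrite mul_mx_row mulmx1 trmx_mul mulmxA -trmx_mul mulVmx // trmx1 mul1mx.
by apply: unit_eqmx; rewrite unitmx_tr.
Qed.

End Shilov.

(** * Limit maps at fixed points *)

Section LimitMap.
Variables (R : realType) (n : nat).
Local Notation C := R[i].
Variable f : boundary_circle R -> 'M[R]_(n + n).
Hypothesis f_pos : forall x y z, positively_oriented x y z -> mtriple (f x) (f y) (f z).

Lemma limit_chart h : symplectic h -> (f None :=: frame_oo R n *m h^T)%MS ->
  exists Y : R -> 'M[R]_n, [/\ forall t, (Y t)^T = Y t,
    forall t, (f (Some t) :=: frame (Y t) *m h^T)%MS &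
    forall s t, s < t -> posdef (Y t - Y s)].
Proof.
move=> sh e; have hu := symplectic_unit sh.
have tri s t : s < t -> exists X Y : 'M[R]_n, [/\ X^T = X, Y^T = Y, posdef (Y - X),
    (f (Some s) :=: frame X *m h^T)%MS & (f (Some t) :=: frame Y *m h^T)%MS].
  by move=> st; apply: lt_of_mtriple e => //; apply: f_pos; rewrite /positively_oriented /= st.
have /choice[Y hY] : forall t, exists Yt : 'M[R]_n, Yt^T = Yt /\ (f (Some t) :=: frame Yt *m h^T)%MS.
  by move=> t; have [|X [_ [sX _ _ eX _]]] := tri t (t + 1); [rewrite ltrDl|exists X].
exists Y; split=> [t|t|s t st]; [by have [] := hY t|by have [] := hY t|].
have [X [X' [sX sX' p eX eX']]] := tri s t st.
have -> : Y t = X'.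
  by apply: frame_inj; apply: (eqmx_act_inj hu); apply: eqmx_trans eX'; apply/eqmx_sym; have [] := hY t.
have -> // : Y s = X.
by apply: frame_inj; apply: (eqmx_act_inj hu); apply: eqmx_trans eX; apply/eqmx_sym; have [] := hY s.
Qed.

Lemma fixed_upper g h : symplectic g -> symplectic h -> (f None :=: frame_oo R n *m h^T)%MS ->
  (f None :=: f None *m g^T)%MS ->
  exists a b, [/\ a \in unitmx, g = h *m block_mx a b 0 (invmx a)^T *m invmx h,
    (b *m a^T)^T = b *m a^T &
    forall m1 (l : 'M[R]_(m1, n + n)) (X X' : 'M[R]_n), X^T = X -> (l :=: frame X *m h^T)%MS -> (l *m g^T :=: frame X' *m h^T)%MS ->
      X' = a *m X *m a^T + b *m a^T].
Proof.
move=> sg sh e fx; have hu := symplectic_unit sh.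
pose w := invmx h *m g *m h.
have gE : g = h *m w *m invmx h by rewrite /w !mulmxA mulmxV // mul1mx mulmxK.
have hw : h *m w = g *m h by rewrite gE mulmxKV.
have sw : symplectic w by apply: symplecticM => //; apply: symplecticM => //; exact: symplecticV.
have : (frame_oo R n *m w^T :=: frame_oo R n)%MS.
  apply: (eqmx_act_inj hu); rewrite -mulmxA -trmx_mul hw trmx_mul mulmxA.
  exact: eqmx_trans (eqmxMr _ (eqmx_sym e)) (eqmx_trans (eqmx_sym fx) e).
move=> /(symplectic_upper sw)[a [b [au wE sb]]]; exists a, b; split=> //; first by rewrite -wE.
move=> m1 l X X' sX eX eX'; have [e1 _] := upper_frame au sb sX.
apply: frame_inj; apply: (eqmx_act_inj hu); apply: eqmx_trans (eqmx_sym eX') _.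
apply: (eqmx_trans (eqmx_act g eX)); rewrite -mulmxA -trmx_mul -hw trmx_mul mulmxA.
by rewrite wE; exact: eqmx_act.
Qed.

(* The Lagrangian at oo of the frame h is the attractive one; it is a value of the
   limit map only for a dilation. *)
Definition limit_datum N h :=
  (f (cpt (rep_pt N)) :=: frame 0 *m h^T)%MS /\
  forall x, in_arc_pt N x -> mtriple (f (cpt (rep_pt N))) (f x) (frame_oo R n *m h^T).

(** The hypothesis says |v A| > |v| for every nonzero row [v]; it is evaluated on an eigenvector. *)
Lemma expanding_of_lt (A : 'M[R]_n) : posdef (A *m A^T - 1%:M) -> expanding A.
Proof.
move=> p a /eigenvalueP[v vA v0].
have s : (A *m A^T - 1%:M)^T = A *m A^T - 1%:M by rewrite linearB /= trmx1 trmx_mul trmxK.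
have := posdef_complexify s p v0.
have -> : complexify (A *m A^T - 1%:M) = complexify A *m adj (complexify A) - 1%:M.
  rewrite adj_complexify -complexifyM /complexify map_mxB; congr (_ - _); exact: map_mx1.
have -> : v *m (complexify A *m adj (complexify A) - 1%:M) *m adj v = (v *m complexify A) *m adj (v *m complexify A) - v *m adj v.
  by rewrite mulmxBr mulmxBl mulmx1 adjM !mulmxA.
have -> : (v *m complexify A) *m adj (v *m complexify A) = (a * a^*%C) *: (v *m adj v).
  rewrite vA /adj -scalemxAl; have -> : conj_mx (a *: v) = a^*%C *: conj_mx v.
    by apply/matrixP => i j; rewrite !mxE rmorphM.
  by rewrite linearZ /= -scalemxAr scalerA.
rewrite mxE [X in _ + X]mxE mxE -[X in _ - X]mul1r -mulrBl pmulr_lgt0; last exact: mulmx_adj_gt0.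
have -> : a * a^*%C = `|a| ^+ 2 by rewrite sqr_normc.
by rewrite subr_gt0 expr_gt1 // ?normr_ge0.
Qed.

(** In the chart with the limit map equal to oo, 0 and 1 at oo, 0 and 1, g acts as Y |-> a Y a^T, so
    the value at l^2 > 1 is a a^T. Monotonicity gives a a^T > 1, whence [a] is expanding. *)
Lemma limit_datum_dil g l : 1 < l -> symplectic g ->
  (forall x, (f (moebius_circle (dil l) x) :=: f x *m g^T)%MS) ->
  exists h A, shilov_data g h A /\ limit_datum (Dil l) h.
Proof.
move=> l1 sg fg; have l0 : l != 0 by rewrite gt_eqF // (lt_trans ltr01).
have [h sh [e0 e1 e2]] : mtriple (f None) (f (Some 0)) (f (Some 1)).
  by apply: f_pos; rewrite /positively_oriented /= ltr01.
have hu := symplectic_unit sh.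
have fx : (f None :=: f None *m g^T)%MS by have := fg None; rewrite moebius_circle_dil_fix.
have [a [b [au gE sb act]]] := fixed_upper sg sh e0 fx.
have ba0 : b *m a^T = 0.
  have /= := act _ _ 0 0 (trmx0 _ _ _) e1; rewrite mulmx0 mul0mx add0r => -> //.
  by have := fg (Some 0); rewrite moebius_circle_dil // mulr0 => /eqmx_sym h0; exact: eqmx_trans h0 e1.
have b0 : b = 0 by rewrite -[b](@mulmxK _ _ _ a^T) ?unitmx_tr // ba0 mul0mx.
have [Y [sY eY pY]] := limit_chart sh e0.
have Y1 : Y 1 = 1%:M.
  by apply: frame_inj; apply: (eqmx_act_inj hu); exact: eqmx_trans (eqmx_sym (eY 1)) e2.
have Yl : Y (l ^+ 2) = a *m a^T.
  rewrite (act _ (f (Some 1)) 1%:M (Y (l ^+ 2))) ?trmx1 // ?ba0 ?addr0 ?mulmx1 //.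
  by apply: eqmx_trans (eY _); have := fg (Some 1); rewrite moebius_circle_dil // mulr1 => /eqmx_sym.
exists h, a; split.
  split=> //; first by rewrite gE b0.
  by apply: expanding_of_lt; rewrite -Yl -Y1; apply: pY; rewrite expr_gt1 // ltW // (lt_trans ltr01).
rewrite /limit_datum /= /cpt /= oner_eq0 mul0r; split=> // -[x|//] x0.
have [k sk [k0 k1 k2]] : mtriple (f (Some 0)) (f (Some x)) (f None).
  by apply: f_pos; rewrite /positively_oriented /= x0.
by exists k => //; split=> //; exact: eqmx_trans (eqmx_sym e0) k2.
Qed.

Hypothesis f_rcont : Defs.right_continuous f.

(** Points [t] near minus infinity follow oo in the positive direction, so right continuity applies
    at oo: a frame U (Y t, 1) is close to (1, 0), that is, [U] and E = U Y - 1 are small.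
    Semidefiniteness of -Y t on p + T p U then makes the form of [Y t] at [p] very negative. *)
Lemma limit_escape h (Y : R -> 'M[R]_n) (p : 'rV[R]_n) (M : R) : symplectic h ->
  (f None :=: frame_oo R n *m h^T)%MS -> (forall t, (f (Some t) :=: frame (Y t) *m h^T)%MS) ->
  (forall t, (Y t)^T = Y t) -> (forall t, t < 0 -> posdef (- Y t)) -> 0 <= M -> p != 0 ->
  exists2 t0 : R, t0 <= 0 & forall t : R, t < t0 -> (p *m Y t *m p^T) 0 0 < - M.
Proof.
move=> sh e eY sY pY M0 p0; have hu := symplectic_unit sh.
have htu : h^T \in unitmx by rewrite unitmx_tr.
pose c := (p *m p^T) 0 0; have c0 : 0 < c by exact: mulmx_tr_gt0.
pose s : R := \sum_i `|p 0 i|; have s0 : 0 <= s by apply: sumr_ge0.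
(* [T] makes the main term 2 T c equal to 2 (M + 1); [K] collects the coefficients of the errors,
   which are linear in the size [d] of [E] and [U], so that they stay below 1. [S] converts
   closeness of frames into closeness in the chart [h]. *)
pose T := (M + 1) / c; have T0 : 0 <= T by rewrite divr_ge0 ?addr_ge0 ?(ltW c0).
pose K : R := s ^+ 2 * (2 * T + T ^+ 2 * (1 + n%:R)).
have T2 : 0 <= T ^+ 2 by exact: sqr_ge0.
have K0 : 0 <= K by rewrite mulr_ge0 ?sqr_ge0 // addr_ge0 // mulr_ge0 // addr_ge0.
pose d := (1 + K)^-1; have d0 : 0 < d by rewrite invr_gt0 ltr_pwDl.
have d1 : d <= 1 by rewrite invf_le1 ?lerDl // ltr_pwDl.
have dK : d * K < 1 by rewrite mulrC ltr_pdivrMr ?ltr_pwDl // mul1r ltrDr.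
pose S : R := \sum_k \sum_j `|invmx h^T k j|.
have S0 : 0 <= S by apply: sumr_ge0 => i _; apply: sumr_ge0.
have dS0 : 0 < d / (1 + S) by rewrite divr_gt0 // ltr_pwDl.
have [|y yN near] := f_rcont (x := None) (F := frame_oo R n *m h^T) _ dS0.
  exact/eqmxP/eqmx_sym.
case: y yN near => [t0|//] _ near; exists (Num.min t0 0); first by rewrite ge_min lexx orbT.
move=> t; rewrite lt_min => /andP[tt0 tn].
have [|F' /eqmxP eF nF] := near (Some t); first by rewrite /positively_oriented /= tt0.
have /submxP[U UE] : (F' <= frame (Y t) *m h^T)%MS by rewrite eF eY.
pose E := U *m Y t - 1%:M.
have small : forall i j, `|(row_mx E U) i j| <= d.
  move=> i j; have -> : row_mx E U = (F' - frame_oo R n *m h^T) *m invmx h^T.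
    rewrite mulmxBl mulmxK // UE mulmxA mulmxK // /frame mul_mx_row mulmx1 sY.
    by rewrite /frame_oo opp_row_mx add_row_mx oppr0 addr0.
  rewrite mxE; apply: le_trans (ler_norm_sum _ _ _) _.
  apply: (@le_trans _ _ (\sum_k d / (1 + S) * \sum_j `|invmx h^T k j|)).
    apply: ler_sum => k _; rewrite normrM; apply: ler_pM => //.
      by rewrite mxE [X in _ + X]mxE; exact/ltW/nF.
    by rewrite (bigD1 j) //= lerDl; apply: sumr_ge0.
  rewrite -mulr_sumr -/S -mulrA ler_piMr ?ltW // mulrC ltr_pdivrMr ?ltr_pwDl // mul1r ltrDr.
  exact: ltr01.
have sE i j : `|E i j| <= d by have := small i (lshift n j); rewrite row_mxEl.
have sU i j : `|U i j| <= d by have := small i (rshift n j); rewrite row_mxEr.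
have row (Q : 'M[R]_n) : (forall i j, `|Q i j| <= d) -> forall j, `|(p *m Q) 0 j| <= d * s.
  move=> sQ j; rewrite mxE; apply: le_trans (ler_norm_sum _ _ _) _; rewrite mulr_sumr.
  by apply: ler_sum => i _; rewrite normrM mulrC ler_wpM2r.
have form (Q : 'M[R]_n) : (forall i j, `|Q i j| <= d) -> `|(p *m Q *m p^T) 0 0| <= d * s ^+ 2.
  move=> sQ; rewrite mxE; apply: le_trans (ler_norm_sum _ _ _) _; rewrite expr2 mulrA mulr_sumr.
  by apply: ler_sum => i _; rewrite normrM [p^T i 0]mxE ler_wpM2r // row.
have form2 : `|(p *m E *m (p *m U)^T) 0 0| <= n%:R * (d * s ^+ 2).
  rewrite mxE; apply: le_trans (ler_norm_sum _ _ _) _.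
  rewrite mulr_natl -[X in _ *+ X]card_ord -sumr_const; apply: ler_sum => i _.
  rewrite normrM [(p *m U)^T i 0]mxE; apply: (le_trans (ler_pM _ _ (row _ sE i) (row _ sU i))) => //.
  have -> : d * s * (d * s) = d * (d * s ^+ 2) by ring.
  by rewrite ler_piMl // mulr_ge0 ?sqr_ge0 ?(ltW d0).
pose x := p *m U.
have xY : x *m Y t = p + p *m E by rewrite /x /E mulmxBr mulmx1 mulmxA addrC subrK.
rewrite ltNge; apply/negP => leM.
have nn : 0 <= ((p + T *: x) *m (- Y t) *m (p + T *: x)^T) 0 0.
  by have [->|/(pY _ tn)/ltW//] := eqVneq (p + T *: x) 0; rewrite !mul0mx mxE.
have EE : ((p + T *: x) *m (- Y t) *m (p + T *: x)^T) 0 0 =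
  - (p *m Y t *m p^T) 0 0 - 2 * T * (c + (p *m E *m p^T) 0 0) - T ^+ 2 * ((p *m U *m p^T) 0 0 + (p *m E *m x^T) 0 0).
  have e1 : (p *m Y t *m x^T) 0 0 = (x *m Y t *m p^T) 0 0 by exact: symmetric_cross.
  have e2 : (p *m x^T) 0 0 = (x *m p^T) 0 0.
    by rewrite -[p *m x^T]trmxK trmx_mul trmxK mxE.
  have e3 : (x *m Y t *m p^T) 0 0 = c + (p *m E *m p^T) 0 0 by rewrite xY mulmxDl mxE.
  have e4 : (x *m Y t *m x^T) 0 0 = (x *m p^T) 0 0 + (p *m E *m x^T) 0 0.
    by rewrite xY mulmxDl mxE e2.
  rewrite mulmxN mulNmx mxE -/x -e4 -e3 linearD linearZ /= !mulmxDl !mulmxDr -!scalemxAl -!scalemxAr.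
  have mD (P Q : 'M[R]_1) : (P + Q) 0 0 = P 0 0 + Q 0 0 by rewrite mxE.
  have mZ a (P : 'M[R]_1) : (a *: P) 0 0 = a * P 0 0 by rewrite mxE.
  by rewrite !mD !mZ e1; ring.
move: nn; rewrite EE; apply/negP; rewrite -ltNge.
have b1 := form _ sE; have b2 := form _ sU.
have Tc : T * c = M + 1 by rewrite divfK // gt_eqF.
move: b1 b2 form2; rewrite !ler_norml => /andP[b1 _] /andP[b2 _] /andP[b3 _].
have h1 := ler_wpM2l T0 b1.
have h2 := ler_wpM2l T2 (lerD b2 b3).
move: dK; rewrite /K => dK; lra.
Qed.

(** For an eigenvector with r = |a|^2 > 1 the form phi satisfies phi (Y (t + b)) = r phi (Y t) + phi
    1. Followed backwards from Y 0 = 0, this recursion is contracting and stays bounded, contrary to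
    [limit_escape]. *)
Lemma limit_contracting h (Y : R -> 'M[R]_n) (B : 'M[R]_n) b : symplectic h ->
  (f None :=: frame_oo R n *m h^T)%MS -> (forall t, (f (Some t) :=: frame (Y t) *m h^T)%MS) ->
  (forall t, (Y t)^T = Y t) -> (forall t, t < 0 -> posdef (- Y t)) -> 0 < b -> Y 0 = 0 ->
  (forall t, Y (t + b) = B *m Y t *m B^T + 1%:M) ->
  forall a : C, eigenvalue (complexify B) a -> `|a| <= 1.
Proof.
move=> sh e eY sY pY b0 Y0 rY a /eigenvalueP[v vB v0].
rewrite real_leNgt ?ger0_real //; apply/negP => a1.
have [p [q vE]] := rV_rect v.
pose phi (Q : 'M[R]_n) := (p *m Q *m p^T) 0 0 + (q *m Q *m q^T) 0 0.
have phiE Q : Q^T = Q -> (v *m complexify Q *m adj v) 0 0 = (phi Q)%:C%C.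
  by move=> sQ; rewrite vE; exact: complex_form.
pose r := complex.Re a ^+ 2 + complex.Im a ^+ 2.
have rE : a * a^*%C = r%:C%C by rewrite /r; case: (a) => x y; simpc; congr (_ +i* _)%C; ring.
have r1 : 1 < r.
  have : 1 < `|a| ^+ 2 by rewrite expr_gt1 // ?normr_ge0.
  by rewrite sqr_normc rE ltcR.
have phiD P Q : phi (P + Q) = phi P + phi Q.
  have mE (E F : 'M[R]_1) : (E + F) 0 0 = E 0 0 + F 0 0 by rewrite mxE.
  by rewrite /phi !mulmxDr !mulmxDl !mE addrACA.
have step t : phi (Y (t + b)) = r * phi (Y t) + phi 1%:M.
  have s1 : (B *m Y t *m B^T)^T = B *m Y t *m B^T by rewrite !trmx_mul trmxK sY mulmxA.
  rewrite rY phiD; congr (_ + _).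
  apply: (@complexI R); rewrite -[LHS]phiE // !complexifyM -adj_complexify !mulmxA vB.
  have -> : a *: v *m complexify (Y t) *m adj (complexify B) *m adj v = (a * a^*%C) *: (v *m complexify (Y t) *m adj v).
    rewrite -[_ *m adj (complexify B) *m _]mulmxA -adjM vB -!scalemxAl.
    have -> : adj (a *: v) = a^*%C *: adj v.
      by apply/matrixP => i j; rewrite !mxE rmorphM.
    by rewrite -scalemxAr scalerA.
  by rewrite mxE phiE // rE rmorphM.
have phi0 : phi 0 = 0 by rewrite /phi !mulmx0 !mul0mx mxE addr0.
have nn (z : 'rV[R]_n) : 0 <= (z *m 1%:M *m z^T) 0 0 by rewrite mulmx1; exact: mulmx_tr_ge0.
have phi1 : 0 <= phi 1%:M by rewrite addr_ge0.
(* -L is the fixed point of the recursion. *)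
pose L := phi 1%:M / (r - 1); have r10 : 0 < r - 1 by rewrite subr_gt0.
have L0 : 0 <= L by rewrite divr_ge0 // ltW.
have LE : L * (r - 1) = phi 1%:M by rewrite divfK // gt_eqF.
have low (k : nat) : - L <= phi (Y (- (b *+ k))).
  elim: k => [|k IH]; first by rewrite mulr0n oppr0 Y0 phi0 oppr_le0.
  have := step (- (b *+ k.+1)); rewrite mulrS opprD [- b + _]addrC subrK => E.
  have r0 : 0 < r by lra.
  rewrite -(ler_pM2l r0); rewrite E in IH; nra.
have np t (z : 'rV[R]_n) : t < 0 -> (z *m Y t *m z^T) 0 0 <= 0.
  move=> /pY pt; rewrite -oppr_ge0; have -> : - (z *m Y t *m z^T) 0 0 = (z *m (- Y t) *m z^T) 0 0.
    by rewrite mulmxN mulNmx [RHS]mxE.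
  by have [->|/pt/ltW//] := eqVneq z 0; rewrite !mul0mx mxE.
(* [limit_escape] concerns real vectors: a nonzero one among the real and imaginary parts of [v]
   serves, as the form of [Y t] is nonpositive on the other. *)
have [z [z0 zE]] : exists z : 'rV[R]_n, z != 0 /\ forall t, t < 0 -> phi (Y t) <= (z *m Y t *m z^T) 0 0.
  have [p0|p0] := eqVneq p 0.
    exists q; split; last by move=> t /np h0; rewrite /phi gerDr.
    by apply: contra v0 => /eqP q0; rewrite vE p0 q0 /complexify !map_mx0 scaler0 addr0.
  by exists p; split=> // t /np h0; rewrite /phi gerDl.
have [t0 t00 esc] := limit_escape sh e eY sY pY L0 z0.
have [k kt] : exists k : nat, - (b *+ k) < t0.
  exists (Num.truncn (- t0 / b)).+1; rewrite ltrNl -mulr_natl -ltr_pdivrMr //.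
  by exact: truncnS_gt.
have := esc _ kt; rewrite ltNge => /negP; apply.
by apply: (le_trans (low k)); apply: zE; exact: lt_le_trans kt t00.
Qed.

(** In the chart with the limit map equal to oo, 0 and 1 at oo, 0 and b, g acts as Y |-> B Y B^T +
    1. The spectrum of [B] lies inside the unit circle, so oo is repulsive and the attractive
    Lagrangian is a matrix [X], which has to be shown larger than all [Y t]. *)
Lemma limit_datum_trans g b h1 A1 : 0 < b -> symplectic g ->
  (forall x, (f (moebius_circle (trans b) x) :=: f x *m g^T)%MS) -> shilov_data g h1 A1 ->
  limit_datum (Trans b) h1.
Proof.
move=> b0 sg fg d1; have [s1 g1 x1] := d1.
have [h sh [e0 e1 e2]] : mtriple (f None) (f (Some 0)) (f (Some b)).
  by apply: f_pos; rewrite /positively_oriented /= b0.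
have hu := symplectic_unit sh.
have fx : (f None :=: f None *m g^T)%MS by have := fg None; rewrite moebius_circle_trans_fix.
have [B [c [Bu gE sB act]]] := fixed_upper sg sh e0 fx.
have [Y [sY eY pY]] := limit_chart sh e0.
have uniq t X : (f (Some t) :=: frame X *m h^T)%MS -> Y t = X.
  by move=> eX; apply: frame_inj; apply: (eqmx_act_inj hu); exact: eqmx_trans (eqmx_sym (eY t)) eX.
have Y0 := uniq _ _ e1; have Yb := uniq _ _ e2.
have actY t : Y (t + b) = B *m Y t *m B^T + c *m B^T.
  apply: (act _ (f (Some t))) => //.
  by apply: eqmx_trans (eY (t + b)); have := fg (Some t); rewrite moebius_circle_trans => /eqmx_sym.
have cB : c *m B^T = 1%:M by have := actY 0; rewrite add0r Yb Y0 mulmx0 mul0mx add0r.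
have rY t : Y (t + b) = B *m Y t *m B^T + 1%:M by rewrite actY cB.
have le1 : forall a : C, eigenvalue (complexify B) a -> `|a| <= 1.
  apply: (limit_contracting sh e0 eY sY _ b0 Y0 rY) => t t0.
  by have := pY _ _ t0; rewrite Y0 sub0r.
have dw : shilov_data (block_mx B c 0 (invmx B)^T) (invmx h *m h1) A1.
  have := shilov_conj (symplecticV sh) d1; rewrite invmxK gE !mulmxA mulVmx // mul1mx mulmxKV //.
have [lt1 [E0 [X EX]]] := shilov_upper erefl Bu dw le1.
have hE : h1 = h *m (invmx h *m h1) by rewrite mulKVmx.
have e10 : (f None :=: frame 0 *m h1^T)%MS.
  rewrite hE trmx_mul mulmxA; apply: (eqmx_trans e0); apply/eqmx_sym; exact: eqmxMr.
have e1oo : (frame_oo R n *m h1^T :=: frame X *m h^T)%MS.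
  by rewrite hE trmx_mul mulmxA; exact: eqmxMr.
(* As an image of oo under a symplectic matrix the Lagrangian is isotropic, which for a graph means
   that its matrix is symmetric. *)
have sX : X^T = X.
  have [k [sk]] : exists k, symplectic k /\ (frame X :=: frame_oo R n *m k^T)%MS.
    by exists (invmx h *m h1); split; [exact: symplecticM (symplecticV sh) s1|exact: eqmx_sym].
  rewrite -[k]submxK in sk *; move: (ulsubmx k) (ursubmx k) (dlsubmx k) (drsubmx k) sk => p q r s sk.
  rewrite frame_oo_act => /(free_eqmx_unit (frame_free _))[U Uu].
  rewrite /frame mul_mx_row => /eq_row_mx[eX e1'].
  move: sk => /symplectic_blockP[epr _ _].
  have rE : r = (invmx U)^T by apply: trmx_inj; rewrite trmxK -[LHS](mulKmx Uu) -e1' mulmx1.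
  have pE : p = X *m (invmx U)^T.
    by apply: trmx_inj; rewrite trmx_mul trmxK eX mulKmx.
  have iUu : (invmx U)^T \in unitmx by rewrite unitmx_tr unitmx_inv.
  move: epr; rewrite rE pE trmx_mul !trmxK -!mulmxA => /(congr1 (fun z => U *m z)).
  rewrite !mulmxA mulmxV // !mul1mx => /(congr1 (fun z => z *m invmx (invmx U)^T)).
  by rewrite !mulmxK.
have XE : X = B *m X *m B^T + 1%:M.
  rewrite -cB; apply: (act _ (frame_oo R n *m h1^T)) => //; last first.
    rewrite -mulmxA -trmx_mul.
    have -> : g *m h1 = h1 *m block_mx A1 0 0 (invmx A1)^T by rewrite g1 mulmxKV // symplectic_unit.
    rewrite trmx_mul mulmxA frame_oo_act trmx0.
    have -> : row_mx A1^T 0 = A1^T *m frame_oo R n by rewrite mul_mx_row mulmx1 mulmx0.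
    have A1u : A1^T \in unitmx by rewrite unitmx_tr (expanding_unit x1).
    by rewrite -mulmxA; exact: eqmx_trans (unit_eqmx _ A1u) e1oo.
rewrite /limit_datum /= /cpt /= eqxx; split=> // -[t|//] _.
apply: (mtriple_of_lt sh (sY t) sX _ e0 (eY t) e1oo).
(* Subtracting the equations for [X] and for Y (t + b) turns the Stein expression of X - Y t into Y
   (t + b) - Y t, which is positive by monotonicity. *)
apply: (@posdef_stein _ _ B) => //; first by rewrite linearB /= sX sY.
have -> : X - Y t - B *m (X - Y t) *m B^T = Y (t + b) - Y t.
  by rewrite rY {1}XE mulmxBr mulmxBl opprB addrA; apply/matrixP => i j; rewrite !mxE; ring.
by apply: pY; rewrite ltrDl.
Qed.

End LimitMap.

(** * Cyclic order of the fixed Lagrangians of two elements *)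

Section Interlace.
Variables (R : realType) (n : nat).
Local Notation C := R[i].
Implicit Types (g h k : 'M[R]_(n + n)) (A D X Y : 'M[R]_n).

Lemma mtriple_eqmx m1 m2 m3 p1 p2 p3 (l1 : 'M[R]_(m1, n + n)) (l2 : 'M[R]_(m2, n + n))
    (l3 : 'M[R]_(m3, n + n)) (k1 : 'M[R]_(p1, n + n)) (k2 : 'M[R]_(p2, n + n)) (k3 : 'M[R]_(p3, n + n)) :
  (l1 :=: k1)%MS -> (l2 :=: k2)%MS -> (l3 :=: k3)%MS -> mtriple l1 l2 l3 -> mtriple k1 k2 k3.
Proof.
move=> /eqmx_sym e1 /eqmx_sym e2 /eqmx_sym e3 [g sg [f1 f2 f3]]; exists g => //.
by split; [exact: eqmx_trans e1 f1|exact: eqmx_trans e2 f2|exact: eqmx_trans e3 f3].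
Qed.

(** The square root [S] of D + 1 commutes with [D], so D - 1 = S^-1 (D^2 - 1) S^-1. *)
Lemma sqrt_posdef_gt1 D : D^T = D -> posdef D -> posdef (D *m D - 1%:M) -> posdef (D - 1%:M).
Proof.
move=> sD pD p.
have p1 : posdef (1%:M : 'M[R]_n) by move=> v v0; rewrite mulmx1; exact: mulmx_tr_gt0.
have [|S [sS pS SS]] := posdef_sqrt _ (posdefD pD p1).
  by rewrite linearD /= sD trmx1.
have Su := posdef_unitmx pS.
have DE : D = S *m S - 1%:M by rewrite SS addrK.
have -> : D - 1%:M = invmx S *m (D *m D - 1%:M) *m (invmx S)^T.
  have SD : S *m D = D *m S by rewrite DE mulmxBr mulmxBl mulmxA mulmx1 mul1mx.
  rewrite trmx_inv sS; apply: (can_inj (mulKmx Su)); apply: (can_inj (mulmxK Su)).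
  rewrite [RHS](_ : _ = D *m D - 1%:M); last by rewrite !mulmxA mulmxV // mul1mx mulmxKV.
  rewrite mulmxBr mulmx1 SD -{2}[S]mul1mx -mulmxBl -mulmxA SS.
  by rewrite mulmxDr mulmxBl mulmx1 mul1mx addrA subrK.
by apply: posdef_congr; rewrite ?unitmx_inv.
Qed.

Lemma expanding_conj (a A : 'M[R]_n) : a \in unitmx -> expanding A -> expanding (invmx a *m A *m a).
Proof.
move=> au eA z /eigenvalueP[v vz v0]; apply: eA; apply/eigenvalueP.
have cau : complexify a \in unitmx by rewrite complexify_unit.
exists (v *m invmx (complexify a)).
  move: vz; rewrite !complexifyM complexify_inv !mulmxA => /(congr1 (fun x => x *m invmx (complexify a))).
  by rewrite mulmxK // scalemxAl.
by apply: contra v0 => /eqP h0; rewrite -[v](mulmxKV cau) h0 mul0mx.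
Qed.

(** Two frames of the same pair of Lagrangians differ by a block diagonal symplectic matrix, which
    conjugates [A]. *)
Lemma shilov_reframe g h A k : shilov_data g h A -> symplectic k ->
  (frame_oo R n *m h^T :=: frame_oo R n *m k^T)%MS ->
  (frame (0 : 'M[R]_n) *m h^T :=: frame (0 : 'M[R]_n) *m k^T)%MS ->
  exists A', shilov_data g k A'.
Proof.
move=> [sh gE eA] sk eoo e0; have hu := symplectic_unit sh; have ku := symplectic_unit sk.
pose w := invmx h *m k; have kE : k = h *m w by rewrite /w mulKVmx.
have sw : symplectic w by apply: symplecticM => //; exact: symplecticV.
have [|a [b [au wE sb]]] := symplectic_upper sw.
  by apply: (eqmx_act_inj hu); rewrite -mulmxA -trmx_mul -kE; exact: eqmx_sym.
have [f0 _] := upper_frame au sb (trmx0 _ _ _).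
have b0 : b = 0.
  have ba : 0 = b *m a^T.
    rewrite mulmx0 mul0mx add0r in f0; apply: frame_inj; apply: eqmx_trans f0; rewrite -wE.
    by apply: (eqmx_act_inj hu); rewrite -mulmxA -trmx_mul -kE.
  by rewrite -[b](@mulmxK _ _ _ a^T) ?unitmx_tr // -ba mul0mx.
exists (invmx a *m A *m a); split; [exact: sk| |exact: (expanding_conj au eA)].
have Au := expanding_unit eA.
have iE : invmx (invmx a *m A *m a) = invmx a *m invmx A *m a.
  have Mu : invmx a *m A *m a \in unitmx by rewrite !unitmx_mul unitmx_inv au Au.
  by apply: (can_inj (mulKmx Mu)); rewrite mulmxV // !mulmxA mulmxK // mulmxK // mulVmx.
have e : diag_sp A *m w = w *m diag_sp (invmx a *m A *m a).
  rewrite wE b0 /diag_sp iE !mulmx_block !mul0mx !mulmx0 !addr0 !add0r; congr block_mx.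
    by rewrite !mulmxA mulmxV // mul1mx.
  by rewrite -!trmx_mul mulmxK.
rewrite -/(diag_sp _) -[LHS](mulmxK ku); congr (_ *m _).
move: (diag_sp (invmx a *m A *m a)) e => D' e; clearbody w.
by rewrite gE -/(diag_sp A) kE -!mulmxA mulKmx // e.
Qed.

(** The three triples determine the cyclic order a, b, c, d, e, where b = g^-1 d. In the chart with
    e, a, c at oo, 0, 1, the Lagrangian d is a matrix D^2 > 1 and b a matrix X with 0 < X < 1. From
    D^2 = A X A^T follows det D^2 < det A^2. *)
Lemma interlace g h A k : (0 < n)%N -> symplectic k -> shilov_data g h A ->
  mtriple (frame (0 : 'M[R]_n) *m h^T) (frame (0 : 'M[R]_n) *m k^T) (frame_oo R n *m h^T) ->
  mtriple (frame (0 : 'M[R]_n) *m k^T) (frame (0 : 'M[R]_n) *m k^T *m (invmx g)^T) (frame_oo R n *m k^T) ->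
  mtriple (frame (0 : 'M[R]_n) *m h^T) (frame (0 : 'M[R]_n) *m k^T *m (invmx g)^T) (frame (0 : 'M[R]_n) *m k^T) ->
  exists h' A' D, [/\ shilov_data g h' A', D^T = D, posdef (D - 1%:M), \det D < `|\det A'| &
    (frame_oo R n *m k^T :=: frame 1%:M *m h'^T)%MS /\
    (frame (0 : 'M[R]_n) *m k^T :=: frame (D *m D) *m h'^T)%MS].
Proof.
set a := _ *m h^T; set d := _ *m k^T; set e := _ *m h^T; set b := _ *m (invmx g)^T; set c := _ *m k^T.
move=> n0 sk dg ade dbc abd.
have dab := mtriple_cycle (mtriple_cycle abd).
have abc := mtriple_tail dab dbc.
have acd := mtriple_cycle (mtriple_trans dab dbc).
have ace := mtriple_trans acd ade; have cde := mtriple_tail acd ade.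
have bce := mtriple_tail abc ace.
have abe := mtriple_trans abc ace.
have eac := mtriple_cycle (mtriple_cycle ace).
have [h' sh' [e1 e2 e3]] := eac; have hu := symplectic_unit sh'.
have uniq m (l : 'M[R]_(m, n + n)) X Y : (l :=: frame X *m h'^T)%MS -> (l :=: frame Y *m h'^T)%MS -> X = Y.
  by move=> eX eY; apply: frame_inj; apply: (eqmx_act_inj hu); exact: eqmx_trans (eqmx_sym eX) eY.
have [A' dg'] := shilov_reframe dg sh' e1 e2.
have [_ gE eA'] := dg'; have Au := expanding_unit eA'.
have [X1 [Y [_ sY pY eX1 eY]]] := lt_of_mtriple sh' (mtriple_cycle (mtriple_cycle cde)) e1.
rewrite -(uniq _ _ _ _ e3 eX1) {X1 eX1} in pY.
have [X [X1 [sX _ pX eX eX1]]] := lt_of_mtriple sh' (mtriple_cycle (mtriple_cycle bce)) e1.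
rewrite -(uniq _ _ _ _ e3 eX1) {X1 eX1} in pX.
have [X0 [X' [_ _ p0 eX0 eX']]] := lt_of_mtriple sh' (mtriple_cycle (mtriple_cycle abe)) e1.
rewrite -(uniq _ _ _ _ e2 eX0) -(uniq _ _ _ _ eX eX') subr0 {X0 X' eX0 eX'} in p0.
have p1 : posdef (1%:M : 'M[R]_n) by move=> v v0; rewrite mulmx1; exact: mulmx_tr_gt0.
have pYY : posdef Y by rewrite -[Y](subrK 1%:M); exact: posdefD.
have sg : g \in unitmx.
  by rewrite gE !unitmx_mul unitmx_inv hu unitmxE det_ublock unitrM -!unitmxE Au unitmx_tr unitmx_inv Au.
have YE : Y = A' *m X *m A'^T.
  apply: (uniq _ d) => //.
  have -> : d = b *m g^T by rewrite /b -mulmxA -trmx_mul mulmxV // trmx1 mulmx1.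
  have s0 : ((0 : 'M[R]_n) *m A'^T)^T = 0 *m A'^T by rewrite mul0mx trmx0.
  have [f1 _] := upper_frame Au s0 sX; rewrite mul0mx addr0 in f1.
  apply: (eqmx_trans (eqmxMr g^T eX)); rewrite -[_ *m g^T]mulmxA -trmx_mul.
  have -> : g *m h' = h' *m diag_sp A' by rewrite gE mulmxKV.
  by rewrite trmx_mul mulmxA; exact: eqmxMr.
have [D [sD pD DD]] := posdef_sqrt sY pYY.
exists h', A', D; rewrite DD; split; [exact: dg'|exact: sD| | |by split].
  by apply: sqrt_posdef_gt1; rewrite ?DD.
have [X0 X1] := det_posdef_lt n0 sX (trmx1 _ _) p0 pX; rewrite det1 in X1.
have D0 : 0 < \det D by have [q [q0 /(_ 0)]] := posdef_spectrum sD pD; rewrite raddf0 addr0 => ->; apply: prodr_gt0 => i _; rewrite addr0.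
have A0 : \det A' != 0 by rewrite -unitfE -unitmxE.
have : \det D * \det D < `|\det A'| * `|\det A'|.
  rewrite -det_mulmx DD YE !det_mulmx det_tr -normrM ger0_norm -?expr2 ?sqr_ge0 //.
  rewrite mulrAC gtr_pMr // -expr2 exprn_even_gt0 //.
have N0 := normr_ge0 (\det A'); move: N0 D0; move: (\det D) (`|_|) => x y; nra.
Qed.

End Interlace.

(** * The limit map of a maximal representation in the coordinates of an axis *)

Section Position.
Variables (R : realType) (Sigma : topologicalType) (Gamma : groupType).
Variables (H : hyperbolization R Sigma Gamma) (n : nat).
Variables (rho : Gamma -> 'M[R]_(n + n)) (xi : boundary_circle R -> 'M[R]_(n + n)).
Hypothesis rho_rep : representation rho.
Hypothesis xi_equiv : forall g x,
  (xi (moebius_circle (hol H g) x) == lag_act (rho g) (xi x))%MS.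
Hypothesis xi_rcont : Defs.right_continuous xi.
Hypothesis xi_pos : forall x y z, positively_oriented x y z ->
  maximal_triple (xi x) (xi y) (xi z).

Lemma rho_unit g : rho g \in unitmx.
Proof. exact/symplectic_unit/rho_rep.1. Qed.

Lemma rho1 : rho 1%g = 1%:M.
Proof.
have e : rho 1%g *m rho 1%g = rho 1%g by rewrite -rho_rep.2 mulg1.
by rewrite -[LHS](mulKmx (rho_unit 1%g)) e mulVmx // rho_unit.
Qed.

Lemma rhoV g : rho g^-1%g = invmx (rho g).
Proof.
apply: (can_inj (mulKmx (rho_unit g))).
by rewrite -rho_rep.2 mulgV rho1 mulmxV // rho_unit.
Qed.

Definition framed_limit (m : 'M[R]_2) x := xi (moebius_circle m x).

Lemma framed_limit_pos m x y z : \det m = 1 -> positively_oriented x y z ->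
  mtriple (framed_limit m x) (framed_limit m y) (framed_limit m z).
Proof.
by move=> dm p; apply/maximal_tripleE/xi_pos; rewrite positively_oriented_moebius.
Qed.

Lemma framed_limit_equiv g m T x : \det m = 1 -> \det T = 1 -> hol_rel H g m T ->
  (framed_limit m (moebius_circle T x) :=: framed_limit m x *m (rho g)^T)%MS.
Proof.
move=> dm dT e; rewrite /framed_limit -moebius_circle_mul // -(moebius_circle_psl _ e).
by rewrite moebius_circle_mul ?hol_det //; exact/eqmxP.
Qed.

Lemma framed_limit_rcont m : \det m = 1 -> Defs.right_continuous (framed_limit m).
Proof.
move=> dm x F e eF e0; have mu := unitmx_det1 dm.
have K z : moebius_circle m (moebius_circle (invmx m) z) = z.
  by rewrite -moebius_circle_mul ?det_inv1 // mulmxV // moebius_circleE ?det1 // act2_1 cliftK.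
have [y yx near] := xi_rcont eF e0.
exists (moebius_circle (invmx m) y) => [h|z]; first by apply: yx; rewrite -h K.
by rewrite -(positively_oriented_moebius _ _ _ dm) K => /near.
Qed.

Lemma limit_datum_exists g m N : axis H g m N -> shilov_hyperbolic (rho g) ->
  exists h A, shilov_data (rho g) h A /\ limit_datum (framed_limit m) N h.
Proof.
move=> [dm N0 e] [h0 [A0 d0]].
have fe x := framed_limit_equiv x dm (det_motion N0) e.
have fp x y z := @framed_limit_pos m x y z dm.
case: N N0 e fe => [l l1 _|b b0 _] fe.
  exact: (limit_datum_dil fp l1 (rho_rep.1 g) fe).
exists h0, A0; split=> //.
exact: (limit_datum_trans fp (framed_limit_rcont dm) b0 (rho_rep.1 g) fe d0).
Qed.

Lemma rep_pt_neq0 (N : motion R) : rep_pt N != 0.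
Proof. by case: N => t; apply/eqP => -[] /eqP; rewrite ?oner_eq0 //; move=> _ /eqP; rewrite oner_eq0. Qed.

(** A motion moves the points of its arc away from the repelling point, so a preimage comes before
    the point itself. *)
Lemma arc_oriented (N : motion R) y : motion_pos N -> in_arc_pt N y ->
  positively_oriented (cpt (rep_pt N)) (moebius_circle (invmx (motion_mx N)) y) y.
Proof.
move=> N0; have := det_motion N0; case: N N0 => [l|b] /= N0 dN; case: y => [y|//] y0.
  have l0 : l != 0 by rewrite gt_eqF // (lt_trans ltr01).
  have -> : invmx (dil l) = dil l^-1.
    by rewrite inv_mx2 // !mx2E /dil oppr0 invrK.
  rewrite moebius_circle_dil ?invr_eq0 // /cpt /= oner_eq0 mul0r /positively_oriented /=.
  have L0 : 0 < l^-1 by rewrite invr_gt0 (lt_trans ltr01).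
  have L1 : l^-1 < 1 by rewrite invf_lt1 // (lt_trans ltr01).
  have -> : 0 < l^-1 ^+ 2 * y by rewrite mulr_gt0 // exprn_gt0.
  by have -> : l^-1 ^+ 2 * y < y by rewrite gtr_pMl // exprn_ilt1 // ltW.
have -> : invmx (trans b) = trans (- b).
  by rewrite inv_mx2 // !mx2E /trans oppr0.
rewrite moebius_circle_trans /cpt /= eqxx /positively_oriented /=.
by have -> : y + - b < y by rewrite gtrDl oppr_lt0.
Qed.

(** The two arc conditions give the triples that involve an attractive Lagrangian; the third triple
    consists of values of the limit map. The points p' and q', the repelling point of d and its
    image under g^-1, have to be read in the coordinates of both elements. *)
Lemma position_interlace g m N d k N' : (0 < n)%N -> rel_position H g m N d k N' ->
  shilov_hyperbolic (rho g) -> shilov_hyperbolic (rho d) ->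
  exists h A D k0 B, [/\ shilov_data (rho g) h A, shilov_data (rho d) k0 B,
    [/\ D^T = D, posdef (D - 1%:M) & \det D < `|\det A|],
    (frame_oo R n *m k0^T :=: frame 1%:M *m h^T)%MS &
    (frame 0 *m k0^T :=: frame (D *m D) *m h^T)%MS].
Proof.
move=> n0 [am ak arc1 arc2] sg sd.
have [h [A [dg [h0 harc]]]] := limit_datum_exists am sg.
have [k0 [B [dd [k00 karc]]]] := limit_datum_exists ak sd.
have [dm N0 em] := am; have [dk N0' ek] := ak.
have mu := unitmx_det1 dm.
set K := invmx m *m k in arc1 arc2.
have dK : \det K = 1 by rewrite det_mulmx det_inv1 // dk mulr1.
have Ku := unitmx_det1 dK.
have kE : k = m *m K by rewrite /K mulKVmx.
clearbody K.
set p' := cpt (act2 K (rep_pt N')).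
have p'E : framed_limit m p' = framed_limit k (cpt (rep_pt N')).
  by rewrite /framed_limit kE moebius_circle_mul // [moebius_circle K _]moebius_circle_cpt ?rep_pt_neq0.
have a1 := in_arc_cpt arc1; have a2 := in_arc_cpt arc2.
have dN := det_motion N0.
have dNV := det_inv1 dN.
set q' := moebius_circle (invmx (motion_mx N)) p'.
have q'E : framed_limit m q' = framed_limit k (cpt (act2 (invmx K *m invmx (motion_mx N) *m K) (rep_pt N'))).
  rewrite /framed_limit /q' /p' [in RHS]kE [in RHS]moebius_circle_mul //; congr xi; congr moebius_circle.
  have c1 : act2 K (rep_pt N') != 0 by rewrite act2_neq0 ?rep_pt_neq0.
  have dL : \det (invmx K *m invmx (motion_mx N) *m K) = 1 by rewrite !det_mulmx det_inv1 // dNV dK !mulr1.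
  rewrite !moebius_circle_cpt ?(act2_neq0 _ (rep_pt_neq0 _)) //.
  by rewrite -!act2M !mulmxA mulmxV // mul1mx.
have gE : rho g^-1%g = invmx (rho g) := rhoV g.
have q'lim : (framed_limit m q' :=: framed_limit m p' *m (invmx (rho g))^T)%MS.
  by rewrite -gE; apply: framed_limit_equiv => //; exact: hol_relV.
have t1 := harc _ a1; have t2 := karc _ a2; rewrite -q'E -p'E in t2.
have t3 := framed_limit_pos dm (arc_oriented N0 a1).
rewrite -/p' -/q' in t1 t2 t3; rewrite -p'E in k00.
have sk : symplectic k0 by have [] := dd.
have qk : (framed_limit m q' :=: frame 0 *m k0^T *m (invmx (rho g))^T)%MS.
  exact: eqmx_trans q'lim (eqmxMr _ k00).
have [|||h' [A' [D [dg' sD pD lD [E1 E2]]]]] := @interlace _ _ (rho g) h A k0 n0 sk dg.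
- exact: mtriple_eqmx h0 k00 (eqmx_refl _) t1.
- exact: mtriple_eqmx k00 qk (eqmx_refl _) t2.
- exact: mtriple_eqmx h0 qk k00 t3.
by exists h', A', D, k0, B.
Qed.

End Position.

(** * Cross-ratios in coordinates *)

Section Pairing.
Variables (F : fieldType) (n : nat).
Local Notation J := (symplectic_form n F).
Implicit Types (Z : 'M[F]_n).

Definition sframe Z : 'M[F]_(n, n + n) := row_mx Z^T 1%:M.

(** The symplectic form between the rows of [W] and the frame of [Z]; for the frame of a symmetric X
    it is X - Z. *)
Definition pairing m (W : 'M[F]_(m, n + n)) Z : 'M[F]_(m, n) := W *m J *m (sframe Z)^T.

Lemma pairing_row m (P Q : 'M[F]_(m, n)) Z : pairing (row_mx P Q) Z = P - Q *m Z.
Proof.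
rewrite /pairing /symplectic_form mul_row_block !mulmx0 add0r addr0 mulmx1 mulmxN mulmx1.
by rewrite tr_row_mx trmxK trmx1 mul_row_col mulmx1 mulNmx addrC.
Qed.

Lemma pairing_sframe X Z : X^T = X -> pairing (sframe X) Z = X - Z.
Proof. by move=> sX; rewrite pairing_row mul1mx sX. Qed.

Lemma pairingM p m (U : 'M[F]_(p, m)) (W : 'M[F]_(m, n + n)) Z : pairing (U *m W) Z = U *m pairing W Z.
Proof. by rewrite /pairing !mulmxA. Qed.

Lemma pairingB m (W W' : 'M[F]_(m, n + n)) Z : pairing (W - W') Z = pairing W Z - pairing W' Z.
Proof. by rewrite /pairing !mulmxBl. Qed.

Lemma pairing_eq0 m (W : 'M[F]_(m, n + n)) Z : Z^T = Z -> pairing W Z = 0 -> (W <= lag_of_sym Z)%MS.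
Proof.
move=> sZ; rewrite -[W]hsubmxK pairing_row => /eqP; rewrite subr_eq0 => /eqP e.
rewrite genmxE; apply/submxP; exists (rsubmx W).
by rewrite mul_mx_row mulmx1 sZ -e.
Qed.

Lemma lag_pairing0 m (W : 'M[F]_(m, n + n)) Z : Z^T = Z -> (W <= lag_of_sym Z)%MS -> pairing W Z = 0.
Proof.
move=> sZ; rewrite genmxE => /submxP[U ->].
by rewrite -/(sframe Z) pairingM pairing_sframe // subrr mulmx0.
Qed.

(** A Lagrangian is its own annihilator, so the projection parallel to [Z] is determined by
    preserving the pairing with [Z]. *)
Lemma proj_frame m (W : 'M[F]_(m, n + n)) (G : 'M[F]_(n, n + n)) (l : 'M[F]_(n + n)) Z :
  Z^T = Z -> (l :=: G)%MS -> pairing G Z \in unitmx ->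
  W *m proj_mx l (lag_of_sym Z) = pairing W Z *m invmx (pairing G Z) *m G.
Proof.
move=> sZ lG u; set a := pairing W Z *m _.
have dx : (l :&: lag_of_sym Z)%MS = 0.
  apply/eqP; rewrite -submx0; apply/rV_subP => v; rewrite sub_capmx => /andP[].
  rewrite lG => /submxP[c ->] /(lag_pairing0 sZ); rewrite pairingM => /(congr1 (fun x => x *m invmx (pairing G Z))).
  by rewrite mul0mx mulmxK // => ->; rewrite mul0mx sub0mx.
have e : (W - a *m G <= lag_of_sym Z)%MS.
  by apply: pairing_eq0 => //; rewrite pairingB pairingM /a mulmxKV // subrr.
rewrite -{1}[W](subrK (a *m G)) mulmxDl (proj_mx_0 dx e) add0r proj_mx_id //.
by rewrite lG submxMl.
Qed.

(** [cross_ratio] is written in the basis [row_base l1], of size [\rank l1]; the rectangular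
    matrices [U] and [U'] change to the frame [G1], of size [n]. *)
Lemma cross_ratioE (l1 l4 : 'M[F]_(n + n)) (G1 G4 : 'M[F]_(n, n + n)) Z2 Z3 :
  Z2^T = Z2 -> Z3^T = Z3 -> (l1 :=: G1)%MS -> (l4 :=: G4)%MS -> row_free G1 ->
  pairing G4 Z3 \in unitmx -> pairing G1 Z2 \in unitmx ->
  exists (U : 'M[F]_(n, \rank l1)) (U' : 'M[F]_(\rank l1, n)), [/\ U *m U' = 1%:M, U' *m U = 1%:M &
    cross_ratio l1 (lag_of_sym Z2) (lag_of_sym Z3) l4 =
    U' *m (pairing G1 Z3 *m invmx (pairing G4 Z3) *m (pairing G4 Z2 *m invmx (pairing G1 Z2))) *m U].
Proof.
move=> s2 s3 e1 e4 fG u4 u1; set Q := _ *m (_ *m _).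
have rb : (row_base l1 :=: G1)%MS by apply: eqmx_trans e1; exact: eq_row_base.
have fr := row_base_free l1.
rewrite /cross_ratio /conjmx; move: (row_base l1) rb fr => r rb fr.
have /submxP[U UE] : (G1 <= r)%MS by rewrite rb.
have /submxP[U' UE'] : (r <= G1)%MS by rewrite rb.
have cancel1 (A B : 'M[F]_n) : A *m G1 = B *m G1 -> A = B.
  by move/(congr1 (fun x => x *m pinvmx G1)); rewrite -!mulmxA mulmxVp // !mulmx1.
have cancelb (A B : 'M[F]_(\rank l1)) : A *m r = B *m r -> A = B.
  by move/(congr1 (fun x => x *m pinvmx r)); rewrite -!mulmxA mulmxVp // !mulmx1.
exists U, U'; split.
- by apply: cancel1; rewrite mul1mx -mulmxA -UE' -UE.
- by apply: cancelb; rewrite mul1mx -mulmxA -UE -UE'.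
have -> : r *m (proj_mx l4 (lag_of_sym Z3) *m proj_mx l1 (lag_of_sym Z2)) = U' *m Q *m G1.
  rewrite {1}UE' mulmxA -[U' *m G1 *m _]mulmxA (proj_frame _ s3 e4 u4) -!mulmxA (proj_frame _ s2 e1 u1).
  by rewrite /Q !mulmxA.
by rewrite UE -!mulmxA mulmxVp // mulmx1.
Qed.

End Pairing.

(** * The Siegel space *)

Section SiegelSpace.
Variables (R : realType) (n : nat).
Local Notation C := R[i].
Local Notation ci := ('i%C : C).
Implicit Types (Z X : 'M[C]_n) (g : 'M[R]_(n + n)).
Local Notation J := (symplectic_form n C).

Definition imag Z : 'M[C]_n := (- ci / 2) *: (Z - conj_mx Z).

Lemma ii : ci * ci = -1.
Proof. by rewrite -expr2 sqr_i. Qed.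

Lemma i_neq0 : ci != 0.
Proof. by apply/eqP => h; have := ii; rewrite h mul0r => /eqP; rewrite eq_sym oppr_eq0 oner_eq0. Qed.

Lemma imagE Z : Z - conj_mx Z = (2 * ci) *: imag Z.
Proof.
rewrite /imag scalerA; have -> : 2 * ci * (- ci / 2) = 1.
  have -> : 2 * ci * (- ci / 2) = - (ci * ci) by field.
  by rewrite ii opprK.
by rewrite scale1r.
Qed.

Lemma conj_mxZ (a : C) m p (A : 'M[C]_(m, p)) : conj_mx (a *: A) = a^*%C *: conj_mx A.
Proof. by apply/matrixP => i j; rewrite !mxE rmorphM. Qed.

Lemma conj_i : ci^*%C = - ci :> C.
Proof. by apply/eqP; rewrite eq_complex /= oppr0 !eqxx. Qed.

Lemma halfE : (2^-1 : C) = (2^-1 : R)%:C%C.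
Proof. by rewrite fmorphV rmorph_nat. Qed.

Lemma conj_half : (2^-1 : C)^*%C = 2^-1.
Proof. by rewrite halfE conjc_real. Qed.

Lemma conj_coef : (- ci / 2)^*%C = ci / 2 :> C.
Proof. by rewrite halfE; apply/eqP; rewrite eq_complex /=; apply/andP; split; apply/eqP; ring. Qed.

Lemma adj_id : adj (1%:M : 'M[C]_n) = 1%:M.
Proof. by rewrite /adj /conj_mx map_mx1 trmx1. Qed.

Lemma adjZ (a : C) m p (A : 'M[C]_(m, p)) : adj (a *: A) = a^*%C *: adj A.
Proof. by rewrite /adj conj_mxZ linearZ. Qed.

Lemma conj_imag Z : conj_mx (imag Z) = imag Z.
Proof.
rewrite /imag conj_mxZ conj_mxD conj_mxN conj_mxK -opprB scalerN -scaleNr; congr (_ *: _).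
by rewrite conj_coef mulNr.
Qed.

Lemma imag_tr Z : Z^T = Z -> (imag Z)^T = imag Z.
Proof. by move=> sZ; rewrite /imag linearZ linearB /= -conj_mxT sZ. Qed.

Lemma complexifyD m p (A B : 'M[R]_(m, p)) : complexify (A + B) = complexify A + complexify B.
Proof. exact: map_mxD. Qed.

Lemma siegelP Z : siegel Z <-> Z^T = Z /\ cposdef (imag Z).
Proof.
split=> [[X [Y [sX sY pY ->]]]|[sZ pZ]].
  split; first by rewrite linearD linearZ /= -!complexifyT sX sY.
  have -> : imag (complexify X + (0 +i* 1)%C *: complexify Y) = complexify Y.
    rewrite /imag conj_mxD conj_mxZ !conj_complexify conj_i scaleNr opprB addrC addrA subrK.
    rewrite -scalerDl scalerA; have -> : - ci / 2 * (ci + ci) = - (ci * ci) by field.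
    by rewrite ii opprK scale1r.
  exact: posdef_complexify.
have [Y YE] := real_mxP (conj_imag Z).
have [|X XE] := @real_mxP R n n (2^-1 *: (Z + conj_mx Z)).
  by rewrite conj_mxZ conj_mxD conj_mxK addrC conj_half.
exists X, Y; split.
- by apply: complexify_inj; rewrite complexifyT -XE linearZ linearD /= -conj_mxT sZ.
- by apply: complexify_inj; rewrite complexifyT -YE imag_tr.
- by apply: complexify_posdef; rewrite -YE.
rewrite -XE -YE /imag scalerA.
have -> : (0 +i* 1)%C * (- ci / 2) = 2^-1 :> C by rewrite mulrA mulrN ii opprK mul1r.
by apply/matrixP => i j; rewrite !mxE; field.
Qed.

Lemma siegel_sym Z : siegel Z -> Z^T = Z.
Proof. by move/siegelP => []. Qed.

Lemma siegel_imag Z : siegel Z -> cposdef (imag Z).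
Proof. by move/siegelP => []. Qed.

Lemma adj_sym Z : Z^T = Z -> adj Z = conj_mx Z.
Proof. by move=> sZ; rewrite /adj -conj_mxT sZ. Qed.

Lemma cposdef_unit_of (A P : 'M[C]_n) (c : C) : cposdef P -> c != 0 -> A - adj A = c *: P -> A \in unitmx.
Proof.
move=> pP c0 e; rewrite -row_free_unit -kermx_eq0; apply/rowV0P => v /sub_kermxP vA.
apply/eqP/negPn/negP => v0; have := pP v v0.
suff -> : v *m P *m adj v = 0 by rewrite mxE ltxx.
apply: (scalerI c0); rewrite scaler0 scalemxAl scalemxAr -e mulmxBr mulmxBl vA mul0mx sub0r.
have -> : v *m adj A *m adj v = adj (v *m A *m adj v) by rewrite !adjM adjK mulmxA.
by rewrite vA mul0mx /adj /conj_mx map_mx0 trmx0 oppr0.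
Qed.

Lemma cposdefD (A B : 'M[C]_n) : cposdef A -> cposdef B -> cposdef (A + B).
Proof. by move=> pA pB v v0; rewrite mulmxDr mulmxDl mxE addr_gt0 ?pA ?pB. Qed.

Lemma cposdef_congr (A B : 'M[C]_n) : A \in unitmx -> cposdef B -> cposdef (A *m B *m adj A).
Proof.
move=> Au pB v v0; have vA : v *m A != 0.
  by apply: contra v0 => /eqP h; rewrite -[v](mulmxK Au) h mul0mx.
by have := pB _ vA; rewrite adjM !mulmxA.
Qed.

Lemma siegel_pairing_unit X Z : siegel X -> siegel Z -> X - conj_mx Z \in unitmx.
Proof.
move=> hX hZ; have sX := siegel_sym hX; have sZ := siegel_sym hZ.
apply: (@cposdef_unit_of _ (imag X + imag Z) (2 * ci)).
- exact: cposdefD (siegel_imag hX) (siegel_imag hZ).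
- by rewrite mulf_neq0 ?i_neq0 // pnatr_eq0.
rewrite adjD adjN /adj -!conj_mxT sX sZ conj_mxK scalerDr -!imagE; apply/matrixP => i j; rewrite !mxE; ring.
Qed.

Lemma siegel_pairing_unitC X Z : siegel X -> siegel Z -> conj_mx X - Z \in unitmx.
Proof.
move=> hX hZ; have := siegel_pairing_unit hX hZ.
have -> : conj_mx X - Z = conj_mx (X - conj_mx Z) by rewrite conj_mxD conj_mxN conj_mxK.
by rewrite /conj_mx map_unitmx.
Qed.

Definition denom g Z : 'M[C]_n := dlsubmx (complexify g) *m Z + drsubmx (complexify g).

Lemma complexify_symplectic g : symplectic g -> (complexify g)^T *m J *m complexify g = J.
Proof.
have JE : complexify (symplectic_form n R) = J.
  by rewrite /complexify map_block_mx !map_mx0 map_mxN !map_mx1.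
by move=> sg; rewrite -JE -complexifyT -!complexifyM sg.
Qed.

Lemma siegel_actP g Z : symplectic g -> siegel Z ->
  [/\ denom g Z \in unitmx, siegel (siegel_act g Z),
      sframe Z *m (complexify g)^T = (denom g Z)^T *m sframe (siegel_act g Z) &
      imag Z = adj (denom g Z) *m imag (siegel_act g Z) *m denom g Z].
Proof.
move=> sg hZ; have sZ := siegel_sym hZ; have pZ := siegel_imag hZ.
set Q := denom g Z.
pose P := ulsubmx (complexify g) *m Z + ursubmx (complexify g).
have NE : sframe Z *m (complexify g)^T = row_mx P^T Q^T.
  rewrite -{1}[complexify g]submxK tr_block_mx /sframe mul_row_block !mul1mx.
  by rewrite /P /Q /denom !linearD /= !trmx_mul.
(* Invariance of the symplectic form for the frames of [Z1] and [Z]. The case Z1 = Z gives the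
   symmetry of g Z, the case Z1 = conj Z gives its imaginary part and the invertibility of the
   denominator. *)
have form (Z1 : 'M[C]_n) P1 Q1 : sframe Z1 *m (complexify g)^T = row_mx P1^T Q1^T -> Z1^T = Z1 ->
    Z1 - Z = P1^T *m Q - Q1^T *m P.
  move=> e s1; rewrite -pairing_sframe // /pairing -(complexify_symplectic sg) !mulmxA e.
  rewrite -!mulmxA -[complexify g *m _]trmxK trmx_mul trmxK NE tr_row_mx !trmxK.
  rewrite /symplectic_form mul_block_col !mul0mx add0r addr0 mul1mx mulNmx mul1mx mul_row_col mulmxN.
  by [].
have f1 := form _ _ _ NE sZ.
have f2 : conj_mx Z - Z = adj P *m Q - adj Q *m P.
  have := form (conj_mx Z) (conj_mx P) (conj_mx Q); rewrite /adj; apply; last by rewrite -conj_mxT sZ.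
  rewrite -!conj_mxT -[row_mx _ _](_ : conj_mx (row_mx P^T Q^T) = _); last by rewrite /conj_mx map_row_mx.
  rewrite -NE conj_mxM conj_mxT conj_complexify; congr (_ *m _).
  by rewrite /conj_mx /sframe map_row_mx map_trmx map_mx1.
have Qu : Q \in unitmx.
  have c0 : - (2 * ci) != 0 :> C by rewrite oppr_eq0 mulf_neq0 ?i_neq0 // pnatr_eq0.
  suff : adj Q \in unitmx by rewrite /adj unitmx_tr /conj_mx map_unitmx.
  rewrite -row_free_unit -kermx_eq0; apply/rowV0P => v /sub_kermxP vQ.
  apply/eqP/negPn/negP => v0; have := pZ v v0.
  suff -> : v *m imag Z *m adj v = 0 by rewrite mxE ltxx.
  apply: (scalerI c0); rewrite scaler0 scalemxAl scalemxAr scaleNr -imagE opprB f2.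
  have Qv : Q *m adj v = 0 by rewrite -[Q]adjK -adjM vQ /adj /conj_mx map_mx0 trmx0.
  by rewrite mulmxBr mulmxBl !mulmxA vQ !mul0mx subr0 -[_ *m Q *m _]mulmxA Qv mulmx0.
have WE : siegel_act g Z = P *m invmx Q by [].
move: (siegel_act g Z) WE => W WE; clearbody P Q.
have sW : W^T = W.
  have Qtu : Q^T \in unitmx by rewrite unitmx_tr.
  rewrite WE trmx_mul; apply: (can_inj (mulmxK Qu)); apply: (can_inj (mulKmx Qtu)).
  rewrite trmx_inv (mulmxKV Qu) !mulmxA (mulmxV Qtu) mul1mx; apply/eqP; rewrite -subr_eq0 -f1 subrr //.
have iW : imag Z = adj Q *m imag W *m Q.
  have c0 : - (2 * ci) != 0 :> C by rewrite oppr_eq0 mulf_neq0 ?i_neq0 // pnatr_eq0.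
  apply: (scalerI c0); rewrite scalemxAl scalemxAr !scaleNr -!imagE !opprB f2.
  rewrite -(adj_sym sW) {}WE adjM mulmxBr mulmxBl !mulmxA.
  have -> : adj Q *m adj (invmx Q) = 1%:M by rewrite -adjM mulVmx // adj_id.
  rewrite (mul1mx (adj P)) (mulmxKV Qu (adj Q *m P)); reflexivity.
split; [exact: Qu| |  |exact: iW].
- apply/siegelP; split; first exact: sW.
  have Qiu : adj (invmx Q) \in unitmx by rewrite /adj unitmx_tr /conj_mx map_unitmx unitmx_inv.
  have <- : adj (invmx Q) *m imag Z *m adj (adj (invmx Q)) = imag W.
    by rewrite adjK iW !mulmxA -adjM mulmxV // adj_id mul1mx mulmxK.
  exact: cposdef_congr Qiu pZ.
rewrite NE /sframe mul_mx_row mulmx1 WE trmx_mul mulmxA -trmx_mul.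
by rewrite trmx_mul trmx_inv mulmxV ?unitmx_tr // mul1mx.
Qed.

End SiegelSpace.

(** * Busemann functions of Lagrangians *)

Section CharPoly.
Variable F : fieldType.

Lemma char_poly_conjmx n m (U : 'M[F]_(n, m)) (U' : 'M[F]_(m, n)) (Q : 'M[F]_n) :
  U *m U' = 1%:M -> U' *m U = 1%:M -> char_poly (U' *m Q *m U) = char_poly Q.
Proof.
move=> e1 e2; have mn : m = n.
  apply/eqP; rewrite eqn_leq -{1}(mxrank1 F m) -{2}(mxrank1 F n) -e1 -e2.
  by rewrite (leq_trans (mxrankM_maxl _ _) (rank_leq_col _)) (leq_trans (mxrankM_maxl _ _) (rank_leq_col _)).
move: U U' e1 e2; rewrite mn => U U' e1 e2.
have -> : char_poly (U' *m Q *m U) = \det (map_mx polyC U' *m char_poly_mx Q *m map_mx polyC U).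
  rewrite /char_poly /char_poly_mx; congr (\det _); rewrite mulmxBr mulmxBl !map_mxM; congr (_ - _).
  by rewrite [_ *m 'X%:M]scalar_mxC -mulmxA -map_mxM e2 map_mx1 mulmx1.
by rewrite !det_mulmx mulrAC -det_mulmx -map_mxM e2 map_mx1 det1 mul1r.
Qed.

Lemma char_poly_mulC n (A B : 'M[F]_n) : char_poly (A *m B) = char_poly (B *m A).
Proof.
pose x : 'M[{poly F}]_n := 'X%:M; pose a := map_mx polyC A; pose b := map_mx polyC B.
have e1 : block_mx x a b 1%:M *m block_mx 1%:M 0 (- b) 1%:M = block_mx (x - a *m b) a 0 1%:M.
  by rewrite mulmx_block !mulmx0 !mulmx1 !mul1mx !add0r mulmxN subrr.
have e2 : block_mx x a b 1%:M *m block_mx 1%:M (- a) 0 x = block_mx x 0 b (x - b *m a).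
  rewrite mulmx_block !mulmx0 !mulmx1 !mul1mx !addr0 !mulmxN.
  by rewrite /x [a *m _]scalar_mxC addNr addrC.
have := congr1 determinant e1; have := congr1 determinant e2.
rewrite !det_mulmx det_lblock det_ublock det_lblock det_ublock !det1 !mul1r !mulr1 => h2 h1.
have x0 : \det x != 0 by rewrite det_scalar expf_neq0 // polyX_eq0.
move: h2; rewrite h1 mulrC => /(mulfI x0).
by rewrite /char_poly /char_poly_mx !map_mxM => ->.
Qed.

Lemma char_poly_tr n (A : 'M[F]_n) : char_poly A^T = char_poly A.
Proof.
rewrite /char_poly /char_poly_mx -[in RHS]det_tr linearB /= tr_scalar_mx; congr (\det (_ - _)).
by rewrite map_trmx.
Qed.

Lemma char_poly_sym4 n (a b c d : 'M[F]_n) : a^T = a -> b^T = b -> c^T = c -> d^T = d ->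
  char_poly (a *m invmx d *m (c *m invmx b)) = char_poly (a *m invmx b *m (c *m invmx d)).
Proof.
move=> sa sb sc sd; rewrite -[LHS]char_poly_tr !trmx_mul !trmx_inv sa sb sc sd.
by rewrite -[X in _ = char_poly X]mulmxA [RHS]char_poly_mulC !mulmxA.
Qed.

Lemma invmxN n (A : 'M[F]_n) : A \in unitmx -> invmx (- A) = - invmx A.
Proof.
move=> Au; have nu : - A \in unitmx by rewrite -scaleN1r unitmxZ ?unitrN1.
by apply: (can_inj (mulKmx nu)); rewrite mulmxV // mulNmx mulmxN opprK mulmxV.
Qed.

End CharPoly.

(** * A determinant inequality of Hadamard type *)

Section Distortion.
Variables (R : realType) (n : nat).
Local Notation C := R[i].
Local Notation ci := ('i%C : C).
Implicit Types (B P Q T Z X : 'M[C]_n).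

Lemma mulmx_adj_diag m (A : 'M[C]_(m, n)) i : (A *m adj A) i i = (row i A *m adj (row i A)) 0 0.
Proof. by rewrite !mxE; apply: eq_bigr => j _; rewrite !mxE. Qed.

Lemma mulmx_adj_ge0 (v : 'rV[C]_n) : 0 <= (v *m adj v) 0 0.
Proof. by have [->|/mulmx_adj_gt0/ltW//] := eqVneq v 0; rewrite mul0mx mxE. Qed.

Lemma det_adj A : \det (adj (A : 'M[C]_n)) = (\det A)^*%C.
Proof. by rewrite /adj det_tr /conj_mx det_map_mx. Qed.

(** Arithmetic and geometric mean of the eigenvalues, whose sum is the trace, at most n. *)
Lemma det_hermitian_le1 (N : 'M[C]_n) : adj N = N -> cposdef N -> (forall i, N i i <= 1) -> \det N <= 1.
Proof.
move=> hN pN dN; have [P [d [PP PP' d0 NE]]] := hermitian_spectral hN pN.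
have detE : \det N = (\prod_i d i)%:C%C.
  rewrite NE !det_mulmx mulrAC -det_mulmx PP' det1 mul1r det_diag rmorph_prod.
  by apply: eq_bigr => i _; rewrite mxE.
have trE : \tr N = (\sum_i d i)%:C%C.
  rewrite NE -mulmxA mxtrace_mulC -mulmxA PP mulmx1 mxtrace_diag rmorph_sum.
  by apply: eq_bigr => i _; rewrite mxE.
have sd : \sum_i d i <= n%:R.
  rewrite -lecR -trE rmorph_nat; apply: (@le_trans _ _ (\sum_(i < n) 1)); first exact: ler_sum.
  by rewrite sumr_const card_ord.
rewrite detE -(rmorph1 (real_complex R)) lecR.
have [/= AGM _] := @leif_AGM _ _ (mem 'I_n) d (fun i _ => ltW (d0 i)).
have s0 : 0 <= \sum_i d i by apply: sumr_ge0 => i _; exact: ltW.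
move: AGM; rewrite card_ord => AGM; apply: le_trans AGM _; apply: exprn_ile1.
  by rewrite divr_ge0 // ler0n.
have [->|m0] := eqVneq (n%:R : R) 0; first by rewrite invr0 mulr0 ler01.
by rewrite ler_pdivrMr ?mul1r // lt_def m0 ler0n.
Qed.

(* Hadamard's inequality in an orthonormal basis of eigenvectors of B B^*, in
   which the rows of 1 - B have length at most 1 + sqrt (t i). *)
Lemma det_sub_bound B P (t : 'I_n -> R) : P *m adj P = 1%:M -> adj P *m P = 1%:M ->
  (forall i, 0 <= t i) -> B *m adj B = adj P *m diag_mx (\row_i (t i)%:C%C) *m P ->
  `|\det (1%:M - B)| ^+ 2 <= (\prod_i (1 + Num.sqrt (t i)) ^+ 2)%:C%C.
Proof.
move=> PP PP' t0 BE; pose s i := Num.sqrt (t i); have s0 i : 0 <= s i by exact: sqrtr_ge0.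
have ss i : s i ^+ 2 = t i by rewrite sqr_sqrtr.
have s1 i : 0 < 1 + s i by rewrite ltr_pwDl.
have [d0|d0] := eqVneq (\det (1%:M - B)) 0.
  by rewrite d0 normr0 expr0n /= ler0c; apply: prodr_ge0 => i _; exact: sqr_ge0.
(* Scaling the rows by the inverses of their bounds reduces the claim to diagonal entries at most
   1. *)
pose c := diag_mx (\row_i ((1 + s i)^-1)%:C%C) : 'M[C]_n.
have cc : adj c = c.
  by rewrite /adj /c; apply/matrixP => i j; rewrite !mxE eq_sym; case: eqP => [->|_]; rewrite ?mulr1n ?mulr0n ?conjc_real ?conjc0.
pose K := P *m (1%:M - B); pose M := c *m K.
have detc : \det c = (\prod_i (1 + s i)^-1)%:C%C.
  by rewrite det_diag rmorph_prod; apply: eq_bigr => i _; rewrite mxE.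
have Mu : M \in unitmx.
  rewrite !unitmx_mul !unitmxE detc !unitfE d0 /= andbT; apply/andP; split.
    by rewrite fmorph_eq0; apply/prodf_neq0 => i _; rewrite invr_eq0 gt_eqF.
  by have := congr1 determinant PP; rewrite det_mulmx det1 => h; apply: contraTneq isT => h0; move: h; rewrite h0 mul0r => /eqP; rewrite eq_sym oner_eq0.
have pI : cposdef (1%:M : 'M[C]_n) by move=> v v0; rewrite mulmx1; exact: mulmx_adj_gt0.
have pN : cposdef (M *m adj M) by have := cposdef_congr Mu pI; rewrite mulmx1.
have hN : adj (M *m adj M) = M *m adj M by rewrite adjM adjK.
have Kii i : (K *m adj K) i i <= ((1 + s i) ^+ 2)%:C%C.
  rewrite mulmx_adj_diag; pose p := row i P; pose q := p *m B.
  have -> : row i K = p - q by rewrite /K row_mul mulmxBr mulmx1.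
  have pp : (p *m adj p) 0 0 = 1 by rewrite -mulmx_adj_diag PP mxE eqxx.
  have qq : (q *m adj q) 0 0 = (t i)%:C%C.
    have -> : q = row i (P *m B) by rewrite row_mul.
    rewrite -mulmx_adj_diag adjM mulmxA -[P *m B *m _]mulmxA BE !mulmxA PP mul1mx -mulmxA PP mulmx1.
    by rewrite !mxE eqxx mulr1n.
  pose x := (p *m adj q + q *m adj p) 0 0.
  have mE (E1 E2 : 'M[C]_1) : (E1 + E2) 0 0 = E1 0 0 + E2 0 0 by rewrite mxE.
  have mN (E1 : 'M[C]_1) : (- E1) 0 0 = - E1 0 0 by rewrite mxE.
  have mZ (a : C) (E1 : 'M[C]_1) : (a *: E1) 0 0 = a * E1 0 0 by rewrite mxE.
  have -> : ((p - q) *m adj (p - q)) 0 0 = 1 + (t i)%:C%C - x.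
    by rewrite adjD adjN mulmxDl !mulmxDr !mulNmx !mulmxN opprK /x !mE !mN pp qq; ring.
  (* Cauchy-Schwarz for p and q, obtained from |s p + q|^2 >= 0 after division by s; for s = 0 the
     row q vanishes. *)
  have x0 : 0 <= 2 * (s i)%:C%C + x.
    have [h|h] := eqVneq (s i) 0.
      have q0 : q = 0.
        apply/eqP/negPn/negP => /mulmx_adj_gt0; rewrite qq -ss h expr0n /= ltxx //.
      by rewrite h mulr0 add0r /x q0 mul0mx /adj /conj_mx map_mx0 trmx0 mulmx0 addr0 mxE.
    have sp : 0 < (s i)%:C%C :> C by rewrite ltr0C lt_def h s0.
    rewrite -(pmulr_rge0 _ sp); have := mulmx_adj_ge0 ((s i)%:C%C *: p + q).
    rewrite adjD adjZ mulmxDl !mulmxDr -!scalemxAl -!scalemxAr conjc_real !mE !mZ pp qq -ss.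
    by congr (_ <= _); rewrite /x !mE rmorphXn /=; ring.
  rewrite -subr_ge0; have -> : ((1 + s i) ^+ 2)%:C%C - (1 + (t i)%:C%C - x) = 2 * (s i)%:C%C + x.
    by rewrite -ss !rmorphXn rmorphD /= rmorph1; ring.
  exact: x0.
have Nii i : (M *m adj M) i i <= 1.
  have -> : M *m adj M = c *m (K *m adj K) *m c by rewrite /M adjM cc !mulmxA.
  move: (K *m adj K) (Kii i) => K2 K2i.
  rewrite mul_mx_diag mxE mul_diag_mx !mxE mulrAC -rmorphM /= -expr2 exprVn.
  apply: le_trans (ler_wpM2l _ K2i) _; first by rewrite ler0c invr_ge0 sqr_ge0.
  by rewrite -rmorphM /= mulVf // gt_eqF // exprn_gt0.
have := det_hermitian_le1 hN pN Nii.
rewrite det_mulmx det_adj -sqr_normc /M /K !det_mulmx !normrM detc.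
have -> : `|\det P| = 1.
  have := congr1 determinant PP; rewrite det_mulmx det_adj det1 -sqr_normc => /eqP.
  by rewrite sqrp_eq1 ?normr_ge0 // => /eqP.
rewrite mul1r exprMn => le1.
have pr0 : 0 < \prod_i (1 + s i) by apply: prodr_gt0.
have nE : `|(\prod_i (1 + s i)^-1)%:C%C| ^+ 2 = ((\prod_i (1 + s i)) ^- 2)%:C%C :> C.
  rewrite prodfV ger0_norm ?ler0c ?invr_ge0 ?ltW // -rmorphXn /= exprVn; exact: erefl.
have xp : 0 < ((\prod_i (1 + s i)) ^- 2)%:C%C :> C by rewrite ltr0C invr_gt0 exprn_gt0.
rewrite nE in le1; rewrite -(ler_pM2l xp).
apply: (le_trans le1); rewrite prodrXl -rmorphM /= mulVf ?rmorph1 // gt_eqF // exprn_gt0 //.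
Qed.

End Distortion.

Section Busemann.
Variables (R : realType) (n : nat).
Local Notation C := R[i].
Local Notation ci := ('i%C : C).
Implicit Types (P Q T Z X : 'M[C]_n).

Definition disk_ratio (t : R) : R := (1 + Num.sqrt t) / (1 - Num.sqrt t).

(* The cross-ratio R(X, conj Z, Z, conj X), up to conjugation. *)
Definition crm X Z : 'M[C]_n := (X - Z) *m invmx (conj_mx X - Z) *m
  ((conj_mx X - conj_mx Z) *m invmx (X - conj_mx Z)).

Lemma conj_mxV (A : 'M[C]_n) : conj_mx (invmx A) = invmx (conj_mx A).
Proof. by rewrite /conj_mx map_invmx. Qed.

Lemma conj_scalar (a : C) : conj_mx (a%:M : 'M[C]_n) = (a^*%C)%:M.
Proof. by rewrite /conj_mx map_scalar_mx. Qed.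

Lemma crm_hermitian Z : Z^T = Z -> cposdef (imag Z) -> exists T W,
  [/\ W \in unitmx, crm ci%:M Z = T *m adj T, W = Z + ci%:M, Z - ci%:M = T *m W /\ T *m W = W *m T
   & W *m (1%:M - T *m adj T) *m adj W = 4 *: imag Z].
Proof.
move=> sZ pZ; pose W := Z + ci%:M; pose T := (Z - ci%:M) *m invmx W.
have c0 : 2 * ci != 0 :> C by rewrite mulf_neq0 ?i_neq0 // pnatr_eq0.
have aW : adj W = conj_mx Z - ci%:M.
  rewrite /W adjD (adj_sym sZ); congr (_ + _); rewrite /adj conj_scalar conj_i tr_scalar_mx.
  by rewrite raddfN.
have Wu : W \in unitmx.
  have p1 : cposdef (1%:M : 'M[C]_n) by move=> v v0; rewrite mulmx1; exact: mulmx_adj_gt0.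
  apply: (cposdef_unit_of (cposdefD pZ p1) c0).
  rewrite aW scalerDr -imagE scalemx1; apply/matrixP => i j; rewrite !mxE; case: (i == j); rewrite ?mulr1n ?mulr0n; ring.
have TW : Z - ci%:M = T *m W by rewrite mulmxKV.
have cZW : (Z - ci%:M) *m W = W *m (Z - ci%:M).
  rewrite /W mulmxDr !mulmxDl !mulmxDr !mulNmx !mulmxN [Z *m _%:M]scalar_mxC.
  by apply/matrixP => i j; rewrite !mxE; ring.
have WT : T *m W = W *m T by rewrite -TW /T mulmxA -cZW mulmxK.
have sT : T^T = T.
  rewrite /T trmx_mul trmx_inv linearD linearB /= tr_scalar_mx sZ -/W.
  apply: (can_inj (mulKmx Wu)); rewrite (mulKVmx Wu) mulmxA -cZW.
  exact/esym/(mulmxK Wu).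
have aT : adj T = conj_mx T by exact: adj_sym.
clearbody T; exists T, W; split; [exact: Wu| |exact: erefl|by split| ].
  rewrite /crm conj_scalar conj_i aT.
  have -> : ci%:M - Z = - (T *m W) by rewrite -TW opprB.
  have -> : (- ci)%:M - Z = - W by rewrite raddfN /= /W opprD addrC.
  have cW : conj_mx W = conj_mx Z - ci%:M by rewrite /W conj_mxD conj_scalar conj_i raddfN.
  have cTW : conj_mx (T *m W) = conj_mx Z + ci%:M.
    by rewrite -TW conj_mxD conj_mxN conj_scalar conj_i raddfN opprK.
  have -> : (- ci)%:M - conj_mx Z = - (conj_mx T *m conj_mx W).
    by rewrite -conj_mxM cTW raddfN /= opprD addrC.
  have -> : ci%:M - conj_mx Z = - conj_mx W by rewrite cW opprB.
  have cWu : conj_mx W \in unitmx by rewrite /conj_mx map_unitmx.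
  rewrite (invmxN Wu) (invmxN cWu) !mulNmx !mulmxN !opprK (mulmxK Wu) (mulmxK cWu) mulNmx opprK; exact: erefl.
rewrite mulmxBr mulmxBl mulmx1 mulmxA -WT -TW -mulmxA -adjM -WT -TW aW.
have -> : adj (Z - ci%:M) = conj_mx Z + ci%:M.
  rewrite adjD adjN (adj_sym sZ) /adj conj_scalar conj_i tr_scalar_mx raddfN opprK //.
have -> : 4 *: imag Z = - ((2 * ci) *: (Z - conj_mx Z)).
  rewrite imagE scalerA -scaleNr; congr (_ *: _).
  have -> : - (2 * ci * (2 * ci)) = - (4 * (ci * ci)) by ring.
  by rewrite ii mulrN1 opprK.
rewrite /W !mulmxDr !mulmxDl !mulNmx !mulmxN [_ *m ci%:M]scalar_mxC -!scalar_mxM.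
rewrite !mul_scalar_mx; apply/matrixP => i j; rewrite !mxE; ring.
Qed.

Lemma distortion_normal Z : Z^T = Z -> cposdef (imag Z) ->
  exists t : 'I_n -> R, [/\ forall i, 0 <= t i < 1,
    char_poly (crm ci%:M Z) = \prod_i ('X - ((t i)%:C%C)%:P) &
    forall P Q, conj_mx P = P -> conj_mx Q = Q -> P *m Q^T = Q *m P^T -> P - ci *: Q \in unitmx ->
    `|\det (P - Q *m Z)| ^+ 2 <=
      `|\det (P - ci *: Q)| ^+ 2 * \det (imag Z) * (\prod_i disk_ratio (t i))%:C%C].
Proof.
move=> sZ pZ; have [T [W [Wu crmE WE [TW WT] WTW]]] := crm_hermitian sZ pZ.
have Wau : adj W \in unitmx by rewrite /adj unitmx_tr /conj_mx map_unitmx.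
have W4u : W \in unitmx by [].
have p1T : cposdef (1%:M - T *m adj T).
  have Wiu : invmx W \in unitmx by rewrite unitmx_inv.
  have -> : 1%:M - T *m adj T = invmx W *m (4 *: imag Z) *m adj (invmx W).
    rewrite -WTW !mulmxA mulVmx // mul1mx -mulmxA -adjM mulVmx // adj_id mulmx1 //.
  apply: (cposdef_congr Wiu) => v v0; rewrite -scalemxAr -scalemxAl mxE.
  by apply: mulr_gt0; [rewrite ltr0n|exact: (pZ _ v0)].
have h1T : adj (1%:M - T *m adj T) = 1%:M - T *m adj T by rewrite adjD adjN adjM adjK adj_id.
have [U [d [UU UU' d0 UE]]] := hermitian_spectral h1T p1T.
pose t i := 1 - d i.
have TTE : T *m adj T = adj U *m diag_mx (\row_i (t i)%:C%C) *m U.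
  have -> : diag_mx (\row_i (t i)%:C%C) = 1%:M - diag_mx (\row_i (d i)%:C%C) :> 'M[C]_n.
    apply/matrixP => i j; rewrite !mxE; case: (i == j); rewrite ?mulr1n ?mulr0n ?subr0 //.
    by rewrite /t rmorphB rmorph1.
  by rewrite mulmxBr mulmxBl mulmx1 UU' -UE opprB addrC subrK.
have t0 i : 0 <= t i.
  have : ((U *m T) *m adj (U *m T)) i i = (t i)%:C%C.
    rewrite adjM mulmxA -[U *m T *m _]mulmxA TTE !mulmxA UU mul1mx -mulmxA UU mulmx1.
    by rewrite !mxE eqxx mulr1n.
  by rewrite mulmx_adj_diag => h; rewrite -ler0c -h mulmx_adj_ge0.
have t1 i : t i < 1 by rewrite /t ltrBlDr ltrDl.
exists t; split; first by move=> i; rewrite t0 t1.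
- rewrite crmE TTE (char_poly_conjmx _ UU UU') char_poly_trig ?diag_mx_is_trig //.
  by apply: eq_bigr => i _; rewrite !mxE eqxx mulr1n.
move=> P Q rP rQ PQ Eu.
pose E := P - ci *: Q; pose V := invmx E *m conj_mx E.
have cE : conj_mx E = P + ci *: Q by rewrite /E conj_mxD conj_mxN conj_mxZ rP rQ conj_i scaleNr opprK.
have EE : E *m adj E = conj_mx E *m adj (conj_mx E).
  have aE : adj E = P^T + ci *: Q^T.
    by rewrite /adj /E conj_mxD conj_mxN conj_mxZ rP rQ conj_i scaleNr opprK linearD linearZ.
  have -> : adj (conj_mx E) = P^T - ci *: Q^T by rewrite /adj conj_mxK /E linearB linearZ.
  rewrite aE cE /E !mulmxDr !mulmxDl !mulmxN !mulNmx -!scalemxAl -!scalemxAr PQ.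
  apply/matrixP => i j; rewrite !mxE; ring.
have VV : V *m adj V = 1%:M.
  rewrite /V adjM mulmxA -[_ *m conj_mx E *m _]mulmxA -EE !mulmxA mulVmx // mul1mx -adjM mulVmx //.
  exact: adj_id.
have VV' := mulmx1C VV.
have PQZ : (2 * ci) *: (P - Q *m Z) = E *m (1%:M - V *m T) *m W.
  rewrite mulmxBr mulmx1 mulmxBl -[E *m (V *m T) *m W]mulmxA -[V *m T *m W]mulmxA -TW mulmxA [E *m V]mulmxA mulmxV // mul1mx.
  rewrite cE WE mulmxDr mulmxBr (mulmxBl P) (mulmxBl P) (mulmxDl P) (mulmxDl P) -!scalemxAl !mul_mx_scalar.
  apply/matrixP => i j; rewrite !mxE.
  have -> : ci * (ci * Q i j) = - Q i j by rewrite mulrA ii mulN1r.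
  ring.
clearbody V.
(* In the order T V the unitary factor cancels in B B^*, which becomes T T^*. *)
have detVT : \det (1%:M - V *m T) = \det (1%:M - T *m V).
  have Vd : \det V * \det (adj V) = 1 by rewrite -det_mulmx VV det1.
  have -> : 1%:M - V *m T = V *m (1%:M - T *m V) *m adj V.
    by rewrite mulmxBr mulmx1 mulmxBl VV mulmxA -[_ *m V *m _]mulmxA VV mulmx1.
  by rewrite !det_mulmx mulrAC Vd mul1r.
have bound := @det_sub_bound _ _ (T *m V) U t UU UU' t0.
have {}bound : `|\det (1%:M - T *m V)| ^+ 2 <= (\prod_i (1 + Num.sqrt (t i)) ^+ 2)%:C%C.
  by apply: bound; rewrite adjM mulmxA -[T *m V *m _]mulmxA VV mulmx1.
have detI : \det (1%:M - T *m adj T) = (\prod_i (1 - t i))%:C%C.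
  rewrite UE !det_mulmx mulrAC -det_mulmx UU' det1 mul1r det_diag rmorph_prod.
  by apply: eq_bigr => i _; rewrite mxE /t opprB addrC subrK.
have s1 i : Num.sqrt (t i) < 1 by rewrite -sqrtr1 ltr_sqrt.
have rE : (\prod_i (1 + Num.sqrt (t i)) ^+ 2) = \prod_i (1 - t i) * \prod_i disk_ratio (t i).
  rewrite -big_split /=; apply: eq_bigr => i _; rewrite /disk_ratio.
  rewrite -{2}[t i](@sqr_sqrtr R) //; field; rewrite subr_eq0 eq_sym lt_eqF //.
have e1 := congr1 (fun A => `|\det A| ^+ 2) PQZ.
have e2 := congr1 determinant WTW.
have m2 : `|2 * ci| ^+ 2 = 4 :> C.
  have i1 : `|ci| ^+ 2 = 1 :> C by rewrite sqr_normc conj_i mulrN ii opprK.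
  by rewrite normrM exprMn i1 mulr1 normr_nat -natrX.
have kE : `|(2 * ci) ^+ n| ^+ 2 = 4 ^+ n :> C by rewrite normrX exprAC m2.
rewrite /= detZ in e1; move: ((2 * ci) ^+ n) kE e1 => k kE e1.
rewrite !det_mulmx detVT !normrM !exprMn in e1.
rewrite detZ !det_mulmx det_adj mulrAC -sqr_normc detI in e2.
have k0 : 0 < 4 ^+ n :> C by rewrite exprn_gt0 // ltr0n.

rewrite kE in e1; rewrite -(ler_pM2l k0) e1.
have w0 : 0 <= `|\det W| ^+ 2 by rewrite exprn_ge0.
have E0 : 0 <= `|\det E| ^+ 2 by rewrite exprn_ge0.
have -> : 4 ^+ n * (`|\det E| ^+ 2 * \det (imag Z) * (\prod_i disk_ratio (t i))%:C%C) =
  `|\det E| ^+ 2 * (\prod_i (1 + Num.sqrt (t i)) ^+ 2)%:C%C * `|\det W| ^+ 2.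
  rewrite rE rmorphM /=; transitivity (`|\det E| ^+ 2 * (4 ^+ n * \det (imag Z)) * (\prod_i disk_ratio (t i))%:C%C).
    by ring.
  by rewrite -e2; ring.
by apply: ler_wpM2r => //; apply: ler_wpM2l.
Qed.

End Busemann.

Section Distance.
Variables (R : realType) (n : nat).
Local Notation C := R[i].
Local Notation ci := ('i%C : C).
Implicit Types (P Q T Z X : 'M[C]_n) (L : 'M[R]_(n, n + n)).
Local Notation J := (symplectic_form n C).

Definition isotropic_frame L := row_free L /\ L *m symplectic_form n R *m L^T = 0.

Definition height Z : R := complex.Re (\det (imag Z)).
Definition pairing2 L Z : R := complex.Re (`|\det (pairing (complexify L) Z)| ^+ 2).
Definition busemann L Z : R := pairing2 L Z / height Z.

Lemma height_gt0 Z : siegel Z -> 0 < height Z /\ \det (imag Z) = (height Z)%:C%C.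
Proof.
move=> hZ; have pZ := siegel_imag hZ; have sZ := siegel_sym hZ.
have [Y YE] := real_mxP (conj_imag Z).
have sY : Y^T = Y by apply: complexify_inj; rewrite complexifyT -YE imag_tr.
have pY : posdef Y by apply: complexify_posdef; rewrite -YE.
have e : \det (imag Z) = (\det Y)%:C%C by rewrite YE /complexify det_map_mx.
rewrite /height e /=; split=> //.
have [d [d0 /(_ 0)]] := posdef_spectrum sY pY; rewrite raddf0 addr0 => ->.
by apply: prodr_gt0 => i _; rewrite addr0.
Qed.

Lemma pairing2E L Z : `|\det (pairing (complexify L) Z)| ^+ 2 = (pairing2 L Z)%:C%C.
Proof. by rewrite /pairing2 RRe_real // rpredX // normr_real. Qed.

(** A real Lagrangian is transverse to every point of the Siegel space: if v kills p - q Z, then the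
    imaginary part of the form gives v q = 0, and so v p = 0. *)
Lemma isotropic_pairing_unit L Z : isotropic_frame L -> siegel Z -> pairing (complexify L) Z \in unitmx.
Proof.
move=> [fL iL] hZ; have sZ := siegel_sym hZ; have pZ := siegel_imag hZ.
move: fL iL; rewrite -[L]hsubmxK; move: (lsubmx L) (rsubmx L) => p q fL iL.
have pq : p *m q^T = q *m p^T.
  move: iL; rewrite /symplectic_form mul_row_block !mulmx0 add0r addr0 mulmx1 mulmxN mulmx1.
  by rewrite tr_row_mx mul_row_col mulNmx addrC => /eqP; rewrite subr_eq0 => /eqP.
have -> : complexify (row_mx p q) = row_mx (complexify p) (complexify q) by rewrite /complexify map_row_mx.
rewrite pairing_row -row_free_unit -kermx_eq0; apply/rowV0P => v /sub_kermxP vA.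
pose A := (complexify p - complexify q *m Z) *m complexify q^T.
have AE : A - adj A = - ((2 * ci) *: (complexify q *m imag Z *m adj (complexify q))).
  rewrite /A adjM adjD adjN adjM !adj_complexify trmxK (adj_sym sZ) scalemxAl scalemxAr -imagE.
  rewrite mulmxBl mulmxBr !mulmxBr !mulmxBl -!complexifyM pq !complexifyM !mulmxA.
  by apply/matrixP => i j; rewrite !mxE; ring.
have c0 : 2 * ci != 0 :> C by rewrite mulf_neq0 ?i_neq0 // pnatr_eq0.
have vq : v *m complexify q = 0.
  apply/eqP/negPn/negP => v0; have := pZ _ v0.
  suff -> : v *m complexify q *m imag Z *m adj (v *m complexify q) = 0 by rewrite mxE ltxx.
  apply: (scalerI c0); rewrite scaler0 adjM; apply: oppr_inj; rewrite oppr0.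
  have -> : - ((2 * ci) *: (v *m complexify q *m imag Z *m (adj (complexify q) *m adj v))) = v *m (A - adj A) *m adj v.
    rewrite AE mulmxN mulNmx; congr (- _).
    by rewrite -[v *m (_ *: _)]scalemxAr -[(_ *: _) *m adj v]scalemxAl !mulmxA.
  rewrite mulmxBr mulmxBl.
  have vA0 : v *m A = 0 by rewrite /A mulmxA vA mul0mx.
  have -> : v *m adj A *m adj v = adj (v *m A *m adj v) by rewrite !adjM adjK mulmxA.
  by rewrite vA0 mul0mx /adj /conj_mx map_mx0 trmx0 subr0.
have vp : v *m complexify p = 0 by move: vA; rewrite mulmxBr mulmxA vq mul0mx subr0.
have fc : row_free (complexify (row_mx p q)) by rewrite /complexify row_free_map.
have : v *m complexify (row_mx p q) = 0.
  by rewrite /complexify map_row_mx mul_mx_row -/(complexify p) -/(complexify q) vp vq row_mx0.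
by move/(congr1 (fun x => x *m pinvmx (complexify (row_mx p q)))); rewrite mul0mx -mulmxA mulmxVp // mulmx1.
Qed.

Lemma pairing2_gt0 L Z : isotropic_frame L -> siegel Z -> 0 < pairing2 L Z.
Proof.
move=> iL hZ; have := isotropic_pairing_unit iL hZ; rewrite unitmxE unitfE => d0.
by rewrite -ltr0C -pairing2E exprn_gt0 // normr_gt0.
Qed.

Lemma busemann_gt0 L Z : isotropic_frame L -> siegel Z -> 0 < busemann L Z.
Proof. by move=> iL hZ; have [h0 _] := height_gt0 hZ; rewrite divr_gt0 ?pairing2_gt0. Qed.

Lemma ratio_transfer (e a i : C) (u v x z r : R) : 0 < x -> 0 < z -> x%:C%C * i = z%:C%C ->
  e * x%:C%C = u%:C%C -> a * x%:C%C = v%:C%C -> a <= e * i * r%:C%C -> v / z <= u / x * r.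
Proof.
move=> x0 z0 hz hu hv h; have x0' : 0 < x%:C%C :> C by rewrite ltr0C.
have : (v * x)%:C%C <= (u * z * r)%:C%C :> C.
  rewrite !rmorphM /= -hv -hu -hz.
  have -> : e * x%:C%C * (x%:C%C * i) * r%:C%C = e * i * r%:C%C * x%:C%C * x%:C%C by ring.
  by rewrite !(ler_pM2r x0').
rewrite lecR => {}h; rewrite ler_pdivrMr // mulrAC -mulrA [X in _ <= X]mulrAC ler_pdivlMr //.
by rewrite mulrCA mulrA [z * u]mulrC.
Qed.

(** Reduction to the base point i by w |-> s w s + U, where s^2 = Im X and U = Re X. It conjugates
    the cross-ratio by [s] and turns the real frame (P, Q) into another one. *)
Lemma crm_spectrum X Z : siegel X -> siegel Z ->
  exists t : 'I_n -> R, [/\ forall i, 0 <= t i < 1,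
    char_poly (crm X Z) = \prod_i ('X - ((t i)%:C%C)%:P) &
    forall L, isotropic_frame L -> busemann L Z <= busemann L X * \prod_i disk_ratio (t i)].
Proof.
move=> hX hZ; have sX := siegel_sym hX; have sZ := siegel_sym hZ.
have [Y YE] := real_mxP (conj_imag X).
have sY : Y^T = Y by apply: complexify_inj; rewrite complexifyT -YE imag_tr.
have pY : posdef Y by apply: complexify_posdef; rewrite -YE; exact: siegel_imag.
have [S [sS pS SS]] := posdef_sqrt sY pY.
pose s := complexify S; have su : s \in unitmx by rewrite complexify_unit posdef_unitmx.
have cs : conj_mx s = s by exact: conj_complexify.
have ts : s^T = s by rewrite -complexifyT sS.
have ss : s *m s = imag X by rewrite -complexifyM SS YE.
pose U := X - ci *: imag X.
have cU : conj_mx U = U.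
  rewrite /U conj_mxD conj_mxN conj_mxZ conj_i conj_imag scaleNr opprK.
  have -> : conj_mx X = X - (2 * ci) *: imag X by rewrite -imagE opprB addrC subrK.
  by rewrite -addrA; congr (_ + _); rewrite -scaleNr -scalerDl -scaleNr; congr (_ *: _); ring.
have tU : U^T = U by rewrite /U linearB linearZ /= sX imag_tr.
have sis : s *m ci%:M *m s = X - U by rewrite mul_mx_scalar -scalemxAl ss /U opprB addrC subrK.
clearbody U s.
pose z := invmx s *m (Z - U) *m invmx s.
have szs : s *m z *m s = Z - U by rewrite /z !mulmxA (mulmxV su) mul1mx (mulmxKV su).
have cis : conj_mx (invmx s) = invmx s by rewrite conj_mxV cs.
have tis : (invmx s)^T = invmx s by rewrite trmx_inv ts.
have siu : invmx s \in unitmx by rewrite unitmx_inv.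
have tz : z^T = z by rewrite /z !trmx_mul tis linearB /= sZ tU mulmxA.
have iz : imag z = invmx s *m imag Z *m invmx s.
  rewrite /imag /z !conj_mxM cis conj_mxD conj_mxN cU -scalemxAr -scalemxAl -mulmxBl -mulmxBr.
  have -> : Z - U - (conj_mx Z - U) = Z - conj_mx Z by rewrite opprB addrA subrK.
  exact: erefl.
have pz : cposdef (imag z).
  have -> : imag z = invmx s *m imag Z *m adj (invmx s) by rewrite /adj cis tis.
  exact: (cposdef_congr siu (siegel_imag hZ)).
have cz : s *m conj_mx z *m s = conj_mx Z - U.
  by rewrite -{1 2}cs -!conj_mxM szs conj_mxD conj_mxN cU.
have cc : s *m (- ci)%:M *m s = conj_mx X - U.
  by rewrite -{1 2}cs -conj_i -conj_scalar -!conj_mxM sis conj_mxD conj_mxN cU.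
clearbody z.
have diff (a b x y : 'M[C]_n) : s *m a *m s = x - U -> s *m b *m s = y - U -> x - y = s *m (a - b) *m s.
  by move=> e1 e2; rewrite mulmxBr mulmxBl e1 e2 opprB addrA subrK.
have crmE : crm X Z = s *m crm ci%:M z *m invmx s.
  have hi : siegel (ci%:M : 'M[C]_n).
    exists 0, 1%:M; split; rewrite ?trmx0 ?trmx1 //; first by move=> v v0; rewrite mulmx1; exact: mulmx_tr_gt0.
    by rewrite /complexify map_mx0 add0r map_mx1 scalemx1.
  have hz : siegel z by apply/siegelP.
  have u1 := siegel_pairing_unitC hi hz; have u2 := siegel_pairing_unit hi hz.
  have inv (a : 'M[C]_n) : a \in unitmx -> invmx (s *m a *m s) = invmx s *m invmx a *m invmx s.
    move=> au; have u : s *m a *m s \in unitmx by rewrite !unitmx_mul su au.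
    apply: (can_inj (mulKmx u)); rewrite (mulmxV u) !mulmxA (mulmxK su) (mulmxK au); exact/esym/(mulmxV su).
  rewrite /crm conj_scalar conj_i; rewrite conj_scalar conj_i in u1.
  rewrite (diff _ _ _ _ sis szs) (diff _ _ _ _ cc szs) (diff _ _ _ _ cc cz) (diff _ _ _ _ sis cz).
  rewrite (inv _ u1) (inv _ u2) !mulmxA.
  by rewrite !(mulmxK su, mulmxKV su).
have frameE L : isotropic_frame L -> exists P Q, [/\ conj_mx P = P, conj_mx Q = Q, P *m Q^T = Q *m P^T &
    forall w, pairing (complexify L) w = P - Q *m w].
  move=> [_]; rewrite -[L]hsubmxK; move: (lsubmx L) (rsubmx L) => p q iL.
  exists (complexify p), (complexify q); split; [exact: conj_complexify|exact: conj_complexify| |].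
    rewrite -!complexifyT -!complexifyM; congr complexify.
    move: iL; rewrite /symplectic_form mul_row_block !mulmx0 add0r addr0 mulmx1 mulmxN mulmx1.
    by rewrite tr_row_mx mul_row_col mulNmx addrC => /eqP; rewrite subr_eq0 => /eqP.
  by move=> w; rewrite {1}/complexify map_row_mx pairing_row.
have [t [t01 tchar tbound]] := distortion_normal tz pz; exists t; split; first exact: t01.
  by rewrite crmE (@char_poly_conjmx _ _ _ (invmx s) s) ?mulVmx ?mulmxV.
move=> L iL; have [P [Q [rP rQ PQ LE]]] := frameE L iL.
pose P' := (P - Q *m U) *m invmx s; pose Q' := Q *m s.
have eq w w' : s *m w' *m s = w - U -> P - Q *m w = (P' - Q' *m w') *m s.
  move=> e; rewrite /P' /Q' mulmxBl (mulmxKV su) -!mulmxA -/(mulmx _ _).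
  by rewrite [s *m (w' *m s)]mulmxA e mulmxBr opprB addrA subrK.
have eZ := eq _ _ szs; have eX := eq _ _ sis.
have Eu : P' - ci *: Q' \in unitmx.
  have := isotropic_pairing_unit iL hX; rewrite LE eX unitmx_mul su andbT.
  by rewrite mul_mx_scalar.
have rP' : conj_mx P' = P' by rewrite /P' conj_mxM cis conj_mxD conj_mxN conj_mxM rP rQ cU.
have rQ' : conj_mx Q' = Q' by rewrite /Q' conj_mxM rQ cs.
have PQ' : P' *m Q'^T = Q' *m P'^T.
  rewrite /P' /Q' !trmx_mul ts tis linearB /= trmx_mul tU !mulmxA (mulmxKV su) (mulmxK su).
  by rewrite mulmxBl mulmxBr PQ !mulmxA.
clear eq; clearbody P' Q'.
have := tbound _ _ rP' rQ' PQ' Eu.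
have [hZ0 hZE] := height_gt0 hZ; have [hX0 hXE] := height_gt0 hX.
have dZ : `|\det (P - Q *m Z)| ^+ 2 = `|\det (P' - Q' *m z)| ^+ 2 * `|\det s| ^+ 2.
  by rewrite eZ det_mulmx normrM exprMn.
have dX : `|\det (P - Q *m X)| ^+ 2 = `|\det (P' - ci *: Q')| ^+ 2 * `|\det s| ^+ 2.
  by rewrite eX det_mulmx normrM exprMn mul_mx_scalar.
have ds : `|\det s| ^+ 2 = (height X)%:C%C.
  by rewrite -hXE -ss det_mulmx sqr_normc -det_adj /adj cs ts.
have hs0 : 0 < `|\det s| ^+ 2 by rewrite ds ltr0C.
have dz : `|\det s| ^+ 2 * \det (imag z) = (height Z)%:C%C.
  rewrite -hZE iz !det_mulmx sqr_normc -det_adj /adj cs ts.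
  have : \det s * \det (invmx s) = 1 by rewrite -det_mulmx (mulmxV su) det1.
  move: (\det s : C) (\det (invmx s) : C) (\det (imag Z) : C) => a b c ab.
  by transitivity ((a * b) * (a * b) * c); [ring|rewrite ab !mul1r].
have pX := etrans (esym dX) (etrans (congr1 (fun A => `|\det A| ^+ 2) (esym (LE X))) (pairing2E L X)).
have pZ := etrans (esym dZ) (etrans (congr1 (fun A => `|\det A| ^+ 2) (esym (LE Z))) (pairing2E L Z)).
move: (`|\det s| ^+ 2 : C) ds hs0 dz pX pZ => d -> _.
move: (`|\det (P' - ci *: Q')| ^+ 2 : C) (`|\det (P' - Q' *m z)| ^+ 2 : C) (\det (imag z) : C) => e a i.
move=> dz pX pZ h; exact: (ratio_transfer hX0 hZ0 dz pX pZ h).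
Qed.

End Distance.

(** * Lipschitz bounds for the distance and translation lengths *)

Section RiemannianDistance.
Variables (R : realType) (n : nat).
Local Notation C := R[i].
Implicit Types (Z X : 'M[C]_n) (L : 'M[R]_(n, n + n)) (g h : 'M[R]_(n + n)).

Lemma eigenvaluesP m (M : 'M[C]_m) (s : seq C) :
  char_poly M = \prod_(x <- s) ('X - x%:P) -> perm_eq (eigenvalues M) s.
Proof.
move=> e; apply: prod_XsubC_eq; rewrite -e /eigenvalues; case: closed_field_poly_normal => r /=.
by rewrite (monicP (char_poly_monic M)) scale1r => <-.
Qed.

Lemma conj_sym Z : Z^T = Z -> (conj_mx Z)^T = conj_mx Z.
Proof. by move=> sZ; rewrite -conj_mxT sZ. Qed.

Lemma sframe_free Z : row_free (sframe Z).
Proof.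
by apply/row_freeP; exists (col_mx 0 1%:M); rewrite mul_row_col mulmx0 mulmx1 add0r.
Qed.

Lemma lag_sframe Z : (lag_of_sym Z :=: sframe Z)%MS.
Proof. exact: genmxE. Qed.

Definition log_ratio (t : R) : R := ln (disk_ratio t).

Lemma dist_RE X Z (t : 'I_n -> R) : siegel X -> siegel Z ->
  char_poly (crm X Z) = \prod_i ('X - ((t i)%:C%C)%:P) ->
  dist_R X Z = Num.sqrt (\sum_i log_ratio (t i) ^+ 2).
Proof.
move=> hX hZ e; have sX := siegel_sym hX; have sZ := siegel_sym hZ.
rewrite /dist_R; congr Num.sqrt.
have sXc := conj_sym sX; have sZc := conj_sym sZ.
have u1 : pairing (sframe (conj_mx X)) Z \in unitmx by rewrite pairing_sframe // siegel_pairing_unitC.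
have u2 : pairing (sframe X) (conj_mx Z) \in unitmx by rewrite pairing_sframe // siegel_pairing_unit.
have [U [U' [e1 e2 ->]]] := cross_ratioE sZc sZ (lag_sframe X) (lag_sframe (conj_mx X)) (sframe_free X) u1 u2.
have pe : perm_eq (eigenvalues (U' *m (pairing (sframe X) Z *m invmx (pairing (sframe (conj_mx X)) Z) *m
    (pairing (sframe (conj_mx X)) (conj_mx Z) *m invmx (pairing (sframe X) (conj_mx Z)))) *m U))
    [seq (t i)%:C%C | i : 'I_n].
  apply: eigenvaluesP; rewrite (char_poly_conjmx _ e1 e2) !pairing_sframe // big_map big_enum /=.
  exact: e.
by rewrite (perm_big _ pe) /= big_map big_enum /=.
Qed.

Lemma sum_le_sqrt (a : 'I_n -> R) : \sum_i a i <= Num.sqrt n%:R * Num.sqrt (\sum_i a i ^+ 2).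
Proof.
have [n0|n0] := posnP n.
  by rewrite big1 ?mulr_ge0 ?sqrtr_ge0 // => i _; have := ltn_ord i; rewrite {2}n0.
rewrite -sqrtrM ?ler0n //; apply: (le_trans (ler_norm _)); rewrite -sqrtr_sqr ler_wsqrtr //.
set S := \sum_i a i; set Q := \sum_i _; have N0 : 0 < n%:R :> R by rewrite ltr0n.
have : 0 <= \sum_i (n%:R * a i - S) ^+ 2 by apply: sumr_ge0 => i _; exact: sqr_ge0.
have -> : \sum_i (n%:R * a i - S) ^+ 2 = n%:R * (n%:R * Q - S ^+ 2).
  transitivity (\sum_i (n%:R ^+ 2 * a i ^+ 2 - 2 * n%:R * S * a i + S ^+ 2)).
    by apply: eq_bigr => i _; ring.
  rewrite big_split /= sumrB -!mulr_sumr -/S -/Q sumr_const card_ord -mulr_natl; ring.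
by rewrite pmulr_rge0 // subr_ge0.
Qed.

Lemma disk_ratio_ge1 (t : R) : 0 <= t < 1 -> 1 <= disk_ratio t.
Proof.
move=> /andP[t0 t1]; have s1 : Num.sqrt t < 1 by rewrite -sqrtr1 ltr_sqrt.
have s0 := sqrtr_ge0 t; rewrite /disk_ratio ler_pdivlMr ?subr_gt0 //; lra.
Qed.

Lemma ln_prod (a : 'I_n -> R) : (forall i, 0 < a i) ->
  0 < \prod_i a i /\ ln (\prod_i a i) = \sum_i ln (a i).
Proof.
move=> a0; elim/big_ind2: _ => [|x p y q [x0 xE] [y0 yE]|i _]; first by rewrite ln1.
  by rewrite mulr_gt0 // lnM ?posrE // xE yE.
by [].
Qed.

Lemma dist_RC X Z : siegel X -> siegel Z -> dist_R X Z = dist_R Z X.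
Proof.
move=> hX hZ; have [t [_ e _]] := crm_spectrum hX hZ.
have sX := siegel_sym hX; have sZ := siegel_sym hZ.
have u1 := siegel_pairing_unit hX hZ; have u2 := siegel_pairing_unitC hX hZ.
have E : crm Z X = (X - Z) *m invmx (X - conj_mx Z) *m ((conj_mx X - conj_mx Z) *m invmx (conj_mx X - Z)).
  rewrite /crm -(opprB X Z) -(opprB X (conj_mx Z)) -(opprB (conj_mx X) (conj_mx Z)) -(opprB (conj_mx X) Z).
  by rewrite (invmxN u1) (invmxN u2) !(mulNmx, mulmxN, opprK).
have tB (A B : 'M[C]_n) : A^T = A -> B^T = B -> (A - B)^T = A - B by move=> sA sB; rewrite linearB /= sA sB.
have sXc := conj_sym sX; have sZc := conj_sym sZ.
have E' : char_poly (crm Z X) = char_poly (crm X Z).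
  rewrite E /crm; exact: (char_poly_sym4 (tB _ _ sX sZ) (tB _ _ sXc sZ) (tB _ _ sXc sZc) (tB _ _ sX sZc)).
exact: etrans (dist_RE hX hZ e) (esym (dist_RE hZ hX (etrans E' e))).
Qed.

(** The logarithm of the product of the [disk_ratio] is the sum of the log lambda_i, which
    Cauchy-Schwarz bounds by sqrt n times the distance. *)
Lemma busemann_dist L X Z : isotropic_frame L -> siegel X -> siegel Z ->
  ln (busemann L Z) - ln (busemann L X) <= Num.sqrt n%:R * dist_R X Z.
Proof.
move=> iL hX hZ; have [t [t01 e /(_ _ iL)]] := crm_spectrum hX hZ.
have r0 i : 0 < disk_ratio (t i) by rewrite (lt_le_trans ltr01) // disk_ratio_ge1.
have [p0 pE] := ln_prod r0.
have := sum_le_sqrt (fun i => log_ratio (t i)); rewrite -(dist_RE hX hZ e) /log_ratio -pE.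
move: (busemann_gt0 iL hX) (busemann_gt0 iL hZ) p0.
generalize (busemann L X) (busemann L Z) (\prod_i disk_ratio (t i)) (Num.sqrt n%:R * dist_R X Z).
move=> x z r d x0 z0 r0' le h; apply: le_trans le.
by rewrite lerBlDl -lnM ?posrE // ler_ln ?posrE ?mulr_gt0.
Qed.

Lemma busemann_dist_abs L X Z : isotropic_frame L -> siegel X -> siegel Z ->
  `|ln (busemann L X) - ln (busemann L Z)| <= Num.sqrt n%:R * dist_R X Z.
Proof.
move=> iL hX hZ; have h1 := busemann_dist iL hX hZ; have h2 := busemann_dist iL hZ hX.
have h3 := dist_RC hX hZ; move: h1 h2 h3.
generalize (ln (busemann L X)) (ln (busemann L Z)) (dist_R X Z) (dist_R Z X) => x z d d' h1 h2 e.
by rewrite -e in h2; rewrite ler_norml lerNl opprB h1 h2.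
Qed.

Lemma isotropic_act L g : symplectic g -> isotropic_frame L -> isotropic_frame (L *m g^T).
Proof.
move=> sg [fL iL]; have gu := symplectic_unit sg; split.
  by rewrite /row_free mxrankMfree // row_free_unit unitmx_tr.
by rewrite trmx_mul trmxK !mulmxA -[L *m g^T *m _]mulmxA -[L *m (_ *m _) *m g]mulmxA sg.
Qed.

Lemma isotropic_oo : isotropic_frame (frame_oo R n).
Proof.
split; first exact: frame_oo_free.
rewrite /frame_oo /symplectic_form mul_row_block !mulmx0 !mul0mx !mul1mx !addr0.
by rewrite tr_row_mx trmx0 mul_row_col mul0mx mulmx0 addr0.
Qed.

Lemma isotropic_sframe (Y : 'M[R]_n) : Y^T = Y -> isotropic_frame (frame Y).
Proof.
move=> sY; split; first exact: frame_free.
rewrite /frame /symplectic_form mul_row_block !mulmx0 add0r addr0 mulmx1 mulmxN mulmx1 sY.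
by rewrite tr_row_mx trmx1 sY mul_row_col mulmx1 mulNmx mul1mx addNr.
Qed.

Lemma pairing_act (W : 'M[R]_(n, n + n)) g X : symplectic g -> siegel X ->
  pairing (complexify (W *m g^T)) (siegel_act g X) *m denom g X = pairing (complexify W) X.
Proof.
move=> sg hX; have [Qu hgX e _] := siegel_actP sg hX.
have := congr1 trmx e; rewrite !trmx_mul !trmxK => e'.
rewrite /pairing -mulmxA -e' complexifyM complexifyT -!mulmxA; congr (_ *m _).
by rewrite mulmxA -{2}(complexify_symplectic sg) !mulmxA.
Qed.

Lemma busemann_act L g X : symplectic g -> siegel X ->
  busemann (L *m g^T) (siegel_act g X) = busemann L X.
Proof.
move=> sg hX; have [Qu hgX _ iE] := siegel_actP sg hX.
have [h0 hE] := height_gt0 hX; have [h0' hE'] := height_gt0 hgX.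
have q0 : `|\det (denom g X)| != 0 by rewrite normr_eq0 -unitfE -unitmxE.
have pe (A1 A2 Q : 'M[C]_n) : A2 *m Q = A1 -> `|\det A1| ^+ 2 = `|\det A2| ^+ 2 * `|\det Q| ^+ 2.
  by move=> <-; rewrite det_mulmx normrM exprMn.
have ue : (pairing2 L X)%:C%C = (pairing2 (L *m g^T) (siegel_act g X))%:C%C * `|\det (denom g X)| ^+ 2.
  exact: etrans (esym (pairing2E L X)) (etrans (pe _ _ _ (pairing_act L sg hX))
    (congr1 (fun z => z * _) (pairing2E (L *m g^T) (siegel_act g X)))).
have ye : (height X)%:C%C = (height (siegel_act g X))%:C%C * `|\det (denom g X)| ^+ 2.
  by rewrite -hE -hE' iE !det_mulmx det_adj sqr_normc; ring.
rewrite /busemann; move: h0 h0' q0 ue ye.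
generalize (height X) (height (siegel_act g X)) (pairing2 L X) (pairing2 (L *m g^T) (siegel_act g X)).
generalize (`|\det (denom g X)|).
move=> q y y' u u' y0 y0' q0 ue ye.
have e : u' * y = u * y'.
  by apply: (@complexI R); rewrite !(rmorphM (real_complex R)) /= ye ue; ring.
by apply/eqP; rewrite eqr_div ?(gt_eqF y0) ?(gt_eqF y0') // e.
Qed.

Lemma busemannM (U : 'M[R]_n) L X : busemann (U *m L) X = \det U ^+ 2 * busemann L X.
Proof.
rewrite /busemann mulrA; congr (_ / _); apply: (@complexI R).
have := pairing2E (U *m L) X; have := pairing2E L X.
have -> : \det (pairing (complexify (U *m L)) X) = (\det U)%:C%C * \det (pairing (complexify L) X).
  by rewrite complexifyM pairingM det_mulmx /complexify det_map_mx.
generalize (\det (pairing (complexify L) X)) (pairing2 (U *m L) X) (pairing2 L X) (\det U) => d u' u v eu <-.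
by rewrite (rmorphM (real_complex R)) /= -eu normrM exprMn sqr_normc conjc_real -(rmorphM (real_complex R)) -expr2.
Qed.

Lemma translation_bound g h A : (0 < n)%N -> shilov_data g h A ->
  2 * ln `|\det A| <= Num.sqrt n%:R * translation_length g.
Proof.
move=> n0 dg; have [sh gE eA] := dg; have Au := expanding_unit eA; have hu := symplectic_unit sh.
have A0 : 0 < `|\det A| by rewrite normr_gt0 -unitfE -unitmxE.
have s0 : 0 < Num.sqrt n%:R :> R by rewrite sqrtr_gt0 ltr0n.
have sd : symplectic (diag_sp A).
  apply/symplectic_blockP; rewrite !trmx0 !mul0mx !mulmx0 subr0; split=> //.
  by rewrite -trmx_mul mulVmx // trmx1.
have sg : symplectic g by rewrite gE; apply: symplecticM (symplecticV sh); exact: symplecticM sd.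
rewrite -ler_pdivrMl // /translation_length; apply: lb_le_inf.
  (* The base point i shows that the infimum is over a nonempty set, so a lower bound of the set
     bounds it. *)
  exists (dist_R ('i%C)%:M (siegel_act g ('i%C)%:M)); exists ('i%C)%:M => //.
  exists 0, 1%:M; split; rewrite ?trmx0 ?trmx1 //; first by move=> v v0; rewrite mulmx1; exact: mulmx_tr_gt0.
  by rewrite /complexify map_mx0 add0r map_mx1 scalemx1.
move=> _ [X hX <-]; rewrite ler_pdivrMl //.
have [_ hgX _ _] := siegel_actP sg hX.
pose L := frame_oo R n *m h^T.
have iL : isotropic_frame L by apply: isotropic_act => //; exact: isotropic_oo.
have LE : L *m g^T = A^T *m L.
  have gh : g *m h = h *m block_mx A 0 0 (invmx A)^T by rewrite gE mulmxKV.
  rewrite /L -[LHS]mulmxA -trmx_mul gh trmx_mul [LHS]mulmxA frame_oo_act trmx0.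
  by rewrite mulmxA mul_mx_row mulmx1 mulmx0.
have bE : busemann L X = \det A ^+ 2 * busemann L (siegel_act g X).
  by rewrite -(busemann_act L sg hX) LE busemannM det_tr.
apply: le_trans (busemann_dist_abs iL hX hgX); apply: le_trans (ler_norm _).
move: (busemann_gt0 iL hgX); rewrite bE; generalize (busemann L (siegel_act g X)) => b b0.
by rewrite -real_normK ?num_real // lnM ?posrE ?exprn_gt0 // addrK lnXn // mulr_natl lexx.
Qed.

End RiemannianDistance.

(** * Cores and tubes *)

Section Core.
Variables (R : realType) (n : nat).
Local Notation C := R[i].
Implicit Types (X : 'M[C]_n) (g h k : 'M[R]_(n + n)) (D : 'M[R]_n) (W : 'M[R]_(n, n + n)).

(** For the standard frames at 0 and oo this is -X. Thus the core, where the ratio is the negative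
    of its conjugate, generalizes the imaginary axis. *)
Definition core_ratio (W0 W1 : 'M[R]_(n, n + n)) X : 'M[C]_n :=
  pairing (complexify W0) X *m invmx (pairing (complexify W1) X).

Lemma pairing_conj m (W : 'M[R]_(m, n + n)) X :
  pairing (complexify W) (conj_mx X) = conj_mx (pairing (complexify W) X).
Proof.
rewrite -[W]hsubmxK /complexify map_row_mx !pairing_row conj_mxD conj_mxN conj_mxM.
by rewrite -!/(complexify _) !conj_complexify.
Qed.

Lemma frame0E : frame (0 : 'M[R]_n) = row_mx 0 1%:M.
Proof. by rewrite /frame trmx0. Qed.

Lemma cross_antireal m (U : 'M[C]_(n, m)) (U' : 'M[C]_(m, n)) (p0 p1 q0 q1 : 'M[C]_n) :
  U *m U' = 1%:M -> p0 \in unitmx -> p1 \in unitmx ->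
  U' *m (q0 *m invmx q1 *m (p1 *m invmx p0)) *m U = - 1%:M -> q0 *m invmx q1 = - (p0 *m invmx p1).
Proof.
move=> e u0 u1 /(congr1 (fun M => U *m M *m U')).
rewrite mulmxN mulmx1 mulNmx e !mulmxA e mul1mx -mulmxA e mulmx1.
move/(congr1 (fun M => M *m (p0 *m invmx p1))).
by rewrite mulNmx mul1mx !mulmxA (mulmxKV u0) (mulmxK u1).
Qed.

Lemma invmx_ratio (p0 p1 : 'M[C]_n) : p0 \in unitmx -> p1 \in unitmx ->
  p1 *m invmx p0 \in unitmx /\ p0 *m invmx p1 = invmx (p1 *m invmx p0).
Proof.
move=> u0 u1; have u : p1 *m invmx p0 \in unitmx by rewrite unitmx_mul unitmx_inv u0 u1.
by split=> //; apply: (can_inj (mulKmx u)); rewrite (mulmxV u) !mulmxA (mulmxKV u0) (mulmxV u1).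
Qed.

Lemma tube_core_ratio g h A X (W0 W1 : 'M[R]_(n, n + n)) : shilov_data g h A -> tube_core g X ->
  isotropic_frame W0 -> isotropic_frame W1 ->
  (W0 :=: frame 0 *m h^T)%MS -> (W1 :=: frame_oo R n *m h^T)%MS ->
  conj_mx (core_ratio W0 W1 X) = - core_ratio W0 W1 X.
Proof.
move=> dg [hX [Lp [Lm [[h1 [A1 [dg1 /eqmxP ep /eqmxP em]]] cr]]]] i0 i1 e0 e1.
have [u1 u0] := shilov_unique dg dg1; have sX := siegel_sym hX.
have l0 : (complexify Lm :=: complexify W0)%MS.
  apply/map_eqmx; apply: (eqmx_trans em); apply: (eqmx_trans (lag_actE _ _)).
  exact: eqmx_trans (eqmx_trans u0 (eqmx_refl _)) (eqmx_sym e0).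
have l1 : (complexify Lp :=: complexify W1)%MS.
  apply/map_eqmx; apply: (eqmx_trans ep); apply: (eqmx_trans (lag_actE _ _)).
  exact: eqmx_trans u1 (eqmx_sym e1).
have f0 : row_free (complexify W0) by rewrite /complexify row_free_map; have [] := i0.
have p0 := isotropic_pairing_unit i0 hX; have p1 := isotropic_pairing_unit i1 hX.
have p1c : pairing (complexify W1) (conj_mx X) \in unitmx by rewrite pairing_conj /conj_mx map_unitmx.
have [U [U' [e e' crE]]] := cross_ratioE sX (conj_sym sX) l0 l1 f0 p1c p0.
have := cross_antireal e p0 p1 (etrans (esym crE) cr).
by rewrite /core_ratio conj_mxM conj_mxV !pairing_conj.
Qed.

Lemma antireal_inv (G : 'M[C]_n) : G \in unitmx -> conj_mx G = - G -> conj_mx (invmx G) = - invmx G.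
Proof. by move=> Gu e; rewrite conj_mxV e invmxN. Qed.

(** The position of two elements is known up to inverses only; inversion exchanges the two frames
    and inverts the ratio. *)
Lemma tube_core_ratio_sign g h A X (W0 W1 : 'M[R]_(n, n + n)) : shilov_data g h A ->
  tube_core g X \/ tube_core (invmx g) X ->
  isotropic_frame W0 -> isotropic_frame W1 ->
  (W0 :=: frame 0 *m h^T)%MS -> (W1 :=: frame_oo R n *m h^T)%MS ->
  conj_mx (core_ratio W0 W1 X) = - core_ratio W0 W1 X.
Proof.
move=> dg [c|c] i0 i1 e0 e1; first exact: (tube_core_ratio dg c).
have [hX _] := c.
have p0 := isotropic_pairing_unit i0 hX; have p1 := isotropic_pairing_unit i1 hX.
have e0' : (W1 :=: frame 0 *m (h *m symplectic_form n R)^T)%MS.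
  by rewrite trmx_mul mulmxA form_0.
have e1' : (W0 :=: frame_oo R n *m (h *m symplectic_form n R)^T)%MS.
  by rewrite trmx_mul mulmxA form_oo mulNmx; exact: eqmx_trans e0 (eqmx_sym (eqmx_opp _)).
have := tube_core_ratio (shilov_flip dg) c i1 i0 e0' e1'.
have [u E] := invmx_ratio p0 p1.
by rewrite /core_ratio E; exact: antireal_inv.
Qed.

Lemma frame_decomp (Y : 'M[R]_n) : Y^T = Y -> frame Y = Y *m frame_oo R n + frame 0.
Proof. by move=> sY; rewrite frame0E /frame_oo mul_mx_row mulmx1 mulmx0 add_row_mx addr0 add0r /frame sY. Qed.

Lemma norm_det_transfer (A B K P Q S T : 'M[C]_n) : `|\det A| = `|\det B| ->
  A *m K = P *m Q -> B *m K = - S *m T -> `|\det P| * `|\det Q| = `|\det S| * `|\det T|.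
Proof.
move=> nAB e1 e2.
have f1 : `|\det A| * `|\det K| = `|\det P| * `|\det Q| by rewrite -!normrM -!det_mulmx e1.
have f2 : `|\det B| * `|\det K| = `|\det S| * `|\det T|.
  rewrite -normrM -det_mulmx e2 det_mulmx normrM; congr (_ * _).
  by rewrite -scaleN1r detZ normrM normrX normrN1 expr1n mul1r.
by rewrite -f1 nAB f2.
Qed.

Lemma norm2_detM (A B : 'M[C]_n) : `|\det (A *m B)| ^+ 2 = `|\det A| ^+ 2 * `|\det B| ^+ 2.
Proof. by rewrite det_mulmx normrM exprMn. Qed.

Lemma norm_square_transfer (a b u v : R) (x y z : C) : u%:C%C = `|x| ^+ 2 * `|z| ^+ 2 ->
  v%:C%C = `|y| ^+ 2 * `|z| ^+ 2 -> `|a%:C%C| * `|x| = `|b%:C%C| * `|y| -> a ^+ 2 * u = b ^+ 2 * v.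
Proof.
move=> eu ev e; apply: (@complexI R).
have sq (c : R) : (c ^+ 2)%:C%C = `|c%:C%C| ^+ 2 :> C.
  by rewrite sqr_normc conjc_real -(rmorphM (real_complex R)) -expr2.
have pr (c d : R) : (c * d)%:C%C = c%:C%C * d%:C%C :> C by exact: rmorphM.
rewrite (pr (a ^+ 2) u) (pr (b ^+ 2) v) !sq eu ev; transitivity ((`|a%:C%C| * `|x|) ^+ 2 * `|z| ^+ 2); first by ring.
by rewrite e; ring.
Qed.

Section Ratio.
Variables (h : 'M[R]_(n + n)) (X : 'M[C]_n).
Hypotheses (sh : symplectic h) (hX : siegel X).

Local Notation p Y := (pairing (complexify (frame Y *m h^T)) X).
Local Notation poo := (pairing (complexify (frame_oo R n *m h^T)) X).
Local Notation G := (core_ratio (frame 0 *m h^T) (frame_oo R n *m h^T) X).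

Lemma iso_frame (Y : 'M[R]_n) : Y^T = Y -> isotropic_frame (frame Y *m h^T).
Proof. by move=> sY; apply: isotropic_act sh _; exact: isotropic_sframe. Qed.

Lemma iso_oo : isotropic_frame (frame_oo R n *m h^T).
Proof. by apply: isotropic_act sh _; exact: isotropic_oo. Qed.

Lemma pairing_frameE (Y : 'M[R]_n) : Y^T = Y -> p Y = (G + complexify Y) *m poo.
Proof.
move=> sY; have pu := isotropic_pairing_unit iso_oo hX.
rewrite mulmxDl (mulmxKV pu) (frame_decomp sY) mulmxDl complexifyD -mulmxA complexifyM.
by rewrite /pairing !mulmxDl !mulmxA addrC.
Qed.

Lemma norm_det_conj (A B : 'M[C]_n) : conj_mx A = - B -> `|\det A| = `|\det B|.
Proof.
move=> e; have := congr1 (fun M => `|\det M|) e.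
by rewrite /conj_mx det_map_mx -scaleN1r detZ normrM normrX normrN1 expr1n mul1r norm_conjC.
Qed.

Lemma core_busemann_eq D : D^T = D -> conj_mx G = - G ->
  busemann (frame D *m h^T) X = busemann (frame (- D) *m h^T) X.
Proof.
move=> sD aG; have sN : (- D)^T = - D by rewrite linearN /= sD.
have nG : `|\det (G + complexify D)| = `|\det (G + complexify (- D))|.
  by apply: norm_det_conj; rewrite conj_mxD aG conj_complexify /complexify map_mxN opprB addrC.
have e : pairing2 (frame D *m h^T) X = pairing2 (frame (- D) *m h^T) X.
  apply: (@complexI R); apply: etrans (esym (pairing2E _ X)) (etrans _ (pairing2E _ X)).
  rewrite (pairing_frameE sD) (pairing_frameE sN); move: nG.
  generalize poo (G + complexify D) (G + complexify (- D)) => b x y nG.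
  by rewrite !det_mulmx !normrM nG.
by rewrite /busemann e.
Qed.

(** The ratios are related by G' = (G + D^2) (G + 1)^-1, so G' + D and G' - D factor through G + D
    and G - D, with the factors D + 1 and D - 1 in front. On the core of the second pair |det (G' +
    D)| = |det (G' - D)|. *)
Lemma core_busemann_shift D : D^T = D ->
  let G' := core_ratio (frame (D *m D) *m h^T) (frame 1%:M *m h^T) X in conj_mx G' = - G' ->
  \det (D + 1%:M) ^+ 2 * busemann (frame D *m h^T) X =
  \det (D - 1%:M) ^+ 2 * busemann (frame (- D) *m h^T) X.
Proof.
move=> sD G' aG'.
have sN : (- D)^T = - D by rewrite linearN /= sD.
have sDD : (D *m D)^T = D *m D by rewrite trmx_mul sD.
have s1 : (1%:M : 'M[R]_n)^T = 1%:M by exact: trmx1.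
pose d := complexify D.
have G1u : p 1%:M \in unitmx by exact: isotropic_pairing_unit (iso_frame s1) hX.
have pu := isotropic_pairing_unit iso_oo hX.
have c1 : complexify (1%:M : 'M[R]_n) = 1%:M by rewrite /complexify map_mx1.
have GE : G' *m (G + 1%:M) = G + d *m d.
  have e : G' *m p 1%:M = p (D *m D) by rewrite /G' /core_ratio (mulmxKV G1u).
  move: e; rewrite (pairing_frameE sDD) (pairing_frameE s1) (complexifyM D D) c1; move: pu.
  generalize poo => b pu; rewrite mulmxA => /(congr1 (fun M => M *m invmx b)).
  by rewrite !(mulmxK pu).
clearbody G'; move: GE (pairing_frameE sD) (pairing_frameE sN); generalize G poo => H b GE pD pN.
have e1 : (G' + d) *m (H + 1%:M) = (d + 1%:M) *m (H + d).
  rewrite mulmxDl GE !mulmxDl !mulmxDr mulmx1 !mul1mx.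
  by apply/matrixP => i j; rewrite !mxE; ring.
have e2 : (G' - d) *m (H + 1%:M) = - (d - 1%:M) *m (H - d).
  rewrite mulmxBl GE mulNmx !mulmxBl !mulmxBr !mulmxDr mulmx1 !mul1mx.
  by apply/matrixP => i j; rewrite !mxE; ring.
have nG : `|\det (G' + d)| = `|\det (G' - d)|.
  by apply: norm_det_conj; rewrite conj_mxD aG' conj_complexify opprB addrC.
have n1 : `|\det (d + 1%:M)| * `|\det (H + d)| = `|\det (d - 1%:M)| * `|\det (H - d)|.
  exact: norm_det_transfer nG e1 e2.
have dp : \det (d + 1%:M) = (\det (D + 1%:M))%:C%C.
  by rewrite -c1 /d -complexifyD /complexify det_map_mx.
have dm : \det (d - 1%:M) = (\det (D - 1%:M))%:C%C.
  by rewrite -c1 /d /complexify -map_mxB det_map_mx.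
have eD := etrans (esym (pairing2E (frame D *m h^T) X)) (congr1 (fun M => `|\det M| ^+ 2) pD).
have eN := etrans (esym (pairing2E (frame (- D) *m h^T) X)) (congr1 (fun M => `|\det M| ^+ 2) pN).
have cN : complexify (- D) = - d by rewrite /complexify map_mxN.
have {}eD := etrans eD (norm2_detM (H + d) b).
rewrite cN in eN; have {}eN := etrans eN (norm2_detM (H - d) b).
rewrite dp dm in n1.
rewrite /busemann; move: eD eN; generalize (pairing2 (frame D *m h^T) X) (pairing2 (frame (- D) *m h^T) X).
move=> u v eD eN; rewrite !mulrA; congr (_ / _); exact: norm_square_transfer eD eN n1.
Qed.

End Ratio.
End Core.

(** * Widths of tubes *)

Section Coth.
Variable R : realType.
Implicit Types (s x y M : R).

Lemma mul2l_lt (a x y : R) : 0 < a -> x < y -> a * x < a * y.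
Proof. by move=> a0 xy; rewrite ltr_pM2l. Qed.

Lemma mul2l_lt_inv (a x y : R) : 0 < a -> a * x < a * y -> x < y.
Proof. by move=> a0; rewrite ltr_pM2l. Qed.

Lemma width_arith (u v w x y p r a b c W V : R) :
  `|u - v| <= p -> `|w - v| <= p -> `|u - x| <= r -> `|w - y| <= r ->
  2 * a + x = 2 * b + y -> c < a - b -> 2 * W <= c -> p < W -> r < V -> W < V.
Proof.
rewrite !ler_norml => /andP[? ?] /andP[? ?] /andP[? ?] /andP[? ?] *; lra.
Qed.

Lemma ln_square_transfer (a b x y : R) : 0 < a -> 0 < b -> 0 < x -> 0 < y ->
  a ^+ 2 * x = b ^+ 2 * y -> 2 * ln a + ln x = 2 * ln b + ln y.
Proof.
move=> a0 b0 x0 y0 /(congr1 (@ln R)).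
by rewrite !expr2 !lnM ?posrE ?mulr_gt0 // => ?; lra.
Qed.

Lemma ln_le_sub1 x : 0 < x -> ln x <= x - 1.
Proof. by move=> x0; rewrite -{1}[x](subrK 1) addrC; apply: le_ln1Dx; lra. Qed.

(** Twice [arccoth]; at x = e^u it is log coth (u / 2). *)
Definition coth_ln x : R := ln ((x + 1) / (x - 1)).

(* The tangent inequality of the convex function u |-> ln coth (u / 2) at
   u = ln M; both halves are instances of the weighted AM-GM inequality. *)
Lemma coth_ln_tangent s M : 1 < s -> 1 < M ->
  coth_ln M - (2 * M / (M ^+ 2 - 1)) * (ln s - ln M) <= coth_ln s.
Proof.
move=> s1 M1; have s0 : 0 < s by lra.
have M0 : 0 < M by lra.
have sp : 0 < s + 1 by lra. have sm : 0 < s - 1 by lra.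
have Mp : 0 < M + 1 by lra. have Mm : 0 < M - 1 by lra.
rewrite /coth_ln !ln_div ?posrE //.
pose L := ln M - ln s.
pose a := ln (s + 1) - ln (M + 1) + L; pose b := ln (s - 1) - ln (M - 1) + L.
have nz := (gt_eqF s0, gt_eqF M0, gt_eqF sp, gt_eqF sm, gt_eqF Mp, gt_eqF Mm).
have lMs : ln (M / s) = L by rewrite ln_div ?posrE.
have ea : ln ((s + 1) * M / ((M + 1) * s)) = a.
  by rewrite ln_div ?posrE ?mulr_gt0 // !lnM ?posrE // /a /L; lra.
have eb : ln ((s - 1) * M / ((M - 1) * s)) = b.
  by rewrite ln_div ?posrE ?mulr_gt0 // !lnM ?posrE // /b /L; lra.
(* The inequality ln x <= x - 1 is used at 1 / y with weight M and at M / (s y) with weight 1; by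
   [e] the weighted right-hand sides cancel. *)
have ha : L <= (M + 1) * a.
  set y := (s + 1) * M / ((M + 1) * s) in ea.
  have y0 : 0 < y by rewrite divr_gt0 // mulr_gt0.
  have i1 : - a <= y^-1 - 1 by rewrite -ea -lnV ?posrE // ln_le_sub1 // invr_gt0.
  have i2 : L - a <= M / s / y - 1.
    have pMs : M / s \is Num.pos by rewrite posrE divr_gt0.
    have py : y \is Num.pos by rewrite posrE.
    have e' := ln_div pMs py; rewrite lMs ea in e'; rewrite -e'.
    exact: (ln_le_sub1 (divr_gt0 (divr_gt0 M0 s0) y0)).
  have e : M * (y^-1 - 1) + (M / s / y - 1) = 0.
    by rewrite /y; field; rewrite !nz.
  have := ler_wpM2l (ltW M0) i1; lra.
have hb : (M - 1) * b <= - L.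
  set y := (s - 1) * M / ((M - 1) * s) in eb.
  have y0 : 0 < y by rewrite divr_gt0 // mulr_gt0.
  have i1 : b <= y - 1 by rewrite -eb ln_le_sub1.
  have i2 : L <= M / s - 1 by rewrite -lMs ln_le_sub1 // divr_gt0.
  have e : (M - 1) * (y - 1) + (M / s - 1) = 0 by rewrite /y; field; rewrite !nz.
  have := ler_wpM2l (ltW Mm) i1; lra.
have ha' : L / (M + 1) <= a by rewrite ler_pdivrMr // mulrC.
have hb' : b <= - L / (M - 1) by rewrite ler_pdivlMr // mulrC.
have e : 2 * M / (M ^+ 2 - 1) * (ln s - ln M) = - (L / (M + 1)) + - L / (M - 1).
  have M2 : M ^+ 2 - 1 != 0 by rewrite subr_sqr_1 mulf_neq0 ?nz.
  by rewrite /L; field; rewrite M2 !nz.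
by rewrite e; rewrite /a /b in ha' hb' *; lra.
Qed.

Lemma coth_ln_sum n (s : 'I_n -> R) M : (0 < n)%N -> (forall i, 1 < s i) -> 1 < M ->
  \sum_i ln (s i) < n%:R * ln M -> n%:R * coth_ln M < \sum_i coth_ln (s i).
Proof.
move=> n0 s1 M1 lt; pose c := 2 * M / (M ^+ 2 - 1).
have c0 : 0 < c.
  by rewrite divr_gt0 ?mulr_gt0 ?subr_gt0 ?exprn_egt1 // (lt_trans ltr01).
apply: (@lt_le_trans _ _ (\sum_i (coth_ln M - c * (ln (s i) - ln M)))); last first.
  by apply: ler_sum => i _; exact: coth_ln_tangent.
rewrite sumrB -mulr_sumr sumrB !sumr_const card_ord -[coth_ln M *+ n]mulr_natl -[ln M *+ n]mulr_natl.
by rewrite ltrBrDr gtrDl pmulr_rlt0 // subr_lt0.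
Qed.

Lemma coth_ln_anti x y : 1 < x -> x <= y -> coth_ln y <= coth_ln x.
Proof.
move=> x1 xy; have xm : 0 < x - 1 by lra. have ym : 0 < y - 1 by lra.
rewrite /coth_ln ler_ln ?posrE ?divr_gt0 //; try lra.
by rewrite ler_pdivrMr // mulrAC ler_pdivlMr //; nra.
Qed.

Lemma coth_ln_gt0 x : 1 < x -> 0 < coth_ln x.
Proof. by move=> x1; apply: ln_gt0; rewrite ltr_pdivlMr; lra. Qed.

End Coth.

Section Width.
Variables (R : realType) (n : nat).
Local Notation C := R[i].
Implicit Types (X Z : 'M[C]_n) (g h k q : 'M[R]_(n + n)) (A D : 'M[R]_n).
Hypothesis n0 : (0 < n)%N.

Lemma det_expanding A : expanding A -> 1 < `|\det A|.
Proof.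
move=> eA; have [rs rsE] := closed_field_poly_normal (char_poly (complexify A)).
rewrite (monicP (char_poly_monic _)) scale1r in rsE.
have szr : size rs = n.
  by have := congr1 (fun p => size (polyseq p)) rsE; rewrite size_char_poly size_prod_XsubC => -[].
have dE : `|\det (complexify A)| = \prod_(z <- rs) `|z|.
  have := congr1 (fun p : {poly C} => p`_0) rsE; rewrite char_poly_det coef0_prod_XsubC szr.
  by move=> /(mulrI _)/= ->; rewrite ?normr_prod // unitrX ?unitrN1.
have r1 z : z \in rs -> 1 < `|z|.
  move=> zr; apply: eA; rewrite eigenvalue_root_char rsE root_prod_XsubC //.
have lt : 1 < `|\det (complexify A)|.
  rewrite dE; move: szr r1 {rsE dE}; case: rs => [|z rs] /= szr r1; first by move: n0; rewrite -szr.
  rewrite big_cons; have h1 : 1 < `|z| by apply: r1; rewrite mem_head.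
  have h2 : 1 <= \prod_(j <- rs) `|j|.
    rewrite big_seq; elim/big_ind: _ => // [x y x1 y1|j jr]; first exact: mulr_ege1.
    by apply: ltW; apply: r1; rewrite in_cons jr orbT.
  by rewrite (lt_le_trans h1) // ler_peMr.
have cdE : \det (complexify A) = (\det A)%:C%C by rewrite /complexify det_map_mx.
move: lt; rewrite cdE -(ltr_pXn2r (n := 2)) ?nnegrE ?normr_ge0 ?ler01 //.
rewrite sqr_normc conjc_real -(rmorphM (real_complex R)) /= expr1n ltcR -expr2 => lt.
by rewrite -(ltr_pXn2r (n := 2)) ?nnegrE ?normr_ge0 ?ler01 // expr1n real_normK ?num_real.
Qed.

Lemma sqrt_n_gt0 : 0 < Num.sqrt n%:R :> R.
Proof. by rewrite sqrtr_gt0 ltr0n. Qed.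

Lemma sqrt_nE : Num.sqrt n%:R * Num.sqrt n%:R = n%:R :> R.
Proof. by rewrite -expr2 sqr_sqrtr // ler0n. Qed.

(** |det A|^(1/n), the geometric mean of the moduli of the eigenvalues. *)
Definition geo_mean A : R := expR (ln `|\det A| / n%:R).

(** [translation_bound] divided by 2 n says that the exponent in [width] is at least ln |det A| / n,
    and arccoth is decreasing. *)
Lemma width_bound g h A : shilov_data g h A ->
  0 < width g /\ 2 * (Num.sqrt n%:R * width g) <= n%:R * coth_ln (geo_mean A).
Proof.
move=> dg; have [_ _ eA] := dg; have d1 := det_expanding eA.
have tb := translation_bound n0 dg; have s0 := sqrt_n_gt0; have ss := sqrt_nE.
have N0 : 0 < n%:R :> R by rewrite ltr0n.
have l0 : 0 < ln `|\det A| by exact: ln_gt0.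
have le : ln `|\det A| / n%:R <= translation_length g / (2 * Num.sqrt n%:R).
  rewrite ler_pdivrMr // mulrAC ler_pdivlMr ?mulr_gt0 //.
  move: tb s0 ss; generalize (translation_length g) (ln `|\det A|) (Num.sqrt n%:R : R) => t l s tb s0' <-.
  by have := ler_wpM2l (ltW s0') tb; lra.
have m1 : 1 < geo_mean A by rewrite /geo_mean expR_gt1 divr_gt0.
have e1 : geo_mean A <= expR (translation_length g / (2 * Num.sqrt n%:R)) by rewrite ler_expR.
have wE : width g = Num.sqrt n%:R * (coth_ln (expR (translation_length g / (2 * Num.sqrt n%:R))) / 2) by [].
rewrite wE; move: e1; generalize (expR (translation_length g / (2 * Num.sqrt n%:R))) => x e1.
have x1 : 1 < x by exact: lt_le_trans e1.
split; first by rewrite mulr_gt0 // divr_gt0 // coth_ln_gt0.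
have e2 (s u : R) : 2 * (s * (s * (u / 2))) = s * s * u by field.
by rewrite e2 ss ler_pM2l // coth_ln_anti.
Qed.

Lemma dist_Rxx X : siegel X -> dist_R X X = 0.
Proof.
move=> hX; rewrite (@dist_RE _ _ X X (fun=> 0)) //.
  rewrite /log_ratio /disk_ratio sqrtr0 addr0 subr0 divr1 ln1 big1 ?sqrtr0 // => i _.
  by rewrite expr0n.
rewrite /crm subrr !mul0mx char_poly_trig; last by apply/is_trig_mxP => i j _; rewrite mxE.
by apply: eq_bigr => i _; rewrite mxE.
Qed.

Lemma tube_core_shilov g X : tube_core g X -> siegel X /\ exists h A, shilov_data g h A.
Proof. by move=> [hX [Lp [Lm [[h [A [dg _ _]]] _]]]]; split=> //; exists h, A. Qed.

Lemma tube_core_sub g : tube_core g `<=` tube g.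
Proof.
move=> X cX; have [hX [h [A dg]]] := tube_core_shilov cX; have [w0 _] := width_bound dg.
split=> //; apply: (@le_lt_trans _ _ (0%R)%:E); last by rewrite lte_fin.
by rewrite -(dist_Rxx hX); apply: ereal_inf_lbound; exists X.
Qed.

Lemma tube_near g X : tube g X -> siegel X /\ exists2 Z, tube_core g Z & dist_R X Z < width g.
Proof.
move=> [hX /ereal_inf_lt[_ [Z cZ <-]]]; rewrite lte_fin => lt; split=> //; by exists Z.
Qed.

Lemma geo_mean_gt1 A : 1 < `|\det A| -> 1 < geo_mean A.
Proof. by move=> A1; rewrite /geo_mean expR_gt1 divr_gt0 ?ltr0n // ln_gt0. Qed.

Lemma ln_geo_mean A : n%:R * ln (geo_mean A) = ln `|\det A|.
Proof. by rewrite /geo_mean expRK mulrC divfK // pnatr_eq0 -lt0n. Qed.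

(** [coth_ln_sum] for the eigenvalues 1 + e_i of [D], whose product is below that of n copies of
    [geo_mean A]. *)
Lemma det_coth_lt A D : D^T = D -> posdef (D - 1%:M) -> \det D < `|\det A| -> 1 < `|\det A| ->
  [/\ 0 < \det (D - 1%:M), 0 < \det (D + 1%:M) &
    n%:R * coth_ln (geo_mean A) < ln (\det (D + 1%:M)) - ln (\det (D - 1%:M))].
Proof.
move=> sD pD ltD A1.
have sDm : (D - 1%:M)^T = D - 1%:M by rewrite linearB /= sD trmx1.
have [e [epos eE]] := posdef_spectrum sDm pD.
have dm : \det (D - 1%:M) = \prod_i e i.
  by have := eE 0; rewrite raddf0 addr0 => ->; apply: eq_bigr => i _; rewrite addr0.
have dD : \det D = \prod_i (e i + 1) by have := eE 1; rewrite subrK.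
have dp : \det (D + 1%:M) = \prod_i (e i + 1 + 1).
  have := eE 2; have -> : D - 1%:M + 2%:M = D + 1%:M.
    by rewrite -addrA; congr (_ + _); rewrite -raddfN -raddfD; congr (_%:M); ring.
  by move=> ->; apply: eq_bigr => i _; ring.
have p1 i : 0 < e i + 1 by rewrite addr_gt0.
have p2 i : 0 < e i + 1 + 1 by rewrite addr_gt0.
have [dm0 lm] := ln_prod epos; have [dD0 lD] := ln_prod p1; have [dp0 lp] := ln_prod p2.
rewrite -dm in dm0 lm; rewrite -dD in dD0 lD; rewrite -dp in dp0 lp.
have A0 : 0 < `|\det A| by exact: lt_trans A1.
split=> //.
have -> : ln (\det (D + 1%:M)) - ln (\det (D - 1%:M)) = \sum_i coth_ln (e i + 1).
  by rewrite lp lm -sumrB; apply: eq_bigr => i _; rewrite /coth_ln addrK ln_div ?posrE.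
apply: (coth_ln_sum n0 _ (geo_mean_gt1 A1)) => [i|]; first by rewrite ltrDr.
by rewrite -lD ln_geo_mean ltr_ln ?posrE.
Qed.

(* Here q moves X into the second tube, so the frame h2 = q h transports the two
   Lagrangians +-D, whose Busemann functions compare the two cores. *)
Lemma width_lt g d q G E h A D k B X : symplectic q -> symplectic g -> symplectic d ->
  G = g \/ G = invmx g -> E = d \/ E = invmx d ->
  shilov_data G h A -> shilov_data (invmx q *m E *m q) k B ->
  D^T = D -> posdef (D - 1%:M) -> \det D < `|\det A| ->
  (frame_oo R n *m k^T :=: frame 1%:M *m h^T)%MS ->
  (frame (0 : 'M[R]_n) *m k^T :=: frame (D *m D) *m h^T)%MS ->
  tube g X -> tube d (siegel_act q X) -> width g < width d.
Proof.
move=> sq sg sd GE EE dG dk sD pD ltD e1 e0 /tube_near[hX [Z1 c1 l1]] /tube_near[hqX [Z2 c2 l2]].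
have [sh _ eA] := dG; have qu := symplectic_unit sq.
have gu := symplectic_unit sg; have du := symplectic_unit sd.
have [w0 wle] : 0 < width g /\ 2 * (Num.sqrt n%:R * width g) <= n%:R * coth_ln (geo_mean A).
  case: GE => GE; first by rewrite -GE; exact: width_bound dG.
  have := width_bound (shilov_flip dG); rewrite GE invmxK /geo_mean det_tr; exact.
have sN : (- D)^T = - D by rewrite linearN /= sD.
have [hZ1 _] := tube_core_shilov c1; have [hZ2 _] := tube_core_shilov c2.
have c1' : tube_core G Z1 \/ tube_core (invmx G) Z1.
  by case: GE => ->; [left|right; rewrite invmxK].
have c2' : tube_core E Z2 \/ tube_core (invmx E) Z2.
  by case: EE => ->; [left|right; rewrite invmxK].
have EE' : q *m (invmx q *m E *m q) *m invmx q = E by rewrite !mulmxA (mulmxV qu) mul1mx (mulmxK qu).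
have dq := shilov_conj sq dk; rewrite {}EE' in dq.
pose h2 := q *m h; have sh2 : symplectic h2 by exact: symplecticM.
have s1 : (1%:M : 'M[R]_n)^T = 1%:M by exact: trmx1.
have sDD : (D *m D)^T = D *m D by rewrite trmx_mul sD.
have b1 : busemann (frame D *m h^T) Z1 = busemann (frame (- D) *m h^T) Z1.
  apply: (core_busemann_eq sh hZ1 sD); apply: (tube_core_ratio_sign dG c1') => //.
    by apply: (iso_frame sh); rewrite trmx0.
  exact: (iso_oo sh).
have b2 : \det (D + 1%:M) ^+ 2 * busemann (frame D *m h2^T) Z2 =
    \det (D - 1%:M) ^+ 2 * busemann (frame (- D) *m h2^T) Z2.
  apply: (core_busemann_shift sh2 hZ2 sD); apply: (tube_core_ratio_sign dq c2').
  - exact: (iso_frame sh2 sDD).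
  - exact: (iso_frame sh2 s1).
  - by rewrite /h2 !trmx_mul !mulmxA; apply: eqmx_sym; exact: eqmxMr.
  - by rewrite /h2 !trmx_mul !mulmxA; apply: eqmx_sym; exact: eqmxMr.
have bq (L : 'M[R]_(n, n + n)) : busemann (L *m h2^T) (siegel_act q X) = busemann (L *m h^T) X.
  by rewrite /h2 trmx_mul mulmxA busemann_act.
have iD := iso_frame sh sD; have iN := iso_frame sh sN.
have iD2 := iso_frame sh2 sD; have iN2 := iso_frame sh2 sN.
have k1 := busemann_dist_abs iD hX hZ1; have k2 := busemann_dist_abs iN hX hZ1.
have k3 := busemann_dist_abs iD2 hqX hZ2; have k4 := busemann_dist_abs iN2 hqX hZ2.
rewrite !bq in k3 k4; rewrite b1 in k1.
have [dm0 dp0 Jens] := det_coth_lt sD pD ltD (det_expanding eA).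
have lb2 : 2 * ln (\det (D + 1%:M)) + ln (busemann (frame D *m h2^T) Z2) =
    2 * ln (\det (D - 1%:M)) + ln (busemann (frame (- D) *m h2^T) Z2).
  have B1 := busemann_gt0 iD2 hZ2; have B2 := busemann_gt0 iN2 hZ2.
  exact: (ln_square_transfer dp0 dm0 B1 B2 b2).
have s0 := sqrt_n_gt0.
have m1 : Num.sqrt n%:R * dist_R X Z1 < Num.sqrt n%:R * width g by exact: (mul2l_lt s0 l1).
have m2 : Num.sqrt n%:R * dist_R (siegel_act q X) Z2 < Num.sqrt n%:R * width d by exact: (mul2l_lt s0 l2).
apply: (mul2l_lt_inv s0).
(* The difference of the two log Busemann functions changes by 2 log (det (D + 1) / det (D - 1))
   from [Z1] to [Z2]. The way over [X] and its image allows a change below 2 sqrt n (w(g) + w(d)),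
   whereas [Jens] and [wle] make it exceed 4 sqrt n w(g). *)
exact: (width_arith k1 k2 k3 k4 lb2 Jens wle m1 m2).
Qed.

End Width.

(** * The deck group *)

Section CyclicSubgroups.
Variable Gamma : groupType.
Implicit Types (g h gamma delta : Gamma).

Lemma cyclic_subgroup_inv gamma g : cyclic_subgroup gamma g -> cyclic_subgroup gamma g^-1%g.
Proof. by move=> [k [] ->]; exists k; [right|left; rewrite invgK]. Qed.

Lemma expg_subgroup gamma a b : cyclic_subgroup gamma (gamma ^+ a * gamma ^- b)%g.
Proof.
case: (leqP b a) => ab.
  by exists (a - b)%N; left; rewrite -{1}(subnK ab) expgnDr mulgK.
by exists (b - a)%N; right; rewrite -{1}(subnK (ltnW ab)) expgnDr invgM mulVKg.
Qed.

Lemma cyclic_subgroup_mul gamma g h : cyclic_subgroup gamma g -> cyclic_subgroup gamma h ->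
  cyclic_subgroup gamma (g * h)%g.
Proof.
have com a b : (gamma ^- a * gamma ^+ b = gamma ^+ b * gamma ^- a)%g.
  by apply: commuteVg; rewrite -!expgnDr addnC.
move=> [a [] ->] [b [] ->].
- by exists (a + b)%N; left; rewrite expgnDr.
- exact: expg_subgroup.
- by rewrite com; exact: expg_subgroup.
- by exists (b + a)%N; right; rewrite expgnDr invgM.
Qed.

Hypothesis torsion_free : forall g (k : nat), (g ^+ k.+1 = 1)%g -> g = 1%g.

(** If delta = gamma^k and gamma = delta^l up to signs, then absence of torsion forces k l = 1. *)
Lemma mutual_powers gamma delta : gamma <> 1%g ->
  cyclic_subgroup gamma delta -> cyclic_subgroup delta gamma ->
  delta = gamma \/ delta = gamma^-1%g.
Proof.
move=> g1 [k kE] [l lE].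
have [e eE dE] : exists2 e, e = gamma \/ e = gamma^-1%g & delta = (e ^+ k)%g.
  by case: kE => ->; [exists gamma; [left|]|exists gamma^-1%g; [right|rewrite expVgn]].
suff <- : e = delta by [].
have e1 : e <> 1%g by case: eE => -> //; rewrite -invg1 => /invg_inj.
have : e = (e ^+ (k * l))%g \/ e = (e ^- (k * l))%g.
  rewrite expgnA -dE; case: eE lE => -> [] gE.
  - by left.
  - by right.
  - by right; rewrite -gE.
  - by left; rewrite gE invgK.
case => [E|E].
- case kl: (k * l)%N E => [|m]; first by rewrite expg0.
  rewrite expgS -{1}[e]mulg1 => /mulgI/esym E.
  case: m kl E => [|m] kl E; last by case: e1; exact: torsion_free E.
  have k1 : k = 1%N by move: kl => /eqP; rewrite muln_eq1 => /andP[/eqP].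
  by rewrite dE k1 expg1.
- case: e1; apply: (@torsion_free e (k * l)%N).
  by rewrite expgS {1}E mulVg.
Qed.

(** q^2 commutes with gamma, so it is a power of gamma and is inverted by q. It also commutes with
    q, so it is torsion and trivial; then q = 1 and gamma^2 = 1. *)
Lemma no_inversion gamma q : gamma <> 1%g -> (q^-1 * gamma * q = gamma^-1)%g ->
  (forall h, (gamma * h = h * gamma)%g -> cyclic_subgroup gamma h) -> False.
Proof.
move=> g1 qE cent; apply: g1.
have Eq : (gamma * q = q * gamma^-1)%g by rewrite -qE !mulgA mulgV mul1g.
have EV : (gamma^-1 * q = q * gamma)%g.
  by apply: (mulgI gamma); rewrite mulVKg mulgA Eq mulgVK.
have EX k : (gamma ^+ k * q = q * gamma ^- k)%g.
  elim: k => [|k IH]; first by rewrite !expg0 invg1 mul1g mulg1.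
  by rewrite {1}expgS -mulgA IH mulgA Eq -mulgA -invgM -expgSr.
have EXV k : (gamma ^- k * q = q * gamma ^+ k)%g.
  elim: k => [|k IH]; first by rewrite !expg0 invg1 mul1g mulg1.
  by rewrite {1}expgSr invgM -mulgA IH mulgA EV -mulgA -expgS.
have [k kE] : cyclic_subgroup gamma (q * q)%g.
  by apply: cent; rewrite mulgA Eq -mulgA EV mulgA.
have k0 : (gamma ^+ (k + k) = 1)%g.
  have [E|E] := kE.
  - have := EX k; rewrite -E -mulgA => /mulgI e.
    by rewrite expgnDr -E {1}e mulVg.
  - have := EXV k; rewrite -E -mulgA => /mulgI e.
    by rewrite expgnDr -{1}e E mulVg.
case: k kE k0 => [|k] kE k0; last by rewrite addSn in k0; exact: torsion_free k0.
have q1 : q = 1%g.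
  apply: (@torsion_free q 1); rewrite expgS expg1.
  by case: kE => ->; rewrite expg0 ?invg1.
have := qE; rewrite q1 invg1 mul1g mulg1 => e.
by apply: (@torsion_free gamma 1); rewrite expgS expg1 {2}e mulgV.
Qed.

End CyclicSubgroups.

(** * Torsion-freeness and commuting simple elements *)

Section Deck.
Variables (R : realType) (S : topologicalType) (Gamma : groupType).
Variable H : hyperbolization R S Gamma.
Implicit Types (g h q gamma delta : Gamma).

Local Notation U := (@upper_half_plane R).

Lemma motion_no_period (N : motion R) (k : nat) : motion_pos N ->
  iter k.+1 (moebius (motion_mx N)) (0, 1) <> (0, 1).
Proof.
case: N => [l|b] pos zk.
- have /= l1 : 1 < l by []; have l0 : 0 < l by apply: lt_trans l1.
  have zE j : (iter j (moebius (dil l)) (0, 1)).2 = (l ^+ 2) ^+ j.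
    elim: j => [|j IH]; first by rewrite expr0.
    by rewrite iterS (moebius_dil _ (lt0r_neq0 l0)) [(_, _).2]/= IH [RHS]exprS.
  have : 1 < (l ^+ 2) ^+ k.+1 by rewrite exprn_egt1 // exprn_egt1.
  by rewrite -zE [iter _ _ _]zk ltxx.
- have zE j : (iter j (moebius (trans b)) (0, 1)).1 = b *+ j.
    elim: j => [|j IH]; first by rewrite mulr0n.
    by rewrite iterS moebius_trans /= IH mulrSr.
  have : 0 < b *+ k.+1 by rewrite pmulrn_lgt0.
  by rewrite -zE [iter _ _ _]zk ltxx.
Qed.

Lemma deck_torsion_free g (k : nat) : (g ^+ k.+1 = 1)%g -> g = 1%g.
Proof.
move=> gk; case: (pselect (g = 1%g)) => // g1.
have [g' [m [N [gE [dm N0 em]]]]] := axis_exists H g1.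
have g'k : (g' ^+ k.+1 = 1)%g by case: gE => -> //; rewrite expVgn gk invg1.
have dN := det_motion N0.
pose z j := iter j (moebius (motion_mx N)) (0 : R, 1 : R).
have Uz j : U (z j) by elim: j => [|j IH]; [exact: U_i|exact: moebius_uhp].
have Um j : U (moebius m (z j)) by exact: moebius_uhp.
have dz j : deck H (g' ^+ j)%g (moebius m (z 0%N)) = moebius m (z j).
  elim: j => [|j IH]; first by rewrite expg0 deck1 //; exact: (Um 0%N).
  by rewrite expgS deckM ?IH ?(hol_rel_moebius dm dN em) //; exact: (Um 0%N).
case: (@motion_no_period N k N0).
apply: (moebius_inj dm (Uz k.+1) (Uz 0%N)).
by rewrite -[LHS](dz k.+1) g'k deck1 //; exact: (Um 0%N).
Qed.

Lemma commuting_simple gamma delta f e : gamma <> 1%g -> delta <> 1%g ->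
  simple_path H gamma f -> simple_path H delta e -> (gamma * delta = delta * gamma)%g ->
  delta = gamma \/ delta = gamma^-1%g.
Proof.
move=> g1 d1 sf se com; apply: (mutual_powers deck_torsion_free g1).
  exact: simple_centralizer sf com.
by apply: (simple_centralizer d1 se).
Qed.

Lemma conj_neq1 q delta : delta <> 1%g -> (q^-1 * delta * q)%g <> 1%g.
Proof.
move=> d1 e; apply: d1; apply: (mulIg q); rewrite mul1g; apply: (mulgI q^-1%g).
by rewrite mulgA e mulVg.
Qed.

Lemma simple_path_conjV q delta e : simple_path H delta e ->
  simple_path H (q^-1 * delta * q)%g (deck H q^-1%g \o e).
Proof. by move=> /(@simple_path_conj _ _ _ H _ _ q^-1%g); rewrite invgK. Qed.

End Deck.

(** * Disjointness of tubes *)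

Section Action.
Variables (R : realType) (n : nat).
Implicit Types (g h : 'M[R]_(n + n)) (X : 'M[R[i]]_n).

Lemma siegel_act_mul g h X : symplectic g -> symplectic h -> siegel X ->
  siegel_act (g *m h) X = siegel_act g (siegel_act h X).
Proof.
move=> sg sh hX; have [_ hY e1 _] := siegel_actP sh hX.
have [_ _ e2 _] := siegel_actP sg hY; have [du _ e3 _] := siegel_actP (symplecticM sg sh) hX.
move: e3; rewrite complexifyM trmx_mul mulmxA e1 -mulmxA e2 mulmxA /sframe !mul_mx_row !mulmx1.
move=> /eq_row_mx[ee dd]; move: ee; rewrite dd => ee.
have dT : (denom (g *m h) X)^T \in unitmx by rewrite unitmx_tr.
by apply: trmx_inj; apply: (can_inj (mulKmx dT)); rewrite ee.
Qed.

Lemma siegel_act1 X : siegel_act 1%:M X = X.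
Proof.
rewrite /siegel_act /= scalar_mx_block /complexify map_block_mx !map_mx1 !map_mx0.
rewrite block_mxKul block_mxKur block_mxKdl block_mxKdr mul0mx mul1mx addr0 add0r.
by rewrite invmx1 mulmx1.
Qed.

End Action.

Section Tubes.
Variables (R : realType) (Sigma : topologicalType) (Gamma : groupType).
Variables (H : hyperbolization R Sigma Gamma) (n : nat).
Variables (rho : Gamma -> 'M[R]_(n + n)) (xi : boundary_circle R -> 'M[R]_(n + n)).
Hypothesis n0 : (0 < n)%N.
Hypothesis rho_rep : representation rho.
Hypothesis xi_equiv : forall g x,
  (xi (moebius_circle (hol H g) x) == lag_act (rho g) (xi x))%MS.
Hypothesis xi_rcont : Defs.right_continuous xi.
Hypothesis xi_pos : forall x y z, positively_oriented x y z ->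
  maximal_triple (xi x) (xi y) (xi z).
Implicit Types (g q gamma delta : Gamma) (X Y : 'M[R[i]]_n).

Let rho_sp g : symplectic (rho g). Proof. exact: rho_rep.1. Qed.

Lemma shilov_sign g gamma : g = gamma \/ g = gamma^-1%g ->
  shilov_hyperbolic (rho gamma) -> shilov_hyperbolic (rho g).
Proof.
move=> [] -> // [h [A dA]]; rewrite (rhoV rho_rep); exists (h *m symplectic_form n R), A^T.
exact: shilov_flip.
Qed.

Lemma tube_shilov gamma X : tube (rho gamma) X -> siegel X /\ shilov_hyperbolic (rho gamma).
Proof. by move=> /tube_near[hX [Z /tube_core_shilov[]]]. Qed.

Lemma tube_meet_lt gamma delta q f e X : gamma <> 1%g -> delta <> 1%g ->
  simple_path H gamma f -> simple_path H delta e ->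
  (forall s t, f s <> deck H q^-1%g (e t)) ->
  (gamma * (q^-1 * delta * q) <> q^-1 * delta * q * gamma)%g ->
  tube (rho gamma) X -> tube (rho delta) (siegel_act (rho q) X) ->
  width (rho gamma) < width (rho delta).
Proof.
move=> g1 d1 sf se fe ncom tX tY.
have [g [d [m [N [k [N' [gE dE pos]]]]]]] :=
  axes_good_position g1 (@conj_neq1 _ q _ d1) sf (simple_path_conjV q se) fe ncom.
have [_ sg] := tube_shilov tX; have [_ sd] := tube_shilov tY.
have [d' d'E dd] : exists2 d', d' = delta \/ d' = delta^-1%g & d = (q^-1 * d' * q)%g.
  case: dE => ->; first by exists delta; [left|].
  by exists delta^-1%g; [right|rewrite !invgM invgK mulgA].
have rd : rho d = invmx (rho q) *m rho d' *m rho q.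
  by rewrite dd !rho_rep.2 (rhoV rho_rep).
have sD : shilov_hyperbolic (rho d).
  have [h [A dA]] := shilov_sign d'E sd.
  rewrite rd; have := shilov_conj (rho_sp q^-1%g) dA; rewrite (rhoV rho_rep) invmxK => dB.
  by exists (invmx (rho q) *m h), A.
have [h [A [D [k0 [B [dA dB [sDD pD lD] e1 e0]]]]]] :=
  position_interlace rho_rep xi_equiv xi_rcont xi_pos n0 pos (shilov_sign gE sg) sD.
rewrite rd in dB.
have sign (a b : Gamma) : a = b \/ a = b^-1%g -> rho a = rho b \/ rho a = invmx (rho b).
  by case=> ->; [left|right; exact: (rhoV rho_rep)].
exact: (width_lt n0 (rho_sp q) (rho_sp gamma) (rho_sp delta) (sign _ _ gE) (sign _ _ d'E)
  dA dB sDD pD lD e1 e0 tX tY).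
Qed.

Lemma act_back q X : siegel X -> siegel_act (rho q^-1%g) (siegel_act (rho q) X) = X.
Proof. by move=> hX; rewrite -siegel_act_mul // -rho_rep.2 mulVg (rho1 rho_rep) siegel_act1. Qed.

(** [tube_meet_lt] for (gamma, delta, q) and for (delta, gamma, q^-1) gives opposite strict
    inequalities between the widths. *)
Lemma tubes_commute gamma delta q f e X : gamma <> 1%g -> delta <> 1%g ->
  simple_path H gamma f -> simple_path H delta e ->
  (forall s t, f s <> deck H q^-1%g (e t)) ->
  tube (rho gamma) X -> tube (rho delta) (siegel_act (rho q) X) ->
  (gamma * (q^-1 * delta * q) = q^-1 * delta * q * gamma)%g.
Proof.
move=> g1 d1 sf se fe tX tY; apply: contrapT => ncom.
have [hX _] := tube_shilov tX; have [[_ Uf _] _] := sf; have [[_ Ue _] _] := se.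
have lt1 := tube_meet_lt g1 d1 sf se fe ncom tX tY.
have fe' s t : e s <> deck H q^-1^-1%g (f t).
  by move=> E; apply: (fe t s); rewrite E invgK deckK.
have ncom' : (delta * (q^-1^-1 * gamma * q^-1) <> q^-1^-1 * gamma * q^-1 * delta)%g.
  rewrite invgK => E; apply: ncom; apply: (mulgI q); apply: (mulIg q^-1%g).
  by move: E; rewrite !mulgA mulgV mul1g !mulgK => ->.
have tX' : tube (rho gamma) (siegel_act (rho q^-1%g) (siegel_act (rho q) X)) by rewrite act_back.
have lt2 := tube_meet_lt d1 g1 se sf fe' ncom' tY tX'.
by have := lt_trans lt1 lt2; rewrite ltxx.
Qed.

Lemma orbit_class_eq (G : set Gamma) X Y : orbit_class rho G X = orbit_class rho G Y ->
  G 1%g -> siegel Y -> exists2 q, G q & Y = siegel_act (rho q) X.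
Proof.
move=> e G1 hY; have : orbit_class rho G Y Y by exists 1%g; rewrite ?(rho1 rho_rep) ?siegel_act1.
by rewrite -e => -[q Gq <-]; exists q.
Qed.

Lemma orbit_class_cyclic gamma q X : siegel X -> cyclic_subgroup gamma q ->
  orbit_class rho (cyclic_subgroup gamma) X =
  orbit_class rho (cyclic_subgroup gamma) (siegel_act (rho q) X).
Proof.
move=> hX cq; apply/seteqP; split=> _ [g cg <-].
  exists (g * q^-1)%g; first by apply: cyclic_subgroup_mul => //; exact: cyclic_subgroup_inv.
  by rewrite -siegel_act_mul // -rho_rep.2 mulgVK.
exists (g * q)%g; first exact: cyclic_subgroup_mul.
by rewrite rho_rep.2 siegel_act_mul.
Qed.

(** If the path meets its translate by q^-1, simplicity makes q a power of gamma. Otherwise gamma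
    commutes with its conjugate by q, which is therefore gamma or its inverse: the first puts q in
    the centralizer, the second is excluded by [no_inversion]. *)
Lemma tube_embedded gamma f : gamma <> 1%g -> simple_path H gamma f ->
  embedded_tubular_neighbourhood rho gamma.
Proof.
move=> g1 sf; split; first exact: tube_core_sub.
move=> X Y tX tY /orbit_class_eq[//||q _ YE]; first by case: (tube_shilov tY).
have [hX _] := tube_shilov tX; rewrite YE in tY *.
apply: orbit_class_cyclic => //.
have [ef sf'] := sf.
case: (pselect (exists s t, f s = deck H q^-1%g (f t))) => [[s [t st]]|fe].
  by rewrite -[q]invgK; apply: cyclic_subgroup_inv; apply: (sf' _ t s).
have com : (gamma * (q^-1 * gamma * q) = q^-1 * gamma * q * gamma)%g.
  by apply: (tubes_commute g1 g1 sf sf _ tX tY) => s t E; apply: fe; exists s, t.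
have [E|E] := commuting_simple g1 (@conj_neq1 _ q _ g1) sf (simple_path_conjV q sf) com.
  apply: (simple_centralizer g1 sf).
  by apply: (mulgI q^-1%g); rewrite mulgA E mulKg.
exfalso; apply: (no_inversion (@deck_torsion_free _ _ _ H) g1 E) => h.
exact: (simple_centralizer g1 sf).
Qed.

Lemma tube_images_disjoint gamma delta f e : gamma <> 1%g -> delta <> 1%g ->
  simple_path H gamma f -> simple_path H delta e -> disjoint_paths H f e ->
  ~ parallel gamma delta -> tube_image rho gamma `&` tube_image rho delta = set0.
Proof.
move=> g1 d1 sf se fe npar; rewrite -subset0 => _ [[X tX <-] [Y tY /esym/orbit_class_eq]].
case=> [//||q _ YE]; first by case: (tube_shilov tY).
rewrite YE in tY; have [[_ Uf _] _] := sf; have [[_ Ue _] _] := se.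
have com : (gamma * (q^-1 * delta * q) = q^-1 * delta * q * gamma)%g.
  apply: (tubes_commute g1 d1 sf se _ tX tY) => s t E; apply: (fe q s t).
  by rewrite E deckKV.
apply: npar; exists q.
have back x : (q^-1 * delta * q = x)%g -> delta = (q * x * q^-1)%g.
  by move=> <-; rewrite !mulgA mulgV mul1g mulgK.
have [E|E] := commuting_simple g1 (@conj_neq1 _ q _ d1) sf (simple_path_conjV q se) com.
  by left; exact: back.
by right; exact: back.
Qed.

End Tubes.

Theorem corollary1p3 (R : realType) (Sigma : topologicalType)
  (Gamma : groupType) (H : hyperbolization R Sigma Gamma) (n : nat)
  (rho : Gamma -> 'M[R]_(n + n)) (gamma : Gamma) :
  compact_surface R Sigma -> (0 < n)%N -> anosov_maximal H rho ->
  simple_element H gamma ->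
  embedded_tubular_neighbourhood rho gamma /\
  (forall delta : Gamma, simple_element H delta ->
     disjoint_elements H gamma delta ->
     tube_image rho gamma `&` tube_image rho delta = set0).
Proof.
move=> cS n0 [[rep [xi [_ xe xr xp]]] _] sg; have [g1 _] := sg; split.
  have [f sf] := simple_element_path cS sg.
  exact: (tube_embedded n0 rep xe xr xp g1 sf).
move=> delta [d1 _] dis; have [f [e [sf se fe]]] := disjoint_elements_paths cS dis.
exact: (tube_images_disjoint n0 rep xe xr xp g1 d1 sf se fe dis.1).
Qed.
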